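(* Let $\Omega\subset\mathbb R^d$ be a bounded smooth domain, $\alpha\in(0,1)$, $T>0$, and let $\mathrm L$ be an operator with Green operator $\mathcal G=\mathrm L^{-1}$ and heat semigroup $\mathcal S(t)$ as in the context. Assume: (1) $\mathcal G$ has a symmetric kernel $\mathbb G(x,y)=\mathbb G(y,x)$ and, for some $s,\gamma\in(0,1]$, $$\mathbb G(x,y)\asymp \frac{1}{|x-y|^{d-2s}}\Big(1\wedge\frac{\delta(x)}{|x-y|}\Big)^{\gamma}\Big(1\wedge\frac{\delta(y)}{|x-y|}\Big)^{\gamma},\qquad x,y\in\Omega,\ x\ne y;$$ (2) the limit $D_\gamma\mathbb G(x,\zeta):=\lim_{\Omega\ni y\to\zeta}\mathbb G(x,y)/\delta(y)^\gamma$ exists and $D_\gamma\mathbb G(x,\zeta)\asymp \delta(x)^\gamma/|x-\zeta|^{d-2s+2\gamma}$ for $x\in\Omega$, $\zeta\in\partial\Omega$; (3) $\mathcal G$ maps $\delta^\gamma L^\infty(\Omega)$ into $\delta^\gamma C(\overline\Omega)$; (4) $0\le v\le 1$ implies $0\le \mathcal S(t)[v]\le 1$ for all $t\geq 0$. Let $u_0\in L^1(\Omega,\delta^\gamma)$ and $f\in L^1(0,T;L^1(\Omega,\delta^\gamma))$, and let the singular boundary datum be $h=0$. Then, for each $\bullet\in\{C,R\}$, the problem $${}^{\bullet}\partial_t^\alpha u+\mathrm Lu=f$$ with initial datum $u_0$ and $h=0$ admits a unique weak-dual solution, and it is given by $u=\mathcal H_\bullet[u_0,f,0]$, where $$\mathcal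 H_C[u_0,f,0](t)=\mathcal S_\alpha(t)[u_0]+\int_0^t\mathcal P_\alpha(t-\tau)[f(\tau)]\,d\tau,\qquad \mathcal H_R[u_0,f,0](t)=\mathcal P_\alpha(t)[u_0]+\int_0^t\mathcal P_\alpha(t-\tau)[f(\tau)]\,d\tau.$$
   Context: Notation: $\delta(x)=\mathrm{dist}(x,\partial\Omega)$; $a\wedge b=\min\{a,b\}$; $a\asymp b$ means $C^{-1}a\le b\le Ca$ for a constant $C>0$ independent of the points involved; $\delta^\gamma X=\{v: v/\delta^\gamma\in X\}$; $L^1(\Omega,\delta^\gamma)=\{v:\int_\Omega|v|\delta^\gamma\,dx<\infty\}$. Operator: $\mathrm L$ is a self-adjoint integro-differential elliptic operator of order $2s$, determined by its Green operator: for every $f\in L^\infty(\Omega)$ the problem $\mathrm LU=f$ in $\Omega$ with $U=0$ on $\partial\Omega$ (resp. on $\mathbb R^d\setminus\overline\Omega$) has a unique bounded solution $U(x)=\mathcal G[f](x)=\int_\Omega\mathbb G(x,y)f(y)\,dy$, and $\mathcal G=\mathrm L^{-1}$. Let $(\varphi_j)_{j\ge1}$ be an orthonormal basis of $L^2(\Omega)$ with $\mathcal G\varphi_j=\lambda_j^{-1}\varphi_j$, $0<\lambda_1\le\lambda_2\le\dots$. The heat semigroup is $\mathcal S(t)[v]=\sum_je^{-\lambda_jt}\langle v,\varphi_j\rangle\varphi_j$, with heat kernel $\mathbb S(t,x,y)$, i.e. $\mathcal S(t)[v](x)=\int_\Omega\mathbb S(t,x,y)v(y)\,dy$. Time-fractional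 kernels: $\Phi_\alpha(t)=\sum_{k\ge0}\frac{(-t)^k}{k!\,\Gamma(1-\alpha(k+1))}$ (Mainardi function). $\mathcal S_\alpha(t)$ and $\mathcal P_\alpha(t)$ are the integral operators on $\Omega$ with kernels $\mathbb S_\alpha(t,x,y)=\int_0^\infty\Phi_\alpha(\tau)\mathbb S(\tau t^\alpha,x,y)\,d\tau$ and $\mathbb P_\alpha(t,x,y)=\alpha t^{\alpha-1}\int_0^\infty\tau\Phi_\alpha(\tau)\mathbb S(\tau t^\alpha,x,y)\,d\tau$. Write $\mathcal H[0,\phi,0](t,x)=\int_0^t\int_\Omega\mathbb P_\alpha(t-\tau,x,y)\phi(\tau,y)\,dy\,d\tau$. Fractional derivatives: ${}^{C}\partial_t^\alpha$ is the Caputo derivative, ${}^{R}\partial_t^\alpha$ the Riemann--Liouville derivative (both started at $t=0$), and ${}^{R}\partial_t^{\alpha-1}w(t)=\frac1{\Gamma(1-\alpha)}\int_0^t(t-\xi)^{-\alpha}w(\xi)\,d\xi$. The initial condition is $u(0,\cdot)=u_0$ in the Caputo case and $\lim_{h\to0^+}{}^{R}\partial_t^{\alpha-1}u(h,\cdot)=u_0$ in the Riemann--Liouville case; these are encoded in the following definition. Weak-dual solution (with $h=0$): a function $u\in L^1(0,T;L^1(\Omega,\delta^\gamma))$ such that for all $\phi\in\delta^\gamma L^\infty((0,T)\times\Omega)$: in the Caputo case, $$\int_0^T\!\!\int_\Omega u(t,x)\phi(T-t,x)\,dx\,dt=\int_\Omega u_0(x)\big({}^{R}\partial_t^{\alpha-1}\mathcal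 H[0,\phi,0]\big)(T,x)\,dx+\int_0^T\!\!\int_\Omega f(t,x)\mathcal H[0,\phi,0](T-t,x)\,dx\,dt;$$ in the Riemann--Liouville case, $$\int_0^T\!\!\int_\Omega u(t,x)\phi(T-t,x)\,dx\,dt=\int_\Omega u_0(x)\mathcal H[0,\phi,0](T,x)\,dx+\int_0^T\!\!\int_\Omega f(t,x)\mathcal H[0,\phi,0](T-t,x)\,dx\,dt.$$ *)

(* Defs.v *)
From HB Require Import structures.
From mathcomp Require Import all_boot all_order all_algebra.
From mathcomp Require Import all_classical all_reals all_analysis.
Set Implicit Arguments.
Unset Strict Implicit.
Unset Printing Implicit Defensive.
Import Order.TTheory GRing.Theory Num.Theory.
Import numFieldNormedType.Exports.
Local Open Scope classical_set_scope.
Local Open Scope ring_scope.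

(* Borel sigma-algebra of R^n, generated by the coordinates. *)
Section measurable_rV.
Variables (R : realType) (n : nat).

Let coord : 'I_n -> 'rV[R]_n -> measurableTypeR R := fun i v => v ord0 i.

Let rV_set0 : g_sigma_preimage coord set0.
Proof. exact: sigma_algebra0. Qed.

Let rV_setC A : g_sigma_preimage coord A -> g_sigma_preimage coord (~` A).
Proof. exact: sigma_algebraC. Qed.

Let rV_bigcup (F : (set 'rV[R]_n)^nat) :
  (forall i, g_sigma_preimage coord (F i)) ->
  g_sigma_preimage coord (\bigcup_i F i).
Proof. exact: sigma_algebra_bigcup. Qed.

HB.instance Definition _ := @isMeasurable.Build default_measure_display
  'rV[R]_n (g_sigma_preimage coord) rV_set0 rV_setC rV_bigcup.

End measurable_rV.

Lemma measurable_coord (R : realType) n (i : 'I_n) :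
  measurable_fun [set: 'rV[R]_n]
    (fun v : 'rV[R]_n => v ord0 i : measurableTypeR R).
Proof.
move=> _ Y mY; rewrite setTI; apply: sub_sigma_algebra => /=.
rewrite -bigcup_seq/=; exists i => /=; first by rewrite mem_index_enum.
by exists Y => //; rewrite setTI.
Qed.

Lemma measurable_fun_rVP (R : realType) d (T : measurableType d) n
    (f : T -> 'rV[R]_n) :
  (forall i, measurable_fun setT (fun t => f t ord0 i : measurableTypeR R)) ->
  measurable_fun setT f.
Proof.
move=> mf; suff : g_sigma_preimage
    (fun (i : 'I_n) => (fun v : 'rV[R]_n => v ord0 i : measurableTypeR R) \o f)
    `<=` @measurable _ T.
  by rewrite g_sigma_preimage_comp => + _ A mA; apply; exists A.
apply: smallest_sub; first exact: sigma_algebra_measurable.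
case: n => [|n] in f mf *; first by rewrite big_ord0.
rewrite -bigcup_mkord_ord; apply: bigcup_sub => i Ii A [B mB <-]; exact: mf.
Qed.

Lemma sigma_finite_product d1 d2 (T1 : measurableType d1)
    (T2 : measurableType d2) (R : realType)
    (m1 : {sigma_finite_measure set T1 -> \bar R})
    (m2 : {sigma_finite_measure set T2 -> \bar R}) :
  sigma_finite setT (m1 \x m2)%E.
Proof.
have /sigma_finiteP[F [TF ndF Foo]] := sigma_finiteT m1.
have /sigma_finiteP[G [TG ndG Goo]] := sigma_finiteT m2.
exists (fun n => F n `*` G n).
  rewrite -setXTT TF TG predeqE => -[x y]; split.
    move=> [/= [n _ Fnx] [k _ Gky]]; exists (maxn n k) => //; split.
    - by move: x Fnx; exact/subsetPset/ndF/leq_maxl.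
    - by move: y Gky; exact/subsetPset/ndG/leq_maxr.
  by move=> [n _ []/= ? ?]; split; exists n.
move=> k; have [? ?] := Foo k; have [? ?] := Goo k.
split; first exact: measurableX.
by rewrite product_measure1E// lte_mul_pinfty// ge0_fin_numE.
Qed.

Section lebesgue_rV_step.
Variables (R : realType) (n : nat).
Variable mu : {sigma_finite_measure set 'rV[R]_n -> \bar R}.

Definition rV_cons (p : measurableTypeR R * 'rV[R]_n) : 'rV[R]_n.+1 :=
  row_mx (p.1 : R)%:M p.2.

Lemma rV_cons0 p : rV_cons p ord0 ord0 = p.1.
Proof.
rewrite mxE; case: splitP => [j _|k /= k0]; last by [].
by rewrite mxE [j]ord1.
Qed.

Lemma rV_consS p i : rV_cons p ord0 (lift ord0 i) = p.2 ord0 i.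
Proof.
rewrite mxE; case: splitP => [j|k /= [ik]]; first by rewrite ord1.
by congr (p.2 _ _); exact/esym/val_inj.
Qed.

Let measurable_rV_cons : measurable_fun setT rV_cons.
Proof.
apply: measurable_fun_rVP => i; case: (unliftP ord0 i) => [j|] ->.
  under eq_fun do rewrite rV_consS.
  by apply: (measurableT_comp (measurable_coord j)); exact: measurable_snd.
under eq_fun do rewrite rV_cons0.
exact: measurable_fst.
Qed.

Definition lebesgue_rV_step : set 'rV[R]_n.+1 -> \bar R :=
  pushforward (lebesgue_measure \x mu)%E rV_cons.


Let step0 : lebesgue_rV_step set0 = 0%E.
Proof. exact: measure0. Qed.

Let step_ge0 A : (0 <= lebesgue_rV_step A)%E.
Proof. exact: measure_ge0. Qed.

Let step_sigma_additive : semi_sigma_additive lebesgue_rV_step.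
Proof. exact: measure_semi_sigma_additive. Qed.

HB.instance Definition _ := isMeasure.Build _ _ _ lebesgue_rV_step
  step0 step_ge0 step_sigma_additive.

Let step_sigma_finite : sigma_finite setT lebesgue_rV_step.
Proof.
have [F UF mF] := sigma_finite_product lebesgue_measure mu.
pose h (v : 'rV[R]_n.+1) : measurableTypeR R * 'rV[R]_n :=
  (v ord0 ord0, \row_i v ord0 (lift ord0 i)).
have mh : measurable_fun setT h.
  apply/measurable_fun_pairP; split; first exact: measurable_coord.
  apply: measurable_fun_rVP => i /=.
  under eq_fun do rewrite mxE.
  exact: measurable_coord.
have hK p : h (rV_cons p) = p.
  case: p => a v; rewrite /h rV_cons0; congr pair.
  by apply/rowP => i; rewrite mxE rV_consS.
exists (fun k => h @^-1` F k).
  by rewrite -preimage_bigcup -UF preimage_setT.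
move=> k; have [mFk Fky] := mF k; split.
  by rewrite -[X in measurable X]setTI; exact: mh.
rewrite /lebesgue_rV_step /pushforward (_ : _ @^-1` _ = F k)//.
by apply/seteqP; split=> p /=; rewrite hK.
Qed.

HB.instance Definition _ := Measure_isSigmaFinite.Build _ _ _ lebesgue_rV_step
  step_sigma_finite.

End lebesgue_rV_step.

(* The Lebesgue measure of R^n, as an iterated binary product transported along
   the bijection R * R^n -> R^(n+1). *)
Fixpoint lebesgue_rV (R : realType) (n : nat) :
    {sigma_finite_measure set 'rV[R]_n -> \bar R} :=
  match n return {sigma_finite_measure set 'rV[R]_n -> \bar R} with
  | 0 => \d_(0 : 'rV[R]_0)
  | n'.+1 => lebesgue_rV_step (lebesgue_rV R n')
  end.

Section geometry.
Context {R : realType} {d : nat}.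
Implicit Types (Omega : set 'rV[R]_d) (v x : 'rV[R]_d) (f : 'rV[R]_d -> R).

(* The library norm on 'rV is the sup norm, hence this Euclidean one; both give
   the same topology and the same bounded sets. *)
Definition norm2 v : R := Num.sqrt (\sum_i v ord0 i ^+ 2).

Definition boundary Omega : set 'rV[R]_d := closure Omega `\` interior Omega.

Definition bdist Omega x : R :=
  inf [set norm2 (x - z) | z in boundary Omega].

Fixpoint Ck (k : nat) f : Prop :=
  match k with
  | 0 => continuous f
  | k'.+1 => [/\ continuous f,
      forall (i : 'I_d) x, derivable f x (delta_mx ord0 i) &
      forall i : 'I_d, Ck k' (fun x => 'D_(delta_mx ord0 i) f x)]
  end.

Definition smooth f : Prop := forall k, Ck k f.

(* Omega lies locally on one side of a smooth hypersurface: near each boundary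
   point it is a sublevel set of a smooth function with nonzero gradient. The
   function may be taken smooth on all of R^d, by means of a cutoff. *)
Definition bounded_smooth_domain Omega : Prop :=
  [/\ open Omega, connected Omega, Omega !=set0, bounded_set Omega &
    forall z, boundary Omega z ->
      exists psi, [/\ smooth psi,
        exists i : 'I_d, 'D_(delta_mx ord0 i) psi z != 0 &
        \forall x \near z, Omega x <-> psi x < 0]].

End geometry.

Definition Linfty d (T : measurableType d) (R : realType)
    (mu : {measure set T -> \bar R}) (D : set T) (v : T -> R) : Prop :=
  measurable_fun D v /\
  exists M : R, {ae mu, forall x, D x -> `|v x| <= M}.

Definition asymp (R : realType) (I : Type) (D : set I) (a b : I -> R) : Prop :=
  exists2 C : R, 0 < C & forall i, D i -> C^-1 * b i <= a i <= C * b i.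

Section spaces.
Context {R : realType} {d : nat} (Omega : set 'rV[R]_d).
Implicit Types (gamma T : R) (v w : 'rV[R]_d -> R) (u : R -> 'rV[R]_d -> R).

Notation mu := (lebesgue_rV R d).
Notation nu := (lebesgue_measure \x lebesgue_rV R d)%E.
Notation delta := (bdist Omega).

Definition cylinder T : set (measurableTypeR R * 'rV[R]_d) :=
  `]0, T[%classic `*` Omega.

Definition wLinfty gamma v : Prop :=
  Linfty mu Omega (fun x => v x / delta x `^ gamma).

Definition wL1 gamma v : Prop :=
  mu.-integrable Omega (fun x => (v x * delta x `^ gamma)%:E).

Definition wLinfty_cyl gamma T u : Prop :=
  Linfty nu (cylinder T) (fun p => u p.1 p.2 / delta p.2 `^ gamma).

(* L^1(0,T; L^1(Omega, delta^gamma)) identified, by Fubini, with the weighted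
   L^1 space of the cylinder. *)
Definition wL1_cyl gamma T u : Prop :=
  nu.-integrable (cylinder T) (fun p => (u p.1 p.2 * delta p.2 `^ gamma)%:E).

Definition L2 v : Prop :=
  measurable_fun Omega v /\ mu.-integrable Omega (fun x => (v x ^+ 2)%:E).

Definition inner v w : R := \int[mu]_(x in Omega) (v x * w x).

Definition L2_cvg (w_ : nat -> 'rV[R]_d -> R) w : Prop :=
  (\int[mu]_(x in Omega) ((w_ n x - w x) ^+ 2)%:E)%E @[n --> \oo] --> 0%E.

Definition orthonormal_basis (phi : nat -> 'rV[R]_d -> R) : Prop :=
  [/\ forall j, L2 (phi j),
      forall i j, inner (phi i) (phi j) = (i == j)%:R &
      forall v, L2 v ->
        L2_cvg (fun n x => \sum_(j < n) inner v (phi j) * phi j x) v].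

Definition kernel_op (K : 'rV[R]_d -> 'rV[R]_d -> R) v (x : 'rV[R]_d) : R :=
  \int[mu]_(y in Omega) (K x y * v y).

End spaces.

Section green_and_heat.
Context {R : realType} {d : nat} (Omega : set 'rV[R]_d).
Implicit Types (s gamma t : R) (v w f U : 'rV[R]_d -> R).
Implicit Types G : 'rV[R]_d -> 'rV[R]_d -> R.

Notation mu := (lebesgue_rV R d).
Notation delta := (bdist Omega).

(* L is a partially defined operator, with domain domL, on functions on R^d.
   Functions on Omega are extended by 0, so that the condition outside Omega
   is the exterior one; regularity up to the boundary, for operators with
   U = 0 on the boundary only, is part of domL. *)
Definition dirichlet_solution (domL : set ('rV[R]_d -> R))
    (L : ('rV[R]_d -> R) -> 'rV[R]_d -> R) f U : Prop :=
  [/\ domL U, Linfty mu Omega U, forall x, ~ Omega x -> U x = 0 &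
      {ae mu, forall x, Omega x -> L U x = f x}].

Definition green_kernel (domL : set ('rV[R]_d -> R))
    (L : ('rV[R]_d -> R) -> 'rV[R]_d -> R) G : Prop :=
  measurable_fun (Omega `*` Omega) (fun p => G p.1 p.2) /\
  forall f, Linfty mu Omega f ->
    dirichlet_solution domL L f (fun x => \1_Omega x * kernel_op Omega G f x) /\
    forall U, dirichlet_solution domL L f U ->
      {ae mu, forall x, Omega x -> U x = kernel_op Omega G f x}.

Definition green_eigenbasis G (lambda : nat -> R)
    (phi : nat -> 'rV[R]_d -> R) : Prop :=
  [/\ orthonormal_basis Omega phi, 0 < lambda 0%N,
      {homo lambda : i j / (i <= j)%N >-> i <= j} &
      forall j, {ae mu, forall x, Omega x ->
        kernel_op Omega G (phi j) x = (lambda j)^-1 * phi j x}].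

(* w is a representative of S(t)[v], the L^2 sum of the spectral series. *)
Definition heat_semigroup (lambda : nat -> R) (phi : nat -> 'rV[R]_d -> R)
    t v w : Prop :=
  L2 Omega w /\
  L2_cvg Omega (fun n x =>
    \sum_(j < n) expR (- lambda j * t) * inner Omega v (phi j) * phi j x) w.

Definition heat_kernel (lambda : nat -> R) (phi : nat -> 'rV[R]_d -> R)
    (S : R -> 'rV[R]_d -> 'rV[R]_d -> R) : Prop :=
  measurable_fun
    (`]0, +oo[%classic `*` Omega `*` Omega :
       set (measurableTypeR R * 'rV[R]_d * 'rV[R]_d))
    (fun p => S p.1.1 p.1.2 p.2) /\
  forall t v, 0 < t -> L2 Omega v ->
    {ae mu, forall x, Omega x ->
       mu.-integrable Omega (fun y => (S t x y * v y)%:E)} /\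
    heat_semigroup lambda phi t v (kernel_op Omega (S t) v).

Definition submarkovian (lambda : nat -> R)
    (phi : nat -> 'rV[R]_d -> R) : Prop :=
  forall t v w, 0 <= t -> measurable_fun Omega v ->
    {ae mu, forall x, Omega x -> 0 <= v x <= 1} ->
    heat_semigroup lambda phi t v w ->
    {ae mu, forall x, Omega x -> 0 <= w x <= 1}.

Definition green_symmetric G : Prop :=
  forall x y, Omega x -> Omega y -> G x y = G y x.

Definition green_estimate s gamma G : Prop :=
  asymp [set p | [/\ Omega p.1, Omega p.2 & p.1 <> p.2]]
    (fun p => G p.1 p.2)
    (fun p => let r := norm2 (p.1 - p.2) in
       (r `^ (d%:R - 2 * s))^-1
       * Num.min 1 (delta p.1 / r) `^ gamma
       * Num.min 1 (delta p.2 / r) `^ gamma).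

Definition Dgamma gamma G (x z : 'rV[R]_d) : R :=
  lim (G x y / delta y `^ gamma @[y --> within Omega (nbhs z)]).

Definition boundary_estimate s gamma G : Prop :=
  (forall x z, Omega x -> boundary Omega z ->
     cvg (G x y / delta y `^ gamma @[y --> within Omega (nbhs z)])) /\
  asymp [set p | Omega p.1 /\ boundary Omega p.2]
    (fun p => Dgamma gamma G p.1 p.2)
    (fun p => delta p.1 `^ gamma
       / norm2 (p.1 - p.2) `^ (d%:R - 2 * s + 2 * gamma)).

Definition green_boundary_regular gamma G : Prop :=
  forall f, wLinfty Omega gamma f ->
    exists g : 'rV[R]_d -> R,
      {within closure Omega, continuous g} /\
      forall x, Omega x -> kernel_op Omega G f x / delta x `^ gamma = g x.

End green_and_heat.

Section time_fractional.
Context {R : realType}.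
Implicit Types alpha t x : R.

Definition Gamma x : R :=
  \int[lebesgue_measure]_(t in `]0, +oo[) (t `^ (x - 1) * expR (- t)).

(* 1 / Gamma as an entire function, zero at the poles of Gamma: the functional
   equation shifts x to x + m > 0. *)
Definition rGamma x : R :=
  let m := `|Num.floor x|%N.+1 in
  (\prod_(k < m) (x + k%:R)) / Gamma (x + m%:R).

Definition mainardi alpha t : R :=
  limn (series (fun k : nat =>
    (- t) ^+ k / k`!%:R * rGamma (1 - alpha * k.+1%:R))).

(* Riemann-Liouville derivative of order alpha - 1. *)
Definition RL_integral alpha (w : R -> R) t : R :=
  (Gamma (1 - alpha))^-1 *
  \int[lebesgue_measure]_(xi in `]0, t[) ((t - xi) `^ (- alpha) * w xi).

Context {d : nat} (Omega : set 'rV[R]_d).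
Context (S : R -> 'rV[R]_d -> 'rV[R]_d -> R).
Implicit Types (f phi : R -> 'rV[R]_d -> R).

Notation mu := (lebesgue_rV R d).

Definition S_kernel alpha t (x y : 'rV[R]_d) : R :=
  \int[lebesgue_measure]_(tau in `]0, +oo[)
    (mainardi alpha tau * S (tau * t `^ alpha) x y).

Definition P_kernel alpha t (x y : 'rV[R]_d) : R :=
  alpha * t `^ (alpha - 1) *
  \int[lebesgue_measure]_(tau in `]0, +oo[)
    (tau * mainardi alpha tau * S (tau * t `^ alpha) x y).

(* The operator written H[0, phi, 0]: zero initial and boundary data. *)
Definition duhamel alpha phi t (x : 'rV[R]_d) : R :=
  \int[lebesgue_measure]_(tau in `]0, t[)
    kernel_op Omega (P_kernel alpha (t - tau)) (phi tau) x.

Inductive frac_derivative := Caputo | RiemannLiouville.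

Definition H_solution (c : frac_derivative) alpha
    (u0 : 'rV[R]_d -> R) f t (x : 'rV[R]_d) : R :=
  kernel_op Omega
    (match c with
     | Caputo => S_kernel alpha t
     | RiemannLiouville => P_kernel alpha t
     end) u0 x + duhamel alpha f t x.

(* The singular boundary datum is zero. The initial condition, of either kind,
   is carried by the term in u0. All the integrals converge for data and tests
   in these weighted spaces under the assumptions on the Green kernel. *)
Definition weak_dual_solution (c : frac_derivative) alpha (gamma T : R)
    (u0 : 'rV[R]_d -> R) f (u : R -> 'rV[R]_d -> R) : Prop :=
  wL1_cyl Omega gamma T u /\
  forall phi, wLinfty_cyl Omega gamma T phi ->
    \int[lebesgue_measure]_(t in `]0, T[)
      \int[mu]_(x in Omega) (u t x * phi (T - t) x)
    = \int[mu]_(x in Omega)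
        (u0 x * match c with
                | Caputo => RL_integral alpha (fun t => duhamel alpha phi t x) T
                | RiemannLiouville => duhamel alpha phi T x
                end)
      + \int[lebesgue_measure]_(t in `]0, T[)
          \int[mu]_(x in Omega) (f t x * duhamel alpha phi (T - t) x).

End time_fractional.

(* Main.v *)
From HB Require Import structures.
From mathcomp Require Import all_boot all_order all_algebra.
From mathcomp Require Import all_classical all_reals all_analysis measurable_realfun.
From mathcomp Require Import ring lra.
Require Import Defs.
Set Implicit Arguments.
Unset Strict Implicit.
Unset Printing Implicit Defensive.
Import Order.TTheory GRing.Theory Num.Theory.
Import numFieldNormedType.Exports.
Local Open Scope classical_set_scope.
Local Open Scope ring_scope.

(** Both formulations are settled by moving the solution operators onto the test
    function. With the substitution r = tau t^alpha the operators are superpositions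
    of the heat semigroup over its own time r: the kernel of P_alpha(t) is the integral
    of p(r,t) S(r,x,y) dr and that of S_alpha(t) the integral of q(r,t) S(r,x,y) dr,
    where q(r,t) = t^-alpha Phi(r t^-alpha) and
    p(r,t) = alpha r t^(-alpha-1) Phi(r t^-alpha). Since S is symmetric in x and y,
    Fubini's theorem turns the pairing of the candidate solution with phi(T-t,x) into
    pairings of u0 and f with Duhamel integrals of phi. For the Riemann-Liouville
    derivative this is already the required identity; for the Caputo derivative it
    remains that the fractional integral of order 1-alpha maps p(r,.) to q(r,.)
    ([P_subord_convolution], [potential_riemann_liouville]). Two solutions differ by a w
    with vanishing integral against every phi(T-t,x), and the test function
    delta^gamma sgn w(T-t,x) forces w = 0 ([weak_formulation_unique]).

    These applications of Fubini's theorem rest on one estimate: the integral over r > 0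
    and y of S(r,x,y) delta(y)^gamma is at most C delta(x)^gamma. Formally the left side is
    G[delta^gamma](x), which the regularity of the Green operator up to the boundary
    bounds in this way ([green_weight_bound]). The heat semigroup is given only by its
    spectral series, so this is obtained in several steps. By Parseval's identity <G v, z> is the integral of
    <S(r) v, z> dr for bounded v and z ([heat_green_integral]); the integrability of the
    Green kernel used here is [green_integral_bound]. The sub-Markov property and the
    symmetry of the series give S >= 0 and S(r,x,y) = S(r,y,x) almost everywhere
    ([heat_ge0], [heat_sym]), the exceptional sets being made independent of the
    functions tested by means of a countable generating algebra. Finally
    [regular_heat_kernel] produces a measurable kernel that equals S almost everywhere,
    is nonnegative and symmetric everywhere, and satisfies the estimate for every x.
    As p(r,.) and q(r,.) are bounded in L^1(0,T) uniformly in r ([causal_P_subord_L1],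
    [causal_S_subord_L1]), the kernels of P_alpha and S_alpha satisfy the same estimate
    integrated over (0,T) ([subordinated_bound]), and [duality_eq] applies.

    The facts about p and q need an integral representation of the Mainardi function,
    which is defined by a power series with coefficients 1/Gamma. Contour integration is
    done in real form: [ray] is the imaginary part of the holomorphic form
    s^(b-1) exp(c s - x s^alpha) ds on the ray of angle theta, up to a constant phase,
    and its integral does not depend on theta as long as the integrand decays
    ([sector_invariance], [ray_rotation]). Hankel's integral on a ray of angle in
    (pi/2, pi) equals pi / Gamma(1-b) ([hankel_rGamma]), so the series can be summed under
    the integral sign ([mainardi_series]). On the imaginary axis an integration by parts
    gives the bound C / (1 + x^2) ([mainardi_bound]) and writes p(r,t) as an oscillatory
    integral that makes sense for all real t and vanishes for t <= 0, where the ray can be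
    rotated to the positive axis. The convolution of this integral with t^-alpha is
    computed under the integral sign, after insertion of a factor exp(-eps t). *)

(** * Integration on the line: affine substitution and improper integrals *)

Lemma integrable_measurable d (T : measurableType d) (R : realType)
    (m : {measure set T -> \bar R}) (D : set T) (f : T -> R) :
  m.-integrable D (EFin \o f) -> measurable_fun D f.
Proof. by move=> /measurable_int/measurable_EFinP. Qed.

Lemma norm_le_cvg0 (R : realFieldType) (f g : R^nat) : (forall n, `|f n| <= g n) ->
  g n @[n --> \oo] --> 0 -> f n @[n --> \oo] --> 0.
Proof.
move=> fg g0; apply/norm_cvg0P.
apply: (squeeze_cvgr (f := cst 0) (h := g)) g0; last exact: cvg_cst.
by apply: nearW => n; rewrite normr_ge0 fg.
Qed.

Lemma cvg0Ml (R : realFieldType) (c : R) (f : R^nat) : f n @[n --> \oo] --> 0 ->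
  c * f n @[n --> \oo] --> 0.
Proof.
move=> f0; rewrite -[X in _ --> X](mulr0 c).
by apply: cvgM => //; exact: cvg_cst.
Qed.

Lemma le_integrableR d (T : measurableType d) (R : realType)
    (m : {measure set T -> \bar R}) (D : set T) (f g : T -> R) :
  measurable D -> measurable_fun D f -> (forall x, D x -> `|f x| <= g x) ->
  m.-integrable D (EFin \o g) -> m.-integrable D (EFin \o f).
Proof.
move=> mD mf fg; apply: le_integrable => //; first exact/measurable_EFinP.
by move=> x Dx /=; rewrite lee_fin (le_trans (fg _ Dx))// ler_norm.
Qed.

Lemma integrableZR d (T : measurableType d) (R : realType)
    (m : {measure set T -> \bar R}) (D : set T) (c : R) (f : T -> R) :
  measurable D -> m.-integrable D (EFin \o f) ->
  m.-integrable D (EFin \o (fun x => c * f x)).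
Proof. by move=> mD; exact: integrableZl. Qed.

Lemma integrableDR d (T : measurableType d) (R : realType)
    (m : {measure set T -> \bar R}) (D : set T) (f g : T -> R) :
  measurable D -> m.-integrable D (EFin \o f) -> m.-integrable D (EFin \o g) ->
  m.-integrable D (EFin \o (fun x => f x + g x)).
Proof. by move=> mD; exact: integrableD. Qed.

Lemma integrableBR d (T : measurableType d) (R : realType)
    (m : {measure set T -> \bar R}) (D : set T) (f g : T -> R) :
  measurable D -> m.-integrable D (EFin \o f) -> m.-integrable D (EFin \o g) ->
  m.-integrable D (EFin \o (fun x => f x - g x)).
Proof. by move=> mD; exact: integrableB. Qed.

Lemma integrable_setU d (T : measurableType d) (R : realType)
    (m : {measure set T -> \bar R}) (A B : set T) (f : T -> R) :
  measurable A -> measurable B ->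
  m.-integrable A (EFin \o f) -> m.-integrable B (EFin \o f) ->
  m.-integrable (A `|` B) (EFin \o f).
Proof.
move=> mA mB iA iB.
have /integrableP[mfA fA] := iA; have /integrableP[mfB _] := iB.
have mf : measurable_fun (A `|` B) (EFin \o f) by exact/measurable_funU.
have mD : measurable ((A `|` B) `\` A) by apply: measurableD => //; exact: measurableU.
apply/integrableP; split => //; rewrite -(setDUK (@subsetUl _ A B)).
rewrite ge0_integral_setU//; first last.
- rewrite disj_set2E; apply/eqP/seteqP; split => x //= -[Ax [_ nAx]].
  by case: nAx.
- by rewrite setDUK//; exact: measurableT_comp.
rewrite lte_add_pinfty//.
have := integrableS mB mD _ iB => /(_ _)/integrableP[|//].
by move=> x [[]].
Qed.

(** The Lebesgue measure of an interval scales by the slope, so the Lebesgue measure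
    is a multiple of its own image under an affine map; the substitution rules follow. *)
Section affine.
Context {R : realType}.
Notation mu := (@lebesgue_measure R).
Variables (a b : R).
Hypothesis a0 : a != 0.

Let h (x : measurableTypeR R) : measurableTypeR R := a * x + b.

Let mh : measurable_fun setT h.
Proof. by apply: measurable_funD => //; exact: measurable_funM. Qed.

Let nu : {measure set (measurableTypeR R) -> \bar R} :=
  measure_function_pushforward__canonical__measure_function_Measure mu mh.

Let na : {nonneg R} := `|a|%:nng.

Let preim_oc (c d : R) : c < d ->
  mu (h @^-1` `]c, d]) = (`|a|^-1 * (d - c))%:E.
Proof.
move=> cd; have [agt0|alt0|/eqP] := ltgtP 0 a; last by rewrite eq_sym (negbTE a0).
- have -> : h @^-1` `]c, d] = `](c - b) / a, (d - b) / a]%classic.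
    apply/seteqP; split => x /=; rewrite !in_itv/= /h.
      by rewrite ltr_pdivrMr// ler_pdivlMr// ltrBlDr lerBrDr mulrC.
    by rewrite ltr_pdivrMr// ler_pdivlMr// ltrBlDr lerBrDr mulrC.
  rewrite lebesgue_measure_itv/= lte_fin ltr_pM2r ?invr_gt0// ltrD2r cd.
  by rewrite -EFinB gtr0_norm//; congr EFin; field.
- have -> : h @^-1` `]c, d] = `[(d - b) / a, (c - b) / a[%classic.
    apply/seteqP; split => x /=; rewrite !in_itv/= /h.
      by rewrite ler_ndivrMr// ltr_ndivlMr// ltrBlDr lerBrDr [x * a]mulrC andbC.
    by rewrite ler_ndivrMr// ltr_ndivlMr// ltrBlDr lerBrDr [x * a]mulrC andbC.
  rewrite lebesgue_measure_itv/= lte_fin ltr_nM2r ?invr_lt0// ltrD2r cd.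
  by rewrite -EFinB ltr0_norm//; congr EFin; field.
Qed.

Let lebesgue_affine A : measurable A ->
  mu A = mscale na nu A.
Proof.
move=> mA.
apply: (@lebesgue_measure_unique R (mscale na nu)) => // X.
move=> [[c d]] /= _ <-; rewrite /mscale/= /pushforward.
have [cd|dc] := ltP c d.
  rewrite lebesgue_measure_itv/= lte_fin cd preim_oc// -EFinM -EFinB.
  by congr EFin; rewrite mulrA divff ?normr_eq0// mul1r.
by rewrite set_itv_ge -?leNgt ?bnd_simp// preimage_set0 !measure0 mule0.
Qed.

Lemma ge0_integral_affine (f : R -> \bar R) :
  measurable_fun setT f -> (forall x, 0 <= f x)%E ->
  (\int[mu]_x f x = `|a|%:E * \int[mu]_x f (a * x + b)%R)%E.
Proof.
move=> mf f0.
rewrite (eq_measure_integral (mscale na nu)); last first.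
  by move=> A mA _; exact: lebesgue_affine.
rewrite ge0_integral_mscale//=; congr (_ * _)%E.
by rewrite ge0_integral_pushforward//=.
Qed.

Lemma integral_affine (f : R -> \bar R) : measurable_fun setT f ->
  (\int[mu]_x f x = `|a|%:E * \int[mu]_x f (a * x + b)%R)%E.
Proof.
move=> mf; rewrite integralE [in RHS]integralE.
rewrite (ge0_integral_affine (measurable_funepos mf))//.
rewrite (ge0_integral_affine (measurable_funeneg mf))//.
have -> : (fun x => f (a * x + b)%R)^\+%E = (fun x => (f^\+)%E (a * x + b)%R).
  by apply/funext => x; rewrite !funeposE.
have -> : (fun x => f (a * x + b)%R)^\-%E = (fun x => (f^\-)%E (a * x + b)%R).
  by apply/funext => x; rewrite !funenegE.
set A := integral _ _ _; set B := integral _ _ _.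
have A0 : (0 <= A)%E by exact: integral_ge0.
have B0 : (0 <= B)%E by exact: integral_ge0.
have na0 : 0 < `|a| by rewrite normr_gt0.
case: A A0 => [A| |]// A0; case: B B0 => [B| |]// B0.
- by rewrite muleBr.
- by rewrite gt0_muley ?lte_fin//= gt0_muleNy ?lte_fin.
- by rewrite gt0_muley ?lte_fin//= gt0_muley ?lte_fin.
- by rewrite gt0_muley ?lte_fin//= gt0_muleNy ?lte_fin.
Qed.

Lemma Rintegral_affine (f : R -> R) : measurable_fun setT f ->
  \int[mu]_x f x = `|a| * \int[mu]_x f (a * x + b).
Proof.
move=> mf; rewrite /Rintegral integral_affine; last exact/measurable_EFinP.
set I := integral _ _ _.
have na0 : 0 < `|a| by rewrite normr_gt0.
case: I => [I| |]//=.
- by rewrite gt0_muley ?lte_fin//= mulr0.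
- by rewrite gt0_muleNy ?lte_fin//= mulr0.
Qed.

End affine.

Section ftc.
Context {R : realType}.
Notation mu := (@lebesgue_measure R).
Implicit Types (f F : R -> R) (a b c l x : R).

Lemma segment_FTC f F a b : a < b ->
  (forall x, a <= x <= b -> {for x, continuous f}) ->
  (forall x, a <= x <= b -> is_derive x 1 F (f x)) ->
  (\int[mu]_(x in `[a, b]) (f x)%:E = (F b - F a)%:E)%E.
Proof.
move=> ab cf dF.
have cF x : a <= x <= b -> {for x, continuous F}.
  by move=> /dF [dFx _]; apply: differentiable_continuous; exact/derivable1_diffP.
rewrite EFinB; apply: continuous_FTC2 => //.
- by apply: continuous_in_subspaceT => x; rewrite inE/= in_itv/= => /cf.
- split.
  + by move=> x; rewrite in_itv/= => /andP[/ltW ax /ltW xb];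
      have [] := dF x; rewrite ?ax.
  + by apply: cvg_at_right_filter; apply: cF; rewrite lexx ltW.
  + by apply: cvg_at_left_filter; apply: cF; rewrite lexx ltW.
- move=> x; rewrite in_itv/= => /andP[/ltW ax /ltW xb].
  by rewrite derive1E; apply: (@derive_val _ _ _ _ _ _ _ (dF x _)); rewrite ax.
Qed.

Lemma segment_integrable f a b :
  (forall x, a <= x <= b -> {for x, continuous f}) ->
  mu.-integrable `[a, b] (EFin \o f).
Proof.
move=> cf; apply: continuous_compact_integrable; first exact: segment_compact.
by apply: continuous_in_subspaceT => x; rewrite inE/= in_itv/= => /cf.
Qed.

(** The fundamental theorem of calculus on an open set exhausted by segments, with
    the values of the primitive at the ends replaced by limits. *)
Section exhaustion.
Variables (D : set R) (a_ b_ : R^nat) (F f : R -> R) (l0 l1 : R).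
Hypothesis ab : forall n, a_ n < b_ n.
Hypothesis nab : forall n,
  `[a_ n, b_ n]%classic `<=` `[a_ n.+1, b_ n.+1]%classic.
Hypothesis DE : D = \bigcup_n `[a_ n, b_ n]%classic.
Hypothesis cf : forall x, D x -> {for x, continuous f}.
Hypothesis dF : forall x, D x -> is_derive x 1 F (f x).
Hypothesis F0 : F (a_ n) @[n --> \oo] --> l0.
Hypothesis F1 : F (b_ n) @[n --> \oo] --> l1.

Let inD n x : a_ n <= x <= b_ n -> D x.
Proof. by move=> axb; rewrite DE; exists n => //=; rewrite in_itv. Qed.

Let seg n : (\int[mu]_(x in `[a_ n, b_ n]) (f x)%:E = (F (b_ n) - F (a_ n))%:E)%E.
Proof. by apply: segment_FTC => // x /inD; [exact: cf|exact: dF]. Qed.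

Let nd : nondecreasing_seq (fun n => `[a_ n, b_ n]%classic : set R).
Proof. by apply/nondecreasing_seqP => n; exact/subsetPset. Qed.

Let mD : measurable D.
Proof. by rewrite DE; exact: bigcup_measurable. Qed.

Lemma exhaustion_measurable : measurable_fun D f.
Proof.
rewrite DE; apply/measurable_fun_bigcup => // n.
by apply: (integrable_measurable (m := mu)); apply: segment_integrable => x /inD/cf.
Qed.

Lemma ge0_exhaustion_FTC : (forall x, D x -> 0 <= f x) ->
  (\int[mu]_(x in D) (f x)%:E = (l1 - l0)%:E)%E.
Proof.
move=> f0.
have lim1 : (\int[mu]_(x in `[a_ n, b_ n]) (f x)%:E)%E @[n --> \oo] -->
    (\int[mu]_(x in D) (f x)%:E)%E.
  rewrite DE; apply: ge0_nondecreasing_set_cvg_integral => //.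
  - move=> n; apply: (measurable_int mu).
    by apply: segment_integrable => x /inD/cf.
  - by move=> n x /=; rewrite in_itv/= lee_fin => /inD/f0.
have lim2 : (\int[mu]_(x in `[a_ n, b_ n]) (f x)%:E)%E @[n --> \oo] -->
    (l1 - l0)%:E.
  by under eq_fun do rewrite seg; apply: cvg_EFin; [exact: nearW|exact: cvgB].
by apply: cvg_unique lim1 lim2.
Qed.

Lemma integrable_exhaustion_cvg (g : R -> R) :
  mu.-integrable D (EFin \o g) ->
  \int[mu]_(x in `[a_ n, b_ n]) g x @[n --> \oo] --> \int[mu]_(x in D) g x.
Proof.
move=> ig.
have igD n : mu.-integrable `[a_ n, b_ n] (EFin \o g).
  apply: integrableS ig => //.
  by move=> x /=; rewrite in_itv/=; exact: inD.
apply: fine_cvg; rewrite fineK; last exact: integrable_fin_num.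
rewrite integral_mkcond.
under eq_fun do rewrite integral_mkcond.
apply: (@dominated_cvg _ _ _ mu setT measurableT
  (fun n => (EFin \o g) \_ `[a_ n, b_ n]%classic)
  ((EFin \o g) \_ D) ((abse \o (EFin \o g)) \_ D)) => //.
- move=> n; apply/(measurable_restrictT _ _).1 => //.
  exact: measurable_int (igD n).
- move=> x _; rewrite /patch; have [xD|xD] := boolP (x \in D).
    apply: cvg_near_cst; move: xD; rewrite inE DE => -[n _ xn].
    exists n => // m /= nm; rewrite mem_set//.
    by move: xn; have /subsetPset := nd nm; exact.
  apply: cvg_near_cst; apply: nearW => n; rewrite ifF//; apply/negbTE.
  apply: contra xD; rewrite !inE/= in_itv/=; exact: inD.
- by move=> x _; rewrite /patch; case: ifP.
- by apply/integrable_restrict => //; rewrite setTI; exact: integrable_abse.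
- move=> n x _; rewrite /patch; case: ifPn => [xn|_]; last first.
    have -> : (`|point : \bar R| = 0)%E by rewrite /= normr0.
    by case: ifP => _ //=; exact: lexx.
  rewrite ifT//; move: xn; rewrite !inE/= in_itv/=; exact: inD.
Qed.

Lemma integrable_exhaustion_FTC : mu.-integrable D (EFin \o f) ->
  \int[mu]_(x in D) f x = l1 - l0.
Proof.
move=> /integrable_exhaustion_cvg lim1.
have lim2 : \int[mu]_(x in `[a_ n, b_ n]) f x @[n --> \oo] --> l1 - l0.
  by under eq_fun do rewrite /Rintegral seg/=; exact: cvgB.
exact: cvg_unique lim1 lim2.
Qed.

End exhaustion.

(** Ends of the segments exhausting the half-line; the shift by 2 makes lo n < hi n
    hold already for n = 0. *)
Definition lo n : R := n.+2%:R^-1.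
Definition hi n : R := n.+2%:R.

Lemma lo_gt0 n : 0 < lo n. Proof. by rewrite invr_gt0. Qed.

Lemma lo_lt_hi n : lo n < hi n.
Proof.
rewrite /lo /hi invf_plt ?posrE//; apply: (@le_lt_trans _ _ 1).
  by rewrite invf_le1// ler1n.
by rewrite ltr1n.
Qed.

Lemma lohi_nd n : `[lo n, hi n]%classic `<=` `[lo n.+1, hi n.+1]%classic.
Proof.
move=> x /=; rewrite !in_itv/= => /andP[lx xh]; apply/andP; split.
  by rewrite (le_trans _ lx)// lef_pV2 ?posrE// ler_nat.
by rewrite (le_trans xh)// ler_nat.
Qed.

Lemma cvg_hi : hi n @[n --> \oo] --> +oo.
Proof.
have := @cvgr_idn R; rewrite -(cvg_shiftn 2).
by under eq_fun do rewrite addn2.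
Qed.

Lemma cvg_lo : lo n @[n --> \oo] --> (0 : R).
Proof.
have := @cvg_harmonic R; rewrite -(cvg_shiftn 1).
by under eq_fun do rewrite addn1.
Qed.

Lemma cvg_comp_lo (F : R -> R) l : F x @[x --> 0^'+] --> l ->
  F (lo n) @[n --> \oo] --> l.
Proof. by move/cvg_at_rightP; apply; split; [exact: lo_gt0|exact: cvg_lo]. Qed.

Lemma cvg_comp_hi (F : R -> R) l : F x @[x --> +oo] --> l ->
  F (hi n) @[n --> \oo] --> l.
Proof. by move=> Fl; apply: cvg_comp Fl; exact: cvg_hi. Qed.

Lemma lohi_bigcup : `]0, +oo[%classic = \bigcup_n `[lo n, hi n]%classic :> set R.
Proof.
apply/seteqP; split => x /=.
  rewrite in_itv/= andbT => x0.
  have : \forall n \near \oo, lo n <= x <= hi n.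
    near=> n; apply/andP; split; near: n.
      exact: (cvgr_le 0 cvg_lo).
    by move/cvgryPge : cvg_hi; exact.
  by move=> [n _ /(_ n (leqnn _)) h]; exists n => //=; rewrite in_itv.
move=> [n _] /=; rewrite !in_itv/= => /andP[lx _].
by rewrite andbT (lt_le_trans _ lx)// lo_gt0.
Unshelve. all: end_near. Qed.

End ftc.

(** * Fubini and convergence theorems for real-valued integrals *)

Section scaling.
Context {R : realType}.
Notation mu := (@lebesgue_measure R).
Notation Ry := (`]0%R, +oo[%classic : set R).

Lemma mem_Ry_mul (c u : R) : 0 < c -> (c * u \in Ry) = (u \in Ry).
Proof. by move=> c0; apply/idP/idP; rewrite !inE/= !in_itv/= !andbT pmulr_rgt0. Qed.

Lemma ge0_integral_scale (c : R) (f : R -> \bar R) : 0 < c ->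
  measurable_fun Ry f -> (forall u, 0 < u -> (0 <= f u)%E) ->
  (\int[mu]_(u in Ry) f u = c%:E * \int[mu]_(u in Ry) f (c * u)%R)%E.
Proof.
move=> c0 mf f0; rewrite integral_mkcond [in RHS]integral_mkcond.
rewrite (@ge0_integral_affine _ c 0 _ (f \_ Ry)) ?gt_eqF//.
- rewrite gtr0_norm//; congr (_ * _)%E; apply: eq_integral => u _.
  by rewrite /patch addr0 mem_Ry_mul.
- by apply/(measurable_restrictT _ _).1.
- move=> u; apply: erestrict_ge0 => v; rewrite /= in_itv/= andbT; exact: f0.
Qed.

Lemma Rintegral_scale (c : R) (f : R -> R) : 0 < c -> measurable_fun Ry f ->
  \int[mu]_(u in Ry) f u = c * \int[mu]_(u in Ry) f (c * u).
Proof.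
move=> c0 mf; rewrite Rintegral_mkcond [in RHS]Rintegral_mkcond.
rewrite (@Rintegral_affine _ c 0 _ (f \_ Ry)) ?gt_eqF//.
- rewrite gtr0_norm//; congr (_ * _); apply: eq_Rintegral => u _.
  by rewrite /patch addr0 mem_Ry_mul.
- by apply/(measurable_restrictT _ _).1.
Qed.

Lemma Rintegral_reflect (T : R) (f : R -> R) : measurable_fun `]0, T[ f ->
  \int[mu]_(u in `]0, T[) f (T - u) = \int[mu]_(u in `]0, T[) f u.
Proof.
move=> mf; rewrite Rintegral_mkcond [in RHS]Rintegral_mkcond.
rewrite [RHS](@Rintegral_affine _ (-1) T)//; last first.
  by apply/(measurable_restrictT _ _).1.
rewrite normrN1 mul1r; apply: eq_Rintegral => u _.
have E : T - u = -1 * u + T by ring.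
rewrite /patch -E.
suff -> : (u \in `]0, T[%classic) = (T - u \in `]0, T[%classic) by [].
apply/idP/idP; rewrite !inE/= !in_itv/= => /andP[a b]; apply/andP; split; lra.
Qed.

End scaling.

Section Rfubini.
Context d1 d2 (T1 : measurableType d1) (T2 : measurableType d2) (R : realType).
Variable m1 : {sigma_finite_measure set T1 -> \bar R}.
Variable m2 : {sigma_finite_measure set T2 -> \bar R}.

(** An integrable function is finite almost everywhere, hence truncating its infinite
    values to 0 changes nothing: this is what passes from extended to real integrals. *)
Lemma fine_integral_ae d (T : measurableType d) (m : {measure set T -> \bar R})
    (F : T -> \bar R) : m.-integrable setT F ->
  (\int[m]_x (fine (F x))%:E = \int[m]_x F x)%E /\
  m.-integrable setT (fun x => (fine (F x))%:E).
Proof.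
move=> iF.
have aeF : ae_eq m setT (fun x => (fine (F x))%:E) F.
  have := integrable_ae measurableT iF; apply: filterS => x /= + _.
  by move=> /(_ I) ?; rewrite fineK.
have mF : measurable_fun setT (fun x => (fine (F x))%:E).
  by apply/measurable_EFinP; apply: measurableT_comp => //; exact: measurable_int iF.
split; first by apply: ae_eq_integral => //; exact: measurable_int iF.
apply/integrableP; split => //.
have /integrableP[mF0 Fy] := iF; apply: le_lt_trans Fy.
rewrite le_eqVlt; apply/orP; left; apply/eqP; apply: ae_eq_integral => //.
- exact: measurableT_comp.
- exact: measurableT_comp.
- by apply: filterS aeF => x /= + _ => /(_ I) e; rewrite -[in RHS]e.
Qed.

Lemma Rfubini1 (g : T1 * T2 -> R) : (m1 \x m2)%E.-integrable setT (EFin \o g) ->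
  \int[m1]_x \int[m2]_y g (x, y) = \int[(m1 \x m2)%E]_p g p.
Proof.
move=> ig; rewrite /Rintegral -(integral12_prod_meas1 ig).
by rewrite (fine_integral_ae (integrable_fubini_F ig)).1.
Qed.

Lemma integrable_Rfubini1 (g : T1 * T2 -> R) :
  (m1 \x m2)%E.-integrable setT (EFin \o g) ->
  m1.-integrable setT (fun x => (\int[m2]_y g (x, y))%:E).
Proof. by move=> ig; exact: (fine_integral_ae (integrable_fubini_F ig)).2. Qed.

End Rfubini.

Lemma Rintegral0 d (T : measurableType d) (R : realType)
    (m : {measure set T -> \bar R}) (D : set T) : \int[m]_(x in D) (0 : R) = 0.
Proof. by rewrite /Rintegral integral0. Qed.

Section Rfubini2.
Context d1 d2 (T1 : measurableType d1) (T2 : measurableType d2) (R : realType).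
Variable m1 : {sigma_finite_measure set T1 -> \bar R}.
Variable m2 : {sigma_finite_measure set T2 -> \bar R}.

Lemma integrable_swap (g : T1 * T2 -> R) :
  (m1 \x m2)%E.-integrable setT (EFin \o g) ->
  (m2 \x m1)%E.-integrable setT (fun p => (g (p.2, p.1))%:E).
Proof.
move=> ig; have mg := integrable_measurable ig.
apply/integrable12ltyP.
  apply/measurable_EFinP; apply: (measurableT_comp mg).
  by apply: measurable_fun_pair; [exact: measurable_snd|exact: measurable_fst].
have mg' : measurable_fun setT (EFin \o g) by exact/measurable_EFinP.
have [h _] := @integrable21ltyP _ _ _ _ _ m1 m2 _ mg'.
exact: h ig.
Qed.

Lemma Rintegral_swap (g : T1 * T2 -> R) :
  (m1 \x m2)%E.-integrable setT (EFin \o g) ->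
  \int[(m2 \x m1)%E]_p g (p.2, p.1) = \int[(m1 \x m2)%E]_p g p.
Proof.
move=> ig; rewrite /Rintegral -(integral21_prod_meas1 ig).
by rewrite -(integral12_prod_meas1 (integrable_swap ig)).
Qed.

Lemma Rfubini2 (g : T1 * T2 -> R) : (m1 \x m2)%E.-integrable setT (EFin \o g) ->
  \int[m2]_y \int[m1]_x g (x, y) = \int[(m1 \x m2)%E]_p g p.
Proof.
move=> ig; rewrite -(Rintegral_swap ig).
have := Rfubini1 (g := fun p => g (p.2, p.1)) (integrable_swap ig).
by move=> <-.
Qed.

Lemma Rfubini (g : T1 * T2 -> R) : (m1 \x m2)%E.-integrable setT (EFin \o g) ->
  \int[m1]_x \int[m2]_y g (x, y) = \int[m2]_y \int[m1]_x g (x, y).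
Proof. by move=> ig; rewrite Rfubini1// Rfubini2. Qed.

Lemma RfubiniD (D1 : set T1) (D2 : set T2) (f : T1 -> T2 -> R) :
  measurable D1 -> measurable D2 ->
  measurable_fun (D1 `*` D2) (fun p => f p.1 p.2) ->
  (\int[m1]_(x in D1) \int[m2]_(y in D2) `|(f x y)%:E| < +oo)%E ->
  \int[m1]_(x in D1) \int[m2]_(y in D2) f x y =
  \int[m2]_(y in D2) \int[m1]_(x in D1) f x y.
Proof.
move=> mD1 mD2 mf foo.
pose g := (fun p => f p.1 p.2) \_ (D1 `*` D2).
have mg : measurable_fun setT g.
  by apply/(measurable_restrictT _ _).1 => //; exact: measurableX.
have gE x y : g (x, y) = if (x \in D1) && (y \in D2) then f x y else 0.
  by rewrite /g patchE/= in_setX.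
have ig : (m1 \x m2)%E.-integrable setT (EFin \o g).
  apply/integrable12ltyP; first exact/measurable_EFinP.
  apply: le_lt_trans foo; rewrite [leRHS]integral_mkcond.
  rewrite le_eqVlt; apply/orP; left; apply/eqP; apply: eq_integral => x _.
  rewrite patchE; case: ifPn => xD.
    rewrite [RHS]integral_mkcond; apply: eq_integral => y _.
    by rewrite /= gE xD/= patchE; case: ifP => //; rewrite normr0.
  rewrite (eq_integral (cst 0%E)) ?integral0// => y _.
  by rewrite /= gE (negbTE xD) normr0.
have h := Rfubini ig.
rewrite [LHS]Rintegral_mkcond [RHS]Rintegral_mkcond.
transitivity (\int[m1]_x \int[m2]_y g (x, y)).
  apply: eq_Rintegral => x _; rewrite patchE; case: ifPn => xD.
    rewrite Rintegral_mkcond; apply: eq_Rintegral => y _.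
    by rewrite gE xD/= patchE.
  by rewrite -[LHS](Rintegral0 m2 setT); apply: eq_Rintegral => y _; rewrite gE (negbTE xD).
rewrite h; apply: eq_Rintegral => y _; rewrite patchE; case: ifPn => yD.
  rewrite [RHS]Rintegral_mkcond; apply: eq_Rintegral => x _.
  by rewrite gE yD andbT patchE.
by rewrite -[RHS](Rintegral0 m1 setT); apply: eq_Rintegral => x _; rewrite gE (negbTE yD) andbF.
Qed.

End Rfubini2.

Lemma Rdominated d (T : measurableType d) (R : realType)
    (m : {measure set T -> \bar R}) (D : set T) (f_ : nat -> T -> R) (f g : T -> R) :
  measurable D -> (forall n, measurable_fun D (f_ n)) ->
  (forall x, D x -> f_ n x @[n --> \oo] --> f x) ->
  m.-integrable D (EFin \o g) ->
  (forall n x, D x -> `|f_ n x| <= g x) ->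
  m.-integrable D (EFin \o f) /\
  \int[m]_(x in D) f_ n x @[n --> \oo] --> \int[m]_(x in D) f x.
Proof.
move=> mD mf_ ff ig fg.
have mf : measurable_fun D (EFin \o f).
  by apply/measurable_EFinP; exact: measurable_fun_cvg mf_ ff.
have mf_' n : measurable_fun D (EFin \o f_ n) by exact/measurable_EFinP.
have ff' : {ae m, forall x, D x -> (f_ n x)%:E @[n --> \oo] --> (f x)%:E}.
  by apply: aeW => x Dx; apply: cvg_EFin; [exact: nearW|exact: ff].
have fg' : {ae m, forall x n, D x -> (`|(f_ n x)%:E| <= (g x)%:E)%E}.
  by apply: aeW => x n Dx; rewrite lee_fin; exact: fg.
have [i _ c] := @dominated_convergence _ _ _ m D mD (fun n => EFin \o f_ n)
  (EFin \o f) (EFin \o g) mf_' mf ff' ig fg'.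
split => //; apply: fine_cvg; rewrite fineK//; exact: integrable_fin_num.
Qed.

(** The integral of a nonnegative function, measurable or not, is a supremum over the
    simple functions below it. *)
Lemma le_integral_any d (T : measurableType d) (R : realType)
    (m : {measure set T -> \bar R}) (D : set T) (f g : T -> \bar R) :
  (forall x, D x -> (0 <= f x)%E) -> (forall x, D x -> (f x <= g x)%E) ->
  (\int[m]_(x in D) f x <= \int[m]_(x in D) g x)%E.
Proof.
move=> f0 fg; rewrite (integral_mkcond D f) (integral_mkcond D g).
have h1 x : (0 <= (f \_ D) x)%E by apply: erestrict_ge0.
have fg' x : ((f \_ D) x <= (g \_ D) x)%E by apply: lee_restrict.
have h2 x : (0 <= (g \_ D) x)%E by apply: le_trans (fg' x).
rewrite !ge0_integralTE//; apply: le_ereal_sup => _ [h hle <-]; exists h => // x.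
exact: le_trans (hle x) (fg' x).
Qed.

Lemma RfubiniD_le d1 d2 (T1 : measurableType d1) (T2 : measurableType d2)
    (R : realType) (m1 : {sigma_finite_measure set T1 -> \bar R})
    (m2 : {sigma_finite_measure set T2 -> \bar R})
    (D1 : set T1) (D2 : set T2) (F : T1 -> T2 -> R) (f : T1 -> R) (g : T2 -> R) :
  measurable D1 -> measurable D2 ->
  measurable_fun (D1 `*` D2) (fun p => F p.1 p.2) ->
  (forall x y, D1 x -> D2 y -> `|F x y| <= f x * g y) ->
  (forall x, D1 x -> 0 <= f x) ->
  m1.-integrable D1 (EFin \o f) -> m2.-integrable D2 (EFin \o g) ->
  \int[m1]_(x in D1) \int[m2]_(y in D2) F x y =
  \int[m2]_(y in D2) \int[m1]_(x in D1) F x y.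
Proof.
move=> mD1 mD2 mF Fle f0 fi gi; apply: RfubiniD => //.
have gE x : D1 x -> (\int[m2]_(y in D2) (f x * g y)%:E =
    (f x)%:E * \int[m2]_(y in D2) (g y)%:E)%E.
  move=> Dx; under eq_integral do rewrite EFinM.
  by rewrite integralZl.
have gfin : (\int[m2]_(y in D2) (g y)%:E)%E \is a fin_num by exact: integrable_fin_num.
apply: (@le_lt_trans _ _ (\int[m1]_(x in D1) ((f x)%:E * \int[m2]_(y in D2) (g y)%:E)%E)%E).
  apply: le_integral_any => x Dx; first exact: integral_ge0.
  rewrite -gE//; apply: le_integral_any => // y Dy.
  by rewrite abse_EFin lee_fin Fle.
rewrite -(fineK gfin) integralZr//; apply: lte_mul_pinfty => //.
- by apply: integral_ge0 => x Dx; rewrite lee_fin f0.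
- exact: integrable_fin_num.
- by rewrite ltry.
Qed.

Lemma Rintegral_pmull d (X : measurableType d) (R : realType)
    (m : {measure set X -> \bar R}) (D : set X) (c : R) (f : X -> R) :
  measurable D -> measurable_fun D f -> 0 < c ->
  \int[m]_(x in D) (c * f x) = c * \int[m]_(x in D) f x.
Proof.
move=> mD mf c0.
have e : (\int[m]_(x in D) (c * f x)%:E = c%:E * \int[m]_(x in D) (f x)%:E)%E.
  have mE : measurable_fun D (EFin \o f) by exact/measurable_EFinP.
  have hp : (\int[m]_(x in D) (fun x => c%:E * (f x)%:E)^\+ x =
      c%:E * \int[m]_(x in D) (EFin \o f)^\+ x)%E.
    rewrite ge0_funeposM ?(ltW c0)// ge0_integralZl_EFin ?(ltW c0)//.
    exact: measurable_funepos.
  have hn : (\int[m]_(x in D) (fun x => c%:E * (f x)%:E)^\- x =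
      c%:E * \int[m]_(x in D) (EFin \o f)^\- x)%E.
    rewrite ge0_funenegM ?(ltW c0)// ge0_integralZl_EFin ?(ltW c0)//.
    exact: measurable_funeneg.
  rewrite (eq_integral (fun x => c%:E * (f x)%:E)%E)//.
  rewrite integralE [in RHS]integralE hp hn.
  have : (0 <= \int[m]_(x in D) (EFin \o f)^\+ x)%E by exact: integral_ge0.
  have : (0 <= \int[m]_(x in D) (EFin \o f)^\- x)%E by exact: integral_ge0.
  case: (\int[m]_(x in D) _)%E => [a| |]//=; case: (\int[m]_(x in D) _)%E => [b| |]//= _ _.
  - by rewrite /= -EFinM -!EFinD -EFinM; congr (_%:E); ring.
  - by rewrite !gt0_muley ?lte_fin// ?gt0_muleNy ?lte_fin.
  - by rewrite !gt0_muley ?lte_fin// ?gt0_muleNy ?lte_fin.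
  - by rewrite !gt0_muley ?lte_fin// ?gt0_muleNy ?lte_fin.
rewrite /Rintegral e; case: (\int[m]_(x in D) _)%E => [s| |]//=.
- by rewrite gt0_muley ?lte_fin//= mulr0.
- by rewrite gt0_muleNy ?lte_fin//= mulr0.
Qed.

Lemma Rintegral_opp d (X : measurableType d) (R : realType)
    (m : {measure set X -> \bar R}) (D : set X) (f : X -> R) :
  \int[m]_(x in D) (- f x) = - \int[m]_(x in D) f x.
Proof.
have e : (\int[m]_(x in D) (- f x)%:E = \int[m]_(x in D) (EFin \o f)^\- x -
    \int[m]_(x in D) (EFin \o f)^\+ x)%E.
  rewrite integralE; congr (_ - _)%E; apply: eq_integral => x _.
    by rewrite funeposE funenegE.
  by rewrite funeposE funenegE/= ?EFinN ?oppeK ?opprK.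
have e' : (\int[m]_(x in D) (f x)%:E = \int[m]_(x in D) (EFin \o f)^\+ x -
    \int[m]_(x in D) (EFin \o f)^\- x)%E by exact: integralE.
rewrite /Rintegral e e'.
have : (0 <= \int[m]_(x in D) (EFin \o f)^\+ x)%E by exact: integral_ge0.
have : (0 <= \int[m]_(x in D) (EFin \o f)^\- x)%E by exact: integral_ge0.
case: (\int[m]_(x in D) _)%E => [a| |]//=; case: (\int[m]_(x in D) _)%E => [b| |]//= _ _;
  rewrite ?oppr0// opprD opprK addrC//.
Qed.

(** If the integral of f is infinite or undefined, both sides take the default value 0. *)
Lemma Rintegral_mull d (X : measurableType d) (R : realType)
    (m : {measure set X -> \bar R}) (D : set X) (c : R) (f : X -> R) :
  measurable D -> measurable_fun D f ->
  \int[m]_(x in D) (c * f x) = c * \int[m]_(x in D) f x.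
Proof.
move=> mD mf; have [c0|c0|->] := ltgtP c 0.
- rewrite -[c]opprK mulNr -Rintegral_pmull ?oppr_gt0// -Rintegral_opp.
  by apply: eq_Rintegral => x _; rewrite mulNr.
- exact: Rintegral_pmull.
- rewrite mul0r -[RHS](Rintegral0 m D); apply: eq_Rintegral => x _; exact: mul0r.
Qed.

Section ae_any.
Context d (T : measurableType d) (R : realType) (m : {measure set T -> \bar R}).
Import HBNNSimple.

(** A simple function below f can be set to 0 on the null set where f <= g fails,
    without changing its integral; it is then below g. *)
Lemma ae_le_integral_any (f g : T -> \bar R) :
  (forall x, (0 <= f x)%E) -> (forall x, (0 <= g x)%E) ->
  {ae m, forall x, (f x <= g x)%E} -> (\int[m]_x f x <= \int[m]_x g x)%E.
Proof.
move=> f0 g0 [N [mN N0 hN]]; rewrite (ge0_integralTE m f0).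
apply: ge_ereal_sup => _ [h hf <-].
pose k x := ((EFin \o h) \_ (~` N)) x.
have -> : sintegral m h = (\int[m]_x k x)%E.
  rewrite -integralT_nnsfun; apply: ae_eq_integral => //.
  - exact/measurable_EFinP.
  - apply/(measurable_restrictT _ _).1; first exact: measurableC.
    by apply: measurable_funTS; exact/measurable_EFinP.
  - exists N; split => // x /= hx; apply: contrapT => nN; apply: hx => _.
    by rewrite /k patchE mem_set.
apply: le_integral_any => x _; first by apply: erestrict_ge0 => y _; rewrite lee_fin.
rewrite /k patchE; case: ifPn => // /[!inE] nN; apply: le_trans (hf x) _.
by apply: contrapT => nfg; apply: nN; apply: hN.
Qed.

(** For arbitrary functions. The evolution kernels are known only almost everywhere and
    are tested against arbitrary functions, so that the integrands are not known
    to be measurable when one kernel is replaced by another. *)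
Lemma ae_eq_Rintegral_any (D : set T) (f g : T -> R) :
  {ae m, forall x, D x -> f x = g x} ->
  \int[m]_(x in D) f x = \int[m]_(x in D) g x.
Proof.
move=> fg; rewrite [LHS]Rintegral_mkcond [RHS]Rintegral_mkcond.
set F := f \_ D; set G := g \_ D.
have FG : {ae m, forall x, F x = G x}.
  apply: filterS fg => x h; rewrite /F /G !patchE.
  by case: ifPn => // /[!inE] /h.
congr fine; rewrite integralE [RHS]integralE.
by congr (_ - _)%E; apply/eqP; rewrite eq_le; apply/andP; split;
  apply: ae_le_integral_any => //; apply: filterS FG => x e; rewrite ?funeposE ?funenegE e.
Qed.

End ae_any.

Lemma measurable_Rintegral d1 d2 (T1 : measurableType d1) (T2 : measurableType d2)
    (R : realType) (m2 : {sigma_finite_measure set T2 -> \bar R}) (g : T1 * T2 -> R) :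
  measurable_fun setT g -> measurable_fun setT (fun x => \int[m2]_y g (x, y)).
Proof.
move=> mg; apply: measurableT_comp; first exact: fine_measurable.
rewrite (_ : (fun x => _) = (fun x => \int[m2]_y ((EFin \o g)^\+ (x, y)) -
    \int[m2]_y ((EFin \o g)^\- (x, y)))%E); last first.
  apply/funext => x; rewrite [LHS]integralE.
  by congr (_ - _)%E; apply: eq_integral => y _; rewrite ?funeposE ?funenegE.
have mE : measurable_fun setT (EFin \o g) by exact/measurable_EFinP.
apply: emeasurable_funB.
  by apply: (@measurable_fun_fubini_tonelli_F _ _ _ _ _ m2 ((EFin \o g)^\+)%E) => //;
    exact: measurable_funepos.
by apply: (@measurable_fun_fubini_tonelli_F _ _ _ _ _ m2 ((EFin \o g)^\-)%E) => //;
  exact: measurable_funeneg.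
Qed.

Lemma measurable_RintegralD d1 d2 (T1 : measurableType d1) (T2 : measurableType d2)
    (R : realType) (m2 : {sigma_finite_measure set T2 -> \bar R})
    (A : set T1) (B : set T2) (g : T1 -> T2 -> R) :
  measurable A -> measurable B ->
  measurable_fun (A `*` B) (fun p => g p.1 p.2) ->
  measurable_fun A (fun x => \int[m2]_(y in B) g x y).
Proof.
move=> mA mB mg.
pose h := (fun p => g p.1 p.2) \_ (A `*` B).
have mh : measurable_fun setT h.
  by apply/(measurable_restrictT _ _).1 => //; exact: measurableX.
apply: eq_measurable_fun (measurable_funTS (measurable_Rintegral m2 mh)) => x xA.
rewrite [RHS]Rintegral_mkcond; apply: eq_Rintegral => y _.
by rewrite /h !patchE/= in_setX xA.
Qed.

Lemma measurable_ge0_integralD d1 d2 (T1 : measurableType d1) (T2 : measurableType d2)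
    (R : realType) (m2 : {sigma_finite_measure set T2 -> \bar R})
    (A : set T1) (B : set T2) (g : T1 -> T2 -> \bar R) :
  measurable A -> measurable B ->
  measurable_fun (A `*` B) (fun p => g p.1 p.2) ->
  (forall x y, A x -> B y -> (0 <= g x y)%E) ->
  measurable_fun A (fun x => \int[m2]_(y in B) g x y)%E.
Proof.
move=> mA mB mg g0.
pose h := (fun p => g p.1 p.2) \_ (A `*` B).
have mh : measurable_fun setT h.
  by apply/(measurable_restrictT _ _).1 => //; exact: measurableX.
have h0 p : (0 <= h p)%E by apply: erestrict_ge0 => -[x y] [/= Ax By]; exact: g0.
have hF : measurable_fun setT (fubini_F m2 h) by apply: measurable_fun_fubini_tonelli_F.
move: hF => /(measurable_funTS (D := A)); apply: eq_measurable_fun => x xA.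
rewrite /fubini_F [RHS]integral_mkcond; apply: eq_integral => y _.
by rewrite /h !patchE/= in_setX xA.
Qed.

Lemma tonelliD d1 d2 (T1 : measurableType d1) (T2 : measurableType d2)
    (R : realType) (m1 : {sigma_finite_measure set T1 -> \bar R})
    (m2 : {sigma_finite_measure set T2 -> \bar R})
    (A : set T1) (B : set T2) (g : T1 -> T2 -> \bar R) :
  measurable A -> measurable B ->
  measurable_fun (A `*` B) (fun p => g p.1 p.2) ->
  (forall x y, A x -> B y -> (0 <= g x y)%E) ->
  (\int[m1]_(x in A) \int[m2]_(y in B) g x y =
   \int[m2]_(y in B) \int[m1]_(x in A) g x y)%E.
Proof.
move=> mA mB mg g0.
pose h := (fun p => g p.1 p.2) \_ (A `*` B).
have mh : measurable_fun setT h.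
  by apply/(measurable_restrictT _ _).1 => //; exact: measurableX.
have h0 p : (0 <= h p)%E by apply: erestrict_ge0 => -[x y] [/= Ax By]; exact: g0.
have hE x y : h (x, y) = if (x \in A) && (y \in B) then g x y else 0%E.
  by rewrite /h patchE/= in_setX.
have E1 : (\int[m1]_x \int[m2]_y h (x, y) = \int[m1]_(x in A) \int[m2]_(y in B) g x y)%E.
  rewrite [RHS]integral_mkcond; apply: eq_integral => x _; rewrite patchE.
  case: ifPn => xA.
    by rewrite [RHS]integral_mkcond; apply: eq_integral => y _; rewrite hE xA patchE.
  by rewrite (eq_integral (cst 0%E)) ?integral0// => y _; rewrite hE (negbTE xA).
have E2 : (\int[m2]_y \int[m1]_x h (x, y) = \int[m2]_(y in B) \int[m1]_(x in A) g x y)%E.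
  rewrite [RHS]integral_mkcond; apply: eq_integral => y _; rewrite patchE.
  case: ifPn => yB.
    by rewrite [RHS]integral_mkcond; apply: eq_integral => x _; rewrite hE yB andbT patchE.
  by rewrite (eq_integral (cst 0%E)) ?integral0// => x _; rewrite hE (negbTE yB) andbF.
by rewrite -E1 -E2; exact: fubini_tonelli.
Qed.

Lemma abse_Rintegral_le d (T : measurableType d) (R : realType)
    (m : {measure set T -> \bar R}) (D : set T) (f : T -> R) :
  measurable D -> measurable_fun D f ->
  (`|(\int[m]_(x in D) f x)%:E| <= \int[m]_(x in D) `|f x|%:E)%E.
Proof.
move=> mD mf; have mE : measurable_fun D (EFin \o f) by exact/measurable_EFinP.
have h : (`|\int[m]_(x in D) (f x)%:E| <= \int[m]_(x in D) `|f x|%:E)%E.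
  exact: le_abse_integral.
apply: le_trans h.
by rewrite /Rintegral; case: (\int[m]_(x in D) _)%E => //=; rewrite normr0 leey.
Qed.

Lemma ge0_integral0_ae d (T : measurableType d) (R : realType)
    (m : {measure set T -> \bar R}) (D : set T) (f : T -> \bar R) :
  measurable D -> measurable_fun D f -> (forall x, D x -> (0 <= f x)%E) ->
  (\int[m]_(x in D) f x = 0)%E -> {ae m, forall x, D x -> f x = 0%E}.
Proof.
move=> mD mf f0 h; have [ab _] := ae_eq_integral_abs m mD mf.
apply: ab; rewrite -[RHS]h; apply: eq_integral => x /[!inE] Dx.
by rewrite gee0_abs// f0.
Qed.

Lemma ae_integral0 d (T : measurableType d) (R : realType)
    (m : {measure set T -> \bar R}) (D : set T) (f : T -> \bar R) :
  measurable D -> measurable_fun D f ->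
  {ae m, forall x, D x -> f x = 0%E} -> (\int[m]_(x in D) f x = 0)%E.
Proof.
move=> mD mf h; rewrite -(integral0 m D); exact: ae_eq_integral.
Qed.

Lemma ae_lebesgue_imp (R : realType) (P Q : R -> Prop) : (forall r, P r -> Q r) ->
  {ae (@lebesgue_measure R), forall r, P r} -> {ae (@lebesgue_measure R), forall r, Q r}.
Proof.
by move=> PQ; exact: (@filterS _ _ (ae_filter_ringOfSetsType (@lebesgue_measure R)) P Q PQ).
Qed.

(** * Integrals along rays of the complex plane *)

Section rays.
Context {R : realType}.
Notation mu := (@lebesgue_measure R).
Implicit Types (kap c x al b th u : R).

Definition ray_phase kap c x al b th u : R :=
  kap + b * th + c * u * sin th - x * u `^ al * sin (al * th).

Definition ray_modulus c x al b th u : R :=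
  u `^ (b - 1) * expR (c * u * cos th - x * u `^ al * cos (al * th)).

(** Imaginary part of exp(i kap) s^(b-1) exp(c s - x s^al) ds/du for s = u exp(i th),
    with modulus and phase as above. *)
Definition ray kap c x al b th u : R :=
  ray_modulus c x al b th u * sin (ray_phase kap c x al b th u).

(** Derivative in u of [u * ray kap c x al b th u], read off from
    s F'(s) = (b + c s - x al s^al) F(s) for F(s) = s^b exp(c s - x s^al). *)
Definition dray kap c x al b th u : R :=
  b * ray kap c x al b th u + c * ray kap c x al (b + 1) th u
  - x * al * ray kap c x al (b + al) th u.

Lemma gt0_powRD (u b a : R) : 0 < u -> u `^ (b + a) = u `^ b * u `^ a.
Proof. by move=> u0; rewrite powRD// (gt_eqF u0) implybT. Qed.

Lemma gt0_mul_powRB1 (u b : R) : 0 < u -> u * u `^ (b - 1) = u `^ b.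
Proof.
by move=> u0; rewrite -{1}[u]powRr1 ?ltW// -gt0_powRD// addrC subrK.
Qed.

Lemma powRB1D (u b : R) : 0 < u -> u `^ (b + 1 - 1) = u `^ (b - 1) * u.
Proof. by move=> u0; rewrite addrK mulrC gt0_mul_powRB1. Qed.

Lemma powRB1Da (u b a : R) : 0 < u -> u `^ (b + a - 1) = u `^ (b - 1) * u `^ a.
Proof. by move=> u0; rewrite -gt0_powRD//; congr powR; ring. Qed.

Lemma is_derive_uray kap c x al b th u : 0 < u ->
  is_derive u 1 (fun u => u * ray kap c x al b th u) (dray kap c x al b th u).
Proof.
move=> u0; rewrite /dray /ray /ray_modulus.
have p1 := is_derive1_powR al u0.
have p2 := is_derive1_powR (b - 1) u0.
have -> : ray_phase kap c x al (b + 1) th u = ray_phase kap c x al b th u + th.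
  by rewrite /ray_phase; ring.
have -> : ray_phase kap c x al (b + al) th u =
    ray_phase kap c x al b th u + al * th by rewrite /ray_phase; ring.
rewrite powRB1D// powRB1Da//.
rewrite (sinD (ray_phase _ _ _ _ _ _ _) th).
rewrite (sinD (ray_phase _ _ _ _ _ _ _) (al * th)).
have ua := gt0_mul_powRB1 al u0; have ub := gt0_mul_powRB1 (b - 1) u0.
apply: is_derive_eq.
rewrite -/(ray_phase kap c x al b th u).
set B := ray_phase _ _ _ _ _ _ _; set A := expR _.
rewrite /GRing.scale/= -ua -ub; ring.
Qed.

(** The Cauchy-Riemann equation in polar coordinates: the angular derivative is i times
    the radial one of [is_derive_uray], hence the shift of the phase by pi / 2. *)
Lemma is_derive_ray_angle kap c x al b th u : 0 < u ->
  is_derive th 1 (fun th => ray kap c x al b th u)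
    (dray (kap + pi / 2) c x al b th u).
Proof.
move=> u0; rewrite /dray /ray /ray_modulus.
have E b' : ray_phase (kap + pi / 2) c x al b' th u =
    ray_phase kap c x al b' th u + pi / 2 by rewrite /ray_phase; ring.
rewrite !E !sinDpihalf.
have -> : ray_phase kap c x al (b + 1) th u = ray_phase kap c x al b th u + th.
  by rewrite /ray_phase; ring.
have -> : ray_phase kap c x al (b + al) th u =
    ray_phase kap c x al b th u + al * th by rewrite /ray_phase; ring.
rewrite powRB1D// powRB1Da//.
rewrite (cosD (ray_phase _ _ _ _ _ _ _) th).
rewrite (cosD (ray_phase _ _ _ _ _ _ _) (al * th)).
apply: is_derive_eq.
rewrite -/(ray_phase kap c x al b th u).
set B := ray_phase _ _ _ _ _ _ _; set A := expR _.
rewrite /GRing.scale/=; ring.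
Qed.

Lemma continuous_is_derive (f : R -> R) (y l : R) : is_derive y 1 f l ->
  {for y, continuous f}.
Proof.
by move=> [dfx _]; apply: differentiable_continuous; exact/derivable1_diffP.
Qed.

Lemma continuous_ray kap c x al b th u : 0 < u ->
  {for u, continuous (ray kap c x al b th)}.
Proof.
move=> u0; rewrite /ray /ray_modulus /ray_phase.
have p1 := is_derive1_powR al u0.
have p2 := is_derive1_powR (b - 1) u0.
apply: continuous_is_derive.
Qed.

Lemma continuous_dray kap c x al b th u : 0 < u ->
  {for u, continuous (dray kap c x al b th)}.
Proof.
move=> u0; rewrite /dray.
apply: continuousB; [apply: continuousD|]; apply: continuousM;
  by [exact: cst_continuous|exact: continuous_ray].
Qed.

Lemma ray_modulus_ge0 c x al b th u : 0 <= ray_modulus c x al b th u.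
Proof. by rewrite mulr_ge0 ?powR_ge0 ?expR_ge0. Qed.

Lemma norm_ray_le kap c x al b th u :
  `|ray kap c x al b th u| <= ray_modulus c x al b th u.
Proof.
rewrite /ray normrM ger0_norm ?ray_modulus_ge0//.
by rewrite ler_piMr ?ray_modulus_ge0// ler_norml sin_geN1 sin_le1.
Qed.

Lemma ray_modulus_le c x al b th u : 0 < u ->
  ray_modulus c x al b th u <= u `^ (b - 1) * expR (`|c| * u + `|x| * u `^ al).
Proof.
move=> u0; rewrite /ray_modulus ler_wpM2l ?powR_ge0// ler_expR.
have cosb (y : R) : -1 <= cos y <= 1 by rewrite cos_geN1 cos_le1.
have nc (z y : R) : z * cos y <= `|z|.
  rewrite (le_trans (ler_norm _))// normrM ler_piMr//.
  by rewrite ler_norml cosb.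
apply: lerD.
  by rewrite (le_trans (nc _ _))// normrM (gtr0_norm u0).
rewrite -mulNr (le_trans (nc _ _))// normrN normrM.
by rewrite (ger0_norm (powR_ge0 _ _)).
Qed.

Notation Ry := (`]0%R, +oo[%classic : set R).

Lemma Ry_bigcup : Ry = \bigcup_n `[lo n : R, hi n]%classic.
Proof. exact: lohi_bigcup. Qed.

Lemma measurable_Ry (f : R -> R) : (forall u, 0 < u -> {for u, continuous f}) ->
  measurable_fun Ry f.
Proof.
move=> cf; apply: (exhaustion_measurable Ry_bigcup) => x /=.
by rewrite in_itv/= andbT; exact: cf.
Qed.

(** Cauchy's theorem in a sector, in real form. If dH/dt = dK/du, then the integral of
    H(t,u) over a segment of u has derivative K(t,b) - K(t,a) in t; as the segment exhausts
    the half-line, these boundary terms vanish uniformly in t. *)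
Section sector.
Variables (H H' K : R -> R -> R) (k : R -> R) (t0 t3 t1 t2 : R).
Hypothesis t01 : t0 < t1.
Hypothesis t12 : t1 <= t2.
Hypothesis t23 : t2 < t3.
Hypothesis dH : forall t u, t0 < t < t3 -> 0 < u ->
  is_derive t 1 (fun t => H t u) (H' t u).
Hypothesis dK : forall t u, t0 < t < t3 -> 0 < u ->
  is_derive u 1 (K t) (H' t u).
Hypothesis cH : forall t u, t0 < t < t3 -> 0 < u -> {for u, continuous (H t)}.
Hypothesis cH' : forall t u, t0 < t < t3 -> 0 < u -> {for u, continuous (H' t)}.
Hypothesis bH' : forall a b : R, 0 < a -> a < b ->
  exists M : R, forall t u, t0 < t < t3 -> a <= u <= b -> `|H' t u| <= M.
Hypothesis Kk : forall t u, t1 <= t <= t2 -> 0 < u -> `|K t u| <= k u.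
Hypothesis klo : k (lo n) @[n --> \oo] --> 0.
Hypothesis khi : k (hi n) @[n --> \oo] --> 0.
Hypothesis iH1 : mu.-integrable Ry (EFin \o H t1).
Hypothesis iH2 : mu.-integrable Ry (EFin \o H t2).

Let I a b t := \int[mu]_(u in `[a, b]) H t u.

Let dI a b t : 0 < a -> a < b -> t0 < t < t3 ->
  is_derive t 1 (I a b) (K t b - K t a).
Proof.
move=> a0 ab t03.
have pos u : u \in `[a, b] -> 0 < u.
  by rewrite in_itv/= => /andP[+ _]; exact: lt_le_trans.
have [M HM] := bH' a0 ab.
have t03' : t \in `]t0, t3[%classic by rewrite inE/= in_itv.
have int t' : `]t0, t3[%classic t' -> mu.-integrable `[a, b] (EFin \o H t').
  rewrite /= in_itv/= => t'03; apply: segment_integrable => u uab.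
  by apply: cH => //; apply: pos; rewrite in_itv.
have der t' u : `]t0, t3[%classic t' -> `[a, b]%classic u -> derivable (H ^~ u) t' 1.
  by rewrite /= in_itv/= => t'03 /pos u0; have [] := dH t'03 u0.
have iM : mu.-integrable `[a, b] (EFin \o cst `|M|).
  by apply: segment_integrable => u _; exact: cst_continuous.
have ub t' u : `]t0, t3[%classic t' -> `[a, b]%classic u ->
    `|partial1of2 H t' u| <= cst `|M| u.
  rewrite /= => t'03 uab; rewrite partial1of2E.
  have u0 := pos _ uab; rewrite in_itv/= in t'03.
  rewrite (@derive_val _ _ _ _ _ _ _ (dH t'03 u0)).
  by rewrite (le_trans _ (ler_norm _))// HM//; move: uab; rewrite in_itv.
have It0 : `]t0, t3[%classic t by rewrite /= in_itv.
have G0 (u : R) : 0 <= cst `|M| u by exact: normr_ge0.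
split.
  have D := derivable_under_integral (f := H : R -> measurableTypeR R -> R) (measurable_itv _) It0 int der G0 iM ub.
  exact: D.
rewrite -derive1E.
rewrite (differentiation_under_integral (f := H : R -> measurableTypeR R -> R) (measurable_itv _) It0 int der G0 iM ub)//.
transitivity (\int[mu]_(u in `[a, b]) H' t u).
  apply: eq_Rintegral => u; rewrite inE/= => /pos u0; rewrite partial1of2E.
  by rewrite (@derive_val _ _ _ _ _ _ _ (dH t03 u0)).
rewrite /Rintegral; have -> // :
    (\int[mu]_(u in `[a, b]) (H' t u)%:E = (K t b - K t a)%:E)%E.
apply: segment_FTC => // u uab.
- by apply: cH' => //; apply: pos; rewrite in_itv.
- by apply: dK => //; apply: pos; rewrite in_itv.
Qed.

Let bound n : `|I (lo n) (hi n) t2 - I (lo n) (hi n) t1| <=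
  (k (lo n) + k (hi n)) * (t2 - t1).
Proof.
have [t12'|] := ltP t1 t2; last first.
  move=> t21; have -> : t1 = t2 by apply/le_anti; rewrite t12.
  by rewrite !subrr normr0 mulr0.
have inI t : t1 <= t <= t2 -> t0 < t < t3.
  by move=> /andP[t1t tt2]; rewrite (lt_le_trans t01)//= (le_lt_trans tt2).
have dIt t : t1 <= t <= t2 ->
    is_derive t 1 (I (lo n) (hi n)) (K t (hi n) - K t (lo n)).
  by move=> tI; apply: dI; rewrite ?lo_gt0 ?lo_lt_hi ?inI.
have dIo t : t \in `]t1, t2[ ->
    is_derive t 1 (I (lo n) (hi n)) (K t (hi n) - K t (lo n)).
  by rewrite in_itv/= => /andP[/ltW t1t /ltW tt2]; apply: dIt; rewrite t1t.
have cI : {within `[t1, t2], continuous (I (lo n) (hi n))}.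
  apply: continuous_in_subspaceT => t; rewrite inE/= in_itv/= => /dIt.
  exact: continuous_is_derive.
have [t tI ->] := MVT t12' dIo cI.
move: tI; rewrite in_itv/= => /andP[/ltW t1t /ltW tt2].
rewrite normrM ler_pM ?normr_ge0//; last by rewrite ger0_norm ?subr_ge0.
rewrite (le_trans (ler_normB _ _))// addrC lerD//.
  by rewrite Kk ?t1t// lo_gt0.
by rewrite Kk ?t1t// /hi.
Qed.

Lemma sector_invariance :
  \int[mu]_(u in Ry) H t1 u = \int[mu]_(u in Ry) H t2 u.
Proof.
have cv t : mu.-integrable Ry (EFin \o H t) ->
    I (lo n) (hi n) t @[n --> \oo] --> \int[mu]_(u in Ry) H t u.
  move=> iH; apply: integrable_exhaustion_cvg => //.
  - by move=> n; exact: lohi_nd.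
  - exact: Ry_bigcup.
have d0 : I (lo n) (hi n) t2 - I (lo n) (hi n) t1 @[n --> \oo] --> 0.
  apply: (norm_le_cvg0 bound).
  rewrite -[X in _ --> X](mul0r (t2 - t1)) -[X in X * _](addr0 0).
  by apply: cvgMr_tmp; exact: cvgD.
have d1 : I (lo n) (hi n) t2 - I (lo n) (hi n) t1 @[n --> \oo] -->
    \int[mu]_(u in Ry) H t2 u - \int[mu]_(u in Ry) H t1 u.
  by apply: cvgB; exact: cv.
have /eqP : 0 = \int[mu]_(u in Ry) H t2 u - \int[mu]_(u in Ry) H t1 u.
  exact: cvg_unique d0 d1.
by rewrite eq_sym subr_eq0 => /eqP.
Qed.

End sector.

End rays.

(** * Integrability on the half-line and rotation of rays *)

Section halfline.
Context {R : realType}.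
Notation mu := (@lebesgue_measure R).
Notation Ry := (`]0%R, +oo[%classic : set R).
Implicit Types (kap c x al b th u p q k : R).

Lemma lo_lt1 n : lo n < 1 :> R.
Proof. by rewrite /lo invf_lt1// ltr1n. Qed.

Lemma itv0c_bigcup c : 0 < c ->
  `]0, c]%classic = \bigcup_n `[c * lo n, c]%classic :> set R.
Proof.
move=> c0; apply/seteqP; split => u /=; rewrite in_itv/=.
  move=> /andP[u0 uc].
  have : Ry (u / c) by rewrite /= in_itv/= andbT divr_gt0.
  rewrite lohi_bigcup => -[n _]; rewrite /= in_itv/= => /andP[nu _].
  by exists n => //=; rewrite in_itv/= uc andbT mulrC -ler_pdivlMr.
move=> [n _] /=; rewrite in_itv/= => /andP[nu ->].
by rewrite andbT (lt_le_trans _ nu)// mulr_gt0// lo_gt0.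
Qed.

Lemma is_derive_powR_div b u : 0 < b -> 0 < u ->
  is_derive u 1 (fun u => u `^ b / b) (u `^ (b - 1)).
Proof.
move=> b0 u0; have p := is_derive1_powR b u0.
apply: is_derive_eq; rewrite /GRing.scale/=.
by rewrite mulr0 add0r mulrA mulVf ?gt_eqF// mul1r.
Qed.

Lemma continuous_powR b u : 0 < u -> {for u, continuous (fun u : R => u `^ b)}.
Proof. by move=> u0; have p := is_derive1_powR b u0; exact: continuous_is_derive p. Qed.

Lemma cvg_powR_lo c b : 0 < c -> 0 < b -> (c * lo n) `^ b @[n --> \oo] --> (0 : R).
Proof.
move=> c0 b0; under eq_fun do rewrite powRM ?(ltW c0) ?(ltW (lo_gt0 _))//.
apply: cvg0Ml; exact: cvg_comp_lo (powR_cvg0 b0).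
Qed.

Lemma integral_powR0 b c : 0 < b -> 0 < c ->
  (\int[mu]_(u in `]0%R, c]) (u `^ (b - 1))%:E = (c `^ b / b)%:E)%E.
Proof.
move=> b0 c0.
have pos u : `]0, c]%classic u -> 0 < u by rewrite /= in_itv/= => /andP[].
rewrite -[in RHS](subr0 (c `^ b / b)).
apply: (ge0_exhaustion_FTC (F := fun u => u `^ b / b) _ _ (itv0c_bigcup c0)) => //.
- by move=> n; rewrite gtr_pMr// lo_lt1.
- move=> n u /=; rewrite !in_itv/= => /andP[nu ->]; rewrite andbT (le_trans _ nu)//.
  by rewrite ler_pM2l// lef_pV2 ?posrE// ler_nat.
- by move=> u /pos; exact: continuous_powR.
- by move=> u /pos; exact: is_derive_powR_div.
- under eq_fun do rewrite mulrC; apply: cvg0Ml; exact: cvg_powR_lo.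
- exact: cvg_cst.
- by move=> u _; exact: powR_ge0.
Qed.

Lemma measurable_powR_Ry b (D : set R) : measurable_fun D (fun u : R => u `^ b).
Proof. by apply: measurable_funTS; exact: measurable_powR. Qed.

Lemma integrable_powR0 b c : 0 < b -> 0 < c ->
  mu.-integrable `]0, c] (fun u => (u `^ (b - 1))%:E).
Proof.
move=> b0 c0; apply/integrableP; split.
  by apply/measurable_EFinP; exact: measurable_powR_Ry.
under eq_integral do rewrite gee0_abs ?lee_fin ?powR_ge0//.
by rewrite integral_powR0// ltry.
Qed.

Lemma itv1y_bigcup :
  `[1, +oo[%classic = \bigcup_n `[1, hi n]%classic :> set R.
Proof.
apply/seteqP; split => u /=; rewrite in_itv/= andbT.
  move=> u1; have : Ry u by rewrite /= in_itv/= andbT (lt_le_trans _ u1).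
  rewrite lohi_bigcup => -[n _]; rewrite /= in_itv/= => /andP[_ nu].
  by exists n => //=; rewrite in_itv/= nu u1.
by move=> [n _] /=; rewrite in_itv/= => /andP[].
Qed.

Lemma powR_hi_inv e n : hi n `^ (- e) = lo n `^ e :> R.
Proof. by rewrite -mulN1r powRrM powR_inv1 ?ler0n. Qed.

Lemma cvg_powR_hi e : 0 < e -> hi n `^ (- e) @[n --> \oo] --> (0 : R).
Proof.
move=> e0; under eq_fun do rewrite powR_hi_inv.
exact: cvg_comp_lo (powR_cvg0 e0).
Qed.

Lemma integrable_powRy e : 0 < e ->
  mu.-integrable `[1, +oo[ (fun u => (u `^ (-1 - e))%:E).
Proof.
move=> e0.
have pos u : `[1, +oo[%classic u -> 0 < u.
  by rewrite /= in_itv/= andbT; exact: lt_le_trans.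
have cV u : `[1, +oo[%classic u -> {for u, continuous (fun u : R => u `^ (-1 - e))}.
  by move=> /pos u0; exact: continuous_powR.
have der u : `[1, +oo[%classic u ->
    is_derive u 1 (fun u => - (u `^ (- e) / e)) (u `^ (-1 - e)).
  move=> /pos u0; have i := is_derive1_powR (- e) u0.
  apply: is_derive_eq; rewrite /GRing.scale/= [- e - 1]addrC; field.
  by rewrite gt_eqF.
have nab n : (`[1%R, hi n]%classic : set R) `<=` `[1%R, hi n.+1]%classic.
  by move=> u /=; rewrite !in_itv/= => /andP[-> un]; rewrite (le_trans un)// ler_nat.
have ab n : 1 < hi n :> R by rewrite /hi ltr1n.
apply/integrableP; split.
  apply/measurable_EFinP; exact: (exhaustion_measurable itv1y_bigcup).
under eq_integral do rewrite gee0_abs ?lee_fin ?powR_ge0//.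
suff -> : (\int[mu]_(u in `[1%R, +oo[) (u `^ (-1 - e))%:E = (0 - - (1 `^ (- e) / e))%:E)%E.
  by rewrite ltry.
apply: (ge0_exhaustion_FTC ab nab itv1y_bigcup cV der) => //.
- exact: cvg_cst.
- under eq_fun do rewrite -mulrN mulrC; apply: cvg0Ml; exact: cvg_powR_hi.
- by move=> u _; exact: powR_ge0.
Qed.

(** Comparison with u^p near 0 and with u^(-1-e) at infinity. *)
Lemma dominated_Ry (f : R -> R) (C p e : R) : measurable_fun Ry f -> -1 < p ->
  0 < e ->
  (forall u, 0 < u <= 1 -> `|f u| <= C * u `^ p) ->
  (forall u, 1 <= u -> `|f u| <= C * u `^ (-1 - e)) ->
  mu.-integrable Ry (EFin \o f).
Proof.
move=> mf p1 e0 f0 f1.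
have p0 : 0 < p + 1 by rewrite -ltrBlDr sub0r.
have i0 : mu.-integrable `]0, 1] (fun u : R => (C * u `^ p)%:E).
  apply: integrableZR => //; rewrite -[p](addrK 1); exact: integrable_powR0.
have i1 : mu.-integrable `[1, +oo[ (fun u => (C * u `^ (-1 - e))%:E).
  by apply: integrableZR => //; exact: integrable_powRy.
have j0 : mu.-integrable `]0, 1] (EFin \o f).
  apply: le_integrable i0 => //.
    apply/measurable_EFinP; apply: measurable_funS mf => // u /=.
    by rewrite !in_itv/= andbT => /andP[].
  move=> u /=; rewrite in_itv/= => u1; rewrite lee_fin (le_trans (f0 _ u1))//.
  exact: ler_norm.
have j1 : mu.-integrable `[1, +oo[ (EFin \o f).
  apply: le_integrable i1 => //.
    apply/measurable_EFinP; apply: measurable_funS mf => // u /=.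
    by rewrite !in_itv/= !andbT; exact: lt_le_trans.
  move=> u /=; rewrite in_itv/= andbT => u1; rewrite lee_fin (le_trans (f1 _ u1))//.
  exact: ler_norm.
have -> : Ry = `]0, 1] `|` `[1, +oo[.
  apply/seteqP; split => u /=; rewrite !in_itv/= ?andbT.
    by move=> u0; rewrite u0/=; apply/orP; exact: le_total.
  by move=> [/andP[]//|]; exact: lt_le_trans.
exact: integrable_setU.
Qed.

Lemma powR_expR_le p q k : 0 < q -> 0 < k ->
  exists2 C, 0 < C & forall u, 1 <= u -> u `^ p * expR (- (k * u `^ q)) <= C * u ^- 2.
Proof.
move=> q0 k0.
pose m := (Num.trunc ((`|p| + 2) / q)).+1.
have mq : p + 2 <= q * m%:R.
  rewrite mulrC -ler_pdivrMr// (@le_trans _ _ ((`|p| + 2) / q))//.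
    by rewrite ler_pM2r ?invr_gt0// lerD2r ler_norm.
  by apply: ltW; rewrite /m; apply: truncnS_gt.
exists (m`!%:R / k ^+ m) => [|u u1].
  by rewrite divr_gt0 ?exprn_gt0// ltr0n fact_gt0.
have u0 : 0 < u by rewrite (lt_le_trans _ u1).
have e : (k * u `^ q) ^+ m / m`!%:R <= expR (k * u `^ q).
  have := @expR_ge1Dxn R (k * u `^ q) m.-1.
  rewrite prednK// => /(_ (mulr_ge0 (ltW k0) (powR_ge0 _ _))).
  by apply: le_trans; rewrite lerDr.
rewrite expRN ler_pdivrMr ?expR_gt0//.
apply: le_trans (ler_wpM2l _ e); last first.
  by rewrite !mulr_ge0 ?invr_ge0 ?ler0n ?exprn_ge0 ?ltW.
have -> : m`!%:R / k ^+ m * u ^- 2 * ((k * u `^ q) ^+ m / m`!%:R) =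
    (u `^ q) ^+ m / u ^+ 2.
  rewrite exprMn; field.
  by rewrite pnatr_eq0 -lt0n fact_gt0 !expf_neq0// gt_eqF.
rewrite ler_pdivlMr ?exprn_gt0// -!powR_mulrn ?powR_ge0 ?(ltW u0)//.
rewrite -gt0_powRD// -powRrM.
by rewrite ler_powR.
Qed.

Lemma integrable_powR_expR p q k : -1 < p -> 0 < q -> 0 < k ->
  mu.-integrable Ry (fun u => (u `^ p * expR (- (k * u `^ q)))%:E).
Proof.
move=> p1 q0 k0; have [C C0 HC] := powR_expR_le p q0 k0.
apply: (@dominated_Ry _ (1 + C) p 1) => //.
- apply: measurable_funM; first exact: measurable_powR_Ry.
  apply: measurableT_comp => //; apply: measurableT_comp => //.
  by apply: measurable_funM => //; exact: measurable_powR_Ry.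
- move=> u /andP[u0 _].
  rewrite ger0_norm ?mulr_ge0 ?powR_ge0 ?expR_ge0// mulrC ler_wpM2r ?powR_ge0//.
  rewrite (@le_trans _ _ 1) ?lerDl ?ltW//.
  by rewrite -expR0 ltr_expR oppr_lt0 mulr_gt0// powR_gt0.
- move=> u u1; rewrite ger0_norm ?mulr_ge0 ?powR_ge0 ?expR_ge0//.
  have -> : -1 - 1 = - 2%:R :> R by ring.
  rewrite powR_invn ?(le_trans _ u1)//.
  by rewrite (le_trans (HC _ u1))// ler_wpM2r ?invr_ge0 ?sqr_ge0// lerDr.
Qed.

Lemma cvg0_powR_expR p q k : 0 < p -> 0 < q -> 0 < k ->
  let h u := u `^ p * expR (- (k * u `^ q)) in
  h (lo n) @[n --> \oo] --> (0 : R) /\ h (hi n) @[n --> \oo] --> (0 : R).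
Proof.
move=> p0 q0 k0 h; split.
  apply: (@norm_le_cvg0 _ _ (fun n => (1 * lo n) `^ p)); last exact: cvg_powR_lo.
  move=> n; rewrite mul1r ger0_norm ?mulr_ge0 ?powR_ge0 ?expR_ge0// ler_piMr ?powR_ge0//.
  by rewrite -expR0 ler_expR oppr_le0 mulr_ge0 ?ltW// powR_gt0// lo_gt0.
have [C C0 HC] := powR_expR_le p q0 k0.
apply: (@norm_le_cvg0 _ _ (fun n => C * lo n)).
  move=> n; rewrite ger0_norm ?mulr_ge0 ?powR_ge0 ?expR_ge0// (le_trans (HC _ _))//.
    by rewrite /hi ler1n.
  rewrite ler_pM2l// /lo /hi -exprVn expr2 ler_piMl// ?invr_ge0//.
  by rewrite invf_le1// ler1n.
by apply: cvg0Ml; exact: cvg_lo.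
Qed.

Lemma segment_bounded (f : R -> R) (a b : R) : a <= b ->
  (forall u, a <= u <= b -> {for u, continuous f}) ->
  exists M, forall u, a <= u <= b -> `|f u| <= M.
Proof.
move=> ab cf.
have cnf : {within `[a, b], continuous (fun u => `|f u|)}.
  apply: continuous_in_subspaceT => u; rewrite inE/= in_itv/= => /cf cu.
  by apply: continuous_comp => //; exact: norm_continuous.
have [c _ Hc] := EVT_max ab cnf.
by exists `|f c| => u uab; apply: Hc; rewrite in_itv.
Qed.

Lemma integrable_ray kap c x al b th q k : 0 < b -> 0 < q -> 0 < k ->
  (forall u, 0 < u ->
    ray_modulus c x al b th u <= u `^ (b - 1) * expR (- (k * u `^ q))) ->
  mu.-integrable Ry (EFin \o ray kap c x al b th).
Proof.
move=> b0 q0 k0 H.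
apply: (le_integrableR (T := measurableTypeR R) (g := fun u => u `^ (b - 1) * expR (- (k * u `^ q)))) => //.
- apply: measurable_Ry => u u0; exact: continuous_ray.
- move=> u /=; rewrite in_itv/= andbT => u0.
  by rewrite (le_trans (norm_ray_le _ _ _ _ _ _ _))// H.
- by apply: integrable_powR_expR => //; rewrite ltrBrDr addNr.
Qed.

(** The hypothesis asks for decay uniformly on the closed sector, which gives both the
    integrability on the two bounding rays and the vanishing of the boundary terms. *)
Lemma ray_rotation kap c x al b q k (t1 t2 : R) : 0 < b -> 0 < q -> 0 < k ->
  t1 <= t2 ->
  (forall t u, t1 <= t <= t2 -> 0 < u ->
    ray_modulus c x al b t u <= u `^ (b - 1) * expR (- (k * u `^ q))) ->
  \int[mu]_(u in Ry) ray kap c x al b t1 u =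
  \int[mu]_(u in Ry) ray kap c x al b t2 u.
Proof.
move=> b0 q0 k0 t12 H.
have [hlo hhi] := cvg0_powR_expR b0 q0 k0.
apply: (@sector_invariance _ (fun t => ray kap c x al b t)
  (fun t => dray (kap + pi / 2) c x al b t)
  (fun t u => u * ray (kap + pi / 2) c x al b t u)
  (fun u => u `^ b * expR (- (k * u `^ q))) (t1 - 1) (t2 + 1)).
- by rewrite gtrBl.
- exact: t12.
- by rewrite ltrDl.
- by move=> t u _ u0; exact: is_derive_ray_angle.
- by move=> t u _ u0; exact: is_derive_uray.
- by move=> t u _ u0; exact: continuous_ray.
- by move=> t u _ u0; exact: continuous_dray.
- move=> a d a0 ad.
  have B b' : exists M, forall t u, a <= u <= d ->
      `|ray (kap + pi / 2) c x al b' t u| <= M.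
    have [|M HM] := @segment_bounded (fun u =>
        u `^ (b' - 1) * expR (`|c| * u + `|x| * u `^ al)) a d (ltW ad).
      move=> u /andP[au _]; have u0 : 0 < u by rewrite (lt_le_trans a0).
      have p1 := is_derive1_powR al u0; have p2 := is_derive1_powR (b' - 1) u0.
      exact: continuous_is_derive.
    exists M => t u uad; have u0 : 0 < u.
      by move: uad => /andP[au _]; rewrite (lt_le_trans a0).
    rewrite (le_trans (norm_ray_le _ _ _ _ _ _ _))//.
    rewrite (le_trans (ray_modulus_le _ _ _ _ _ u0))// (le_trans _ (HM _ uad))//.
    exact: ler_norm.
  have [M1 H1] := B b; have [M2 H2] := B (b + 1); have [M3 H3] := B (b + al).
  exists (`|b| * M1 + `|c| * M2 + `|x * al| * M3) => t u _ uad.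
  rewrite /dray (le_trans (ler_normB _ _))// lerD//.
    rewrite (le_trans (ler_normD _ _))//.
    by rewrite lerD// normrM ler_wpM2l// ?H1 ?H2.
  by rewrite normrM ler_wpM2l// H3.
- move=> t u tt u0; rewrite normrM (gtr0_norm u0).
  rewrite (le_trans (ler_wpM2l (ltW u0) (norm_ray_le _ _ _ _ _ _ _)))//.
  rewrite (le_trans (ler_wpM2l (ltW u0) (H _ _ tt u0)))//.
  by rewrite mulrA gt0_mul_powRB1.
- exact: hlo.
- exact: hhi.
- by apply: (integrable_ray _ b0 q0 k0) => u u0; apply: H; rewrite ?lexx.
- by apply: (integrable_ray _ b0 q0 k0) => u u0; apply: H; rewrite ?lexx ?t12.
Qed.

End halfline.

(** * A Poisson-type integral *)

(** The integral of s^(a-1) / (1 - s) along a ray of angle t has imaginary part pi: it does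
    not depend on t, and as t tends to 0 half of the residue at s = 1 remains. *)
Section poisson.
Context {R : realType}.
Notation mu := (@lebesgue_measure R).
Notation Ry := (`]0%R, +oo[%classic : set R).
Implicit Types (a t u y m : R).

Definition poisson_den t u : R := u ^+ 2 - 2 * u * cos t + 1.
Definition poisson_num a t u : R := sin (a * t) + u * sin ((1 - a) * t).
(** Imaginary part of s^(a-1) / (1 - s) ds/du for s = u exp(i t). *)
Definition poisson a t u : R := u `^ (a - 1) * poisson_num a t u / poisson_den t u.

Lemma poisson_den_ge t u : 0 <= u -> (1 - `|cos t|) * (1 + u ^+ 2) <= poisson_den t u.
Proof.
move=> u0; rewrite /poisson_den.
have h1 : 2 * u <= 1 + u ^+ 2 by have := sqr_ge0 (u - 1); nra.
have h2 := ler_norm (cos t); have h3 := normr_ge0 (cos t).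
have h4 : u * cos t <= u * `|cos t| by rewrite ler_wpM2l.
have h5 : 2 * u * `|cos t| <= (1 + u ^+ 2) * `|cos t| by rewrite ler_wpM2r.
nra.
Qed.

Lemma norm_cos_lt1 t : 0 < t < pi -> `|cos t| < 1.
Proof.
move=> /sin_gt0_pi s0; rewrite -(@ltr_pXn2r _ 2) ?nnegrE// expr1n.
rewrite real_normK ?num_real//; have := cos2Dsin2 t; have := exprn_gt0 2 s0; lra.
Qed.

Lemma poisson_num_le a t u : 0 <= u -> `|poisson_num a t u| <= 1 + u.
Proof.
move=> u0; rewrite (le_trans (ler_normD _ _))// lerD ?sin_max//.
by rewrite normrM (ger0_norm u0) ler_piMr ?sin_max.
Qed.

(** The common value of the angular derivative of [poisson] and of the radial derivative
    of [cpoisson], as required by [sector_invariance]. *)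
Definition dpoisson a t u : R :=
  u `^ (a - 1) * (a * cos (a * t) + u * ((1 - a) * cos ((1 - a) * t))) / poisson_den t u
  - u `^ (a - 1) * poisson_num a t u * (2 * u * sin t) / poisson_den t u ^+ 2.

Definition cpoisson a t u : R :=
  u `^ a * (cos (a * t) - u * cos ((1 - a) * t)) / poisson_den t u.

Lemma poisson_den_gt0 t u : 0 < t < pi -> 0 <= u -> 0 < poisson_den t u.
Proof.
move=> tpi u0; apply: lt_le_trans (poisson_den_ge t u0).
by rewrite mulr_gt0 ?subr_gt0 ?norm_cos_lt1// ltr_pwDl// sqr_ge0.
Qed.

Lemma is_derive_poisson a t u : 0 < t < pi -> 0 < u ->
  is_derive t 1 (fun t => poisson a t u) (dpoisson a t u).
Proof.
move=> tpi u0; have D0 : poisson_den t u != 0.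
  by rewrite gt_eqF// poisson_den_gt0// ltW.
have dD : is_derive t 1 (fun t => poisson_den t u) (2 * u * sin t).
  by rewrite /poisson_den; apply: is_derive_eq; rewrite /GRing.scale/=; ring.
have dN : is_derive t 1 (fun t => poisson_num a t u)
    (a * cos (a * t) + u * ((1 - a) * cos ((1 - a) * t))).
  by rewrite /poisson_num; apply: is_derive_eq; rewrite /GRing.scale/=; ring.
have dV := is_deriveV (f := fun t => poisson_den t u) D0 dD.
rewrite /poisson /dpoisson; apply: is_derive_eq.
by rewrite /GRing.scale/=; field.
Qed.

Lemma is_derive_cpoisson a t u : 0 < t < pi -> 0 < u ->
  is_derive u 1 (fun u => cpoisson a t u) (dpoisson a t u).
Proof.
move=> tpi u0; have D0 : poisson_den t u != 0.
  by rewrite gt_eqF// poisson_den_gt0// ltW.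
have dD : is_derive u 1 (fun u => poisson_den t u) (2 * u - 2 * cos t).
  by rewrite /poisson_den; apply: is_derive_eq; rewrite /GRing.scale/=; ring.
have dP := is_derive1_powR a u0.
have dV := is_deriveV D0 dD.
rewrite /cpoisson /dpoisson; apply: is_derive_eq.
rewrite /GRing.scale/= /poisson_num.
have -> : (1 - a) * t = t - a * t by ring.
rewrite sinB cosB -(gt0_mul_powRB1 a u0).
set p := u `^ _; set ca := cos (a * t); set sa := sin (a * t).
set C := cos t * ca + sin t * sa; set S := sin t * ca - cos t * sa.
have key : C * poisson_den t u + (ca - u * C) * (u - cos t) = (sa + u * S) * sin t.
  apply/eqP; rewrite -subr_eq0; apply/eqP.
  transitivity (u * ca * (1 - (cos t ^+ 2 + sin t ^+ 2))).
    by rewrite /poisson_den /C /S; ring.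
  by rewrite cos2Dsin2 subrr mulr0.
apply/eqP; rewrite -subr_eq0; apply/eqP.
transitivity ((- 2 * p * u) * (C * poisson_den t u + (ca - u * C) * (u - cos t)
   - (sa + u * S) * sin t) / poisson_den t u ^+ 2).
  by rewrite /C /S; field.
by rewrite key subrr mulr0 mul0r.
Qed.

Lemma continuous_poisson a t u : 0 < t < pi -> 0 < u -> {for u, continuous (poisson a t)}.
Proof.
move=> tpi u0; have D0 : poisson_den t u != 0.
  by rewrite gt_eqF// poisson_den_gt0// ltW.
have dD : is_derive u 1 (fun u => poisson_den t u) (2 * u - 2 * cos t).
  by rewrite /poisson_den; apply: is_derive_eq; rewrite /GRing.scale/=; ring.
have dP := is_derive1_powR (a - 1) u0.
have dV := is_deriveV D0 dD.
rewrite /poisson /poisson_num; exact: continuous_is_derive.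
Qed.

Lemma continuous_dpoisson a t u : 0 < t < pi -> 0 < u -> {for u, continuous (dpoisson a t)}.
Proof.
move=> tpi u0; have D0 : poisson_den t u != 0.
  by rewrite gt_eqF// poisson_den_gt0// ltW.
have dD : is_derive u 1 (fun u => poisson_den t u) (2 * u - 2 * cos t).
  by rewrite /poisson_den; apply: is_derive_eq; rewrite /GRing.scale/=; ring.
have dP := is_derive1_powR (a - 1) u0.
have dV := is_deriveV D0 dD.
have -> : dpoisson a t = fun u =>
  u `^ (a - 1) * (a * cos (a * t) + u * ((1 - a) * cos ((1 - a) * t))) * (poisson_den t u)^-1
  - u `^ (a - 1) * poisson_num a t u * (2 * u * sin t) * ((poisson_den t u)^-1 * (poisson_den t u)^-1).
  by apply/funext => v; rewrite /dpoisson expr2 invfM.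
rewrite /poisson_num; exact: continuous_is_derive.
Qed.

Lemma frac_le m N D u : 0 < u -> 0 < m -> m * (1 + u ^+ 2) <= D ->
  N <= 1 + u -> N / D <= 2 / m / (1 + u).
Proof.
move=> u0 m0 mD Nu; have D0 : 0 < D.
  by apply: lt_le_trans mD; rewrite mulr_gt0// ltr_pwDl// sqr_ge0.
have u1 : 0 < 1 + u by lra.
rewrite ler_pdivrMr// mulrAC ler_pdivlMr//.
rewrite mulrAC ler_pdivlMr//.
have h : (1 + u) * (1 + u) <= 2 * (1 + u ^+ 2) by have := sqr_ge0 (u - 1); nra.
have h1 : N * (1 + u) <= (1 + u) * (1 + u) by rewrite ler_wpM2r// ltW.
have h2 : N * (1 + u) * m <= 2 * (1 + u ^+ 2) * m.
  by rewrite ler_wpM2r ?(ltW m0)// (le_trans h1).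
by rewrite (le_trans h2)// -mulrA ler_wpM2l// mulrC.
Qed.

Lemma poisson_le a t u m : 0 < u -> 0 < m -> m <= 1 - `|cos t| ->
  `|poisson a t u| <= 2 / m * (u `^ (a - 1) / (1 + u)).
Proof.
move=> u0 m0 mt; have mD : m * (1 + u ^+ 2) <= poisson_den t u.
  apply: le_trans (poisson_den_ge t (ltW u0)).
  by rewrite ler_wpM2r// addr_ge0// sqr_ge0.
have D0 : 0 <= poisson_den t u.
  by apply: le_trans mD; rewrite mulr_ge0 ?(ltW m0)// addr_ge0// sqr_ge0.
rewrite /poisson !normrM (ger0_norm (powR_ge0 _ _)) normfV (ger0_norm D0).
have -> : 2 / m * (u `^ (a - 1) / (1 + u)) = u `^ (a - 1) * (2 / m / (1 + u)).
  by ring.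
rewrite -mulrA ler_wpM2l ?powR_ge0//.
exact: frac_le (poisson_num_le _ _ (ltW u0)).
Qed.

Lemma cpoisson_le a t u m : 0 < u -> 0 < m -> m <= 1 - `|cos t| ->
  `|cpoisson a t u| <= 2 / m * (u `^ a / (1 + u)).
Proof.
move=> u0 m0 mt; have mD : m * (1 + u ^+ 2) <= poisson_den t u.
  apply: le_trans (poisson_den_ge t (ltW u0)).
  by rewrite ler_wpM2r// addr_ge0// sqr_ge0.
have D0 : 0 <= poisson_den t u.
  by apply: le_trans mD; rewrite mulr_ge0 ?(ltW m0)// addr_ge0// sqr_ge0.
rewrite /cpoisson !normrM (ger0_norm (powR_ge0 _ _)) normfV (ger0_norm D0).
have -> : 2 / m * (u `^ a / (1 + u)) = u `^ a * (2 / m / (1 + u)) by ring.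
rewrite -mulrA ler_wpM2l ?powR_ge0//.
apply: frac_le => //; rewrite (le_trans (ler_normB _ _))// lerD ?cos_max//.
by rewrite normrM (gtr0_norm u0) ler_piMr ?cos_max// ltW.
Qed.

Definition pweight a u : R := u `^ (a - 1) / (1 + u).

Lemma pweight_ge0 a u : 0 < u -> 0 <= pweight a u.
Proof. by move=> u0; rewrite divr_ge0 ?powR_ge0//; lra. Qed.

Lemma integrable_pweight a : 0 < a < 1 -> mu.-integrable Ry (EFin \o pweight a).
Proof.
move=> /andP[a0 a1]; apply: (@dominated_Ry _ _ 1 (a - 1) (1 - a)); last 2 first.
- move=> u /andP[u0 _]; rewrite ger0_norm ?pweight_ge0// mul1r.
  by rewrite ler_pdivrMr ?ler_peMr ?powR_ge0//; lra.
- move=> u u1; have u0 : 0 < u by lra.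
  rewrite ger0_norm ?pweight_ge0// mul1r.
  have -> : -1 - (1 - a) = a - 1 + (- 1) by ring.
  rewrite gt0_powRD// powR_inv1 ?(ltW u0)// ler_wpM2l ?powR_ge0//.
  by rewrite lef_pV2 ?posrE//; lra.
- apply: measurable_Ry => u u0; have p := is_derive1_powR (a - 1) u0.
  have n0 : 1 + u != 0 by rewrite gt_eqF//; lra.
  have d1 : is_derive u 1 (fun u : R => 1 + u) (0 + 1) by exact: is_deriveD.
  have d2 := is_deriveV n0 d1.
  rewrite /pweight; exact: continuous_is_derive.
- by rewrite ltrBrDr addNr.
- by rewrite subr_gt0.
Qed.

Lemma integrable_poisson a t : 0 < a < 1 -> 0 < t < pi ->
  mu.-integrable Ry (EFin \o poisson a t).
Proof.
move=> a01 tpi; have c0 : 0 < 1 - `|cos t| by rewrite subr_gt0 norm_cos_lt1.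
apply: (le_integrableR (T := measurableTypeR R)
  (g := fun u => 2 / (1 - `|cos t|) * pweight a u)) => //.
- by apply: measurable_Ry => u u0; exact: continuous_poisson.
- by move=> u /=; rewrite in_itv/= andbT => u0; exact: poisson_le.
- by apply: integrableZR => //; exact: integrable_pweight.
Qed.

Lemma cos_gap (t0 t3 : R) : 0 < t0 -> t0 <= t3 -> t3 < pi ->
  exists2 m, 0 < m & forall t, t0 <= t <= t3 -> m <= 1 - `|cos t|.
Proof.
move=> t00 t03 t3p.
have cf : {within `[t0, t3], continuous (fun t : R => `|cos t|)}.
  apply: continuous_in_subspaceT => t _.
  by apply: continuous_comp; [exact: continuous_cos|exact: norm_continuous].
have [c cI Hc] := EVT_max t03 cf.
exists (1 - `|cos c|) => [|t tI]; last by rewrite lerB// Hc// in_itv.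
rewrite subr_gt0 norm_cos_lt1//; move: cI; rewrite in_itv/= => /andP[c0 c3].
by rewrite (lt_le_trans t00)//= (le_lt_trans c3).
Qed.

Lemma poisson_rotation a (t1 t2 : R) : 0 < a < 1 -> 0 < t1 -> t1 <= t2 -> t2 < pi ->
  \int[mu]_(u in Ry) poisson a t1 u = \int[mu]_(u in Ry) poisson a t2 u.
Proof.
move=> a01 t10 t12 t2pi; have /andP[a0 a1] := a01.
have t00 : 0 < t1 / 2 by rewrite divr_gt0.
have t3p : (t2 + pi) / 2 < pi by lra.
have t03 : t1 / 2 <= (t2 + pi) / 2 by lra.
have [m m0 Hm] := cos_gap t00 t03 t3p.
have tin t : t1 / 2 < t < (t2 + pi) / 2 -> 0 < t < pi.
  by move=> /andP[h1 h2]; apply/andP; split; lra.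
apply: (@sector_invariance _ (poisson a) (dpoisson a) (cpoisson a)
  (fun u => 2 / m * (u `^ a / (1 + u))) (t1 / 2) ((t2 + pi) / 2)).
- lra.
- exact: t12.
- lra.
- by move=> t u /tin tp u0; exact: is_derive_poisson.
- by move=> t u /tin tp u0; exact: is_derive_cpoisson.
- by move=> t u /tin tp u0; exact: continuous_poisson.
- by move=> t u /tin tp u0; exact: continuous_dpoisson.
- move=> x y x0 xy.
  have [|M HM] := @segment_bounded _ (fun u => u `^ (a - 1) * (1 + u) * m^-1
      + u `^ (a - 1) * (1 + u) * (2 * u) * (m^-1 * m^-1)) x y (ltW xy).
    move=> u /andP[xu _]; have u0 : 0 < u by rewrite (lt_le_trans x0).
    have p := is_derive1_powR (a - 1) u0; exact: continuous_is_derive.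
  exists M => t u tI uI; have u0 : 0 < u.
    by move: uI => /andP[xu _]; rewrite (lt_le_trans x0).
  apply: le_trans (HM _ uI); apply: le_trans (ler_norm _).
  have mD : m <= poisson_den t u.
    apply: le_trans (poisson_den_ge t (ltW u0)).
    have h : m <= 1 - `|cos t|.
      by apply: Hm; move: tI => /andP[/ltW -> /ltW ->].
    by apply: (le_trans h); rewrite ler_peMr ?(le_trans _ h) ?(ltW m0)// lerDl sqr_ge0.
  have D0 : 0 < poisson_den t u by rewrite (lt_le_trans m0).
  have mV : (poisson_den t u)^-1 <= m^-1 by rewrite lef_pV2.
  rewrite /dpoisson (le_trans (ler_normB _ _))// lerD//.
    rewrite !normrM normfV (ger0_norm (powR_ge0 _ _)) (gtr0_norm D0).
    rewrite ler_pM ?invr_ge0 ?(ltW D0)//.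
      by rewrite mulr_ge0 ?powR_ge0.
    rewrite ler_wpM2l ?powR_ge0// (le_trans (ler_normD _ _))//.
    rewrite !normrM (gtr0_norm u0) (gtr0_norm a0) (gtr0_norm (x := 1 - a)) ?subr_gt0//.
    have h1 : a * `|cos (a * t)| <= 1 by rewrite mulr_ile1 ?cos_max// ltW.
    have h2 : u * ((1 - a) * `|cos ((1 - a) * t)|) <= u * 1.
      by rewrite ler_wpM2l ?(ltW u0)// mulr_ile1 ?cos_max//; lra.
    lra.
  rewrite !normrM normfV (ger0_norm (powR_ge0 _ _)).
  rewrite (gtr0_norm (exprn_gt0 _ D0)) expr2 invfM.
  rewrite ler_pM ?mulr_ge0 ?invr_ge0 ?powR_ge0 ?(ltW D0)//; last first.
    by rewrite ler_pM ?invr_ge0 ?(ltW D0).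
  rewrite ler_pM ?mulr_ge0 ?powR_ge0//.
    by rewrite ler_wpM2l ?powR_ge0// poisson_num_le// ltW.
  by rewrite (gtr0_norm u0) normr_nat ler_piMr ?sin_max// mulr_ge0// ltW.
- move=> t u /andP[tt1 tt2] u0; apply: cpoisson_le => //.
  by apply: Hm; apply/andP; split; lra.
- apply: cvg0Ml; apply: (@norm_le_cvg0 _ _ (fun n => (1 * lo n) `^ a)).
    move=> n; have l0 := lo_gt0 (R := R) n; rewrite mul1r ger0_norm; last first.
      by rewrite divr_ge0 ?powR_ge0//; lra.
    by rewrite ler_pdivrMr ?ler_peMr ?powR_ge0//; lra.
  exact: cvg_powR_lo.
- apply: cvg0Ml; apply: (@norm_le_cvg0 _ _ (fun n => hi n `^ (- (1 - a)))).
    move=> n; have h0 : 0 < hi n :> R by rewrite /hi.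
    rewrite ger0_norm; last by rewrite divr_ge0 ?powR_ge0//; lra.
    rewrite opprB gt0_powRD// powR_inv1 ?(ltW h0)// ler_wpM2l ?powR_ge0//.
    by rewrite lef_pV2 ?posrE//; lra.
  by apply: cvg_powR_hi; rewrite subr_gt0.
- by apply: integrable_poisson => //; apply/andP; split; lra.
- by apply: integrable_poisson => //; apply/andP; split; lra.
Qed.

Lemma sin_le0 y : 0 <= y -> `|sin y| <= y.
Proof.
rewrite le_eqVlt => /predU1P[<-|y0]; first by rewrite sin0 normr0.
have [c _] := @MVT R sin cos 0 y y0 (fun x _ => is_derive_sin x)
  (continuous_subspaceT (@continuous_sin R)).
by rewrite sin0 !subr0 => ->; rewrite normrM (gtr0_norm y0) ler_piMl ?cos_max ?ltW.
Qed.

Lemma one_sub_cosE y : 1 - cos y = 2 * sin (y / 2) ^+ 2.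
Proof.
have -> : cos y = cos ((y / 2) *+ 2) by rewrite -mulr_natr mulfVK.
by rewrite cos_mulr2n cos2sin2; ring.
Qed.

Lemma one_sub_cos_le y : 0 <= y -> 1 - cos y <= y ^+ 2 / 2.
Proof.
move=> y0; rewrite one_sub_cosE.
have h : `|sin (y / 2)| ^+ 2 <= (y / 2) ^+ 2.
  by rewrite ler_pXn2r ?nnegrE ?divr_ge0// sin_le0// divr_ge0.
by rewrite real_normK ?num_real// in h; nra.
Qed.

Lemma sin_cubic y : 0 <= y -> `|sin y - y| <= y ^+ 3 / 2.
Proof.
rewrite le_eqVlt => /predU1P[<-|y0].
  by rewrite sin0 subr0 normr0 expr0n mul0r.
have df x : x \in `]0, y[ -> is_derive x 1 (fun x : R => x - sin x) (1 - cos x).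
  by move=> _; apply: is_derive_eq.
have cf : {within `[0, y], continuous (fun x : R => x - sin x)}.
  apply: continuous_subspaceT => x.
  have d : is_derive x 1 (fun x : R => x - sin x) (1 - cos x) by apply: is_derive_eq.
  exact: continuous_is_derive d.
have [c] := MVT y0 df cf; rewrite in_itv/= => /andP[c0 cy].
rewrite sin0 !subr0 distrC => ->.
have h := one_sub_cos_le (ltW c0); have h2 := cos_le1 c.
have h3 : c ^+ 2 <= y ^+ 2 by rewrite ler_pXn2r ?nnegrE ?ltW.
rewrite ger0_norm ?mulr_ge0 ?subr_ge0 ?(ltW y0)//.
rewrite [y ^+ 3]exprSr mulrAC ler_wpM2r ?(ltW y0)//; lra.
Qed.

Lemma poisson_den_ge2 t u : 0 < u -> 0 < t <= 1 ->
  (u - 1) ^+ 2 <= poisson_den t u /\ t ^+ 2 * (1 + u) ^+ 2 <= 16 * poisson_den t u.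
Proof.
move=> u0 /andP[t0 t1].
have E : poisson_den t u = (u - 1) ^+ 2 + 2 * u * (1 - cos t).
  by rewrite /poisson_den; ring.
have c1 : 0 <= 1 - cos t by rewrite subr_ge0 cos_le1.
have c2 : t ^+ 2 / 8 <= 1 - cos t.
  rewrite one_sub_cosE; have t20 : 0 <= t / 2 by lra.
  have := sin_cubic t20; rewrite ler_norml => /andP[+ _].
  have t21 : t ^+ 2 <= 1 by rewrite expr_le1 // ltW.
  have h1 : (t / 2) ^+ 3 <= t / 2 * 4^-1 by rewrite exprSr; nra.
  move=> h2; have h3 : t / 4 <= sin (t / 2) by lra.
  have h4 : (t / 4) ^+ 2 <= sin (t / 2) ^+ 2 by rewrite ler_pXn2r ?nnegrE//; lra.
  nra.
split; first by rewrite E lerDl mulr_ge0//; lra.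
rewrite E.
have h : u * (t ^+ 2 / 8) <= u * (1 - cos t) by rewrite ler_wpM2l ?(ltW u0).
have t21 : t ^+ 2 <= 1 by rewrite expr_le1 // ltW.
have h5 : t ^+ 2 * (u - 1) ^+ 2 <= (u - 1) ^+ 2 by rewrite ler_piMl ?sqr_ge0.
have h6 := sqr_ge0 (u - 1).
have -> : t ^+ 2 * (1 + u) ^+ 2 = t ^+ 2 * (u - 1) ^+ 2 + 4 * (u * t ^+ 2) by ring.
nra.
Qed.

(** The lower bound is Young's inequality and the upper bound says that the gap vanishes
    to second order at u = 1, where the Poisson kernel concentrates for small angles. *)
Lemma young_gap a u : 0 < a < 1 -> 0 < u ->
  0 <= a + u * (1 - a) - u `^ (1 - a) <= (u - 1) ^+ 2.
Proof.
move=> /andP[a0 a1] u0; have b0 : 0 < 1 - a by lra.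
apply/andP; split.
  have := @conjugate_powR R (u `^ (1 - a)) 1 (1 - a)^-1 a^-1
    (powR_ge0 _ _) ler01.
  rewrite !invr_gt0 !invrK mulr1 powR1 mul1r -powRrM mulfV ?(gt_eqF b0)// powRr1 ?(ltW u0)//.
  move=> /(_ b0 a0); rewrite subrK => /(_ erefl); lra.
have h : 1 - a * (u - 1) <= u `^ (- a).
  rewrite /powR gt_eqF//; apply: le_trans (expR_ge1Dx _).
  have := @le_ln1Dx R (u - 1); rewrite [1 + _]addrC subrK => h.
  have {}h : ln u <= u - 1 by apply: h; lra.
  by rewrite mulNr lerD2l lerN2 ler_pM2l.
have e : u `^ (1 - a) = u * u `^ (- a) by rewrite gt0_powRD// powRr1// ltW.
have h2 : u * (1 - a * (u - 1)) <= u `^ (1 - a) by rewrite e ler_pM2l.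
have h6 := sqr_ge0 (u - 1); have h7 : a * (u - 1) ^+ 2 <= 1 * (u - 1) ^+ 2.
  by rewrite ler_wpM2r// ltW.
nra.
Qed.

(** Near u = 1 the integrand is the Poisson kernel sin t / (u^2 - 2 u cos t + 1) to leading
    order; the error is of order t, uniformly in u, against an integrable weight. The
    constant 25 is 9 + 16, from the two terms in the numerator. *)
Lemma poisson_approx a t u : 0 < a < 1 -> 0 < u -> 0 < t <= 1 ->
  `|poisson a t u - sin t / poisson_den t u| <= 25 * t * pweight a u.
Proof.
move=> a01 u0 t01; have /andP[a0 a1] := a01; have /andP[t0 t1] := t01.
have [D1 D2] := poisson_den_ge2 u0 t01.
have u1 : 0 < 1 + u by lra.
have D0 : 0 < poisson_den t u.
  have : 0 < t ^+ 2 * (1 + u) ^+ 2 by rewrite mulr_gt0 ?exprn_gt0.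
  lra.
have pe : u `^ (a - 1) * u `^ (1 - a) = 1.
  by rewrite -gt0_powRD// addrC addrA subrK subrr powRr0.
set p := u `^ (a - 1) in pe *; have p0 : 0 <= p by exact: powR_ge0.
have -> : poisson a t u - sin t / poisson_den t u =
    p * (poisson_num a t u - u `^ (1 - a) * sin t) / poisson_den t u.
  by rewrite mulrBr mulrA pe mul1r mulrBl.
rewrite !normrM normfV (ger0_norm p0) (gtr0_norm D0) /pweight.
have -> : 25 * t * (p / (1 + u)) = p * (25 * t / (1 + u)) by ring.
rewrite -mulrA ler_wpM2l// ler_pdivrMr// mulrAC ler_pdivlMr//.
have /andP[g0 g1] := young_gap a01 u0.
set g := a + _ - _ in g0 g1.
have s1 : `|sin (a * t) - a * t| <= t ^+ 3 / 2.
  rewrite (le_trans (sin_cubic _))//; first by rewrite mulr_ge0// ltW.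
  rewrite ler_wpM2r// ler_pXn2r ?nnegrE ?mulr_ge0 ?(ltW t0) ?(ltW a0)//.
  by rewrite ler_piMl ?ltW.
have s2 : `|sin ((1 - a) * t) - (1 - a) * t| <= t ^+ 3 / 2.
  have b0 : 0 <= 1 - a by lra.
  rewrite (le_trans (sin_cubic _))//; first by rewrite mulr_ge0// ltW.
  rewrite ler_wpM2r// ler_pXn2r ?nnegrE ?mulr_ge0 ?(ltW t0)//.
  by rewrite ler_piMl ?(ltW t0)//; lra.
have s3 := sin_cubic (ltW t0).
have q0 : 0 <= u `^ (1 - a) by exact: powR_ge0.
have q1 : u `^ (1 - a) <= 1 + u by move: g0; rewrite /g; nra.
have num : `|poisson_num a t u - u `^ (1 - a) * sin t| <= t * g + t ^+ 3 * (1 + u).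
  have -> : poisson_num a t u - u `^ (1 - a) * sin t = t * g +
      ((sin (a * t) - a * t) + u * (sin ((1 - a) * t) - (1 - a) * t)
       - u `^ (1 - a) * (sin t - t)) by rewrite /poisson_num /g; ring.
  rewrite (le_trans (ler_normD _ _))// lerD//; first by rewrite ger0_norm// mulr_ge0 ?(ltW t0).
  rewrite (le_trans (ler_normB _ _))//.
  have e1 : `|sin (a * t) - a * t + u * (sin ((1 - a) * t) - (1 - a) * t)| <=
      t ^+ 3 / 2 + u * (t ^+ 3 / 2).
    by rewrite (le_trans (ler_normD _ _))// lerD// normrM (gtr0_norm u0) ler_wpM2l ?(ltW u0).
  have e2 : `|u `^ (1 - a) * (sin t - t)| <= (1 + u) * (t ^+ 3 / 2).
    by rewrite normrM (ger0_norm q0) ler_pM.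
  lra.
apply: le_trans (ler_wpM2r (ltW u1) num) _.
have k1 : t * g * (1 + u) <= 9 * t * poisson_den t u.
  have k : g * (1 + u) <= 9 * (u - 1) ^+ 2.
    have [u2|u2] := leP u 2.
      have : g * (1 + u) <= (u - 1) ^+ 2 * 3 by rewrite ler_pM//; lra.
      by have := sqr_ge0 (u - 1); lra.
    have gu : g <= 1 + u by rewrite /g; nra.
    have : g * (1 + u) <= (1 + u) * (1 + u) by rewrite ler_wpM2r ?(ltW u1).
    nra.
  have : t * (g * (1 + u)) <= t * (9 * poisson_den t u).
    by rewrite ler_wpM2l ?(ltW t0)//; lra.
  by rewrite mulrA [t * (9 * _)]mulrCA mulrA.
have k2 : t ^+ 3 * (1 + u) * (1 + u) <= 16 * t * poisson_den t u.
  have : t * (t ^+ 2 * (1 + u) ^+ 2) <= t * (16 * poisson_den t u).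
    by rewrite ler_wpM2l ?(ltW t0).
  have -> : t * (t ^+ 2 * (1 + u) ^+ 2) = t ^+ 3 * (1 + u) * (1 + u) by ring.
  by rewrite [t * (16 * _)]mulrCA mulrA.
lra.
Qed.

(** The denominator is (u - cos t)^2 + (sin t)^2, so atan ((u - cos t) / sin t) is a
    primitive. *)
Lemma integral_poisson_kernel t : 0 < t < pi ->
  (\int[mu]_(u in Ry) (sin t / poisson_den t u)%:E = (pi - t)%:E)%E.
Proof.
move=> tpi; have s0 := sin_gt0_pi tpi; have sn0 : sin t != 0 by rewrite gt_eqF.
have -> : pi - t = pi / 2 - (t - pi / 2) :> R by lra.
have posE u : Ry u -> 0 < u by rewrite /= in_itv/= andbT.
apply: (ge0_exhaustion_FTC (F := fun u => atan ((u - cos t) / sin t))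
  (@lo_lt_hi R) (@lohi_nd R) (@lohi_bigcup R)).
- move=> u /posE u0; have D0 : poisson_den t u != 0 by rewrite gt_eqF// poisson_den_gt0// ltW.
  have dD : is_derive u 1 (fun u => poisson_den t u) (2 * u - 2 * cos t).
    by rewrite /poisson_den; apply: is_derive_eq; rewrite /GRing.scale/=; ring.
  have dV := is_deriveV D0 dD; exact: continuous_is_derive.
- move=> u /posE u0; have D0 := poisson_den_gt0 tpi (ltW u0).
  have d1 : is_derive u 1 (fun u : R => (u - cos t) / sin t) (sin t)^-1.
    by apply: is_derive_eq; rewrite /GRing.scale/=; ring.
  have d2 := is_derive1_atan ((u - cos t) / sin t).
  have d3 := is_derive1_comp (f := @atan R) (g := fun u => (u - cos t) / sin t) d2 d1.
  apply: is_derive_eq.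
  have e : poisson_den t u = (u - cos t) ^+ 2 + sin t ^+ 2.
    transitivity ((u - cos t) ^+ 2 + sin t ^+ 2 + (1 - (cos t ^+ 2 + sin t ^+ 2))).
      by rewrite /poisson_den; ring.
    by rewrite cos2Dsin2 subrr addr0.
  have D1 : (u - cos t) ^+ 2 + sin t ^+ 2 != 0 by rewrite -e gt_eqF.
  by rewrite e; field; rewrite sn0 ?andbT /=; first [exact: D1|rewrite addrC; exact: D1].
- have -> : t - pi / 2 = atan (- cos t / sin t).
    rewrite -[LHS]tanK; last by rewrite in_itv/=; move: tpi => /andP[? ?]; apply/andP; split; lra.
    by rewrite /tan sinBpihalf cosBpihalf.
  apply: continuous_cvg; first exact: continuous_atan.
  apply: cvgMr_tmp; rewrite -[X in _ --> X]add0r; apply: cvgB; last exact: cvg_cst.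
  exact: cvg_lo.
- apply: (cvg_comp _ _ _ (@cvgy_atan R)).
  apply/cvgryPge => A; near=> n; rewrite ler_pdivlMr// lerBrDr.
  by near: n; move/cvgryPge : (@cvg_hi R); exact.
- move=> u /posE u0; rewrite divr_ge0 ?(ltW s0)// ltW//.
  exact: poisson_den_gt0 tpi (ltW u0).
Unshelve. all: end_near. Qed.

(** By rotation invariance the integral may be computed in the limit of angles tending
    to 0, where it is that of the Poisson kernel, namely pi - t. *)
Lemma integral_poisson a t : 0 < a < 1 -> 0 < t < pi ->
  \int[mu]_(u in Ry) poisson a t u = pi.
Proof.
move=> a01 tpi; have /andP[t0 tp] := tpi.
pose C := \int[mu]_(u in Ry) pweight a u.
have C0 : 0 <= C by apply: Rintegral_ge0 => u /=; rewrite in_itv/= andbT => u0; exact: pweight_ge0.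
have key x : 0 < x <= 1 -> x <= t ->
    `|\int[mu]_(u in Ry) poisson a t u - pi| <= (25 * C + 1) * x.
  move=> x01 xt; have /andP[x0 x1] := x01.
  have xpi : 0 < x < pi by rewrite x0/= (le_lt_trans xt).
  rewrite -(poisson_rotation a01 x0 xt tp).
  have ik : mu.-integrable Ry (EFin \o (fun u => sin x / poisson_den x u)).
    apply/integrableP; split.
      apply/measurable_EFinP; apply: measurable_Ry => u u0.
      have D0 : poisson_den x u != 0 by rewrite gt_eqF// poisson_den_gt0// ltW.
      have dD : is_derive u 1 (fun u => poisson_den x u) (2 * u - 2 * cos x).
        by rewrite /poisson_den; apply: is_derive_eq; rewrite /GRing.scale/=; ring.
      have dV := is_deriveV D0 dD; exact: continuous_is_derive.
    under eq_integral => u.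
      rewrite inE/= in_itv/= andbT => u0.
      rewrite ger0_norm; last first.
        by rewrite divr_ge0 ?(ltW (sin_gt0_pi xpi))// ltW// poisson_den_gt0// ltW.
      over.
    by rewrite /= integral_poisson_kernel// ltry.
  have e : \int[mu]_(u in Ry) (sin x / poisson_den x u) = pi - x.
    by rewrite /Rintegral integral_poisson_kernel.
  have ip := integrable_poisson a01 xpi.
  have -> : \int[mu]_(u in Ry) poisson a x u - pi =
      \int[mu]_(u in Ry) (poisson a x u - sin x / poisson_den x u) - x.
    by rewrite RintegralB// e; ring.
  have id : mu.-integrable Ry (EFin \o (fun u => poisson a x u - sin x / poisson_den x u)).
    exact: integrableBR.
  rewrite (le_trans (ler_normB _ _))// mulrDl mul1r lerD//; last by rewrite gtr0_norm.
  rewrite (le_trans (le_normr_Rintegral _ id))//.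
  have -> : 25 * C * x = \int[mu]_(u in Ry) (25 * x * pweight a u).
    by rewrite RintegralZl//; [rewrite /C; ring|exact: integrable_pweight].
  apply: le_Rintegral => //.
  - exact: integrable_norm id.
  - by apply: integrableZR => //; exact: integrable_pweight.
  - by move=> u /=; rewrite in_itv/= andbT => u0; exact: poisson_approx.
apply/eqP; rewrite -subr_eq0 -normr_le0; apply/ler_addgt0Pr => e e0; rewrite add0r.
pose x := Num.min (Num.min 1 t) (e / (25 * C + 1)).
have k0 : 0 < 25 * C + 1 by lra.
have x0 : 0 < x by rewrite !lt_min ltr01 t0 divr_gt0.
apply: (le_trans (key x _ _)).
- by rewrite x0/= !ge_min lexx.
- by rewrite !ge_min lexx orbT.
- by rewrite mulrC -ler_pdivlMr// ge_min lexx orbT.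
Qed.

End poisson.

(** * The Gamma function and Hankel integrals *)

Section gamma.
Context {R : realType}.
Notation mu := (@lebesgue_measure R).
Notation Ry := (`]0%R, +oo[%classic : set R).
Implicit Types (a b t u y m : R).

Lemma Ry_gt0 u : Ry u -> 0 < u.
Proof. by rewrite /= in_itv/= andbT. Qed.

Lemma integrable_Gamma b k : 0 < b -> 0 < k ->
  mu.-integrable Ry (EFin \o (fun u => u `^ (b - 1) * expR (- (k * u)))).
Proof.
move=> b0 k0.
have := @integrable_powR_expR R (b - 1) 1 k _ ltr01 k0.
rewrite ltrBrDr addNr => /(_ b0); apply: eq_integrable => //.
by move=> u; rewrite inE => /Ry_gt0 u0; rewrite /= powRr1// ltW.
Qed.

Lemma Gamma_scale b k : 0 < b -> 0 < k ->
  \int[mu]_(u in Ry) (u `^ (b - 1) * expR (- (k * u))) = k `^ (- b) * Gamma b.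
Proof.
move=> b0 k0.
have i := integrable_Gamma b0 k0.
have -> : Gamma b = k * (k `^ (b - 1) *
    \int[mu]_(u in Ry) (u `^ (b - 1) * expR (- (k * u)))).
  rewrite /Gamma (Rintegral_scale k0); last first.
    apply: measurable_funM; first exact: measurable_powR_Ry.
    by apply: measurableT_comp => //; exact: measurableT_comp.
  congr (_ * _); rewrite -RintegralZl//.
  apply: eq_Rintegral => u; rewrite inE => /Ry_gt0 u0.
  by rewrite powRM ?(ltW k0) ?(ltW u0)// mulrA.
by rewrite [k * _]mulrA gt0_mul_powRB1// mulrA -gt0_powRD// addNr powRr0 mul1r.
Qed.

Lemma Gamma_scaleE b k : 0 < b -> 0 < k ->
  (\int[mu]_(u in Ry) (u `^ (b - 1) * expR (- (k * u)))%:E = (k `^ (- b) * Gamma b)%:E)%E.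
Proof.
move=> b0 k0; rewrite -Gamma_scale// /Rintegral fineK//.
by apply: integrable_fin_num => //; exact: integrable_Gamma.
Qed.

Lemma Gamma_ge0 b : 0 <= Gamma b.
Proof.
by apply: Rintegral_ge0 => u _; rewrite mulr_ge0 ?powR_ge0 ?expR_ge0.
Qed.

Lemma Gamma_add1 b : 0 < b -> Gamma (b + 1) = b * Gamma b.
Proof.
move=> b0.
have i1 := integrable_Gamma b0 ltr01.
have b10 : 0 < b + 1 by rewrite addr_gt0.
have i2 := integrable_Gamma b10 ltr01.
pose f u : R := b * (u `^ (b - 1) * expR (- (1 * u))) - u `^ (b + 1 - 1) * expR (- (1 * u)).
have if_ : mu.-integrable Ry (EFin \o f) by apply: integrableBR => //; exact: integrableZR.
have [hlo hhi] := cvg0_powR_expR b0 (@ltr01 R) (@ltr01 R).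
have : \int[mu]_(u in Ry) f u = 0 - 0.
  apply: (integrable_exhaustion_FTC (F := fun u => u `^ b * expR (- (1 * u)))
    (@lo_lt_hi R) (@lohi_nd R) (@lohi_bigcup R)) => //.
  - move=> u /Ry_gt0 u0; have p1 := is_derive1_powR (b - 1) u0.
    have p2 := is_derive1_powR (b + 1 - 1) u0; rewrite /f; exact: continuous_is_derive.
  - move=> u /Ry_gt0 u0; have p1 := is_derive1_powR b u0.
    apply: is_derive_eq; rewrite /GRing.scale/= /f addrK; ring.
  - apply: cvg_trans hlo; apply: near_eq_cvg; apply: nearW => n.
    by rewrite powRr1 ?(ltW (lo_gt0 _)).
  - apply: cvg_trans hhi; apply: near_eq_cvg; apply: nearW => n.
    by rewrite powRr1 ?ler0n.
rewrite subrr /f RintegralB//; last exact: integrableZR.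
rewrite RintegralZl// (Gamma_scale b0 ltr01) (Gamma_scale b10 ltr01) !powR1 !mul1r.
by move/eqP; rewrite subr_eq0 => /eqP.
Qed.

Lemma Gamma1 : Gamma 1 = 1 :> R.
Proof.
have i := integrable_Gamma (@ltr01 R) (@ltr01 R).
have : \int[mu]_(u in Ry) expR (- u) = 0 - (- 1).
  apply: (integrable_exhaustion_FTC (F := fun u => - expR (- u))
    (@lo_lt_hi R) (@lohi_nd R) (@lohi_bigcup R)) => //.
  - by move=> u _; exact: continuous_is_derive.
  - by move=> u _; apply: is_derive_eq; rewrite /GRing.scale/=; ring.
  - apply: cvgN; rewrite -[X in _ --> X]expR0 -oppr0.
    apply: continuous_cvg; first exact: continuous_expR.
    by apply: cvgN; exact: cvg_lo.
  - by rewrite -oppr0; apply: cvgN; apply: (cvg_comp_hi (@cvgr_expR R)).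
  - apply: eq_integrable i => // u; rewrite inE => /Ry_gt0 u0.
    by rewrite /= subrr powRr0 !mul1r.
rewrite sub0r opprK => h; rewrite -[RHS]h /Gamma.
apply: eq_Rintegral => u; rewrite inE => /Ry_gt0 u0.
by rewrite subrr powRr0 mul1r.
Qed.

Lemma normr_sin_le y : `|sin y| <= `|y|.
Proof.
have [y0|y0] := leP 0 y; first by rewrite (ger0_norm y0) sin_le0.
by rewrite -normrN -sinN -(normrN y) (@ger0_norm _ (- y)) ?sin_le0; lra.
Qed.

(** Integral of the derivative of [u * ray kap c x al b t u], which vanishes at both
    ends. *)
Lemma ray_ibp kap c x al b t q k : 0 < b -> 0 < q -> 0 < k ->
  (forall u, 0 < u ->
    ray_modulus c x al b t u <= u `^ (b - 1) * expR (- (k * u `^ q))) ->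
  mu.-integrable Ry (EFin \o ray kap c x al b t) ->
  mu.-integrable Ry (EFin \o ray kap c x al (b + 1) t) ->
  mu.-integrable Ry (EFin \o ray kap c x al (b + al) t) ->
  b * \int[mu]_(u in Ry) ray kap c x al b t u
  + c * \int[mu]_(u in Ry) ray kap c x al (b + 1) t u
  - x * al * \int[mu]_(u in Ry) ray kap c x al (b + al) t u = 0.
Proof.
move=> b0 q0 k0 H i0 i1 i2.
have [hlo hhi] := cvg0_powR_expR b0 q0 k0.
have bd u : 0 < u -> `|u * ray kap c x al b t u| <= u `^ b * expR (- (k * u `^ q)).
  move=> u0; rewrite normrM (gtr0_norm u0) -(gt0_mul_powRB1 b u0) -mulrA.
  by rewrite ler_wpM2l ?(ltW u0)// (le_trans (norm_ray_le _ _ _ _ _ _ _))// H.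
rewrite -!RintegralZl// -RintegralD//; [|exact: integrableZR|exact: integrableZR].
rewrite -RintegralB//; [|apply: integrableDR => //; exact: integrableZR|exact: integrableZR].
rewrite -[RHS](subrr 0).
apply: (integrable_exhaustion_FTC (F := fun u => u * ray kap c x al b t u)
    (@lo_lt_hi R) (@lohi_nd R) (@lohi_bigcup R)) => //.
- move=> u /Ry_gt0 u0; exact: continuous_dray.
- move=> u /Ry_gt0 u0; exact: is_derive_uray.
- by apply: norm_le_cvg0 hlo => n; rewrite bd// lo_gt0.
- by apply: norm_le_cvg0 hhi => n; rewrite bd// /hi.
- apply: integrableBR => //; last exact: integrableZR.
  by apply: integrableDR => //; exact: integrableZR.
Qed.

(** The case b = 0 with phase 0. Here s^b exp(c s - x s^al) tends to 1 as s tends to 0, but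
    its imaginary part still vanishes there. *)
Lemma ray_ibp0 c x al t q k : 0 < al -> 0 < q -> 0 < k ->
  (forall u, 0 < u -> c * u * cos t - x * u `^ al * cos (al * t) <= - (k * u `^ q)) ->
  mu.-integrable Ry (EFin \o ray 0 c x al 1 t) ->
  mu.-integrable Ry (EFin \o ray 0 c x al al t) ->
  c * \int[mu]_(u in Ry) ray 0 c x al 1 t u
  = x * al * \int[mu]_(u in Ry) ray 0 c x al al t u.
Proof.
move=> al0 q0 k0 H i1 i2.
apply/eqP; rewrite -subr_eq0; apply/eqP.
have e u : 0 < u -> u * ray 0 c x al 0 t u = expR (c * u * cos t - x * u `^ al * cos (al * t))
    * sin (c * u * sin t - x * u `^ al * sin (al * t)).
  move=> u0; rewrite /ray /ray_modulus /ray_phase !mulrA gt0_mul_powRB1// powRr0 mul1r.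
  by congr (_ * sin _); ring.
have E1 u : 0 < u -> expR (c * u * cos t - x * u `^ al * cos (al * t)) <= 1.
  move=> u0; rewrite -expR0 ler_expR (le_trans (H _ u0))// oppr_le0.
  by rewrite mulr_ge0 ?powR_ge0 ?ltW.
rewrite -!RintegralZl// -RintegralB//; [|exact: integrableZR|exact: integrableZR].
rewrite -[RHS](subrr 0).
apply: (integrable_exhaustion_FTC (F := fun u => u * ray 0 c x al 0 t u)
    (@lo_lt_hi R) (@lohi_nd R) (@lohi_bigcup R)) => //.
- move=> u /Ry_gt0 u0; apply: continuousB; apply: continuousM;
    by [exact: cst_continuous|exact: continuous_ray].
- move=> u /Ry_gt0 u0; have := is_derive_uray 0 c x al 0 t u0.
  by rewrite /dray mul0r !add0r.
- apply: (@norm_le_cvg0 _ _ (fun n => `|c * sin t| * lo n + `|x * sin (al * t)| * (1 * lo n) `^ al)).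
    move=> n; have l0 := lo_gt0 (R := R) n; rewrite e// normrM ger0_norm ?expR_ge0// mul1r.
    apply: (@le_trans _ _ (1 * `|c * lo n * sin t - x * lo n `^ al * sin (al * t)|)).
      by rewrite ler_pM ?expR_ge0 ?E1 ?normr_sin_le.
    rewrite mul1r (le_trans (ler_normB _ _))// lerD// !normrM.
      by rewrite (gtr0_norm l0) mulrAC.
    by rewrite (ger0_norm (powR_ge0 _ _)) mulrAC.
  rewrite -[X in _ --> X]addr0; apply: cvgD; apply: cvg0Ml; first exact: cvg_lo.
  exact: cvg_powR_lo.
- have [C C0 HC] := powR_expR_le 0 q0 k0.
  apply: (@norm_le_cvg0 _ _ (fun n => C * lo n)); last by apply: cvg0Ml; exact: cvg_lo.
  move=> n; have h0 : 0 < hi n :> R by rewrite /hi.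
  rewrite e// normrM ger0_norm ?expR_ge0//.
  apply: (@le_trans _ _ (expR (- (k * hi n `^ q)))).
    apply: (@le_trans _ _ (expR (c * hi n * cos t - x * hi n `^ al * cos (al * t)))).
      by rewrite ler_piMr ?expR_ge0 ?sin_max.
    by rewrite ler_expR H.
  have := HC (hi n); rewrite powRr0 mul1r => h; rewrite (le_trans (h _))//.
    by rewrite /hi ler1n.
  rewrite ler_pM2l// /lo /hi -exprVn expr2 ler_piMl// ?invr_ge0//.
  by rewrite invf_le1// ler1n.
- by apply: integrableBR => //; exact: integrableZR.
Qed.

Lemma laplace_sin kap s A : 0 < A ->
  let h u := expR (- (A * u)) * sin (kap + s * u) in
  mu.-integrable Ry (EFin \o h) /\
  \int[mu]_(u in Ry) h u = (A * sin kap + s * cos kap) / (A ^+ 2 + s ^+ 2).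
Proof.
move=> A0 h; have D0 : A ^+ 2 + s ^+ 2 != 0.
  by rewrite gt_eqF// ltr_wpDr ?sqr_ge0// exprn_gt0.
have ig := integrable_Gamma (@ltr01 R) A0.
have bd u : 0 < u -> `|h u| <= u `^ (1 - 1) * expR (- (A * u)).
  move=> u0; rewrite /h subrr powRr0 mul1r normrM ger0_norm ?expR_ge0//.
  by rewrite ler_piMr ?expR_ge0 ?sin_max.
have ch u : {for u, continuous h} by rewrite /h; exact: continuous_is_derive.
have ih : mu.-integrable Ry (EFin \o h).
  apply: le_integrableR ig => //; first by apply: measurable_Ry.
  by move=> u /Ry_gt0; exact: bd.
split => //.
pose F u := - (expR (- (A * u)) * (A * sin (kap + s * u) + s * cos (kap + s * u)) / (A ^+ 2 + s ^+ 2)).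
have dF u : is_derive u 1 F (h u).
  by rewrite /F /h; apply: is_derive_eq; rewrite /GRing.scale/=; field; exact: D0.
have -> : (A * sin kap + s * cos kap) / (A ^+ 2 + s ^+ 2) = 0 - F 0.
  by rewrite /F !mulr0 !addr0 oppr0 expR0 mul1r sub0r opprK.
apply: (integrable_exhaustion_FTC (F := F)
    (@lo_lt_hi R) (@lohi_nd R) (@lohi_bigcup R)) => //.
- apply: continuous_cvg; last exact: cvg_lo.
  exact: continuous_is_derive (dF 0).
- have [_ hhi] := cvg0_powR_expR (@ltr01 R) (@ltr01 R) A0.
  apply: (@norm_le_cvg0 _ _ (fun n => (`|A| + `|s|) / (A ^+ 2 + s ^+ 2) *
      (hi n `^ 1 * expR (- (A * hi n `^ 1))))); last exact: cvg0Ml.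
  move=> n; rewrite powRr1 ?ler0n// /F normrN !normrM normfV (ger0_norm (expR_ge0 _)).
  rewrite (ger0_norm (x := A ^+ 2 + s ^+ 2)) ?addr_ge0 ?sqr_ge0//.
  have h1 : 1 <= hi n :> R by rewrite /hi ler1n.
  rewrite -mulrA [leRHS]mulrC.
  apply: ler_pM; rewrite ?expR_ge0 ?divr_ge0 ?addr_ge0 ?sqr_ge0//.
    by rewrite ler_peMl ?expR_ge0.
  rewrite ler_wpM2r ?invr_ge0 ?addr_ge0 ?sqr_ge0//.
  rewrite (le_trans (ler_normD _ _))// !normrM.
  by rewrite lerD// ler_piMr ?sin_max ?cos_max.
Qed.

(** Hankel's integral of s^(b-1) exp(s), taken on the upper half of the contour. *)
Definition hankel b t : R := \int[mu]_(u in Ry) ray 0 1 0 1 b t u.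

Section hankel.
Variable t : R.
Hypothesis tpi : pi / 2 < t < pi.

Lemma hankel_cos : cos t < 0.
Proof.
rewrite -[t](subrK (pi / 2)) cosDpihalf oppr_lt0 sin_gt0_pihalf//.
by move: tpi => /andP[? ?]; apply/andP; split; lra.
Qed.

Lemma hankel_modulus b u : 0 < u ->
  ray_modulus 1 0 1 b t u <= u `^ (b - 1) * expR (- (- cos t * u `^ 1)).
Proof.
move=> u0; rewrite le_eqVlt; apply/orP; left; apply/eqP.
by rewrite /ray_modulus powRr1 ?(ltW u0)//; congr (_ * expR _); ring.
Qed.

Lemma integrable_hankel b : 0 < b -> mu.-integrable Ry (EFin \o ray 0 1 0 1 b t).
Proof.
move=> b0; apply: (integrable_ray _ b0 ltr01 (k := - cos t)); last first.
  exact: hankel_modulus.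
by rewrite oppr_gt0 hankel_cos.
Qed.

Lemma hankel_add1 b : 0 < b -> hankel (b + 1) t = - b * hankel b t.
Proof.
move=> b0; have b10 : 0 < b + 1 by rewrite addr_gt0.
have k0 : 0 < - cos t by rewrite oppr_gt0 hankel_cos.
have i0 := integrable_hankel b0; have i1 := integrable_hankel b10.
have := ray_ibp b0 (@ltr01 R) k0 (hankel_modulus b) i0 i1 i1.
rewrite mul0r mul0r subr0 mul1r => /eqP; rewrite addrC addr_eq0 => /eqP.
by rewrite /hankel mulNr.
Qed.

Lemma hankel1 : hankel 1 t = 0.
Proof.
have k0 : 0 < - cos t by rewrite oppr_gt0 hankel_cos.
have i1 := integrable_hankel (@ltr01 R).
have h u : 0 < u -> 1 * u * cos t - 0 * u `^ 1 * cos (1 * t) <= - (- cos t * u `^ 1).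
  move=> u0; rewrite le_eqVlt; apply/orP; left; apply/eqP.
  by rewrite powRr1 ?(ltW u0)//; ring.
have := ray_ibp0 (@ltr01 R) (@ltr01 R) k0 h i1 i1.
by rewrite mul0r mul0r mul1r.
Qed.

(** Writing Gamma(1-b) u^(b-1) as the integral of w^(-b) exp(-u w) dw and integrating
    in u first leaves the integrand of [integral_poisson]. This is the
    reflection formula Gamma(b) Gamma(1-b) sin(pi b) = pi in disguise. *)
Lemma hankel_reflection b : 0 < b < 1 -> hankel b t * Gamma (1 - b) = pi.
Proof.
move=> /andP[b0 b1]; have a0 : 0 < 1 - b by rewrite subr_gt0.
have a01 : 0 < 1 - b < 1 by rewrite a0 ltrBlDr ltrDl.
have t0pi : 0 < t < pi by have p0 := @pi_gt0 R; move: tpi => /andP[? ?]; apply/andP; split; lra.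
rewrite -(integral_poisson a01 t0pi).
have ib := integrable_hankel b0.
pose f u w : R := expR (u * cos t) * sin (b * t + u * sin t) *
  (w `^ (1 - b - 1) * expR (- (u * w))).
have f1 u : 0 < u -> expR (u * cos t) * sin (b * t + u * sin t) * u `^ (- (1 - b))
    = ray 0 1 0 1 b t u.
  move=> u0; rewrite /ray /ray_modulus /ray_phase opprB mulrC mulrA.
  by congr (_ * expR _ * sin _); ring.
transitivity (\int[mu]_(u in Ry) \int[mu]_(w in Ry) f u w).
  rewrite /hankel mulrC -RintegralZl//; apply: eq_Rintegral => u; rewrite inE => /Ry_gt0 u0.
  rewrite /f RintegralZl//; last exact: integrable_Gamma.
  by rewrite Gamma_scale// mulrA f1// mulrC.
rewrite RfubiniD//.
- apply: eq_Rintegral => w; rewrite inE => /Ry_gt0 w0.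
  have A0 : 0 < w - cos t by have := hankel_cos; lra.
  transitivity (\int[mu]_(u in Ry) (w `^ (1 - b - 1) *
      (expR (- ((w - cos t) * u)) * sin (b * t + sin t * u)))).
    apply: eq_Rintegral => u _; rewrite /f.
    have -> : - ((w - cos t) * u) = u * cos t + - (u * w) by ring.
    by rewrite expRD [sin t * u]mulrC; ring.
  have [i E] := laplace_sin (b * t) (sin t) A0.
  rewrite RintegralZl// E /poisson /poisson_num.
  have -> : 1 - (1 - b) = b by ring.
  have -> : (1 - b) * t = t - b * t by ring.
  have -> : (w - cos t) ^+ 2 + sin t ^+ 2 = poisson_den t w.
    transitivity (poisson_den t w - (1 - (cos t ^+ 2 + sin t ^+ 2))).
      by rewrite /poisson_den; ring.
    by rewrite cos2Dsin2 subrr subr0.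
  by rewrite sinB; ring.
- apply: measurable_funTS; apply: measurable_funM.
    apply: measurable_funM.
      apply: measurableT_comp => //; apply: measurable_funM => //.
    apply: measurableT_comp; first exact: continuous_measurable_fun (@continuous_sin R).
    apply: measurable_funD => //; exact: measurable_funM.
  apply: measurable_funM.
    exact: (measurableT_comp (measurable_powR _)).
  apply: measurableT_comp => //; apply: measurableT_comp => //.
  exact: measurable_funM.
- rewrite [X in (X < _)%E](_ : _ =
      (\int[mu]_(u in Ry) (Gamma (1 - b) * `|ray 0 1 0 1 b t u|)%:E)%E).
    apply: integrable_lty => //.
    apply: (@integrableZR _ _ _ mu Ry _ (fun u => `|ray 0 1 0 1 b t u|)) => //.
    exact: integrable_norm.
  apply: eq_integral => u; rewrite inE => /Ry_gt0 u0.
  transitivity (`|expR (u * cos t) * sin (b * t + u * sin t)|%:E *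
      \int[mu]_(w in Ry) (w `^ (1 - b - 1) * expR (- (u * w)))%:E)%E.
    rewrite -ge0_integralZl_EFin//.
    - apply: eq_integral => w _; rewrite -EFinM /= /f normrM; congr (_ * _)%:E.
      by rewrite ger0_norm// mulr_ge0 ?powR_ge0 ?expR_ge0.
    - by move=> w _; rewrite lee_fin mulr_ge0 ?powR_ge0 ?expR_ge0.
    - by have /integrableP[] := integrable_Gamma a0 u0.
  rewrite Gamma_scaleE// -EFinM mulrA -(f1 _ u0) [in RHS]normrM.
  by rewrite (ger0_norm (powR_ge0 _ _)) mulrC.
Qed.

Lemma Gamma_neq0 b : 0 < b < 1 -> Gamma b != 0 :> R.
Proof.
move=> /andP[b0 b1]; have := @hankel_reflection (1 - b).
rewrite subKr subr_gt0 b1 gtrBl b0 => /(_ erefl) h.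
by apply: contra_eq_neq h => ->; rewrite mulr0 eq_sym gt_eqF// pi_gt0.
Qed.

Lemma hankelDn b n : 0 < b ->
  hankel (b + n%:R) t = (\prod_(k < n) (1 - b - n%:R + k%:R)) * hankel b t.
Proof.
move=> b0; elim: n => [|n IHn]; first by rewrite addr0 big_ord0 mul1r.
have bn0 : 0 < b + n%:R by rewrite ltr_wpDr.
rewrite -natr1 addrA hankel_add1// IHn big_ord_recl mulrA.
congr (_ * _ * _); first by rewrite /=; ring.
by apply: eq_bigr => k _; rewrite lift0 -natr1; ring.
Qed.

(** Extension of [hankel_reflection] to all b > 0: both sides satisfy the same recursion
    under b -> b + 1, and for integral b both vanish, 1/Gamma having a zero there. *)
Lemma hankel_rGamma b : 0 < b -> hankel b t = pi * rGamma (1 - b).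
Proof.
move=> b0; rewrite /rGamma.
pose n := `|Num.floor (1 - b)|%N.
have flE : Num.floor (1 - b) = - n%:Z.
  by rewrite /n lez0_abs ?opprK// floor_le0 ltrBlDr ltrDl.
have fI := floor_itv (1 - b); rewrite flE intrD mulrNz -pmulrn in fI.
have /andP[h1 h2] := fI.
pose b' := b - n%:R.
have bE : b = b' + n%:R by rewrite /b' subrK.
have b'0 : 0 < b' by rewrite /b'; move: h2; rewrite /= => h2; lra.
have b'1 : b' <= 1 by rewrite /b'; lra.
rewrite -/n big_ord_recr/= bE hankelDn//.
have -> : \prod_(i < n) (1 - (b' + n%:R) + i%:R) = \prod_(k < n) (1 - b' - n%:R + k%:R).
  by apply: eq_bigr => k _; ring.
have -> : 1 - (b' + n%:R) + n%:R = 1 - b' by ring.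
have -> : 1 - (b' + n%:R) + n.+1%:R = (1 - b') + 1 by rewrite -natr1; ring.
move: b'1; rewrite le_eqVlt => /predU1P[->|b'1].
  by rewrite hankel1 subrr mulr0 mul0r !mulr0.
have b'01 : 0 < b' < 1 by rewrite b'0.
have c01 : 0 < 1 - b' < 1 by rewrite subr_gt0 b'1 gtrBl.
have c0 : 1 - b' != 0 by rewrite subr_eq0 gt_eqF.
have G0 := Gamma_neq0 c01.
rewrite Gamma_add1 ?subr_gt0// -(hankel_reflection b'01).
by field; rewrite G0 c0.
Qed.

End hankel.

End gamma.

(** * The Mainardi function as a contour integral *)

Section mainardi.
Context {R : realType}.
Notation mu := (@lebesgue_measure R).
Notation Ry := (`]0%R, +oo[%classic : set R).
Implicit Types (b t u y m kap phi : R).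

(** Imaginary part of exp(i kap) exp(- y exp(i phi)); [exp_ray_sum] is that of the Taylor
    polynomial in y. *)
Definition exp_ray kap phi y : R := expR (- (y * cos phi)) * sin (kap - y * sin phi).
Definition exp_ray_sum n kap phi y : R :=
  \sum_(k < n) (- y) ^+ k / k`!%:R * sin (kap + k%:R * phi).

Lemma is_derive_exp_ray kap phi y :
  is_derive y 1 (exp_ray kap phi) (- exp_ray (kap + phi) phi y).
Proof.
rewrite /exp_ray; apply: is_derive_eq; rewrite /GRing.scale/=.
have -> : kap + phi - y * sin phi = (kap - y * sin phi) + phi by ring.
by rewrite (sinD (kap - y * sin phi)); ring.
Qed.

Lemma is_derive_monomial (c y : R) n :
  is_derive y 1 (fun y => c * y ^+ n.+1) (c * (n.+1%:R * y ^+ n)).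
Proof.
have d := @is_deriveX R R id n y 1 1 (is_derive_id y 1).
have d2 := @is_deriveZ R R R _ c y 1 _ d.
rewrite (_ : (fun y => c * y ^+ n.+1) = c \*: (id ^+ n.+1)); last first.
  by apply/funext => z; rewrite /= exprfctE.
by apply: is_derive_eq; rewrite /GRing.scale/= mulr1.
Qed.

Lemma is_derive_exp_ray_sum n kap phi y :
  is_derive y 1 (exp_ray_sum n.+1 kap phi) (- exp_ray_sum n (kap + phi) phi y).
Proof.
rewrite /exp_ray_sum.
have -> : (fun y => \sum_(k < n.+1) (- y) ^+ k / k`!%:R * sin (kap + k%:R * phi)) =
    \sum_(k < n.+1) (fun y => (- y) ^+ k / k`!%:R * sin (kap + k%:R * phi)).
  by apply/funext => z; rewrite fct_sumE.
have d (k : 'I_n.+1) : is_derive y 1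
    (fun y => (- y) ^+ k / k`!%:R * sin (kap + k%:R * phi))
    (- (k%:R * (- y) ^+ k.-1) / k`!%:R * sin (kap + k%:R * phi)).
  case: k => -[|k] kn /=.
    have -> : (fun y => (- y) ^+ 0 / 0`!%:R * sin (kap + 0%:R * phi)) =
        cst (sin (kap + 0%:R * phi)).
      by apply/funext => z; rewrite expr0 fact0 divr1 mul1r.
    by rewrite !mul0r oppr0 !mul0r; exact: is_derive_cst.
  have -> : (fun y => (- y) ^+ k.+1 / k.+1`!%:R * sin (kap + k.+1%:R * phi)) =
      (fun y => ((-1) ^+ k.+1 / k.+1`!%:R * sin (kap + k.+1%:R * phi)) * y ^+ k.+1).
    apply/funext => z; rewrite [(- z) ^+ _]exprNn -!mulrA; congr (_ * _).
    by rewrite mulrC -!mulrA.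
  have := is_derive_monomial
    ((-1) ^+ k.+1 / k.+1`!%:R * sin (kap + k.+1%:R * phi)) y k.
  congr is_derive; rewrite [(- y) ^+ k]exprNn [(-1) ^+ k.+1]exprS.
  by move: (k.+1`!%:R)^-1 => F; ring.
have := is_derive_sum d.
move=> h; apply: is_derive_eq; rewrite big_ord_recl/= mul0r oppr0 mul0r mul0r add0r.
rewrite -sumrN; apply: eq_bigr => k _; rewrite /bump leq0n add1n add0n factS natrM.
have -> : kap + k.+1%:R * phi = kap + phi + k%:R * phi by rewrite -natr1; ring.
have N0 : k.+1%:R != 0 :> R by rewrite pnatr_eq0.
have F0 : k`!%:R != 0 :> R by rewrite pnatr_eq0 -lt0n fact_gt0.
by move: (k.+1%:R) (k`!%:R) N0 F0 => N F N0 F0; field; rewrite N0 F0.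
Qed.

(** Induction on n: differentiating the remainder in y gives the remainder of order n-1
    with kap shifted by phi, which the mean value theorem integrates back. *)
Lemma exp_ray_remainder n kap phi y : 0 <= y ->
  `|exp_ray kap phi y - exp_ray_sum n kap phi y| <= y ^+ n / n`!%:R * expR y.
Proof.
elim: n kap phi y => [|n IH] kap phi y y0.
  rewrite /exp_ray_sum big_ord0 subr0 expr0 fact0 divr1 mul1r /exp_ray normrM.
  rewrite ger0_norm ?expR_ge0//.
  apply: (@le_trans _ _ (expR (- (y * cos phi)))).
    by rewrite ler_piMr ?expR_ge0 ?sin_max.
  by rewrite ler_expR; have := cos_geN1 phi; nra.
move: y0; rewrite le_eqVlt => /predU1P[<-|y0].
  rewrite /exp_ray /exp_ray_sum big_ord_recl/= expr0 fact0 divr1 mul1r big1.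
    by rewrite !mul0r !oppr0 expR0 mul1r !addr0 subrr normr0 expr0n/= !mul0r.
  by move=> k _; rewrite /bump leq0n add1n oppr0 expr0n/= !mul0r.
pose h s := exp_ray kap phi s - exp_ray_sum n.+1 kap phi s.
pose h' s := - (exp_ray (kap + phi) phi s - exp_ray_sum n (kap + phi) phi s).
have dh (s : R) : is_derive s 1 h (h' s).
  have d1 := is_derive_exp_ray kap phi s.
  have d2 := is_derive_exp_ray_sum n kap phi s.
  rewrite /h /h'; apply: is_derive_eq; ring.
have h0 : h 0 = 0.
  rewrite /h /exp_ray /exp_ray_sum big_ord_recl/= expr0 fact0 divr1 mul1r big1.
    by rewrite !mul0r !oppr0 expR0 mul1r !addr0 subrr.
  by move=> k _; rewrite /bump leq0n add1n oppr0 expr0n/= !mul0r.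
have key (e : R) : `|e| = 1 -> e * h y <= y ^+ n.+1 / n.+1`!%:R * expR y.
  move=> e1.
  pose g s := expR y / n.+1`!%:R * s ^+ n.+1 - e * h s.
  have dg (s : R) : is_derive s 1 g (s ^+ n / n`!%:R * expR y - e * h' s).
    have d1 := is_derive_monomial (expR y / n.+1`!%:R) s n.
    have d2 : is_derive s 1 (fun s => e * h s) (e * h' s).
      by have d := dh s; apply: is_derive_eq; rewrite /GRing.scale/=; ring.
    have := is_deriveB d1 d2; congr is_derive; congr (_ - _).
    rewrite factS natrM invfM; have n0 : n.+1%:R != 0 :> R by rewrite pnatr_eq0.
    rewrite mulrA mulrC -!mulrA; congr (_ * _).
    by rewrite mulrC; congr (_ * _); rewrite mulrC -mulrA mulfV ?mulr1.
  have cg : {within `[0, y], continuous g}.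
    by apply: continuous_subspaceT => s; exact: continuous_is_derive (dg s).
  have [c] := MVT y0 (fun s _ => dg s) cg.
  rewrite in_itv/= => /andP[c0 cy].
  have g0 : g 0 = 0 by rewrite /g h0 expr0n/= !mulr0 subrr.
  have gy : g y = y ^+ n.+1 / n.+1`!%:R * expR y - e * h y.
    by rewrite /g; congr (_ - _); rewrite mulrAC [expR y * _]mulrC mulrAC.
  rewrite g0 !subr0 => gE; rewrite -subr_ge0 -gy gE mulr_ge0 ?(ltW y0)//.
  rewrite subr_ge0 (le_trans (ler_norm _))// normrM e1 mul1r normrN.
  rewrite (le_trans (IH _ _ _ (ltW c0)))//.
  by rewrite ler_wpM2l ?divr_ge0 ?exprn_ge0 ?(ltW c0)// ler_expR ltW.
rewrite -/(h y) ler_norml; apply/andP; split.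
  by have := key (-1); rewrite normrN1 => /(_ erefl); lra.
by have := key 1; rewrite normr1 => /(_ erefl); lra.
Qed.

Lemma powR_le_linear (al : R) (e : R) : 0 < al < 1 -> 0 < e ->
  exists2 C, 0 < C & forall u, 0 < u -> u `^ al <= e * u + C.
Proof.
move=> /andP[al0 al1] e0.
have b01 : 0 < 1 - al < 1 by rewrite subr_gt0 al1 gtrBl.
pose l := e `^ (1 - al)^-1; have l0 : 0 < l by rewrite powR_gt0.
have lE : l `^ (1 - al) = e.
  by rewrite /l -powRrM mulVf ?powRr1 ?(ltW e0)// subr_eq0 gt_eqF.
exists (l `^ (- al)); first by rewrite powR_gt0.
move=> u u0; have := young_gap b01 (mulr_gt0 l0 u0); rewrite subKr => /andP[+ _].
rewrite powRM ?(ltW l0) ?(ltW u0)// => h.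
have {}h : l `^ al * u `^ al <= 1 + l * u.
  have lu : 0 < l * u by rewrite mulr_gt0.
  have : 0 < (1 - al) * (l * u) by rewrite mulr_gt0// subr_gt0.
  lra.
have pl : l `^ al * l `^ (- al) = 1 by rewrite -gt0_powRD// subrr powRr0.
have -> : u `^ al = l `^ (- al) * (l `^ al * u `^ al) by rewrite mulrA [X in X * _]mulrC pl mul1r.
apply: (le_trans (ler_wpM2l (powR_ge0 _ _) h)).
have e2 : l `^ (- al) * l = e by rewrite -[X in _ * X]powRr1 ?(ltW l0)// -gt0_powRD// addrC.
by rewrite mulrDr mulr1 mulrA e2 addrC.
Qed.

Variable al : R.
Hypothesis al01 : 0 < al < 1.

Let al0 : 0 < al. Proof. by case/andP: al01. Qed.
Let al1 : al < 1. Proof. by case/andP: al01. Qed.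

(** On a ray of such an angle t both exp(s) and exp(- x s^al) decay, since cos t < 0 and
    cos (al t) > 0. *)
Lemma opening_angle : exists2 t : R, pi / 2 < t < pi & al * t < pi / 2.
Proof.
have p0 := @pi_gt0 R.
(* The second condition becomes al (3 - al) < 2, that is (1 - al) (2 - al) > 0. *)
exists (pi / 2 * (1 + (1 - al) / 2)).
  have h1 : 0 < pi * (1 - al) by rewrite mulr_gt0// subr_gt0.
  have h2 : 0 < pi * al by rewrite mulr_gt0.
  by apply/andP; split; lra.
have h : al * (3 - al) < 2.
  have c1 : 0 < 1 - al by rewrite subr_gt0.
  have c2 : 0 < 2 - al by lra.
  by have := mulr_gt0 c1 c2; lra.
have -> : al * (pi / 2 * (1 + (1 - al) / 2)) = pi / 4 * (al * (3 - al)) by field.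
nra.
Qed.

Section angle.
Variable t : R.
Hypothesis tpi : pi / 2 < t < pi.
Hypothesis alt : al * t < pi / 2.

Let cost : cos t < 0. Proof. exact: hankel_cos. Qed.

Let t_gt0 : 0 < t.
Proof. by have p0 := @pi_gt0 R; case/andP: tpi => ? _; lra. Qed.

Let cosalt : 0 < cos (al * t).
Proof.
have p0 := @pi_gt0 R; apply: cos_gt0_pihalf; rewrite alt andbT.
by have : 0 < al * t by [rewrite mulr_gt0]; lra.
Qed.

Lemma ray_exp_ray (x u : R) : 0 < u -> ray 0 1 x al al t u =
  u `^ (al - 1) * expR (u * cos t) *
  exp_ray (al * t + u * sin t) (al * t) (x * u `^ al).
Proof.
move=> u0; rewrite /ray /ray_modulus /ray_phase /exp_ray.
have -> : 1 * u * cos t - x * u `^ al * cos (al * t) =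
    u * cos t + - (x * u `^ al * cos (al * t)) by ring.
have -> : 0 + al * t + 1 * u * sin t - x * u `^ al * sin (al * t) =
    al * t + u * sin t - x * u `^ al * sin (al * t) by ring.
by rewrite expRD; ring.
Qed.

Lemma ray_exp_ray_sum (x u : R) n : 0 < u ->
  \sum_(k < n) ((- x) ^+ k / k`!%:R * ray 0 1 0 1 (al * k.+1%:R) t u) =
  u `^ (al - 1) * expR (u * cos t) *
  exp_ray_sum n (al * t + u * sin t) (al * t) (x * u `^ al).
Proof.
move=> u0; rewrite /exp_ray_sum mulr_sumr; apply: eq_bigr => k _.
rewrite /ray /ray_modulus /ray_phase.
have -> : u `^ (al * k.+1%:R - 1) = u `^ (al - 1) * (u `^ al) ^+ k.
  rewrite -powR_mulrn ?powR_ge0// -powRrM -gt0_powRD//; congr powR.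
  by rewrite -natr1; ring.
have -> : 0 + al * k.+1%:R * t + 1 * u * sin t - 0 * u `^ 1 * sin (1 * t) =
  al * t + u * sin t + k%:R * (al * t) by rewrite -natr1; ring.
have -> : 1 * u * cos t - 0 * u `^ 1 * cos (1 * t) = u * cos t by ring.
by rewrite -mulNr exprMn; ring.
Qed.

(** Expanding exp(- x s^al) under the integral sign, the k-th term is a Hankel integral
    with b = al (k+1), hence pi / Gamma(1 - al (k+1)). The remainder is dominated because
    exp(2 x u^al) is absorbed by exp(u cos t). *)
Lemma mainardi_series (x : R) : 0 <= x ->
  series (fun k : nat => (- x) ^+ k / k`!%:R * rGamma (1 - al * k.+1%:R)) n
  @[n --> \oo] --> pi^-1 * \int[mu]_(u in Ry) ray 0 1 x al al t u.
Proof.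
move=> x0; have p0 := @pi_gt0 R.
(* This slope makes 2 x u^al at most 2 x C + |cos t| u / 2. *)
have k0 : 0 < - cos t / (4 * x + 1) by rewrite divr_gt0 ?oppr_gt0//; lra.
have [C C0 HC] := powR_le_linear al01 k0.
pose w u := u `^ (al - 1) * expR (u * cos t).
have w0 u : 0 <= w u by rewrite mulr_ge0 ?powR_ge0 ?expR_ge0.
pose G u := expR (2 * x * C) * (u `^ (al - 1) * expR (- (- cos t / 2 * u))).
have iG : mu.-integrable Ry (EFin \o G).
  by apply: integrableZR => //; apply: integrable_Gamma => //; rewrite divr_gt0 ?oppr_gt0.
have wG u : 0 < u -> w u * expR (2 * (x * u `^ al)) <= G u.
  move=> u0.
  have -> : w u * expR (2 * (x * u `^ al)) =
      u `^ (al - 1) * expR (u * cos t + 2 * (x * u `^ al)) by rewrite /w expRD; ring.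
  have -> : G u = u `^ (al - 1) * expR (2 * x * C + - (- cos t / 2 * u)).
    by rewrite /G expRD; ring.
  rewrite ler_wpM2l ?powR_ge0// ler_expR.
  have h1 : x * u `^ al <= x * (- cos t / (4 * x + 1) * u + C) by rewrite ler_wpM2l// HC.
  have h2 : 4 * x / (4 * x + 1) <= 1 by rewrite ler_pdivrMr; lra.
  have h3 : (- cos t) * u * (4 * x / (4 * x + 1)) <= (- cos t) * u * 1.
    by rewrite ler_wpM2l// mulr_ge0 ?(ltW u0) ?oppr_ge0 ?(ltW cost).
  have h4 : x * (- cos t / (4 * x + 1) * u) = (- cos t) * u * (4 * x / (4 * x + 1)) / 4.
    by field; rewrite gt_eqF//; lra.
  lra.
pose D n u := w u * ((x * u `^ al) ^+ n / n`!%:R * expR (x * u `^ al)).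
have y0 u : 0 <= x * u `^ al by rewrite mulr_ge0 ?powR_ge0.
have ex0 n (y : R) : 0 <= y -> y ^+ n / n`!%:R <= expR y.
  case: n => [|n] yy; first by rewrite expr0 fact0 divr1 -expR0 ler_expR.
  by apply: le_trans (expR_ge1Dxn n yy); rewrite lerDr.
have DG n u : Ry u -> `|D n u| <= G u.
  move=> /Ry_gt0 u0; rewrite ger0_norm; last first.
    by rewrite mulr_ge0 ?w0// mulr_ge0 ?divr_ge0 ?exprn_ge0 ?expR_ge0.
  apply: le_trans (wG _ u0); rewrite /D ler_wpM2l ?w0//.
  by rewrite mulr2n mulrDl mul1r expRD ler_wpM2r ?expR_ge0// ex0.
have mw : measurable_fun Ry w.
  apply: measurable_funM; first exact: measurable_powR_Ry.
  by apply: measurableT_comp => //; exact: measurable_funM.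
have my : measurable_fun Ry (fun u => x * u `^ al).
  by apply: measurable_funM => //; exact: measurable_powR_Ry.
have mD n : measurable_fun Ry (D n).
  apply: measurable_funM => //; apply: measurable_funM.
    by apply: measurable_funM => //; exact: measurable_funX.
  exact: measurableT_comp.
have D0 u : Ry u -> D n u @[n --> \oo] --> (0 : R).
  move=> _; rewrite /D; apply: cvg0Ml.
  under eq_fun do rewrite mulrC; apply: cvg0Ml.
  have := cvg_series_cvg_0 (@is_cvg_series_exp_coeff R (x * u `^ al)).
  by apply: cvg_trans; apply: near_eq_cvg; apply: nearW => n; rewrite /exp_coeff.
have [_ Dcv] := Rdominated (m := mu) (measurable_itv _) mD D0 iG DG.
rewrite Rintegral0 in Dcv.
have iray : mu.-integrable Ry (EFin \o ray 0 1 x al al t).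
  apply: (integrable_ray _ al0 ltr01 (k := - cos t)); first by rewrite oppr_gt0.
  move=> u u0; rewrite /ray_modulus ler_wpM2l ?powR_ge0// ler_expR powRr1 ?(ltW u0)//.
  have : 0 <= x * u `^ al * cos (al * t) by rewrite mulr_ge0// ltW.
  lra.
have ak0 k : 0 < al * k.+1%:R by rewrite mulr_gt0.
pose s n u := \sum_(k < n) ((- x) ^+ k / k`!%:R * ray 0 1 0 1 (al * k.+1%:R) t u).
have is_ n : mu.-integrable Ry (EFin \o s n) /\
   series (fun k : nat => (- x) ^+ k / k`!%:R * rGamma (1 - al * k.+1%:R)) n =
   pi^-1 * \int[mu]_(u in Ry) s n u.
  rewrite /series/= big_mkord; elim: n => [|n [IH1 IH2]].
    rewrite big_ord0 /s; split.
      by apply: eq_integrable (integrable0 _ _) => // u _; rewrite /= big_ord0.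
    rewrite (@eq_Rintegral _ _ _ _ _ (fun=> 0)) ?Rintegral0 ?mulr0// => u _.
    by rewrite big_ord0.
  have ih := integrable_hankel tpi (ak0 n).
  have sE : s n.+1 = fun u => s n u + (- x) ^+ n / n`!%:R * ray 0 1 0 1 (al * n.+1%:R) t u.
    by apply/funext => u; rewrite /s big_ord_recr.
  have ih' : mu.-integrable Ry (EFin \o
      (fun u => (- x) ^+ n / n`!%:R * ray 0 1 0 1 (al * n.+1%:R) t u)).
    exact: integrableZR.
  rewrite sE; split; first exact: integrableDR.
  rewrite RintegralD// mulrDr -IH2 big_ord_recr/=; congr (_ + _).
  rewrite RintegralZl// -/(hankel _ _) hankel_rGamma//.
  by rewrite [RHS]mulrCA; congr (_ * _); rewrite mulrA mulVf ?mul1r ?gt_eqF.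
apply/subr_cvg0.
apply: (@norm_le_cvg0 _ _ (fun n => pi^-1 * \int[mu]_(u in Ry) D n u)); last exact: cvg0Ml.
move=> n; have [i1 ->] := is_ n.
have id : mu.-integrable Ry (EFin \o (fun u => s n u - ray 0 1 x al al t u)).
  exact: integrableBR.
rewrite -mulrBr -RintegralB// normrM ger0_norm ?invr_ge0 ?(ltW p0)//.
rewrite ler_wpM2l ?invr_ge0 ?(ltW p0)// (le_trans (le_normr_Rintegral _ id))//.
apply: le_Rintegral => //.
- exact: integrable_norm id.
- exact: (le_integrableR (m := mu) (measurable_itv _) (mD n) (DG n) iG).
- move=> u /Ry_gt0 u0; rewrite /s ray_exp_ray_sum// ray_exp_ray// -mulrBr normrM.
  by rewrite ger0_norm ?w0// /D ler_wpM2l ?w0// distrC exp_ray_remainder.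
Qed.

End angle.

End mainardi.

(** * Decay of the Mainardi function *)

Section subordination.
Context {R : realType}.
Notation mu := (@lebesgue_measure R).
Notation Ry := (`]0%R, +oo[%classic : set R).
Implicit Types (b t u y m kap phi x r : R).
Variable al : R.
Hypothesis al01 : 0 < al < 1.

Let al0 : 0 < al. Proof. by case/andP: al01. Qed.
Let al1 : al < 1. Proof. by case/andP: al01. Qed.
Let pi0 : 0 < pi :> R. Proof. exact: pi_gt0. Qed.

Lemma cos_ge_le (a t : R) : 0 <= a -> a <= t -> t <= pi -> cos t <= cos a.
Proof.
move=> a0 at_ tp; rewrite leNgt; apply/negP => h.
have : t < a by rewrite -(ltr_cos (R := R)) ?in_itv/= ?a0 ?tp ?(le_trans at_) ?(le_trans a0).
by rewrite ltNge at_.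
Qed.

Lemma cos_al_half : 0 < cos (al * (pi / 2)) :> R.
Proof.
apply: cos_gt0_pihalf.
have h1 : 0 < pi * al by rewrite mulr_gt0.
have h2 : 0 < pi * (1 - al) by rewrite mulr_gt0// subr_gt0.
by apply/andP; split; lra.
Qed.

Lemma mainardi_cvg x : 0 <= x ->
  series (fun k : nat => (- x) ^+ k / k`!%:R * rGamma (1 - al * k.+1%:R)) n
  @[n --> \oo] --> mainardi al x.
Proof.
move=> x0; have [t tpi alt] := opening_angle al01.
have h := mainardi_series al01 tpi alt x0.
by rewrite /mainardi (cvg_lim _ h).
Qed.

(** On the imaginary axis exp(s) no longer decays, but exp(- x s^al) does as x > 0. *)
Lemma mainardi_half x : 0 < x ->
  mainardi al x = pi^-1 * \int[mu]_(u in Ry) ray 0 1 x al al (pi / 2) u.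
Proof.
move=> x0; have [t tpi alt] := opening_angle al01.
have h := mainardi_series al01 tpi alt (ltW x0).
rewrite /mainardi (cvg_lim _ h)//; congr (_ * _); apply/esym.
have /andP[t1 t2] := tpi.
have c0 : 0 < cos (al * t).
  apply: cos_gt0_pihalf; rewrite alt andbT.
  by have : 0 < al * t by [apply: mulr_gt0 => //; lra]; lra.
have k0 : 0 < x * cos (al * t) by rewrite mulr_gt0.
apply: (ray_rotation _ al0 al0 k0 (ltW t1)) => th u /andP[th1 th2] u0.
rewrite /ray_modulus ler_wpM2l ?powR_ge0// ler_expR.
have h1 : cos th <= 0.
  by rewrite -(cos_pihalf R); apply: cos_ge_le; lra.
have h2 : cos (al * t) <= cos (al * th).
  have th0 : 0 <= th by rewrite (le_trans _ th1)// divr_ge0 ?(ltW pi0).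
  have e1 : 0 <= al * th by rewrite mulr_ge0 ?(ltW al0).
  have pp := pi0.
  have e2 : al * th <= al * t by rewrite ler_wpM2l// ltW.
  by apply: cos_ge_le => //; lra.
have h3 : u * cos th <= 0 by rewrite pmulr_rle0.
have h4 : x * u `^ al * cos (al * t) <= x * u `^ al * cos (al * th).
  by rewrite ler_wpM2l// mulr_ge0 ?powR_ge0 ?ltW.
have -> : x * cos (al * t) * u `^ al = x * u `^ al * cos (al * t) by ring.
lra.
Qed.

Lemma half_modulus c x b u : 0 < u ->
  ray_modulus c x al b (pi / 2) u <=
  u `^ (b - 1) * expR (- (x * cos (al * (pi / 2)) * u `^ al)).
Proof.
move=> u0; rewrite /ray_modulus cos_pihalf le_eqVlt; apply/orP; left; apply/eqP.
by congr (_ * expR _); ring.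
Qed.

Lemma integrable_half kap c x b : 0 < x -> 0 < b ->
  mu.-integrable Ry (EFin \o ray kap c x al b (pi / 2)).
Proof.
move=> x0 b0; apply: (integrable_ray _ b0 al0 (k := x * cos (al * (pi / 2)))).
  by rewrite mulr_gt0 ?cos_al_half.
by move=> u; exact: half_modulus.
Qed.

Lemma half_ibp c x : 0 < x ->
  c * \int[mu]_(u in Ry) ray 0 c x al 1 (pi / 2) u =
  x * al * \int[mu]_(u in Ry) ray 0 c x al al (pi / 2) u.
Proof.
move=> x0.
have k0 : 0 < x * cos (al * (pi / 2)) by rewrite mulr_gt0 ?cos_al_half.
apply: (ray_ibp0 al0 al0 k0); try exact: integrable_half.
move=> u u0; rewrite cos_pihalf le_eqVlt; apply/orP; left; apply/eqP; ring.
Qed.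

Lemma mainardi_ibp x : 0 < x -> x * al * mainardi al x =
  pi^-1 * \int[mu]_(u in Ry) ray 0 1 x al 1 (pi / 2) u.
Proof.
by move=> x0; rewrite mainardi_half// mulrCA -half_ibp// mul1r.
Qed.

Lemma mainardi_bounded : exists2 C, 0 < C & forall x, 0 <= x -> `|mainardi al x| <= C.
Proof.
have [t tpi alt] := opening_angle al01; have /andP[t1 t2] := tpi.
have ct := hankel_cos tpi.
have c0 : 0 < cos (al * t).
  apply: cos_gt0_pihalf; rewrite alt andbT.
  by have : 0 < al * t by [apply: mulr_gt0 => //; lra]; lra.
have k0 : 0 < - cos t by rewrite oppr_gt0.
have ig := integrable_Gamma al0 k0.
pose C := pi^-1 * \int[mu]_(u in Ry) (u `^ (al - 1) * expR (- (- cos t * u))).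
have C0 : 0 <= C.
  rewrite mulr_ge0 ?invr_ge0 ?(ltW pi0)//; apply: Rintegral_ge0 => u _.
  by rewrite mulr_ge0 ?powR_ge0 ?expR_ge0.
exists (C + 1) => [|x x0]; first by rewrite ltr_wpDl.
have h := mainardi_series al01 tpi alt x0.
rewrite /mainardi (cvg_lim _ h)// (@le_trans _ _ C)// ?lerDl//.
rewrite normrM ger0_norm ?invr_ge0 ?(ltW pi0)// ler_wpM2l ?invr_ge0 ?(ltW pi0)//.
have bd u : Ry u -> `|ray 0 1 x al al t u| <= u `^ (al - 1) * expR (- (- cos t * u)).
  move=> /Ry_gt0 u0; rewrite (le_trans (norm_ray_le _ _ _ _ _ _ _))//.
  rewrite /ray_modulus ler_wpM2l ?powR_ge0// ler_expR.
  have : 0 <= x * u `^ al * cos (al * t) by rewrite !mulr_ge0 ?powR_ge0 ?(ltW c0).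
  lra.
have mr : measurable_fun Ry (ray 0 1 x al al t).
  by apply: measurable_Ry => u; exact: continuous_ray.
have ir := le_integrableR (m := mu) (measurable_itv _) mr bd ig.
rewrite (le_trans (le_normr_Rintegral _ ir))//; apply: le_Rintegral => //.
exact: integrable_norm ir.
Qed.

(** After the integration by parts the integrand carries no negative power of u; half of
    the exponential decay in x u^al then pays for a factor 1 / (x u^al). Together with the
    factor 1 / (x al) from [mainardi_ibp] this gives x^-2. *)
Lemma mainardi_decay : exists2 C, 0 < C & forall x, 1 <= x -> `|mainardi al x| <= C * x ^- 2.
Proof.
pose c := cos (al * (pi / 2)) : R; have c0 : 0 < c := cos_al_half.
have c20 : 0 < c / 2 by rewrite divr_gt0.
have aln : -1 < - al by rewrite ltrN2.
have ig := integrable_powR_expR aln al0 c20.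
pose I := \int[mu]_(u in Ry) (u `^ (- al) * expR (- (c / 2 * u `^ al))).
have I0 : 0 <= I.
  by apply: Rintegral_ge0 => u _; rewrite mulr_ge0 ?powR_ge0 ?expR_ge0.
pose C := (pi^-1 * (2 / c * I)) / al.
have C0 : 0 <= C.
  by rewrite !mulr_ge0 ?invr_ge0 ?(ltW pi0) ?(ltW c0) ?(ltW al0).
exists (C + 1) => [|x x1]; first by rewrite ltr_wpDl.
have x0 : 0 < x by rewrite (lt_le_trans _ x1).
have bd u : Ry u -> `|ray 0 1 x al 1 (pi / 2) u| <=
    x^-1 * (2 / c) * (u `^ (- al) * expR (- (c / 2 * u `^ al))).
  move=> /Ry_gt0 u0; rewrite (le_trans (norm_ray_le _ _ _ _ _ _ _))//.
  rewrite (le_trans (half_modulus _ _ _ u0))// subrr powRr0 mul1r -/c.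
  set y := u `^ al; have y0 : 0 < y by rewrite powR_gt0.
  rewrite powRN -/y.
  have -> : x^-1 * (2 / c) * (y^-1 * expR (- (c / 2 * y))) =
      (x * c * y / 2)^-1 * expR (- (c / 2 * y)).
    by field; rewrite !gt_eqF.
  rewrite ler_pdivlMl; last by rewrite !mulr_gt0 ?invr_gt0.
  have e1 : x * c * y / 2 <= expR (x * c * y / 2).
    by apply: le_trans (expR_ge1Dx _); rewrite lerDr.
  apply: (le_trans (ler_wpM2r (expR_ge0 _) e1)).
  rewrite -expRD ler_expR.
  have : c * y <= x * (c * y) by rewrite ler_peMl// mulr_ge0// ltW.
  lra.
have mr : measurable_fun Ry (ray 0 1 x al 1 (pi / 2)).
  by apply: measurable_Ry => u; exact: continuous_ray.
have ig' := @integrableZR _ _ _ mu Ry (x^-1 * (2 / c)) _ (measurable_itv _) ig.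
have ir := le_integrableR (m := mu) (measurable_itv _) mr bd ig'.
have E := mainardi_ibp x0.
have xal0 : 0 < x * al by rewrite mulr_gt0.
have -> : mainardi al x = (x * al)^-1 * (pi^-1 * \int[mu]_(u in Ry) ray 0 1 x al 1 (pi / 2) u).
  by rewrite -E mulKf// gt_eqF.
rewrite !normrM (ger0_norm (x := (x * al)^-1)) ?invr_ge0 ?(ltW xal0)//.
rewrite (ger0_norm (x := pi^-1)) ?invr_ge0 ?(ltW pi0)//.
have le1 : `|\int[mu]_(u in Ry) ray 0 1 x al 1 (pi / 2) u| <= x^-1 * (2 / c) * I.
  rewrite (le_trans (le_normr_Rintegral _ ir))// -RintegralZl//.
  by apply: le_Rintegral => //; exact: integrable_norm ir.
apply: (@le_trans _ _ (C * x ^- 2)).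
  have -> : C * x ^- 2 = (x * al)^-1 * (pi^-1 * (x^-1 * (2 / c) * I)).
    by rewrite /C !invfM; ring.
  by rewrite ler_wpM2l ?invr_ge0 ?(ltW xal0)// ler_wpM2l ?invr_ge0 ?(ltW pi0).
by rewrite ler_wpM2r ?invr_ge0 ?sqr_ge0// lerDl.
Qed.

Lemma mainardi_bound : exists2 C, 0 < C & forall x, 0 <= x -> `|mainardi al x| <= C / (1 + x ^+ 2).
Proof.
have [C1 C10 H1] := mainardi_bounded; have [C2 C20 H2] := mainardi_decay.
exists (2 * (C1 + C2)) => [|x x0]; first by rewrite mulr_gt0// addr_gt0.
have d0 : 0 < 1 + x ^+ 2 by rewrite ltr_wpDr ?sqr_ge0.
rewrite ler_pdivlMr//; have [x1|x1] := leP x 1.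
  have x21 : x ^+ 2 <= 1 by rewrite expr_le1.
  have := H1 _ x0; have n0 := normr_ge0 (mainardi al x).
  have : `|mainardi al x| * (1 + x ^+ 2) <= C1 * 2 by rewrite ler_pM ?H1 ?normr_ge0//; lra.
  lra.
have x20 : 0 < x ^+ 2 by rewrite exprn_gt0// (lt_trans _ x1).
have := H2 _ (ltW x1); rewrite ler_pdivlMr// => h.
have x21 : 1 <= x ^+ 2 by rewrite exprn_ege1// ltW.
have n0 := normr_ge0 (mainardi al x).
have : `|mainardi al x| * 1 <= `|mainardi al x| * x ^+ 2 by rewrite ler_wpM2l.
lra.
Qed.

Lemma measurable_mainardi : measurable_fun Ry (mainardi al).
Proof.
apply: (@measurable_fun_cvg _ _ _ Ry (fun n x =>
  series (fun k : nat => (- x) ^+ k / k`!%:R * rGamma (1 - al * k.+1%:R)) n)).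
  move=> n; rewrite /series/=; apply: measurable_sum => k.
  apply: measurable_funM => //; apply: measurable_funM => //.
  by apply: measurable_funX; exact: measurable_funN.
by move=> x /Ry_gt0 /ltW x0; exact: mainardi_cvg.
Qed.

(** Densities over the heat time r in the kernels of P_alpha(t) and S_alpha(t): the
    substitution r = tau t^al in the definitions of these kernels. *)
Definition P_subord r t := al * r * t `^ (- al - 1) * mainardi al (r * t `^ (- al)).
Definition S_subord r t := t `^ (- al) * mainardi al (r * t `^ (- al)).

Lemma ray_scale kap b r x : 0 < x -> 0 < r -> 0 < b ->
  \int[mu]_(u in Ry) ray kap 1 (r * x `^ (- al)) al b (pi / 2) u =
  x `^ b * \int[mu]_(u in Ry) ray kap x r al b (pi / 2) u.
Proof.
move=> x0 r0 b0; rewrite (Rintegral_scale x0); last first.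
  by apply: measurable_Ry => u; exact: continuous_ray.
rewrite -(gt0_mul_powRB1 b x0) -mulrA; congr (_ * _).
rewrite -RintegralZl//; last exact: integrable_half.
apply: eq_Rintegral => u /[!inE] /Ry_gt0 u0.
have e : r * x `^ (- al) * (x * u) `^ al = r * u `^ al.
  rewrite powRM ?(ltW x0) ?(ltW u0)// powRN.
  have : x `^ al != 0 by rewrite gt_eqF ?powR_gt0.
  by move=> h; field.
rewrite /ray /ray_modulus /ray_phase e powRM ?(ltW x0) ?(ltW u0)// !mul1r -!mulrA.
by congr (_ * (_ * (_ * sin _))); ring.
Qed.

(** The integration by parts of [mainardi_ibp] absorbs the factor r. The right side
    extends to all real t, and vanishes for t <= 0. *)
Lemma P_subordE r t : 0 < r -> 0 < t ->
  P_subord r t = pi^-1 * \int[mu]_(u in Ry) ray 0 t r al 1 (pi / 2) u.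
Proof.
move=> r0 t0; rewrite /P_subord.
have x0 : 0 < r * t `^ (- al) by rewrite mulr_gt0 ?powR_gt0.
have := mainardi_ibp x0; rewrite ray_scale// powRr1 ?(ltW t0)// => E.
have -> : al * r * t `^ (- al - 1) * mainardi al (r * t `^ (- al)) =
   t^-1 * (r * t `^ (- al) * al * mainardi al (r * t `^ (- al))).
  by rewrite gt0_powRD// powR_inv1 ?(ltW t0)//; ring.
by rewrite E mulrCA mulKf// gt_eqF.
Qed.

Lemma S_subordE r t : 0 < r -> 0 < t ->
  S_subord r t = pi^-1 * \int[mu]_(u in Ry) ray 0 t r al al (pi / 2) u.
Proof.
move=> r0 t0; rewrite /S_subord.
have x0 : 0 < r * t `^ (- al) by rewrite mulr_gt0 ?powR_gt0.
rewrite mainardi_half// ray_scale//.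
have h : t `^ al != 0 by rewrite gt_eqF ?powR_gt0.
by rewrite powRN mulrCA mulKf.
Qed.

End subordination.

(** * Fractional integral of the subordination kernel *)

Lemma cvg_seq_comp (R : realType) (h : R -> R) (f : nat -> R) (a : R) :
  {for a, continuous h} -> f n @[n --> \oo] --> a -> h (f n) @[n --> \oo] --> h a.
Proof. by move=> ch fa; apply: continuous_cvg. Qed.

Section convolution.
Context {R : realType}.
Notation mu := (@lebesgue_measure R).
Notation Ry := (`]0%R, +oo[%classic : set R).
Implicit Types (b t u y m kap phi x r eps : R).

Lemma polar_angle eps u : 0 < eps -> 0 < u ->
  let rho := Num.sqrt (eps ^+ 2 + u ^+ 2) in
  let psi := acos (eps / rho) in
  [/\ 0 < rho, u <= rho, 0 <= psi <= pi, rho * cos psi = eps & rho * sin psi = u].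
Proof.
move=> e0 u0 /=; set rho := Num.sqrt _.
have s0 : 0 < eps ^+ 2 + u ^+ 2 by rewrite addr_gt0 ?exprn_gt0.
have r0 : 0 < rho by rewrite sqrtr_gt0.
have r2 : rho ^+ 2 = eps ^+ 2 + u ^+ 2 by rewrite sqr_sqrtr ?ltW.
have ur : u <= rho.
  by rewrite -(ler_pXn2r (n := 2)) ?nnegrE ?(ltW u0) ?(ltW r0)// r2 lerDr sqr_ge0.
have er : eps <= rho.
  by rewrite -(ler_pXn2r (n := 2)) ?nnegrE ?(ltW e0) ?(ltW r0)// r2 lerDl sqr_ge0.
have q0 : 0 <= eps / rho by rewrite divr_ge0 ?ltW.
have q1 : -1 <= eps / rho <= 1.
  by rewrite (le_trans _ q0) ?lerN10//= ler_pdivrMr ?mul1r.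
split => //.
- by rewrite acos_ge0 ?acos_lepi.
- by rewrite acosK ?in_itv//= mulrC divfK ?gt_eqF.
rewrite sin_acos// -{1}(ger0_norm (ltW r0)) -sqrtr_sqr -sqrtrM ?sqr_ge0//.
rewrite -[RHS](ger0_norm (ltW u0)) -sqrtr_sqr; congr Num.sqrt.
rewrite expr_div_n mulrBr mulr1 mulrCA divff ?mulr1 ?sqrf_eq0 ?gt_eqF//.
by rewrite r2 addrC addKr.
Qed.

(** Imaginary part of exp(i Y) times the Laplace transform Gamma(b) z^(-b) of v^(b-1) at
    z = eps + i u: rotating the ray by the argument psi of z makes the exponent real. *)
Lemma gamma_complex b eps u Y : 0 < b -> 0 < eps -> 0 < u ->
  let rho := Num.sqrt (eps ^+ 2 + u ^+ 2) in
  let psi := acos (eps / rho) in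
  \int[mu]_(v in Ry) (v `^ (b - 1) * expR (- (eps * v)) * sin (Y - u * v)) =
  Gamma b * rho `^ (- b) * sin (Y - b * psi).
Proof.
move=> b0 e0 u0; have := polar_angle e0 u0; lazy zeta.
set rho := Num.sqrt _; set psi := acos _ => -[r0 ur /andP[p0 p1] rc rs].
pose kap := Y - b * psi.
have -> : \int[mu]_(v in Ry) (v `^ (b - 1) * expR (- (eps * v)) * sin (Y - u * v)) =
    \int[mu]_(v in Ry) ray kap (- rho) 0 1 b psi v.
  apply: eq_Rintegral => v _; rewrite /ray /ray_modulus /ray_phase -rc -rs /kap.
  by congr (_ * expR _ * sin _); ring.
have e1 : 0 < eps by [].
rewrite -(ray_rotation kap b0 (ltr01) e1 p0); last first.
  move=> th v /andP[th0 thp] v0; rewrite /ray_modulus ler_wpM2l ?powR_ge0// ler_expR.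
  have h : cos psi <= cos th by exact: cos_ge_le.
  rewrite powRr1 ?(ltW v0)// -rc !mul0r subr0.
  have : v * rho * cos psi <= v * rho * cos th by rewrite ler_wpM2l// mulr_ge0// ltW.
  lra.
transitivity (\int[mu]_(v in Ry) (sin kap * (v `^ (b - 1) * expR (- (rho * v))))).
  apply: eq_Rintegral => v _; rewrite /ray /ray_modulus /ray_phase !mulr0 sin0 cos0.
  by rewrite mulrC; congr (sin _ * (_ * expR _)); ring.
by rewrite RintegralZl ?Gamma_scale//; [ring|exact: integrable_Gamma].
Qed.

Section kernels.
Variable al : R.
Hypothesis al01 : 0 < al < 1.
Let al0 : 0 < al. Proof. by case/andP: al01. Qed.
Let al1 : al < 1. Proof. by case/andP: al01. Qed.
Let pi0 : 0 < pi :> R. Proof. exact: pi_gt0. Qed.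
Let cc0 : 0 < cos (al * (pi / 2)) :> R. Proof. exact: cos_al_half. Qed.

Lemma measurable_kernel_arg d (X : measurableType d) (D : set X) (r t : X -> R) :
  measurable D -> measurable_fun D r -> measurable_fun D t ->
  (forall z, D z -> 0 < r z /\ 0 < t z) ->
  measurable_fun D (fun z => mainardi al (r z * t z `^ (- al))).
Proof.
move=> mD mr mt rt.
apply: (measurable_comp (F := Ry) (f := mainardi al)) => //.
- by move=> _ [x /rt[? ?] <-]; rewrite /= in_itv/= andbT mulr_gt0 ?powR_gt0.
- exact: measurable_mainardi.
- by apply: measurable_funM => //; exact: measurableT_comp (measurable_powR _) mt.
Qed.

Lemma measurable_P_subord d (X : measurableType d) (D : set X) (r t : X -> R) :
  measurable D -> measurable_fun D r -> measurable_fun D t ->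
  (forall z, D z -> 0 < r z /\ 0 < t z) ->
  measurable_fun D (fun z => P_subord al (r z) (t z)).
Proof.
move=> mD mr mt rt; apply: measurable_funM; last exact: measurable_kernel_arg.
by apply: measurable_funM; [exact: measurable_funM|exact: measurableT_comp (measurable_powR _) mt].
Qed.

Lemma measurable_S_subord d (X : measurableType d) (D : set X) (r t : X -> R) :
  measurable D -> measurable_fun D r -> measurable_fun D t ->
  (forall z, D z -> 0 < r z /\ 0 < t z) ->
  measurable_fun D (fun z => S_subord al (r z) (t z)).
Proof.
move=> mD mr mt rt; apply: measurable_funM; last exact: measurable_kernel_arg.
exact: measurableT_comp (measurable_powR _) mt.
Qed.

Section fixed.
Variables r t : R.
Hypothesis r0 : 0 < r.
Hypothesis t0 : 0 < t.
Let b := 1 - al.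
Let b0 : 0 < b. Proof. by rewrite subr_gt0. Qed.
Let E u := expR (- (r * cos (al * (pi / 2)) * u `^ al)).
Let Y u := pi / 2 + t * u - r * u `^ al * sin (al * (pi / 2)).
Let phat xi := pi^-1 * \int[mu]_(u in Ry) ray 0 xi r al 1 (pi / 2) u.

Let E0 u : 0 <= E u. Proof. exact: expR_ge0. Qed.

Let k0 : 0 < r * cos (al * (pi / 2)). Proof. by rewrite mulr_gt0. Qed.

Let powE p : -1 < p -> mu.-integrable Ry (EFin \o (fun u => u `^ p * E u)).
Proof. by move=> p1; exact: (integrable_powR_expR p1 al0 k0). Qed.

Let iE : mu.-integrable Ry (EFin \o E).
Proof.
have := powE (p := 0) (ltrN10 _); apply: eq_integrable => // u _ /=.
by rewrite powRr0 mul1r.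
Qed.

Let rayE eta u : 0 < u -> ray 0 (t - eta) r al 1 (pi / 2) u = E u * sin (Y u - u * eta).
Proof.
move=> u0; rewrite /ray /ray_modulus /ray_phase subrr powRr0 mul1r sin_pihalf cos_pihalf.
by congr (expR _ * sin _); rewrite /Y; ring.
Qed.

Let M := pi^-1 * \int[mu]_(u in Ry) E u.

Let phat_bound xi : `|phat xi| <= M.
Proof.
rewrite normrM ger0_norm ?invr_ge0 ?(ltW pi0)// ler_wpM2l ?invr_ge0 ?(ltW pi0)//.
have ir := integrable_half al01 0 xi r0 ltr01.
rewrite (le_trans (le_normr_Rintegral _ ir))//; apply: le_Rintegral => //.
  exact: integrable_norm ir.
move=> u /Ry_gt0 u0; rewrite (_ : xi = t - (t - xi)); last by ring.
by rewrite rayE// normrM ger0_norm// ler_piMr// ler_norml sin_geN1 sin_le1.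
Qed.

Let phat_le0 xi : xi <= 0 -> phat xi = 0.
Proof.
move=> xi0; rewrite /phat -(ray_rotation (t1 := 0) 0 ltr01 al0 k0); first last.
- move=> th u /andP[th0 th1] u0; rewrite /ray_modulus ler_wpM2l ?powR_ge0// ler_expR.
  have pp := pi0.
  have e1 : 0 <= al * th by rewrite mulr_ge0 ?(ltW al0).
  have e2 : al * th <= al * (pi / 2) by rewrite ler_wpM2l// ltW.
  have e3 : al * (pi / 2) <= pi / 2 by rewrite ler_piMl ?(ltW al1)// divr_ge0// ltW.
  have h2 : cos (al * (pi / 2)) <= cos (al * th) by apply: cos_ge_le => //; lra.
  have h3 : 0 <= cos th by apply: cos_ge0_pihalf; apply/andP; split; lra.
  have h4 : xi * u * cos th <= 0 by rewrite mulr_le0_ge0// mulr_le0_ge0// ltW.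
  have h5 : r * u `^ al * cos (al * (pi / 2)) <= r * u `^ al * cos (al * th).
    by rewrite ler_wpM2l// mulr_ge0 ?powR_ge0 ?ltW.
  have -> : r * cos (al * (pi / 2)) * u `^ al = r * u `^ al * cos (al * (pi / 2)) by ring.
  lra.
- by rewrite divr_ge0// ltW.
rewrite -[RHS](mulr0 pi^-1) -[in RHS](Rintegral0 mu Ry); congr (_ * _).
apply: eq_Rintegral => u _; by rewrite /ray /ray_phase !(mulr0, sin0, addr0, subr0).
Qed.

Let phatE xi : 0 < xi -> phat xi = P_subord al r xi.
Proof. by move=> x0; rewrite P_subordE. Qed.

Let rho eps u := Num.sqrt (eps ^+ 2 + u ^+ 2).
Let psi eps u := acos (eps / rho eps u).

(** The integrand on the imaginary axis after convolution with v^(b-1) exp(- eps v). *)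
Let hh eps u := E u * (Gamma b * rho eps u `^ (- b) * sin (Y u - b * psi eps u)).

Let mE : measurable_fun (setT : set R) E.
Proof.
apply: measurableT_comp => //; apply: measurable_funN.
by apply: measurable_funM.
Qed.

Let mY : measurable_fun (setT : set R) Y.
Proof.
apply: measurable_funB.
  by apply: measurable_funD => //; exact: measurable_funM.
by apply: measurable_funM => //; exact: measurable_funM.
Qed.

Let continuous_hh eps u : 0 < eps -> 0 < u -> {for u, continuous (hh eps)}.
Proof.
move=> e0 u0.
have := polar_angle e0 u0; lazy zeta; rewrite -/(rho eps u) => -[h0 h1 _ _ _].
have cr : {for u, continuous (rho eps)}.
  apply: continuous_comp; last exact: sqrt_continuous.
  by apply: cvgD; [exact: cvg_cst|exact: exprn_continuous].
have cp : {for u, continuous (fun u => u `^ al)} by exact: continuous_powR.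
have ceps : {for u, continuous (psi eps)}.
  have e1 : -1 < eps / rho eps u < 1.
    rewrite ltr_pdivrMr// mul1r (lt_le_trans (ltrN10 _)) ?divr_ge0 ?ltW//=.
    rewrite -(ltr_pXn2r (n := 2)) ?nnegrE ?(ltW e0) ?(ltW h0)//.
    by rewrite sqr_sqrtr ?addr_ge0 ?sqr_ge0// ltrDl exprn_gt0.
  apply: (continuous_comp (f := fun u => eps / rho eps u) (g := acos)); last exact: continuous_acos.
  by apply: cvgM; [exact: cvg_cst|apply: cvgV cr; rewrite gt_eqF].
have cE : {for u, continuous E}.
  apply: continuous_comp; last exact: continuous_expR.
  by apply: cvgN; apply: cvgM cp; exact: cvg_cst.
have cY : {for u, continuous Y}.
  apply: cvgB.
    by apply: cvgD; [exact: cvg_cst|apply: cvgM; [exact: cvg_cst|exact: cvg_id]].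
  by apply: cvgM; [apply: cvgM cp; exact: cvg_cst|exact: cvg_cst].
apply: cvgM cE _; apply: cvgM.
  apply: cvgM; first exact: cvg_cst.
  apply: (continuous_comp (g := fun u => u `^ (- b))) cr _.
  exact: continuous_powR.
apply: (continuous_comp (f := fun x => Y x - b * psi eps x) (g := sin)); last exact: continuous_sin.
by apply: cvgB cY _; apply: cvgM ceps; exact: cvg_cst.
Qed.

Let hh_le eps u : 0 < eps -> 0 < u ->
  `|hh eps u| <= Gamma b * (u `^ (al - 1) * E u).
Proof.
move=> e0 u0; have := polar_angle e0 u0; lazy zeta; rewrite -/(rho eps u) => -[h0 h1 _ _ _].
rewrite /hh normrM ger0_norm// mulrA mulrC ler_wpM2r//.
rewrite normrM normrM (ger0_norm (Gamma_ge0 _)) -mulrA ler_wpM2l ?Gamma_ge0//.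
rewrite ger0_norm ?powR_ge0//; apply: (@le_trans _ _ (rho eps u `^ (- b))).
  by rewrite ler_piMr ?powR_ge0// ler_norml sin_geN1 sin_le1.
have -> : al - 1 = - b by rewrite opprB.
by rewrite !powRN lef_pV2 ?posrE ?powR_gt0// ge0_ler_powR ?nnegrE ?(ltW b0) ?(ltW u0) ?(ltW h0).
Qed.

Let ihh eps : 0 < eps -> mu.-integrable Ry (EFin \o hh eps).
Proof.
move=> e0; apply: (le_integrableR (m := mu) (g := fun u => Gamma b * (u `^ (al - 1) * E u))) => //.
- by apply: measurable_Ry => u; exact: continuous_hh.
- by move=> u /Ry_gt0; exact: hh_le.
- by apply: integrableZR => //; apply: powE; rewrite ltrBrDl addrN.
Qed.

(** The factor exp(- eps v) makes the double integral absolutely convergent. *)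
Let conv_eps eps : 0 < eps ->
  \int[mu]_(eta in Ry) (eta `^ (b - 1) * expR (- (eps * eta)) * phat (t - eta)) =
  pi^-1 * \int[mu]_(u in Ry) hh eps u.
Proof.
move=> e0.
pose V eta := eta `^ (b - 1) * expR (- (eps * eta)).
have V0 eta : 0 <= V eta by rewrite mulr_ge0 ?powR_ge0 ?expR_ge0.
have iV : mu.-integrable Ry (EFin \o V) by exact: integrable_Gamma.
pose W eta := pi^-1 * V eta.
have W0 eta : 0 <= W eta by rewrite mulr_ge0 ?invr_ge0 ?(ltW pi0).
have iW : mu.-integrable Ry (EFin \o W) by exact: integrableZR.
have bd eta u : `|W eta * (E u * sin (Y u - u * eta))| <= W eta * E u.
  rewrite normrM (ger0_norm (W0 _)) ler_wpM2l// normrM ger0_norm// ler_piMr//.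
  by rewrite ler_norml sin_geN1 sin_le1.
have mV : measurable_fun (setT : set R) V.
  apply: measurable_funM => //; apply: measurableT_comp => //.
  by apply: measurable_funN; exact: measurable_funM.
have mW : measurable_fun (setT : set R) W by exact: measurable_funM.
have mF : measurable_fun (setT : set (measurableTypeR R * measurableTypeR R))
    (fun p => W p.1 * (E p.2 * sin (Y p.2 - p.2 * p.1))).
  apply: measurable_funM; first exact: measurableT_comp mW measurable_fst.
  apply: measurable_funM; first exact: measurableT_comp mE measurable_snd.
  apply: (measurableT_comp (continuous_measurable_fun (@continuous_sin R))).
  apply: measurable_funB; first exact: measurableT_comp mY measurable_snd.
  by apply: measurable_funM; [exact: measurable_snd|exact: measurable_fst].
transitivity (\int[mu]_(eta in Ry) (\int[mu]_(u in Ry)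
    (W eta * (E u * sin (Y u - u * eta))))).
  apply: eq_Rintegral => eta _; rewrite /phat mulrA [_ / _]mulrC.
  rewrite RintegralZl//; last first.
    have ir := integrable_half al01 0 (t - eta) r0 ltr01.
    by apply: eq_integrable ir => // u /[!inE] /Ry_gt0 u0; rewrite /= rayE.
  by congr (_ * _); apply: eq_Rintegral => u /[!inE] /Ry_gt0 u0; rewrite rayE.
have mRR : measurable (Ry `*` Ry : set (measurableTypeR R * measurableTypeR R)).
  exact: measurableX.
have sw := @RfubiniD_le _ _ _ _ _ mu mu Ry Ry
  (fun eta u => W eta * (E u * sin (Y u - u * eta))) W E
  (measurable_itv _) (measurable_itv _) (measurable_funS measurableT (@subsetT _ _) mF)
  (fun x y _ _ => bd x y) (fun x _ => W0 x) iW iE.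
rewrite {}sw -Rintegral_mull//; last exact: integrable_measurable (ihh e0).
apply: eq_Rintegral => u /[!inE] /Ry_gt0 u0.
have := gamma_complex (Y u) b0 e0 u0; lazy zeta; rewrite -/(rho eps u) -/(psi eps u) => gc.
rewrite /hh -gc mulrA -Rintegral_mull//; last first.
  apply: measurable_funTS; apply: measurable_funM => //.
  apply: (measurableT_comp (continuous_measurable_fun (@continuous_sin R))).
  by apply: measurable_funB => //; exact: measurable_funM.
by apply: eq_Rintegral => v _; rewrite /W /V; ring.
Qed.

Let eps_ n : R := n.+1%:R^-1.
Let eps_gt0 n : 0 < eps_ n. Proof. by rewrite invr_gt0. Qed.
Let cvg_eps : eps_ n @[n --> \oo] --> (0 : R).
Proof. exact: cvg_harmonic. Qed.

Let cvg_hh u : 0 < u ->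
  hh (eps_ n) u @[n --> \oo] --> Gamma b * ray 0 t r al al (pi / 2) u.
Proof.
move=> u0.
have cr : rho (eps_ n) u @[n --> \oo] --> u.
  rewrite -[X in _ --> X](ger0_norm (ltW u0)) -sqrtr_sqr.
  rewrite -[X in Num.sqrt X]add0r.
  apply: (cvg_seq_comp (h := Num.sqrt) (f := fun n => eps_ n ^+ 2 + u ^+ 2)).
    exact: sqrt_continuous.
  apply: cvgD; last exact: cvg_cst.
  rewrite (_ : 0 = 0 ^+ 2 :> R); last by rewrite expr0n.
  by apply: (cvg_seq_comp (h := fun x : R => x ^+ 2)) cvg_eps; exact: exprn_continuous.
have cq : eps_ n / rho (eps_ n) u @[n --> \oo] --> (0 : R).
  rewrite -(mul0r u^-1); apply: cvgM cvg_eps _.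
  by apply: cvgV cr; rewrite gt_eqF.
have cpsi : psi (eps_ n) u @[n --> \oo] --> (pi / 2 : R).
  rewrite -acos0; apply: (cvg_seq_comp (h := acos)) cq.
  by apply: continuous_acos; rewrite ltrN10 ltr01.
have -> : Gamma b * ray 0 t r al al (pi / 2) u =
    E u * (Gamma b * u `^ (- b) * sin (Y u - b * (pi / 2))).
  rewrite /ray /ray_modulus /ray_phase cos_pihalf sin_pihalf (_ : al - 1 = - b); last first.
    by rewrite opprB.
  transitivity (E u * (Gamma b * u `^ (- b) * sin (0 + al * (pi / 2) + t * u * 1 -
     r * u `^ al * sin (al * (pi / 2))))).
    rewrite (_ : t * u * 0 - r * u `^ al * cos (al * (pi / 2)) =
      - (r * cos (al * (pi / 2)) * u `^ al)); last by ring.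
    by rewrite -/(E u); ring.
  by congr (_ * (_ * sin _)); rewrite /Y /b; ring.
apply: cvgM; first exact: cvg_cst.
apply: cvgM.
  apply: cvgM; first exact: cvg_cst.
  by apply: (cvg_seq_comp (h := fun x : R => x `^ (- b))) cr; exact: continuous_powR.
apply: (cvg_seq_comp (h := sin)); first exact: continuous_sin.
by apply: cvgB; [exact: cvg_cst|apply: cvgM cpsi; exact: cvg_cst].
Qed.

Let rhs_cvg : pi^-1 * \int[mu]_(u in Ry) hh (eps_ n) u @[n --> \oo] -->
  Gamma b * S_subord al r t.
Proof.
have igg : mu.-integrable Ry (EFin \o (fun u => Gamma b * (u `^ (al - 1) * E u))).
  by apply: integrableZR => //; apply: powE; rewrite ltrBrDl addrN.
have [_ c] := @Rdominated _ _ _ mu Ry (fun n => hh (eps_ n))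
  (fun u => Gamma b * ray 0 t r al al (pi / 2) u) _ (measurable_itv _)
  (fun n => integrable_measurable (ihh (eps_gt0 n)))
  (fun u h => cvg_hh (Ry_gt0 h)) igg (fun n u h => hh_le (eps_gt0 n) (Ry_gt0 h)).
rewrite S_subordE// mulrCA -RintegralZl//; last exact: integrable_half.
by apply: cvgM c; exact: cvg_cst.
Qed.

Let Jt := (`]0, t[%classic : set R).
Let D := (fun eta => eta `^ (b - 1) * phat (t - eta)).

Let mJ : measurable Jt. Proof. exact: measurable_itv. Qed.

Let mD : measurable_fun Jt D.
Proof.
apply: measurable_funM; first exact: measurable_powR_Ry.
suff mp : measurable_fun Jt (fun eta => P_subord al r (t - eta)).
  apply: eq_measurable_fun mp => eta /[!inE]/=.
  by rewrite /Jt/= in_itv/= => /andP[_ h]; rewrite phatE// subr_gt0.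
apply: (@measurable_P_subord _ _ Jt (fun=> r) (fun eta => t - eta)) => //.
  by apply: measurable_funTS; exact: measurable_funB.
by move=> eta; rewrite /Jt/= in_itv/= => /andP[_ h]; rewrite subr_gt0.
Qed.

Let lhs_cvg :
  \int[mu]_(eta in Ry) (eta `^ (b - 1) * expR (- (eps_ n * eta)) * phat (t - eta))
  @[n --> \oo] --> \int[mu]_(eta in Jt) D eta.
Proof.
have e n : \int[mu]_(eta in Ry) (eta `^ (b - 1) * expR (- (eps_ n * eta)) * phat (t - eta))
   = \int[mu]_(eta in Jt) (D eta * expR (- (eps_ n * eta))).
  rewrite [LHS]Rintegral_mkcond [RHS]Rintegral_mkcond; apply: eq_Rintegral => eta _.
  rewrite !patchE; case: ifPn => [|h].
    rewrite inE/= in_itv/= andbT => e0; case: ifPn => [_|]; first by rewrite /D; ring.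
    rewrite notin_setE /Jt/= in_itv/= e0/= => /negP; rewrite -leNgt => te.
    by rewrite phat_le0 ?mulr0// subr_le0.
  case: ifPn => //; rewrite inE /Jt/= in_itv/= => /andP[e0 _].
  by move: h; rewrite notin_setE/= in_itv/= andbT e0.
under eq_fun do rewrite e.
have ig : mu.-integrable Jt (EFin \o (fun eta => M * eta `^ (b - 1))).
  apply: integrableZR => //.
  have := integrable_powR0 b0 t0; apply: integrableS => // x.
  by rewrite /Jt/= !in_itv/= => /andP[-> /ltW].
apply: (@Rdominated _ _ _ mu Jt (fun n eta => D eta * expR (- (eps_ n * eta))) D
  (fun eta => M * eta `^ (b - 1)) _ _ _ ig _).2 => //.
- move=> n; apply: (measurable_funM mD); apply: measurable_funTS.
  by apply: measurableT_comp => //; apply: measurable_funN; exact: measurable_funM.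
- move=> eta _; rewrite -[X in _ --> X]mulr1; apply: cvgM; first exact: cvg_cst.
  rewrite -expR0; apply: (cvg_seq_comp (h := expR)); first exact: continuous_expR.
  rewrite -oppr0; apply: cvgN; rewrite -(mul0r eta).
  by apply: cvgM cvg_eps _; exact: cvg_cst.
move=> n eta; rewrite /Jt/= in_itv/= => /andP[e0 _].
rewrite /D normrM (ger0_norm (expR_ge0 _)) normrM ger0_norm ?powR_ge0//.
rewrite -mulrA [leLHS]mulrC ler_wpM2r ?powR_ge0// (le_trans _ (phat_bound (t - eta)))//.
by rewrite ler_piMr// -expR0 ler_expR oppr_le0 mulr_ge0// ltW.
Qed.

(** The Laplace transforms in t of p(r,.) and q(r,.) are exp(- r s^al) and
    s^(al-1) exp(- r s^al), and that of t^(-al) is Gamma(1-al) s^(al-1). The proof computes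
    the convolution on the representation by oscillatory integrals, letting eps tend to 0 on
    both sides by dominated convergence. *)
Lemma P_subord_convolution :
  \int[mu]_(xi in `]0, t[) ((t - xi) `^ (- al) * P_subord al r xi) =
  Gamma (1 - al) * S_subord al r t.
Proof.
have h : pi^-1 * \int[mu]_(u in Ry) hh (eps_ n) u @[n --> \oo] -->
    \int[mu]_(eta in Jt) D eta.
  by under eq_fun do rewrite -(conv_eps (eps_gt0 _)); exact: lhs_cvg.
rewrite -(cvg_lim _ rhs_cvg)// (cvg_lim _ h)//.
rewrite -[RHS](Rintegral_reflect mD); apply: eq_Rintegral => xi.
rewrite inE/= in_itv/= => /andP[x0 _].
by rewrite /D subKr phatE//; congr (_ `^ _ * _); rewrite /b; ring.
Qed.

End fixed.
End kernels.
End convolution.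

(** * Subordination of the heat kernel *)

Section kernel_bounds.
Context {R : realType}.
Notation mu := (@lebesgue_measure R).
Notation Ry := (`]0%R, +oo[%classic : set R).
Implicit Types (b t u y m r : R).
Variable al : R.
Hypothesis al01 : 0 < al < 1.
Let al0 : 0 < al. Proof. by case/andP: al01. Qed.
Let al1 : al < 1. Proof. by case/andP: al01. Qed.

Lemma S_subord_bound : exists2 C, 0 < C & forall r t, 0 < r -> 0 < t ->
  `|S_subord al r t| <= C * t `^ (- al).
Proof.
have [C C0 h] := mainardi_bounded al01; exists C => // r t r0 t0.
rewrite /S_subord normrM ger0_norm ?powR_ge0// mulrC ler_wpM2r ?powR_ge0//.
by rewrite h// mulr_ge0 ?powR_ge0 ?(ltW r0).
Qed.

(** Self-similarity in r, whence the norm of p(r,.) in L^1 does not depend on r. *)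
Lemma P_subord_scale r u : 0 < r -> 0 < u ->
  r `^ al^-1 * P_subord al r (r `^ al^-1 * u) = P_subord al 1 u.
Proof.
move=> r0 u0; set c := r `^ al^-1; have c0 : 0 < c by rewrite powR_gt0.
have cal : c `^ al = r by rewrite /c -powRrM mulVf ?gt_eqF// powRr1// ltW.
rewrite /P_subord !powRM ?(ltW c0) ?(ltW u0)// !powRN cal !gt0_powRD// powRN cal.
rewrite [r * (_ / _)]mulrA divff ?gt_eqF// !powR_inv1 ?(ltW c0) ?(ltW u0)//.
by field; rewrite !gt_eqF ?powR_gt0.
Qed.

Lemma integrable_P_subord1 : mu.-integrable Ry (EFin \o P_subord al 1).
Proof.
have [C C0 h] := mainardi_bound al01.
apply: (@dominated_Ry _ _ (al * C) (al - 1) al) => //.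
- by apply: (@measurable_P_subord _ _ al01 _ _ Ry (fun=> 1) id) => // t /Ry_gt0.
- by rewrite ltrBrDl addrN.
- move=> t /andP[t0 t1]; set x := t `^ (- al); have x0 : 0 < x by rewrite powR_gt0.
  rewrite /P_subord -/x mul1r mulr1 normrM ger0_norm ?mulr_ge0 ?powR_ge0 ?(ltW al0)//.
  have e : al * t `^ (- al - 1) * (C / x ^+ 2) = al * C * t `^ (al - 1).
    rewrite !gt0_powRD// /x powRN powR_inv1 ?(ltW t0)//.
    have := powR_gt0 al t0; set y := t `^ al => y0.
    by field; rewrite !gt_eqF.
  rewrite -e ler_wpM2l ?mulr_ge0 ?powR_ge0 ?(ltW al0)//.
  rewrite (le_trans (h _ (ltW x0)))// ler_wpM2l ?(ltW C0)// lef_pV2 ?posrE ?lerDr//.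
    by rewrite addr_gt0 ?exprn_gt0.
  by rewrite exprn_gt0.
- move=> t t1; have t0 : 0 < t by rewrite (lt_le_trans _ t1).
  set x := t `^ (- al); have x0 : 0 < x by rewrite powR_gt0.
  rewrite /P_subord -/x mul1r mulr1 normrM ger0_norm ?mulr_ge0 ?powR_ge0 ?(ltW al0)//.
  rewrite [- al - 1]addrC -[leLHS]mulrA -[leRHS]mulrA ler_wpM2l ?(ltW al0)//.
  rewrite [leRHS]mulrC ler_wpM2l ?powR_ge0//.
  rewrite (le_trans (h _ (ltW x0)))// ler_pdivrMr ?addr_gt0 ?exprn_gt0//.
  by rewrite ler_peMr ?(ltW C0)// lerDl sqr_ge0.
Qed.

Lemma P_subord_L1 : exists2 C, 0 <= C & forall r, 0 < r ->
  (\int[mu]_(t in Ry) `|P_subord al r t|%:E = C%:E)%E.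
Proof.
have ip := integrable_P_subord1.
have ia := integrable_norm ip.
exists (\int[mu]_(t in Ry) `|P_subord al 1 t|).
  by apply: Rintegral_ge0 => t _; exact: normr_ge0.
move=> r r0; set c := r `^ al^-1; have c0 : 0 < c by rewrite powR_gt0.
rewrite (ge0_integral_scale c0)//; last first.
  apply/measurable_EFinP; apply: measurableT_comp => //.
  by apply: (@measurable_P_subord _ _ al01 _ _ Ry (fun=> r) id) => // t /Ry_gt0.
rewrite -ge0_integralZl_EFin ?(ltW c0)//; last first.
  apply/measurable_EFinP; apply: measurableT_comp => //.
  apply: (@measurable_P_subord _ _ al01 _ _ Ry (fun=> r) (fun x => c * x)).
  - exact: measurable_itv.
  - exact: measurable_cst.
  - by apply: measurable_funTS; exact: measurable_funM.
  - by move=> z /Ry_gt0 z0; rewrite mulr_gt0.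
rewrite fineK//; last exact: integrable_fin_num.
apply: eq_integral => u /[!inE] /Ry_gt0 u0.
by rewrite -EFinM -(P_subord_scale r0 u0) -/c [in RHS]normrM (ger0_norm (ltW c0)).
Qed.

End kernel_bounds.

Section kernel_representation.
Context {R : realType} {d : nat} (Omega : set 'rV[R]_d).
Notation mu := (@lebesgue_measure R).
Notation Ry := (`]0%R, +oo[%classic : set R).
Variable S : R -> 'rV[R]_d -> 'rV[R]_d -> R.
Hypothesis mOmega : measurable Omega.
Hypothesis mS : measurable_fun
    (`]0, +oo[%classic `*` Omega `*` Omega :
       set (measurableTypeR R * 'rV[R]_d * 'rV[R]_d))
    (fun p => S p.1.1 p.1.2 p.2).
Variable al : R.
Hypothesis al01 : 0 < al < 1.
Variables x y : 'rV[R]_d.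
Hypotheses (xO : Omega x) (yO : Omega y).

Lemma measurable_heat_section : measurable_fun Ry (fun r => S r x y).
Proof.
apply: (measurable_comp (f := fun p => S p.1.1 p.1.2 p.2)
  (g := fun r : measurableTypeR R => (r, x, y)) _ _ mS).
- by apply: measurableX => //; apply: measurableX.
- by move=> _ [r r0 <-].
- by apply: measurable_funTS; apply: measurable_fun_pair => //; exact: measurable_fun_pair.
Qed.

(** The substitution r = tau t^al. *)
Lemma heat_subordination (h : R -> R) t : 0 < t -> measurable_fun Ry h ->
  \int[mu]_(tau in Ry) (h tau * S (tau * t `^ al) x y) =
  t `^ (- al) * \int[mu]_(r in Ry) (h (r * t `^ (- al)) * S r x y).
Proof.
move=> t0 mh.
have ta0 : 0 < t `^ al by rewrite powR_gt0.
have c0 : 0 < t `^ (- al) by rewrite powR_gt0.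
have e u : u * t `^ (- al) * t `^ al = u by rewrite -mulrA powRN mulVf ?mulr1// gt_eqF.
rewrite (Rintegral_scale c0).
  by congr (_ * _); apply: eq_Rintegral => u _; rewrite [_ * u]mulrC e.
apply: measurable_funM => //.
apply: (measurable_comp (F := Ry) (f := fun r => S r x y)) => //.
- by move=> _ [tau /Ry_gt0 ? <-]; rewrite /= in_itv/= andbT mulr_gt0.
- exact: measurable_heat_section.
- by apply: measurable_funTS; exact: measurable_funM.
Qed.

Let measurable_scaled (h : R -> R) t : 0 < t -> measurable_fun Ry h ->
  measurable_fun Ry (fun r => h (r * t `^ (- al)) * S r x y).
Proof.
move=> t0 mh; apply: measurable_funM; last exact: measurable_heat_section.
apply: (measurable_comp (F := Ry) (f := h)) => //.
- by move=> _ [tau /Ry_gt0 ? <-]; rewrite /= in_itv/= andbT mulr_gt0 ?powR_gt0.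
- by apply: measurable_funTS; exact: measurable_funM.
Qed.

Lemma S_kernelE t : 0 < t ->
  S_kernel S al t x y = \int[mu]_(r in Ry) (S_subord al r t * S r x y).
Proof.
move=> t0; rewrite /S_kernel (heat_subordination t0 (measurable_mainardi al01)).
rewrite -Rintegral_pmull ?powR_gt0//; last exact: measurable_scaled (measurable_mainardi al01).
by apply: eq_Rintegral => u _; rewrite /S_subord mulrA.
Qed.

Lemma P_kernelE t : 0 < t ->
  P_kernel S al t x y = \int[mu]_(r in Ry) (P_subord al r t * S r x y).
Proof.
move=> t0; rewrite /P_kernel.
have mh : measurable_fun Ry (fun tau => tau * mainardi al tau).
  by apply: measurable_funM => //; exact: measurable_mainardi.
rewrite (heat_subordination t0 mh) mulrA -Rintegral_pmull//; last 2 first.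
- exact: (measurable_scaled t0 mh).
- by case/andP: al01 => al0 _; rewrite !mulr_gt0 ?powR_gt0.
apply: eq_Rintegral => u _; rewrite /P_subord !gt0_powRD// powRN.
have := powR_gt0 al t0; set v := t `^ al => v0; set m := mainardi _ _.
by rewrite powR_inv1 ?(ltW t0)//; field; rewrite !gt_eqF.
Qed.

End kernel_representation.

(** * Borel structure and geometry of the domain *)

Lemma continuous_sum (R : realType) (T : topologicalType) (I : Type) (s : seq I)
    (F : I -> T -> R) :
  (forall i, continuous (F i)) -> continuous (fun x => \sum_(i <- s) F i x).
Proof.
move=> cF x; elim: s => [|i s IH].
  have -> : (fun x => \sum_(i <- [::]) F i x) = cst 0.
    by apply/funext => y; rewrite big_nil.
  exact: cst_continuous.
have -> : (fun x => \sum_(j <- i :: s) F j x) = (fun x => F i x + \sum_(j <- s) F j x).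
  by apply/funext => y; rewrite big_cons.
by apply: continuousD IH; exact: cF.
Qed.

Section borel.
Context {R : realType} {n : nat}.
Implicit Types (x y z v : 'rV[R]_n) (U : set 'rV[R]_n).

Lemma rV_ballP x y e : 0 < e ->
  ball x e y <-> forall i, `|x ord0 i - y ord0 i| < e.
Proof.
move=> e0; split => [[_ h] i|h]; first exact: (h ord0 i).
by split=> // i j; rewrite (ord1 i); exact: h.
Qed.

Let box (p : 'rV[rat]_n * nat) : set 'rV[R]_n :=
  [set y | forall i, `|ratr (p.1 ord0 i) - y ord0 i| < p.2.+1%:R^-1].

Let measurable_box p : measurable (box p).
Proof.
have -> : box p = \bigcap_(i in [set: 'I_n])
    [set y | `|ratr (p.1 ord0 i) - y ord0 i| < p.2.+1%:R^-1].
  by apply/seteqP; split => y /= h i; [move=> _|]; exact: h.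
apply: fin_bigcap_measurable => [|i _]; first exact: finite_finset.
have m : measurable_fun setT (fun y : 'rV[R]_n => `|ratr (p.1 ord0 i) - y ord0 i|).
  apply: measurableT_comp => //; apply: measurable_funB => //.
  exact: measurable_coord.
have := m measurableT _ (measurable_itv `]-oo, p.2.+1%:R^-1[).
by rewrite setTI; congr measurable; apply/seteqP; split => y; rewrite /= in_itv.
Qed.

(** An open set is the union of the rational boxes that it contains. *)
Lemma open_measurable_rV U : open U -> measurable U.
Proof.
move=> oU.
have -> : U = \bigcup_(p in [set: 'rV[rat]_n * nat])
    (if `[< box p `<=` U >] then box p else set0).
  apply/seteqP; split => [x Ux|x [p _]]; last by case: asboolP => // h /h.
  have := open_nbhs_nbhs (conj oU Ux); rewrite -nbhs_ballE => -[e /= e0 eU].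
  have [k ke] : exists k : nat, k.+1%:R^-1 < e / 2.
    have := near_infty_natSinv_lt (PosNum (divr_gt0 e0 (ltr0n R 2))).
    by move=> [k _ /(_ k (leqnn _))]; exists k.
  have /choice[q hq] : forall i, exists q : rat, `|ratr q - x ord0 i| < k.+1%:R^-1 :> R.
    move=> i; have h : x ord0 i - k.+1%:R^-1 < x ord0 i + k.+1%:R^-1.
      by rewrite ltrBlDr -addrA ltrDl addr_gt0// invr_gt0.
    have [q] := rat_in_itvoo h; rewrite in_itv/= => /andP[h1 h2]; exists q.
    by rewrite ltr_distl h1 h2.
  exists (\row_i q i, k) => //; case: asboolP => [_|/=].
    by move=> i; rewrite /= mxE.
  case => y hy; apply: eU; apply/rV_ballP => // i.
  have := hy i; have := hq i; rewrite /= mxE.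
  rewrite distrC => h1 h2; rewrite -(subrKA (ratr (q i))).
  by rewrite (le_lt_trans (ler_normD _ _))// [ltRHS]splitr ltrD// (lt_trans _ ke).
apply: countable_bigcupT_measurable => [|p]; first exact: countableP.
by case: asboolP.
Qed.

Lemma norm2_ge0 v : 0 <= norm2 v. Proof. exact: sqrtr_ge0. Qed.

Lemma coord_le_norm2 v i : `|v ord0 i| <= norm2 v.
Proof.
rewrite -sqrtr_sqr ler_wsqrtr// (bigD1 i)//= lerDl.
by apply: sumr_ge0 => j _; exact: sqr_ge0.
Qed.

Lemma norm2_le v M : (forall i, `|v ord0 i| <= M) -> norm2 v <= Num.sqrt (n%:R * M ^+ 2).
Proof.
move=> h; rewrite ler_wsqrtr// (le_trans (ler_sum _ (G := fun=> M ^+ 2) _))//.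
  by move=> i _; rewrite -real_normK ?num_real// ler_pXn2r ?nnegrE// (le_trans _ (h i)).
by rewrite big_const_ord iter_addr_0 mulr_natl.
Qed.

Lemma continuous_norm2B z : continuous (fun x => norm2 (x - z)).
Proof.
move=> x; apply: (continuous_comp (f := fun x => \sum_i (x - z) ord0 i ^+ 2)
  (g := Num.sqrt)); last exact: sqrt_continuous.
apply: continuous_sum => i {}x.
apply: (continuous_comp (f := fun x : 'rV[R]_n => (x - z) ord0 i) (g := fun u : R => u ^+ 2));
  last exact: exprn_continuous.
have -> : (fun x : 'rV[R]_n => (x - z) ord0 i) = (fun x => x ord0 i - z ord0 i).
  by apply/funext => y; rewrite !mxE.
by apply: continuousB; [exact: coord_continuous|exact: cst_continuous].
Qed.

Lemma coord_le_norm v i : `|v ord0 i| <= `|v|.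
Proof.
rewrite [leRHS]/Num.norm/= mx_normrE.
have -> : `|v ord0 i| = `|v (@ord0 0, i).1 (@ord0 0, i).2| by [].
exact: (le_bigmax_cond _ (fun k => `|v k.1 k.2|)).
Qed.

Lemma norm_le_coord v M : 0 <= M -> (forall i, `|v ord0 i| <= M) -> `|v| <= M.
Proof.
move=> M0 h; rewrite [leLHS]/Num.norm/= mx_normrE; apply: bigmax_le => //.
by move=> [i j] _; rewrite (ord1 i); exact: h.
Qed.

End borel.

Section domain.
Context {R : realType} {d : nat}.
Variable Omega : set 'rV[R]_d.
Hypothesis d0 : (0 < d)%N.
Hypothesis hO : bounded_smooth_domain Omega.
Notation delta := (bdist Omega).

Let oO : open Omega. Proof. by case: hO. Qed.

Lemma measurable_domain : measurable Omega.
Proof. exact: open_measurable_rV. Qed.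

Lemma domain_bounded : exists2 M : R, 0 < M &
  forall x, Omega x -> forall i, `|x ord0 i| <= M.
Proof.
have [_ _ _ [M [_ hM]] _] := hO; exists (Num.max M 0 + 1) => [|x Ox i].
  by rewrite ltr_wpDl// le_max lexx orbT.
have := hM (Num.max M 0 + 1) _ x Ox; rewrite ltr_pwDr ?le_max ?lexx//= => /(_ isT).
by apply: le_trans; exact: coord_le_norm.
Qed.

(** Otherwise Omega is open and closed, so it contains every line that it meets, against
    boundedness. *)
Lemma boundary_nonempty : boundary Omega !=set0.
Proof.
apply/set0P/negP => /eqP b0.
have cO : closed Omega.
  move=> x cx; apply: contrapT => nx; have : boundary Omega x.
    by split => //; apply: contra_not nx; exact: interior_subset.
  by rewrite b0.
have [x Ox] : Omega !=set0 by case: hO.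
pose e : 'rV[R]_d := const_mx 1.
pose p (t : R) := x + t *: e.
have cp : continuous p.
  move=> t; apply: cvgD; first exact: cvg_cst.
  by apply: cvgZr_tmp; exact: cvg_id.
have cT : connected [set: R] by apply/connected_intervalP => a b _ _ c _.
have E : p @^-1` Omega = setT.
  apply: cT.
  - by exists 0; rewrite /= /p scale0r addr0.
  - by exists (p @^-1` Omega); rewrite ?setTI//; apply: open_comp => // t _; exact: cp.
  - by exists (p @^-1` Omega); rewrite ?setTI//; apply: preimage_closed => //; exact: cp.
have [M M0 hM] := domain_bounded.
pose i := Ordinal d0.
have : Omega (p (M + 1 - x ord0 i)) by have : (p @^-1` Omega) (M + 1 - x ord0 i) by rewrite E.
move=> /hM /(_ i); rewrite !mxE mulr1 addrC subrK ger0_norm; last by rewrite addr_ge0 ?(ltW M0).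
by rewrite gerDl ler10.
Qed.

Let lb x : has_lbound [set norm2 (x - z) | z in boundary Omega].
Proof. by exists 0 => _ [z _ <-]; exact: norm2_ge0. Qed.

Let ne x : [set norm2 (x - z) | z in boundary Omega] !=set0.
Proof. by have [z bz] := boundary_nonempty; exists (norm2 (x - z)), z. Qed.

(** Sublevel sets of an infimum of continuous functions are unions of open sets. *)
Lemma bdist_lt_bigcup c : [set x | delta x < c] =
  \bigcup_(z in boundary Omega) [set x | norm2 (x - z) < c].
Proof.
apply/seteqP; split => x /=; last first.
  by move=> [z bz /= h]; apply: le_lt_trans h; apply: ge_inf => //; exists z.
by move=> /(inf_lt (ne x))[_ [z bz <-] h]; exists z.
Qed.

Lemma measurable_bdist : measurable_fun setT delta.
Proof.
apply: (measurability _ (RGenInftyO.measurableE R)) => //.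
move=> _ [_ [c ->] <-]; rewrite setTI.
have -> : delta @^-1` `]-oo, c[ = [set x | delta x < c].
  by apply/seteqP; split => x; rewrite /= in_itv.
apply: open_measurable_rV; rewrite bdist_lt_bigcup; apply: bigcup_open => z _.
have -> : [set x | norm2 (x - z) < c] = (fun x => norm2 (x - z)) @^-1` [set u | u < c] by [].
by apply: open_comp => [x _|]; [exact: continuous_norm2B|exact: open_lt].
Qed.

Lemma bdist_gt0 x : Omega x -> 0 < delta x.
Proof.
move=> Ox; have := open_nbhs_nbhs (conj oO Ox); rewrite -nbhs_ballE => -[e /= e0 eO].
apply: (lt_le_trans e0); apply: lb_le_inf => // _ [z [_ nz] <-].
rewrite leNgt; apply/negP => h; apply: nz.
rewrite -[interior _]/(Omega^°) ((interior_id _).1 oO)//; apply: eO; apply/rV_ballP => // i.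
by apply: le_lt_trans h; have := coord_le_norm2 (x - z) i; rewrite !mxE.
Qed.

Lemma bdist_bounded : exists2 K : R, 0 < K & forall x, Omega x -> delta x <= K.
Proof.
have [M M0 hM] := domain_bounded; have [z bz] := boundary_nonempty.
exists (Num.sqrt (d%:R * (M + norm2 z) ^+ 2) + 1) => [|x Ox].
  by rewrite ltr_wpDl// sqrtr_ge0.
rewrite (@le_trans _ _ (norm2 (x - z)))//; first by apply: ge_inf => //; exists z.
rewrite (le_trans (norm2_le (M := M + norm2 z) _)) ?lerDl// => i.
rewrite !mxE (le_trans (ler_normB _ _))// lerD ?hM//; exact: coord_le_norm2.
Qed.

Variable gamma : R.
Notation D := (fun x => delta x `^ gamma).

Lemma measurable_weight A : measurable_fun A D.
Proof.
by apply: measurable_funTS; exact: measurableT_comp (measurable_powR _) measurable_bdist.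
Qed.

Lemma weight_gt0 x : Omega x -> 0 < D x.
Proof. by move=> /bdist_gt0 ?; rewrite powR_gt0. Qed.

Lemma weight_bounded : 0 <= gamma -> exists2 K : R, 0 < K & forall x, Omega x -> D x <= K.
Proof.
move=> g0; have [K K0 hK] := bdist_bounded; exists (K `^ gamma) => [|x Ox].
  by rewrite powR_gt0.
by rewrite ge0_ler_powR// ?nnegrE ?hK ?(ltW K0)// ltW// bdist_gt0.
Qed.

(** The weight itself is an admissible datum; its image divided by the weight extends
    continuously to the compact closure of Omega, and is therefore bounded. *)
Lemma green_weight_bound (G : 'rV[R]_d -> 'rV[R]_d -> R) : 0 < gamma ->
  green_boundary_regular Omega gamma G ->
  exists2 C : R, 0 < C & forall x, Omega x -> `|kernel_op Omega G D x| <= C * D x.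
Proof.
move=> g0 hG; have wD : wLinfty Omega gamma D.
  split.
    have m1 : measurable_fun Omega (fun=> 1 : R) by exact: measurable_cst.
    apply: eq_measurable_fun m1 => x /[!inE] Ox.
    by rewrite divff// gt_eqF ?weight_gt0.
  exists 1; apply: aeW => x Ox.
  by rewrite divff ?normr1// gt_eqF ?weight_gt0.
have [g [cg gE]] := hG _ wD.
have cc : compact (closure Omega).
  apply: bounded_closed_compact; last exact: closed_closure.
  have [M M0 hM] := domain_bounded.
  have : closed [set x : 'rV[R]_d | forall i, `|x ord0 i| <= M].
    have -> : [set x : 'rV[R]_d | forall i, `|x ord0 i| <= M] =
      \bigcap_(i in setT) ((fun x : 'rV[R]_d => `|x ord0 i|) @^-1` [set u | u <= M]).
      by apply/seteqP; split => x h i; [move=> _|]; exact: h.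
    apply: closed_bigI => i _; apply: preimage_closed; last exact: closed_le.
    move=> x _; apply: (continuous_comp (f := fun x : 'rV[R]_d => x ord0 i)
      (g := fun u : R => `|u|)); [exact: coord_continuous|exact: norm_continuous].
  move=> /closure_id cE.
  have sub : closure Omega `<=` [set x : 'rV[R]_d | forall i, `|x ord0 i| <= M].
    by rewrite {1}cE; apply: closure_subset => x Ox i; exact: hM.
  exists M; split; first exact: num_real.
  move=> M' MM' x /sub h; apply: norm_le_coord => [|i]; first by rewrite ltW// (lt_trans M0).
  by rewrite (le_trans (h i))// ltW.
have /compact_bounded[M [_ hM]] := continuous_compact cg cc.
exists (Num.max M 0 + 1) => [|x Ox]; first by rewrite ltr_wpDl// le_max lexx orbT.
have := hM (Num.max M 0 + 1) _ (g x) (ex_intro2 _ _ x (subset_closure Ox) erefl).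
rewrite ltr_pwDr ?le_max ?lexx//= => /(_ isT).
rewrite -gE// normrM normfV (ger0_norm (ltW (weight_gt0 Ox))).
by rewrite ler_pdivrMr// weight_gt0.
Qed.

End domain.

(** * Integrability of the Green kernel *)

Section product_integral.
Context {R : realType}.
Notation mu := (@lebesgue_measure R).
Local Open Scope ereal_scope.

Lemma measurable_rV_cons n : measurable_fun setT (@rV_cons R n).
Proof.
apply: measurable_fun_rVP => i; case: (unliftP ord0 i) => [j|] ->.
  under eq_fun do rewrite rV_consS.
  by apply: (measurableT_comp (measurable_coord j)); exact: measurable_snd.
by under eq_fun do rewrite rV_cons0; exact: measurable_fst.
Qed.

Lemma measurable_rV_prod n (h : 'I_n -> R -> \bar R) :
  (forall i, measurable_fun setT (h i)) ->
  measurable_fun setT (fun y : 'rV[R]_n => \prod_i h i (y ord0 i)).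
Proof.
move=> mh; rewrite unlock /reducebig; elim: (index_enum _) => [|i s IH]/=.
  exact: measurable_cst.
apply: emeasurable_funM IH; apply: measurableT_comp (mh i) _.
exact: measurable_coord.
Qed.

(** By induction on n along the iterated construction of the measure. *)
Lemma integral_rV_prod n (h : 'I_n -> R -> \bar R) :
  (forall i, measurable_fun setT (h i)) -> (forall i u, 0 <= h i u) ->
  \int[lebesgue_rV R n]_y \prod_i h i (y ord0 i) = \prod_i \int[mu]_u h i u.
Proof.
elim: n h => [|n IH] h mh h0.
  rewrite big_ord0 (eq_integral (cst 1)) => [|y _]; last by rewrite big_ord0.
  by rewrite /= integral_dirac// diracE in_setT mule1.
have mp := measurable_rV_prod mh.
have p0 (m : nat) (k : 'I_m -> R -> \bar R) (y : 'rV[R]_m) :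
    (forall i u, 0 <= k i u) -> 0 <= \prod_i k i (y ord0 i).
  by move=> k0; apply: prode_ge0 => i _; exact: k0.
rewrite [LHS](ge0_integral_pushforward (measurable_rV_cons (n := n)))//; last first.
  by move=> y _; exact: p0.
rewrite preimage_setT.
pose k i := h (lift ord0 i).
have E (p : measurableTypeR R * 'rV[R]_n) :
    \prod_i h i (rV_cons p ord0 i) = h ord0 p.1 * \prod_i k i (p.2 ord0 i).
  rewrite big_ord_recl rV_cons0; congr (_ * _).
  by apply: eq_bigr => i _; rewrite rV_consS.
have mk : measurable_fun setT (fun y : 'rV[R]_n => \prod_i k i (y ord0 i)).
  by apply: measurable_rV_prod => i; exact: mh.
pose H (p : measurableTypeR R * 'rV[R]_n) := h ord0 p.1 * \prod_i k i (p.2 ord0 i).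
rewrite (eq_integral H); last first.
  by move=> p _; rewrite /= E.
rewrite (@fubini_tonelli1 _ _ _ _ _ mu (lebesgue_rV R n)); last 2 first.
- apply: emeasurable_funM; first exact: measurableT_comp (mh _) measurable_fst.
  exact: measurableT_comp mk measurable_snd.
- by move=> p; rewrite mule_ge0// p0// => i u; exact: h0.
rewrite /fubini_F big_ord_recl -IH; last 2 first.
- by move=> i; exact: mh.
- by move=> i u; exact: h0.
rewrite -ge0_integralZr//; [|exact: mh|]; last first.
  by apply: integral_ge0 => y _; apply: prode_ge0 => i _; exact: h0.
apply: eq_integral => u _ /=; rewrite /H -ge0_integralZl//=.
by move=> y _; apply: prode_ge0 => i _; exact: h0.
Qed.

(** Infinite at u = a, so that the bound by a product of such functions in
    [green_integral_bound] also holds at the points that share a coordinate with x. *)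
Definition pole b (a M u : R) : \bar R :=
  if (`|u| <= M)%R then (if u == a then +oo else (`|u - a| `^ (- b))%:E) else 0.

Lemma pole_ge0 b a M u : 0 <= pole b a M u.
Proof. by rewrite /pole; case: ifP => // _; case: ifP => // _; rewrite lee_fin powR_ge0. Qed.

Lemma measurable_pole b a M : measurable_fun setT (pole b a M).
Proof.
apply: measurable_fun_if => //.
- by apply: measurable_fun_ler => //; exact: measurableT_comp.
- apply: measurable_funTS; apply: measurable_fun_if => //.
    by apply: measurable_fun_eqr.
  apply: measurable_funTS; apply/measurable_EFinP.
  apply: (measurableT_comp (measurable_powR _)); apply: measurableT_comp => //.
  exact: measurable_funB.
Qed.

Lemma integral_pole_le b M : (0 <= b < 1)%R -> (0 < M)%R -> exists2 C : R, (0 <= C)%R &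
  forall a, (`|a| <= M)%R -> \int[mu]_u pole b a M u <= C%:E.
Proof.
move=> /andP[b0 b1] M0.
have M20 : (0 < 2 * M)%R by rewrite mulr_gt0.
have b'0 : (0 < 1 - b)%R by rewrite subr_gt0.
pose k1 v : \bar R := ((fun u => (u `^ (1 - b - 1))%:E) \_ `]0%R, (2 * M)%R]) v.
pose k0 v : \bar R := if v == 0%R :> R then +oo else 0.
have mk1 : measurable_fun setT k1.
  apply/(measurable_restrictT _ _).1; first exact: measurable_itv.
  by apply/measurable_EFinP; exact: measurable_powR_Ry.
have k1_ge0 v : 0 <= k1 v by apply: erestrict_ge0 => u _; rewrite lee_fin powR_ge0.
have k0_ge0 v : 0 <= k0 v by rewrite /k0; case: ifP.
have mk0 : measurable_fun setT k0.
  by apply: measurable_fun_if => //; apply: measurable_fun_eqr.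
have ik1 : \int[mu]_v k1 v = ((2 * M) `^ (1 - b) / (1 - b))%:E.
  by rewrite -integral_mkcond integral_powR0.
have ik0 : \int[mu]_v k0 v = 0.
  have -> : k0 = (cst +oo) \_ [set 0%R].
    apply/funext => v; rewrite patchE /k0; case: eqP => [->|h].
      by rewrite mem_set.
    by rewrite memNset.
  by rewrite -integral_mkcond integral_set1.
have mk1N : measurable_fun setT (fun v : R => k1 (- v)%R).
  by apply: measurableT_comp mk1 _; exact: measurable_funN.
have ik1N : \int[mu]_v k1 (- v)%R = ((2 * M) `^ (1 - b) / (1 - b))%:E.
  have N0 : (-1 != 0 :> R)%R by rewrite oppr_eq0 oner_eq0.
  rewrite -ik1 [RHS](ge0_integral_affine (a := -1) 0 N0)// normrN1 mul1e.
  by apply: eq_integral => v _; rewrite mulN1r addr0.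
exists ((2 * M) `^ (1 - b) / (1 - b) + (2 * M) `^ (1 - b) / (1 - b))%R.
  by rewrite addr_ge0// divr_ge0 ?powR_ge0// ltW.
move=> a aM; have N1 : (1 != 0 :> R)%R by exact: oner_neq0.
rewrite (ge0_integral_affine (a := 1) a N1)//; last 2 first.
- exact: measurable_pole.
- by move=> u; exact: pole_ge0.
rewrite normr1 mul1e EFinD -{1}ik1 -{}ik1N -[leRHS]adde0 -ik0.
rewrite -ge0_integralD// -ge0_integralD//; last 2 first.
- by move=> v _; rewrite adde_ge0.
- exact: emeasurable_funD.
apply: le_integral_any => v _; first exact: pole_ge0.
rewrite mul1r /pole; case: ifPn => [va|_]; last by rewrite !adde_ge0.
rewrite -subr_eq0 addrK; case: eqP => [->|/eqP v0].
  by rewrite /k0 eqxx addey// gt_eqF// (lt_le_trans ltNy0)// adde_ge0.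
have v2 : (`|v| <= 2 * M)%R.
  rewrite -[v](addrK a) (le_trans (ler_normB _ _))//.
  by have := lerD va aM; rewrite mulr2n mulrDl !mul1r.
have k1E w : (0 < w <= 2 * M)%R -> k1 w = (w `^ (- b))%:E.
  move=> w2; rewrite /k1 patchE mem_set ?in_itv//=; congr (_ `^ _)%:E; ring.
have [v_gt0|v_le0] := ltP 0%R v.
  rewrite gtr0_norm// k1E; last by rewrite v_gt0 -(gtr0_norm v_gt0).
  by rewrite -addeA leeDl// adde_ge0.
have v_lt0 : (v < 0)%R by rewrite lt_neqAle v0.
rewrite ltr0_norm// (k1E (- v)%R); last by rewrite oppr_gt0 v_lt0 -(ltr0_norm v_lt0).
by rewrite addeAC leeDr// adde_ge0.
Qed.
End product_integral.

Lemma mul_unit_interval2 (R : realFieldType) (a b c : R) : 0 <= a -> 0 <= b <= 1 ->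
  0 <= c <= 1 -> 0 <= a * b * c <= a.
Proof.
move=> a0 /andP[b0 b1] /andP[c0 c1]; rewrite !mulr_ge0//= -mulrA ler_piMr//.
by rewrite mulr_ile1.
Qed.

Section green_bound.
Context {R : realType} {d : nat}.
Variable Omega : set 'rV[R]_d.
Hypothesis d0 : (0 < d)%N.
Hypothesis hO : bounded_smooth_domain Omega.
Notation mu := (lebesgue_rV R d).

Lemma domain_measure_lty : (mu Omega < +oo)%E.
Proof.
have [M M0 hM] := domain_bounded hO.
have mO := measurable_domain hO.
pose h (i : 'I_d) (u : R) : \bar R := (\1_(`[(- M)%R, M]%classic) u)%:E.
have mh i : measurable_fun setT (h i).
  by apply/measurable_EFinP; apply: measurable_indic; exact: measurable_itv.
have h0 i u : (0 <= h i u)%E by rewrite lee_fin.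
rewrite -[ltLHS]mul1e -(integral_cst mu mO).
apply: (@le_lt_trans _ _ (\int[mu]_y (\prod_i h i (y ord0 i)))%E).
  rewrite integral_mkcond; apply: le_integral_any => x _; rewrite patchE.
    by case: ifP.
  case: ifPn => [/[!inE] Ox|_]; last exact: prode_ge0.
  rewrite big1//= => i _; rewrite /h indicE mem_set//= in_itv/=.
  by rewrite -ler_norml hM.
rewrite integral_rV_prod//.
have -> : (\prod_(i < d) \int[@lebesgue_measure R]_u h i u = \prod_(i < d) (M + M)%:E)%E.
  apply: eq_bigr => i _; rewrite integral_indic// setIT.
  by rewrite [LHS](lebesgue_measure_itv `[(- M)%R, M])/= lte_fin gtrN// opprK.
by rewrite prodEFin ltry.
Qed.

(** With r the distance of x and y, r^(2s-d) is at most a constant times r^(s-d), as r is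
    bounded, and r^(s-d) is at most the product over the coordinates of
    |y_i - x_i|^(-(d-s)/d), since r dominates each |y_i - x_i|. Each factor is integrable,
    its exponent being less than 1, and Tonelli's theorem avoids polar coordinates. *)
Lemma green_integral_bound s gamma (G : 'rV[R]_d -> 'rV[R]_d -> R) :
  0 < s <= 1 -> 0 <= gamma -> green_estimate Omega s gamma G ->
  exists2 C : R, 0 <= C & forall x, Omega x ->
    (\int[mu]_(y in Omega) `|(G x y)%:E| <= C%:E)%E.
Proof.
move=> /andP[s0 s1] g0 [C C0 hG].
have [M M0 hM] := domain_bounded hO.
have dR0 : 0 < d%:R :> R by rewrite ltr0n.
have d1 : 1 <= d%:R :> R by rewrite ler1n.
pose b := (d%:R - s) / d%:R : R.
have b01 : 0 <= b < 1.
  rewrite divr_ge0 ?subr_ge0 ?(le_trans s1)//= ltr_pdivrMr// mul1r.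
  by rewrite ltrBlDr ltrDl.
have [K K0 hK] := integral_pole_le b01 M0.
pose Mr := Num.sqrt (d%:R * (2 * M) ^+ 2) : R.
have rM x y : Omega x -> Omega y -> norm2 (x - y) <= Mr.
  move=> Ox Oy; apply: norm2_le => i; rewrite !mxE (le_trans (ler_normB _ _))//.
  by have := lerD (hM _ Ox i) (hM _ Oy i); rewrite mulr2n mulrDl !mul1r.
exists (C * Mr `^ s * K ^+ d).
  by rewrite !mulr_ge0 ?powR_ge0 ?(ltW C0) ?exprn_ge0.
move=> x Ox.
pose h (i : 'I_d) := pole b (x ord0 i) M.
have mh i : measurable_fun setT (h i) by exact: measurable_pole.
have h0 i u : (0 <= h i u)%E by exact: pole_ge0.
have p0 (y : 'rV[R]_d) : (0 <= \prod_i h i (y ord0 i))%E by apply: prode_ge0.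
have mp := measurable_rV_prod mh.
apply: (@le_trans _ _ (\int[mu]_y ((C * Mr `^ s)%:E * \prod_i h i (y ord0 i)))%E); last first.
  rewrite ge0_integralZl//; last by rewrite lee_fin mulr_ge0 ?powR_ge0// ltW.
  rewrite integral_rV_prod// [leRHS]EFinM lee_wpmul2l//.
    by rewrite lee_fin mulr_ge0 ?powR_ge0// ltW.
  have -> : (K ^+ d)%:E = (\prod_(i < d) K%:E)%E.
    by rewrite prodEFin prodr_const card_ord.
  apply: (big_ind2 (fun a b => 0 <= a /\ a <= b)%E _ _ _).2 => //.
    by move=> a1 b1 a2 b2 [? ?] [? ?]; rewrite mule_ge0// lee_pmul.
  by move=> i _; split; [exact: integral_ge0|apply: hK; exact: hM].
rewrite integral_mkcond; apply: le_integral_any => y _; rewrite patchE.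
  by case: ifP => // _; exact: abse_ge0.
case: ifPn => [|_]; last first.
  by rewrite mule_ge0// lee_fin mulr_ge0 ?powR_ge0// ltW.
rewrite inE => Oy.
have hy i : `|y ord0 i| <= M by exact: hM.
have Mr0 : 0 < Mr by rewrite sqrtr_gt0 mulr_gt0// exprn_gt0// mulr_gt0.
have [[i xy]|nxy] := pselect (exists i, x ord0 i = y ord0 i).
  rewrite (bigD1 i)//= {1}/h {1}/pole hy xy eqxx gt0_mulye ?gt0_muley ?leey//.
    by rewrite lte_fin mulr_gt0// powR_gt0.
  apply: (big_ind (fun z => 0 < z)%E) => [|a b'|j _]; rewrite ?lte_fin//; first exact: mule_gt0.
  rewrite /h /pole hy; case: eqP => [_|/eqP ne]; first by [].
  by rewrite lte_fin powR_gt0// normr_gt0 subr_eq0.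
have xy i : y ord0 i != x ord0 i by apply/eqP => e; apply: nxy; exists i.
have hE i : h i (y ord0 i) = (`|y ord0 i - x ord0 i| `^ (- b))%:E.
  by rewrite /h /pole hy (negbTE (xy i)).
have xny : x <> y by move=> e; apply: nxy; exists (Ordinal d0); rewrite e.
have [Gl Gu] := andP (hG (x, y) (And3 Ox Oy xny)).
move: Gl Gu => /=; set r := norm2 (x - y) => Gl Gu.
have r0 : 0 < r.
  apply: lt_le_trans (coord_le_norm2 _ (Ordinal d0)).
  by rewrite normr_gt0 !mxE subr_eq0 eq_sym.
under eq_bigr do rewrite hE.
rewrite prodEFin -EFinM lee_fin.
have min01 z : Omega z -> 0 <= Num.min 1 (bdist Omega z / r) `^ gamma <= 1.
  move=> Oz; rewrite powR_ge0/=; have one : 1 `^ gamma = 1 :> R by rewrite powR1.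
  rewrite -[leRHS]one.
  rewrite ge0_ler_powR// ?nnegrE ?ler01 ?ge_min ?lexx// le_min ler01/=.
  by rewrite divr_ge0 ?(ltW r0)// ltW// bdist_gt0.
have rp : 0 < (r `^ (d%:R - 2 * s))^-1 by rewrite invr_gt0 powR_gt0.
have /andP[h0' h1] := mul_unit_interval2 (ltW rp) (min01 x Ox) (min01 y Oy).
rewrite ger0_norm; last first.
  by apply: le_trans Gl; apply: mulr_ge0 h0'; rewrite invr_ge0 ltW.
apply: (le_trans Gu); rewrite -[leRHS]mulrA ler_wpM2l ?(ltW C0)//; apply: (le_trans h1).
have -> : (r `^ (d%:R - 2 * s))^-1 = r `^ s * r `^ (- (d%:R - s)).
  by rewrite -powRN -gt0_powRD//; congr (_ `^ _); ring.
apply: ler_pM; rewrite ?powR_ge0//.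
  by rewrite ge0_ler_powR ?nnegrE ?(ltW s0) ?(ltW r0) ?rM// sqrtr_ge0.
have -> : r `^ (- (d%:R - s)) = \prod_(i < d) r `^ (- b).
  rewrite prodr_const card_ord -powR_mulrn ?powR_ge0// -powRrM; congr (_ `^ _).
  by rewrite /b; field; rewrite gt_eqF.
apply: ler_prod => i _; rewrite powR_ge0/=.
have ci : 0 < `|y ord0 i - x ord0 i| by rewrite normr_gt0 subr_eq0.
have cr : `|y ord0 i - x ord0 i| <= r.
  by have := coord_le_norm2 (x - y) i; rewrite !mxE distrC.
rewrite !powRN lef_pV2 ?posrE ?powR_gt0// ge0_ler_powR ?nnegrE ?(ltW ci) ?(ltW r0)//.
by case/andP: b01.
Qed.

End green_bound.

(** * Expansions in an orthonormal basis *)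

Section L2.
Context {R : realType} {d : nat} (Omega : set 'rV[R]_d).
Notation mu := (lebesgue_rV R d).
Notation L2 := (L2 Omega).
Notation inner := (inner Omega).
Hypothesis mO : measurable Omega.
Implicit Types v w z : 'rV[R]_d -> R.

Lemma L2_mul v w : L2 v -> L2 w -> mu.-integrable Omega (EFin \o (fun x => v x * w x)).
Proof.
move=> [mv iv] [mw iw].
apply: (le_integrableR (g := fun x => v x ^+ 2 + w x ^+ 2)) => //.
- exact: measurable_funM.
- move=> x _; rewrite ler_norml.
  have h1 := sqr_ge0 (v x + w x); have h2 := sqr_ge0 (v x - w x).
  have h3 := sqr_ge0 (v x); have h4 := sqr_ge0 (w x).
  by rewrite sqrrD in h1; rewrite sqrrB in h2; apply/andP; split; lra.
- exact: integrableDR.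
Qed.

Lemma L2_add v w : L2 v -> L2 w -> L2 (fun x => v x + w x).
Proof.
move=> hv hw; have ivw := L2_mul hv hw; move: hv hw => [mv iv] [mw iw].
split; first exact: measurable_funD.
have i1 : mu.-integrable Omega (EFin \o (fun x => v x ^+ 2 + 2 * (v x * w x) + w x ^+ 2)).
  by apply: integrableDR => //; apply: integrableDR => //; exact: integrableZR.
by apply: eq_integrable i1 => // x _ /=; congr (_%:E); ring.
Qed.

Lemma L2_scale c v : L2 v -> L2 (fun x => c * v x).
Proof.
move=> [mv iv]; split; first exact: measurable_funM.
have i1 : mu.-integrable Omega (EFin \o (fun x => c ^+ 2 * v x ^+ 2)) by exact: integrableZR.
by apply: eq_integrable i1 => // x _ /=; congr (_%:E); ring.
Qed.

Lemma L2_sum n (c : nat -> R) (v : nat -> 'rV[R]_d -> R) : (forall j, L2 (v j)) ->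
  L2 (fun x => \sum_(j < n) c j * v j x).
Proof.
move=> hv; elim: n => [|n IH].
  have -> : (fun x => \sum_(j < 0) c j * v j x) = (fun x => 0 * v 0%N x).
    by apply/funext => x; rewrite big_ord0 mul0r.
  exact: L2_scale.
have -> : (fun x => \sum_(j < n.+1) c j * v j x) =
    (fun x => \sum_(j < n) c j * v j x + c n * v n x).
  by apply/funext => x; rewrite big_ord_recr.
by apply: L2_add => //; exact: L2_scale.
Qed.

Lemma innerC v w : inner v w = inner w v.
Proof. by apply: eq_Rintegral => x _; rewrite mulrC. Qed.

Lemma innerDl v w z : L2 v -> L2 w -> L2 z ->
  inner (fun x => v x + w x) z = inner v z + inner w z.
Proof.
move=> hv hw hz; rewrite /Defs.inner -RintegralD//; try exact: L2_mul.
by apply: eq_Rintegral => x _; rewrite mulrDl.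
Qed.

Lemma innerZl c v z : L2 v -> L2 z -> inner (fun x => c * v x) z = c * inner v z.
Proof.
move=> hv hz; rewrite /Defs.inner -RintegralZl//; last exact: L2_mul.
by apply: eq_Rintegral => x _; rewrite mulrA.
Qed.

Lemma inner_suml n (c : nat -> R) (v : nat -> 'rV[R]_d -> R) z :
  (forall j, L2 (v j)) -> L2 z ->
  inner (fun x => \sum_(j < n) c j * v j x) z = \sum_(j < n) c j * inner (v j) z.
Proof.
move=> hv hz; elim: n => [|n IH].
  rewrite big_ord0 -[RHS](Rintegral0 mu Omega); apply: eq_Rintegral => x _.
  by rewrite big_ord0 mul0r.
rewrite big_ord_recr/= -IH -innerZl// -innerDl//.
- by apply: eq_Rintegral => x _; rewrite big_ord_recr.
- exact: L2_sum.
- exact: L2_scale.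
Qed.

Lemma inner_ge0 v : 0 <= inner v v.
Proof. by apply: Rintegral_ge0 => x _; rewrite -expr2 sqr_ge0. Qed.

(** Discriminant of the polynomial |v + t w|^2 in t. *)
Lemma cauchy_schwarz v w : L2 v -> L2 w -> inner v w ^+ 2 <= inner v v * inner w w.
Proof.
move=> hv hw.
have q t : 0 <= inner v v + 2 * t * inner v w + t ^+ 2 * inner w w.
  have htw := L2_scale t hw; have h := L2_add hv htw.
  have := inner_ge0 (fun x => v x + t * w x).
  rewrite innerDl// (innerC v) innerDl// (innerZl t hw hv) (innerZl t hw h).
  rewrite (innerC w (fun x => v x + t * w x)) innerDl// (innerZl t hw hw).
  by rewrite (innerC w v) => h0; lra.
have [w0|w0] := eqVneq (inner w w) 0.
  have [->|vw0] := eqVneq (inner v w) 0; first by rewrite expr0n mulr_ge0 ?inner_ge0.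
  have := q (- (inner v v + 1) / (2 * inner v w)); rewrite w0 mulr0 addr0.
  have -> : inner v v + 2 * (- (inner v v + 1) / (2 * inner v w)) * inner v w = -1.
    by field.
  by move=> ?; lra.
have wp : 0 < inner w w by rewrite lt_neqAle eq_sym w0 inner_ge0.
have := q (- inner v w / inner w w).
have -> : inner v v + 2 * (- inner v w / inner w w) * inner v w +
    (- inner v w / inner w w) ^+ 2 * inner w w =
    inner v v - inner v w ^+ 2 / inner w w by field.
by rewrite subr_ge0 ler_pdivrMr.
Qed.

Lemma L2_cvg_inner (w_ : nat -> 'rV[R]_d -> R) w z :
  (forall n, L2 (w_ n)) -> L2 w -> L2 z -> L2_cvg Omega w_ w ->
  inner (w_ n) z @[n --> \oo] --> inner w z.
Proof.
move=> hwn hw hz cw.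
pose e n := fun x => w_ n x + -1 * w x.
have he n : L2 (e n) by apply: L2_add => //; exact: L2_scale.
have ee : inner (e n) (e n) @[n --> \oo] --> 0.
  have E n : inner (e n) (e n) =
      fine (\int[mu]_(x in Omega) ((w_ n x - w x) ^+ 2)%:E)%E.
    by apply: eq_Rintegral => x _; rewrite -expr2 /e mulN1r.
  by under eq_fun do rewrite E; exact: (fine_cvg cw).
have e0 : inner (e n) z @[n --> \oo] --> 0.
  have c0 : 0 < inner z z + 1 by rewrite ltr_wpDl ?inner_ge0.
  apply/cvgrPdist_le => eps eps0.
  have d0 : 0 < eps ^+ 2 / (inner z z + 1) by rewrite divr_gt0 ?exprn_gt0.
  near=> n; rewrite sub0r normrN.
  rewrite -(ler_pXn2r (n := 2)) ?nnegrE ?(ltW eps0)// real_normK ?num_real//.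
  apply: le_trans (cauchy_schwarz (he n) hz) _.
  have : inner (e n) (e n) <= eps ^+ 2 / (inner z z + 1).
    by near: n; exact: cvgr_le ee _ d0.
  rewrite ler_pdivlMr// => h; apply: le_trans h; rewrite ler_wpM2l ?inner_ge0//.
  by rewrite lerDl.
have E n : inner (w_ n) z = inner (e n) z + inner w z.
  rewrite innerDl//; last exact: L2_scale.
  by rewrite innerZl// mulN1r subrK.
rewrite -[inner w z]add0r; under eq_fun do rewrite E.
by apply: cvgD => //; exact: cvg_cst.
Unshelve. all: by end_near. Qed.

Hypothesis muO : (mu Omega < +oo)%E.

Lemma L2_bounded v M : measurable_fun Omega v -> (forall x, Omega x -> `|v x| <= M) -> L2 v.
Proof.
move=> mv hv; split => //.
apply: (le_integrableR (g := fun=> M ^+ 2)) => //.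
- exact: measurable_funX.
- move=> x Ox; rewrite ger0_norm ?sqr_ge0// -real_normK ?num_real//.
  by rewrite ler_pXn2r ?nnegrE ?hv// (le_trans _ (hv _ Ox)).
- apply/integrableP; split; first by apply/measurable_EFinP; exact: measurable_cst.
  rewrite (eq_integral (cst (`|M ^+ 2|)%:E))// integral_cst//.
  by rewrite lte_mul_pinfty// lee_fin.
Qed.

Section basis.
Variable phi : nat -> 'rV[R]_d -> R.
Hypothesis hphi : orthonormal_basis Omega phi.
Let L2phi j : L2 (phi j). Proof. by case: hphi. Qed.

Lemma parseval v z : L2 v -> L2 z ->
  \sum_(j < n) inner v (phi j) * inner z (phi j) @[n --> \oo] --> inner v z.
Proof.
move=> hv hz; have [_ _ /(_ v hv) h] := hphi.
have := L2_cvg_inner (fun n => L2_sum n (fun j => inner v (phi j)) L2phi) hv hz h.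
apply: cvg_trans; apply: near_eq_cvg; near=> n.
rewrite [LHS](inner_suml n (fun j => inner v (phi j)) L2phi hz).
by apply: eq_bigr => j _; rewrite (innerC z).
Unshelve. all: by end_near. Qed.

Lemma bessel v n : L2 v -> \sum_(j < n) inner v (phi j) ^+ 2 <= inner v v.
Proof.
move=> hv; have h := parseval hv hv.
rewrite -(cvg_lim _ h)//.
under eq_bigr do rewrite expr2.
apply: (nondecreasing_cvgn_le (u_ := fun n => \sum_(j < n) inner v (phi j) * inner v (phi j))).
  apply/nondecreasing_seqP => k; rewrite big_ord_recr/= lerDl.
  by rewrite -expr2 sqr_ge0.
by apply/cvg_ex; exists (inner v v).
Qed.

Lemma heat_inner (lambda : nat -> R) t v w z : L2 z ->
  heat_semigroup Omega lambda phi t v w ->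
  \sum_(j < n) expR (- lambda j * t) * inner v (phi j) * inner z (phi j)
  @[n --> \oo] --> inner w z.
Proof.
move=> hz [hw h].
have := L2_cvg_inner (fun n => L2_sum n (fun j => expR (- lambda j * t) * inner v (phi j)) L2phi) hw hz h.
apply: cvg_trans; apply: near_eq_cvg; near=> n.
rewrite [LHS](inner_suml n (fun j => expR (- lambda j * t) * inner v (phi j)) L2phi hz).
by apply: eq_bigr => j _; rewrite (innerC z).
Unshelve. all: by end_near. Qed.

End basis.
End L2.

(** * The Green operator as the time integral of the heat semigroup *)

Section green_heat.
Context {R : realType} {d : nat} (Omega : set 'rV[R]_d).
Notation mu := (lebesgue_rV R d).
Notation la := (@lebesgue_measure R).
Notation Ry := (`]0%R, +oo[%classic : set R).
Notation L2 := (L2 Omega).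
Notation inner := (inner Omega).
Hypothesis mO : measurable Omega.
Hypothesis muO : (mu Omega < +oo)%E.
Variables (G : 'rV[R]_d -> 'rV[R]_d -> R) (lambda : nat -> R) (phi : nat -> 'rV[R]_d -> R).
Variable S : R -> 'rV[R]_d -> 'rV[R]_d -> R.
Hypothesis mG : measurable_fun (Omega `*` Omega) (fun p => G p.1 p.2).
Hypothesis hphi : green_eigenbasis Omega G lambda phi.
Hypothesis hS : heat_kernel Omega lambda phi S.
Hypothesis symG : green_symmetric Omega G.
Variable C : R.
Hypothesis iG : forall x, Omega x -> (\int[mu]_(y in Omega) `|(G x y)%:E| <= C%:E)%E.
Implicit Types v z : 'rV[R]_d -> R.

Let hb : orthonormal_basis Omega phi. Proof. by case: hphi. Qed.
Let L2phi j : L2 (phi j). Proof. by case: hb. Qed.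
Let l0 : 0 < lambda 0%N. Proof. by case: hphi. Qed.
Let lj j : lambda 0%N <= lambda j.
Proof. by case: hphi => _ _ h _; exact: h. Qed.
Let lp j : 0 < lambda j. Proof. exact: lt_le_trans l0 (lj j). Qed.

Definition bounded_on v := measurable_fun Omega v /\ exists M, forall x, Omega x -> `|v x| <= M.

Lemma bounded_on_L2 v : bounded_on v -> L2 v.
Proof. by move=> [mv [M hM]]; exact: (L2_bounded mO muO mv hM). Qed.

Lemma measurable_green_op v : measurable_fun Omega v ->
  measurable_fun Omega (kernel_op Omega G v).
Proof.
move=> mv; apply: (measurable_RintegralD mu mO mO (g := fun x y => G x y * v y)).
apply: measurable_funM => //.
apply: (measurable_comp (F := Omega) (f := v)) => //; first by move=> _ [[x y] [_ h] <-].
by apply: measurable_funTS; exact: measurable_snd.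
Qed.

Lemma measurable_green_section x : Omega x -> measurable_fun Omega (G x).
Proof.
move=> Ox; apply: (measurable_comp (f := fun p => G p.1 p.2) (g := fun y => (x, y)) _ _ mG).
- exact: measurableX.
- by move=> _ [y Oy <-].
- by apply: measurable_funTS; exact: measurable_fun_pair.
Qed.

Lemma green_op_integrable v M x : measurable_fun Omega v ->
  (forall x, Omega x -> `|v x| <= M) -> Omega x ->
  mu.-integrable Omega (EFin \o (fun y => G x y * v y)).
Proof.
move=> mv hM Ox; have mGx := measurable_green_section Ox.
have iGx : mu.-integrable Omega (EFin \o G x).
  apply/integrableP; split; first exact/measurable_EFinP.
  by apply: (le_lt_trans (iG Ox)); rewrite ltry.
have iGM := integrableZR M mO (integrable_norm iGx).
apply: (le_integrableR (g := fun y => M * `|G x y|)) => //.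
  exact: measurable_funM.
by move=> y Oy; rewrite normrM mulrC ler_wpM2r ?hM.
Qed.

Lemma green_op_bdd v : bounded_on v -> bounded_on (kernel_op Omega G v).
Proof.
move=> [mv [M hM]]; split; first exact: measurable_green_op.
exists (`|M| * C) => x Ox.
have ii := green_op_integrable mv hM Ox.
rewrite /kernel_op (le_trans (le_normr_Rintegral mO ii))//.
have h : (\int[mu]_(y in Omega) `|G x y * v y|%:E <= (`|M| * C)%:E)%E.
  apply: (@le_trans _ _ (`|M|%:E * \int[mu]_(y in Omega) `|(G x y)%:E|)%E); last first.
    by rewrite EFinM lee_wpmul2l ?lee_fin// iG.
  rewrite -ge0_integralZl//; last first.
    by apply: measurableT_comp => //; apply/measurable_EFinP; exact: measurable_green_section.
  apply: le_integral_any => y Oy; first by rewrite lee_fin.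
  by rewrite /= -EFinM lee_fin normrM mulrC ler_wpM2r// (le_trans (hM _ Oy))// ler_norm.
rewrite -lee_fin; apply: le_trans h; rewrite /Rintegral fineK//.
exact: integrable_fin_num (integrable_norm ii).
Qed.

(** The Green operator is symmetric, so this is its eigenvalue equation. *)
Lemma green_coef v j : bounded_on v ->
  inner (kernel_op Omega G v) (phi j) = (lambda j)^-1 * inner v (phi j).
Proof.
move=> bv; have [mv [M hM]] := bv.
have [mphi _] := L2phi j.
have iphi : mu.-integrable Omega (EFin \o phi j).
  have b1 : bounded_on (fun=> 1) by split; [exact: measurable_cst|exists 1 => x _; rewrite normr1].
  have := L2_mul mO (L2phi j) (bounded_on_L2 b1); apply: eq_integrable => // x _ /=.
  by rewrite mulr1.
have mGG : measurable_fun (Omega `*` Omega) (fun p => G p.1 p.2 * v p.2 * phi j p.1).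
  apply: measurable_funM.
    apply: measurable_funM => //.
    apply: (measurable_comp (F := Omega) (f := v)) => //; first by move=> _ [[x y] [_ h] <-].
    by apply: measurable_funTS; exact: measurable_snd.
  apply: (measurable_comp (F := Omega) (f := phi j)) => //; first by move=> _ [[x y] [h _] <-].
  by apply: measurable_funTS; exact: measurable_fst.
transitivity (\int[mu]_(x in Omega) \int[mu]_(y in Omega) (G x y * v y * phi j x)).
  apply: eq_Rintegral => x /[!inE] Ox; rewrite /kernel_op mulrC -RintegralZl//.
    by apply: eq_Rintegral => y _; rewrite mulrC.
  exact: green_op_integrable hM Ox.
rewrite RfubiniD//; last first.
  apply: (@le_lt_trans _ _ (\int[mu]_(x in Omega) ((`|M| * C)%:E * `|phi j x|%:E))%E).
    apply: le_integral_any => x Ox; first by apply: integral_ge0 => y _; exact: abse_ge0.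
    apply: (@le_trans _ _ ((`|M| * `|phi j x|)%:E * \int[mu]_(y in Omega) `|(G x y)%:E|)%E).
      rewrite -ge0_integralZl ?lee_fin ?mulr_ge0//; last first.
        by apply: measurableT_comp => //; apply/measurable_EFinP; exact: measurable_green_section.
      apply: le_integral_any => y Oy; first exact: abse_ge0.
      rewrite /= -EFinM lee_fin !normrM.
      rewrite [leRHS]mulrAC [`|M| * _]mulrC ler_wpM2r// ler_wpM2l//.
      by rewrite (le_trans (hM _ Oy))// ler_norm.
    rewrite [leRHS](_ : _ = (`|M| * `|phi j x|)%:E * C%:E)%E; last first.
      by rewrite -!EFinM; congr (_%:E); ring.
    by rewrite lee_wpmul2l ?iG// lee_fin mulr_ge0.
  rewrite integralZl//; last exact: (integrable_norm iphi).
  have := integrable_fin_num mO (integrable_norm iphi).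
  by case: (\int[mu]_(x in Omega) _)%E => // r _; rewrite -EFinM ltry.
transitivity (\int[mu]_(y in Omega) (v y * kernel_op Omega G (phi j) y)).
  apply: eq_Rintegral => y /[!inE] Oy.
  rewrite /kernel_op -Rintegral_mull//.
    by apply: eq_Rintegral => x /[!inE] Ox; rewrite symG//; ring.
  by apply: measurable_funM => //; exact: measurable_green_section.
rewrite /Defs.inner -RintegralZl//; last by apply: L2_mul => //; exact: bounded_on_L2.
apply: ae_eq_Rintegral_any.
case: hphi => _ _ _ /(_ j); apply: filterS => x h Ox; rewrite h//; ring.
Qed.

(** Integrate sum_j exp(- lambda_j t) <v,phi_j> <z,phi_j> over t > 0 term by term: the
    result is sum_j lambda_j^-1 <v,phi_j> <z,phi_j>, which is <G v, z> by [green_coef] and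
    Parseval. The partial sums are dominated by exp(- lambda_0 t) (|v|^2 + |z|^2) / 2. *)
Lemma heat_green_integral v z : bounded_on v -> bounded_on z ->
  la.-integrable Ry (EFin \o (fun t => inner (kernel_op Omega (S t) v) z)) /\
  \int[la]_(t in Ry) inner (kernel_op Omega (S t) v) z = inner (kernel_op Omega G v) z.
Proof.
move=> bv bz; have hv := bounded_on_L2 bv; have hz := bounded_on_L2 bz.
have bg := green_op_bdd bv; have hg := bounded_on_L2 bg.
pose a j := inner v (phi j) * inner z (phi j).
pose s n t := \sum_(j < n) expR (- lambda j * t) * a j.
pose N := (inner v v + inner z z) / 2.
have sa n : \sum_(j < n) `|a j| <= N.
  apply: (@le_trans _ _ (\sum_(j < n) (inner v (phi j) ^+ 2 / 2 + inner z (phi j) ^+ 2 / 2))).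
    apply: ler_sum => j _; rewrite /a normrM.
    have := sqr_ge0 (`|inner v (phi j)| - `|inner z (phi j)|).
    rewrite sqrrB !real_normK ?num_real//; lra.
  rewrite big_split/= -!mulr_suml /N mulrDl.
  by rewrite lerD// ler_wpM2r ?invr_ge0//; exact: bessel.
have bd n t : Ry t -> `|s n t| <= N * expR (- (lambda 0%N * t)).
  move=> /Ry_gt0 t0; rewrite (le_trans (ler_norm_sum _ _ _))//.
  apply: (@le_trans _ _ (\sum_(j < n) expR (- (lambda 0%N * t)) * `|a j|)).
    apply: ler_sum => j _; rewrite normrM ger0_norm ?expR_ge0// ler_wpM2r//.
    by rewrite ler_expR mulNr lerN2 ler_wpM2r// ltW.
  by rewrite -mulr_sumr mulrC ler_wpM2r ?expR_ge0.
have ie k : 0 < k -> la.-integrable Ry (EFin \o (fun t => expR (- (k * t)))).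
  move=> k0; have := integrable_Gamma ltr01 k0; apply: eq_integrable => // t _ /=.
  by rewrite subrr powRr0 mul1r.
have iek k : 0 < k -> \int[la]_(t in Ry) expR (- (k * t)) = k^-1.
  move=> k0; have := Gamma_scale ltr01 k0; rewrite Gamma1 mulr1 powR_inv1 ?(ltW k0)// => <-.
  by apply: eq_Rintegral => t _; rewrite subrr powRr0 mul1r.
have isn n : la.-integrable Ry (EFin \o s n).
  rewrite /s; elim: n => [|n IH].
    have i0 : la.-integrable Ry (EFin \o (fun=> 0)) by exact: integrable0.
    by apply: eq_integrable i0 => // t _; rewrite /= big_ord0.
  have h := @integrableZR _ _ _ la Ry (a n) _ (measurable_itv _) (ie _ (lp n)).
  have := @integrableDR _ _ _ la Ry _ _ (measurable_itv _) IH h; apply: eq_integrable => // t _ /=.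
  by rewrite big_ord_recr/= mulNr [a n * _]mulrC.
have ints n : \int[la]_(t in Ry) s n t = \sum_(j < n) (lambda j)^-1 * a j.
  elim: n => [|n IH].
    rewrite big_ord0 -[RHS](Rintegral0 la Ry); apply: eq_Rintegral => t _.
    by rewrite /s big_ord0.
  rewrite big_ord_recr/= -IH -(iek _ (lp n)) mulrC -RintegralZl//; last exact: ie.
  rewrite -RintegralD//; last exact: (@integrableZR _ _ _ la Ry (a n) _ (measurable_itv _) (ie _ (lp n))).
  by apply: eq_Rintegral => t _; rewrite /s big_ord_recr/= mulNr mulrC.
have cs t : Ry t -> s n t @[n --> \oo] --> inner (kernel_op Omega (S t) v) z.
  move=> /Ry_gt0 t0; have [_ /(_ t v t0 hv)[_ hw]] := hS.
  have := heat_inner mO hb hz hw; apply: cvg_trans; apply: near_eq_cvg; near=> n.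
  by apply: eq_bigr => j _; rewrite /a mulrA.
have iN := @integrableZR _ _ _ la Ry N _ (measurable_itv _) (ie _ l0).
have [h1 h2] := @Rdominated _ _ _ la Ry s _ _ (measurable_itv _)
  (fun n => integrable_measurable (isn n)) cs iN bd.
split => //; rewrite -(cvg_lim _ h2)//; apply: cvg_lim => //.
have := parseval mO hb hg hz; apply: cvg_trans; apply: near_eq_cvg; near=> n.
by rewrite ints; apply: eq_bigr => j _; rewrite green_coef// /a mulrA.
Unshelve. all: by end_near. Qed.

End green_heat.

(** * The sign of an integrable function from countably many integrals *)

(** Names for the sets of the algebra generated by a sequence of sets. They form a
    countable type, which is what [ae_forall_countable] needs. *)
Inductive bool_term := Atom of nat | Neg of bool_term | Or of bool_term & bool_term.

Fixpoint bool_term_code (t : bool_term) : GenTree.tree nat :=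
  match t with
  | Atom n => GenTree.Leaf n
  | Neg t => GenTree.Node 0 [:: bool_term_code t]
  | Or t u => GenTree.Node 1 [:: bool_term_code t; bool_term_code u]
  end.

Fixpoint bool_term_decode (c : GenTree.tree nat) : option bool_term :=
  match c with
  | GenTree.Leaf n => Some (Atom n)
  | GenTree.Node 0 [:: c] => omap Neg (bool_term_decode c)
  | GenTree.Node 1 [:: c; e] =>
      if bool_term_decode c is Some t then omap (Or t) (bool_term_decode e) else None
  | _ => None
  end.

Lemma bool_term_codeK : pcancel bool_term_code bool_term_decode.
Proof. by elim => [n|t /= ->|t /= -> u ->]. Qed.

HB.instance Definition _ := Countable.copy bool_term (pcan_type bool_term_codeK).

Lemma ae_forall_countable d (T : measurableType d) (R : realType)
    (m : {measure set T -> \bar R}) (I : countType) (P : I -> T -> Prop) :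
  (forall i, {ae m, forall x, P i x}) -> {ae m, forall x, forall i, P i x}.
Proof.
move=> h.
have : {ae m, forall x, forall n : nat, if unpickle n is Some i then P i x else True}.
  apply: ae_foralln => n; case: unpickle => [i|]; first exact: h.
  exact: aeW.
by apply: filterS => x hx i; have := hx (pickle i); rewrite pickleK.
Qed.

Section sign.
Context d (Y : measurableType d) (R : realType) (m : {measure set Y -> \bar R}).
Variables (O : set Y) (f : Y -> R).
Hypothesis mO : measurable O.
Hypothesis intf : m.-integrable O (EFin \o f).

Let mf : measurable_fun O f. Proof. exact: integrable_measurable intf. Qed.

Lemma ae_ge0_of_integrals :
  (forall A, measurable A -> 0 <= \int[m]_(y in O) (f y * \1_A y)) ->
  {ae m, forall y, O y -> 0 <= f y}.
Proof.
move=> h; pose A := O `&` f @^-1` `]-oo, 0[.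
have mA : measurable A by exact: mf.
have mfA : measurable_fun O (fun y => f y * \1_A y).
  by apply: measurable_funM => //; exact: measurable_indic.
have ifA : m.-integrable O (EFin \o (fun y => f y * \1_A y)).
  apply: (le_integrableR (g := fun y => `|f y|)) => //; last exact: integrable_norm.
  move=> y _; rewrite normrM ler_piMr// indicE; case: (_ \in _); by rewrite ?normr1 ?normr0.
have fA y : O y -> f y * \1_A y <= 0.
  move=> Oy; rewrite indicE; have [|_] := boolP (y \in A); last by rewrite mulr0.
  rewrite inE => -[_ /=].
  by rewrite in_itv/= mulr1 => /ltW.
have z : (\int[m]_(y in O) `|(f y * \1_A y)%:E| = 0)%E.
  have e : (\int[m]_(y in O) `|(f y * \1_A y)%:E| =
      (- \int[m]_(y in O) (f y * \1_A y))%:E)%E.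
    rewrite EFinN /Rintegral fineK; last exact: integrable_fin_num.
    rewrite -integralN; last exact: integrable_add_def.
    by apply: eq_integral => y /[!inE] Oy; rewrite /= ler0_norm ?fA.
  apply/eqP; rewrite eq_le integral_ge0// andbT e lee_fin oppr_le0; exact: h.
have mEA : measurable_fun O (EFin \o (fun y => f y * \1_A y)) by exact/measurable_EFinP.
have [ab _] := ae_eq_integral_abs m mO mEA.
have := ab z; apply: filterS => y hy Oy; rewrite leNgt; apply/negP => fy.
have := hy Oy; rewrite /= indicE mem_set /=; last by split => //=; rewrite in_itv.
by rewrite mulr1 => -[fy0]; rewrite fy0 ltxx in fy.
Qed.

Variable C : nat -> set Y.
Hypothesis mC : forall n, measurable (C n).
Hypothesis genC : forall A : set Y, measurable A -> <<s range C >> A.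

Fixpoint bool_term_set (t : bool_term) : set Y :=
  match t with
  | Atom n => C n
  | Neg t => ~` bool_term_set t
  | Or t u => bool_term_set t `|` bool_term_set u
  end.

Lemma measurable_bool_term_set t : measurable (bool_term_set t).
Proof.
by elim: t => [n|t h|t h u h'] /=; [exact: mC|exact: measurableC|exact: measurableU].
Qed.

Let dist (A B : set Y) : R := \int[m]_(y in O) (`|f y| * `|\1_A y - \1_B y|).

Let idist A B : measurable A -> measurable B ->
  m.-integrable O (EFin \o (fun y => `|f y| * `|\1_A y - \1_B y| : R)).
Proof.
move=> mA mB; apply: (le_integrableR (g := fun y => `|f y|)) => //.
- apply: measurable_funM; first exact: measurableT_comp.
  apply: measurableT_comp => //.
  by apply: measurable_funB; exact: measurable_indic.
- move=> y _; rewrite normrM !normr_id ler_piMr// !indicE.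
  by case: (_ \in _); case: (_ \in _); rewrite /= ?subrr ?subr0 ?sub0r ?normrN ?normr1 ?normr0.
- exact: integrable_norm.
Qed.

Let dist_le A B A1 B1 A2 B2 : measurable A -> measurable B -> measurable A1 ->
  measurable B1 -> measurable A2 -> measurable B2 ->
  (forall y, `|\1_A y - \1_B y| <= `|\1_A1 y - \1_B1 y| + `|\1_A2 y - \1_B2 y| :> R) ->
  dist A B <= dist A1 B1 + dist A2 B2.
Proof.
move=> mA mB mA1 mB1 mA2 mB2 h; rewrite /dist -RintegralD//; try exact: idist.
apply: le_Rintegral => //.
- exact: idist.
- by apply: integrableDR => //; exact: idist.
- by move=> y _; rewrite -mulrDr ler_wpM2l.
Qed.

Let approx A := measurable A /\
  forall e, 0 < e -> exists t, dist A (bool_term_set t) <= e.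

Let distxx A : dist A A = 0.
Proof.
by rewrite -[RHS](Rintegral0 m O); apply: eq_Rintegral => y _; rewrite subrr normr0 mulr0.
Qed.

Let approxC A : approx A -> approx (~` A).
Proof.
move=> [mA h]; split; first exact: measurableC.
move=> e /h[t ht]; exists (Neg t); apply: le_trans ht => /=.
rewrite le_eqVlt; apply/orP; left; apply/eqP; apply: eq_Rintegral => y _.
rewrite !indicE !in_setC; congr (_ * _).
by case: (_ \in _); case: (_ \in _); rewrite /= ?subrr// distrC.
Qed.

Let approxU A B : approx A -> approx B -> approx (A `|` B).
Proof.
move=> [mA hA] [mB hB]; split; first exact: measurableU.
move=> e e0; have e20 : 0 < e / 2 by rewrite divr_gt0.
have [t ht] := hA _ e20; have [u hu] := hB _ e20; exists (Or t u).
have mt := measurable_bool_term_set t; have mu := measurable_bool_term_set u.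
rewrite (splitr e); apply: le_trans (lerD ht hu).
apply: dist_le => //=; [exact: measurableU|exact: measurableU|].
move=> y; rewrite !indicE !in_setU.
by case: (y \in A); case: (y \in B); case: (y \in bool_term_set t);
  case: (y \in bool_term_set u); rewrite /= ?subrr ?subr0 ?sub0r ?normrN ?normr1 ?normr0 ?addr0 ?add0r ?lerDl ?ler01.
Qed.

Let approx0 : approx set0.
Proof.
split => // e e0; exists (Neg (Or (Atom 0) (Neg (Atom 0)))).
by rewrite /= setUv setCT distxx ltW.
Qed.

Let approx_bigcup (A : (set Y)^nat) : (forall n, approx (A n)) -> approx (\bigcup_n A n).
Proof.
move=> hA; have mA n : measurable (A n) by case: (hA n).
have mU : measurable (\bigcup_n A n) by exact: bigcup_measurable.
pose U n := \big[setU/set0]_(i < n) A i.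
have hU n : approx (U n).
  elim: n => [|n IH]; first by rewrite /U big_ord0.
  by rewrite /U big_ord_recr/=; exact: approxU.
have mUn n : measurable (U n) by case: (hU n).
split => // e e0; have e20 : 0 < e / 2 by rewrite divr_gt0.
have cU : dist (\bigcup_n A n) (U n) @[n --> \oo] --> (0 : R).
  rewrite -[X in _ --> X](Rintegral0 m O).
  apply: (@Rdominated _ _ _ m O _ (fun=> 0) (fun y => `|f y|) mO _ _ _ _).2.
  - by move=> n; apply: integrable_measurable; exact: idist.
  - move=> y _; apply: cvg_near_cst.
    have [[k _ Aky]|nA] := pselect ((\bigcup_n A n) y).
      near=> n; rewrite !indicE !mem_set ?subrr ?normr0 ?mulr0//.
        rewrite /U -bigcup_mkord; exists k => //=; near: n; exact: nbhs_infty_gt.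
      by exists k.
    near=> n; rewrite !indicE !memNset ?subrr ?normr0 ?mulr0//.
    by rewrite /U -bigcup_mkord => -[k _ Ak]; apply: nA; exists k.
  - exact: integrable_norm.
  - move=> n y _; rewrite normrM !normr_id ler_piMr// !indicE.
    by case: (_ \in _); case: (_ \in _); rewrite /= ?subrr ?subr0 ?sub0r ?normrN ?normr1 ?normr0.
have [n _ hn] := cvgr_le _ cU _ e20.
have [t ht] := (hU n).2 _ e20; exists t.
have mt := measurable_bool_term_set t.
rewrite (splitr e); apply: le_trans (lerD (hn n (leqnn _)) ht).
apply: dist_le => // y.
rewrite (le_trans _ (ler_normD _ _))//; rewrite le_eqVlt; apply/orP; left; apply/eqP.
by congr (`| _ |); ring.
Unshelve. all: by end_near. Qed.

(** The sets that can be approximated by sets of the algebra, in the measure of density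
    |f|, form a sigma-algebra; so the integrals over all measurable sets are
    nonnegative. *)
Lemma ae_ge0_of_countable_integrals :
  (forall t, 0 <= \int[m]_(y in O) (f y * \1_(bool_term_set t) y)) ->
  {ae m, forall y, O y -> 0 <= f y}.
Proof.
move=> h; apply: ae_ge0_of_integrals => A mA.
have sa : sigma_algebra setT approx.
  split; [exact: approx0|by move=> B hB; rewrite setTD; exact: approxC|exact: approx_bigcup].
have gen : range C `<=` approx.
  move=> _ [n _ <-]; split => // e e0; exists (Atom n).
  by rewrite /= distxx ltW.
have [_ hA] := smallest_sub sa gen (genC mA).
have iB B : measurable B -> m.-integrable O (EFin \o (fun y => f y * \1_B y)).
  move=> mB; apply: (le_integrableR (g := fun y => `|f y|)) => //; last exact: integrable_norm.
    by apply: measurable_funM => //; exact: measurable_indic.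
  move=> y _; rewrite normrM ler_piMr// indicE; case: (_ \in _); by rewrite ?normr1 ?normr0.
apply/ler_addgt0Pl => e e0; have [t ht] := hA _ e0.
have mt := measurable_bool_term_set t.
apply: le_trans (h t) _; rewrite addrC -lerBlDl -RintegralB//; [|exact: iB|exact: iB].
apply: le_trans ht; apply: le_trans (ler_norm _) _.
apply: le_trans (le_normr_Rintegral mO _) _.
  by apply: integrableBR => //; exact: iB.
apply: le_Rintegral => //.
- by apply: integrable_norm; apply: integrableBR => //; exact: iB.
- exact: idist.
- by move=> y _; rewrite -mulrBr normrM (distrC (\1_A y)).
Qed.

End sign.

(** * Positivity and symmetry of the heat kernel *)

Section generators.
Context {R : realType} {d : nat}.

(** Enumerated by nat through the encoding of pairs; the numbers that are not codes give the
    empty set. *)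
Definition rat_halfspace (n : nat) : set 'rV[R]_d :=
  if (unpickle n : option ('I_d * rat)) is Some p then [set y | y ord0 p.1 < ratr p.2]
  else set0.

Lemma measurable_rat_halfspace n : measurable (rat_halfspace n).
Proof.
rewrite /rat_halfspace; case: unpickle => [[i q]|]//=.
have := @measurable_coord R d i measurableT _ (measurable_itv `]-oo, ratr q[).
by rewrite setTI; congr measurable; apply/seteqP; split => y; rewrite /= in_itv.
Qed.

Lemma rat_halfspace_generates (A : set 'rV[R]_d) : measurable A ->
  <<s range rat_halfspace >> A.
Proof.
pose Y := g_sigma_algebraType (range rat_halfspace).
have mc (i : 'I_d) : measurable_fun setT
    ((fun v : 'rV[R]_d => v ord0 i) : Y -> measurableTypeR R).
  apply: (measurability _ (RGenInftyO.measurableE R)) => //.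
  move=> _ [_ [c ->] <-]; rewrite setTI.
  have -> : (fun v : 'rV[R]_d => v ord0 i) @^-1` `]-oo, c[ =
      \bigcup_(q : rat) (if ratr q < c then rat_halfspace (pickle (i, q)) else set0).
    apply/seteqP; split => y /=; rewrite in_itv/=.
      move=> /rat_in_itvoo[q]; rewrite in_itv/= => /andP[h1 h2]; exists q => //.
      by rewrite h2 /rat_halfspace pickleK.
    move=> [q _]; case: ifP => // h; rewrite /rat_halfspace pickleK => h'.
    exact: lt_trans h' h.
  apply: bigcupT_measurable_rat => q; case: ifP => _; last exact: measurable0.
  by apply: sub_sigma_algebra; exists (pickle (i, q)).
move=> mA; have : g_sigma_preimage (fun (i : 'I_d) (v : 'rV[R]_d) => v ord0 i : measurableTypeR R)
    `<=` @measurable _ Y; last by move=> /(_ A mA).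
apply: smallest_sub; first exact: sigma_algebra_measurable.
clear A mA; move=> A; rewrite -bigcup_seq/= => -[i _ [B mB <-]].
exact: mc.
Qed.

End generators.

Section positivity.
Context {R : realType} {d : nat} (Omega : set 'rV[R]_d).
Notation mu := (lebesgue_rV R d).
Notation la := (@lebesgue_measure R).
Notation Ry := (`]0%R, +oo[%classic : set R).
Notation L2 := (L2 Omega).
Notation inner := (inner Omega).
Hypothesis mO : measurable Omega.
Hypothesis muO : (mu Omega < +oo)%E.
Variables (lambda : nat -> R) (phi : nat -> 'rV[R]_d -> R).
Variable S : R -> 'rV[R]_d -> 'rV[R]_d -> R.
Hypothesis hb : orthonormal_basis Omega phi.
Hypothesis hS : heat_kernel Omega lambda phi S.
Hypothesis hsub : submarkovian Omega lambda phi.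

Let bd1 (B : set 'rV[R]_d) : measurable B -> bounded_on Omega (\1_B).
Proof.
move=> mB; split; first exact: measurable_indic.
by exists 1 => x _; rewrite indicE; case: (_ \in _); rewrite ?normr1 ?normr0 ?ler01.
Qed.

Let L21 B : measurable B -> L2 (\1_B).
Proof. by move=> mB; apply: bounded_on_L2 => //; exact: bd1. Qed.

Section fixed_time.
Variable t : R.
Hypothesis t0 : 0 < t.

Let mS := hS.1.

Lemma measurable_heat_at : measurable_fun (Omega `*` Omega) (fun p => S t p.1 p.2).
Proof.
apply: (measurable_comp (f := fun p => S p.1.1 p.1.2 p.2)
  (g := fun p => ((t : measurableTypeR R), p.1, p.2)) _ _ mS).
- by apply: measurableX => //; apply: measurableX.
- by move=> _ [[x y] [Ox Oy] <-]; split => //; split => //=; rewrite in_itv/= andbT.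
- apply: measurable_funTS; apply: measurable_fun_pair => //.
  by apply: measurable_fun_pair => //; exact: measurable_cst.
Qed.

Lemma measurable_heat_l x : Omega x -> measurable_fun Omega (S t x).
Proof.
move=> Ox; apply: (measurable_comp (f := fun p => S t p.1 p.2) (g := fun y => (x, y)) _ _ measurable_heat_at).
- exact: measurableX.
- by move=> _ [y Oy <-].
- by apply: measurable_funTS; exact: measurable_fun_pair.
Qed.

Lemma measurable_heat_r x : Omega x -> measurable_fun Omega (fun y => S t y x).
Proof.
move=> Ox; apply: (measurable_comp (f := fun p => S t p.1 p.2) (g := fun y => (y, x)) _ _ measurable_heat_at).
- exact: measurableX.
- by move=> _ [y Oy <-].
- by apply: measurable_funTS; exact: measurable_fun_pair.
Qed.

Let Kt B := kernel_op Omega (S t) (\1_B).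

Let Kt01 B : measurable B -> {ae mu, forall x, Omega x -> 0 <= Kt B x <= 1}.
Proof.
move=> mB; apply: (hsub (v := \1_B) (ltW t0)); first exact: measurable_indic.
  by apply: aeW => x _; rewrite indicE; case: (_ \in _); rewrite /= ?lexx ?ler01.
by case: (hS.2 t _ t0 (L21 mB)).
Qed.

Let int_l : {ae mu, forall x, Omega x -> mu.-integrable Omega (EFin \o S t x)}.
Proof.
have [h _] := hS.2 t _ t0 (L21 measurableT).
apply: filterS h => x h Ox; have := h Ox; apply: eq_integrable => // y _.
by rewrite indicE in_setT mulr1.
Qed.

(** For each set B, S(t)[1_B] >= 0 outside a null set that depends on B. For almost every
    x this holds for all B in a countable generating algebra, which determines the sign
    of S(t,x,.). *)
Lemma heat_ge0 : {ae mu, forall x, Omega x -> {ae mu, forall y, Omega y -> 0 <= S t x y}}.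
Proof.
have h := ae_forall_countable (fun tau =>
  Kt01 (measurable_bool_term_set (@measurable_rat_halfspace R d) tau)).
apply: filterS2 h int_l => x h i Ox.
apply: (ae_ge0_of_countable_integrals mO (i Ox) measurable_rat_halfspace
  rat_halfspace_generates) => tau.
by have /andP[] := h tau Ox.
Qed.

(** The sub-Markov property also gives S(t)[1] <= 1, on a set of finite measure. *)
Lemma heat_mass : (\int[mu]_(x in Omega) \int[mu]_(y in Omega) `|(S t x y)%:E| < +oo)%E.
Proof.
apply: (@le_lt_trans _ _ (\int[mu]_(x in Omega) 1)%E); last by rewrite integral_cst// mul1e.
apply: ae_ge0_le_integral => //.
- by move=> x _; apply: integral_ge0.
- apply: (measurable_ge0_integralD mu mO mO (g := fun x y => `|(S t x y)%:E|)%E) => //.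
  by apply: measurableT_comp => //; apply/measurable_EFinP; exact: measurable_heat_at.
have k1 := Kt01 measurableT.
apply: filterS3 heat_ge0 int_l k1 => x h i k Ox.
have mx := measurable_heat_l Ox.
have e : (\int[mu]_(y in Omega) `|(S t x y)%:E| = (Kt setT x)%:E)%E.
  transitivity (\int[mu]_(y in Omega) (S t x y)%:E)%E.
    apply: ae_eq_integral => //.
    - by apply: measurableT_comp => //; exact/measurable_EFinP.
    - exact/measurable_EFinP.
    - by apply: filterS (h Ox) => y hy Oy; rewrite /= ger0_norm ?hy.
  rewrite /Kt /kernel_op /Rintegral fineK.
    by apply: eq_integral => y _; rewrite indicE in_setT mulr1.
  have := integrable_fin_num mO (i Ox); congr (_ \is a fin_num).
  by apply: eq_integral => y _; rewrite /= indicE in_setT mulr1.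
by rewrite e lee_fin; case/andP: (k Ox).
Qed.

Let measurable_heat_swap : measurable_fun (Omega `*` Omega) (fun p => S t p.2 p.1).
Proof.
apply: (measurable_comp (F := Omega `*` Omega) (f := fun p => S t p.1 p.2)
  (g := fun p => (p.2, p.1))).
- exact: measurableX.
- by move=> _ [[x y] [Ox Oy] <-].
- exact: measurable_heat_at.
- by apply: measurable_funTS; apply: measurable_fun_pair; [exact: measurable_snd|exact: measurable_fst].
Qed.

Let H x := (\int[mu]_(y in Omega) `|(S t y x)%:E|)%E.

Let mH : measurable_fun Omega H.
Proof.
apply: (measurable_ge0_integralD mu mO mO (g := fun x y => `|(S t y x)%:E|)%E) => //.
by apply: measurableT_comp => //; apply/measurable_EFinP; exact: measurable_heat_swap.
Qed.

Let massH : (\int[mu]_(x in Omega) H x < +oo)%E.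
Proof.
apply: le_lt_trans heat_mass; rewrite le_eqVlt; apply/orP; left; apply/eqP.
apply: (tonelliD mu mu mO mO (g := fun x y => `|(S t y x)%:E|)%E) => //.
by apply: measurableT_comp => //; apply/measurable_EFinP; exact: measurable_heat_swap.
Qed.

Let iH : mu.-integrable Omega H.
Proof.
apply/integrableP; split => //.
by under eq_integral do rewrite gee0_abs ?integral_ge0//.
Qed.

Let int_r : {ae mu, forall x, Omega x -> mu.-integrable Omega (EFin \o (fun y => S t y x))}.
Proof.
have := integrable_ae mO iH; apply: filterS => x hx Ox.
apply/integrableP; split; first by apply/measurable_EFinP; exact: measurable_heat_r.
have : (0 <= H x)%E by exact: integral_ge0.
by rewrite -[X in (X < _)%E]/(H x); move: (hx Ox); case: (H x) => // r _ _; rewrite ltry.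
Qed.

(** Both sides are the same spectral series. *)
Let K_sym A B : measurable A -> measurable B -> inner (Kt A) (\1_B) = inner (Kt B) (\1_A).
Proof.
move=> mA mB; have [_ hA] := hS.2 t _ t0 (L21 mA); have [_ hB] := hS.2 t _ t0 (L21 mB).
rewrite -(cvg_lim _ (heat_inner mO hb (L21 mB) hA))//.
rewrite -(cvg_lim _ (heat_inner mO hb (L21 mA) hB))//.
congr (lim _); congr (_ @ \oo); apply/funext => n.
by apply: eq_bigr => j _; rewrite -!mulrA; congr (_ * _); rewrite mulrC.
Qed.

Let Lt B x := \int[mu]_(y in Omega) (S t y x * \1_B y).

Let Lt_eq B : measurable B -> {ae mu, forall x, Omega x -> Kt B x = Lt B x}.
Proof.
move=> mB.
have mSB : measurable_fun (Omega `*` Omega) (fun p => S t p.2 p.1 * \1_B p.2).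
  apply: measurable_funM; first exact: measurable_heat_swap.
  apply: measurable_funTS; apply: measurableT_comp measurable_snd.
  exact: measurable_indic.
have mL : measurable_fun Omega (Lt B).
  exact: (measurable_RintegralD mu mO mO (g := fun x y => S t y x * \1_B y)).
have L2K : L2 (Kt B) by case: (hS.2 t _ t0 (L21 mB)) => _ [].
have iK : mu.-integrable Omega (EFin \o Kt B).
  have := L2_mul mO L2K (L21 measurableT); apply: eq_integrable => // x _ /=.
  by rewrite indicE in_setT mulr1.
have ind1 A (y : 'rV[R]_d) : `|\1_A y : R| <= 1.
  by rewrite indicE; case: (_ \in _); rewrite ?normr1 ?normr0 ?ler01.
have mass A : measurable A -> \int[mu]_(x in Omega) (Lt B x * \1_A x) = inner (Kt A) (\1_B).
  move=> mA.
  transitivity (\int[mu]_(x in Omega) \int[mu]_(y in Omega) (S t y x * \1_B y * \1_A x)).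
    apply: eq_Rintegral => x /[!inE] Ox; rewrite mulrC -Rintegral_mull//.
      by apply: eq_Rintegral => y _; rewrite mulrC.
    by apply: measurable_funM; [exact: measurable_heat_r|exact: measurable_indic].
  rewrite (@RfubiniD _ _ _ _ _ mu mu Omega Omega (fun x y => S t y x * \1_B y * \1_A x) mO mO).
  - apply: eq_Rintegral => y /[!inE] Oy; rewrite [RHS]mulrC -Rintegral_mull//.
      by apply: eq_Rintegral => x _; ring.
    by apply: measurable_funM; [exact: measurable_heat_l|exact: measurable_indic].
  - apply: measurable_funM => //; apply: measurable_funTS; apply: measurableT_comp measurable_fst.
    exact: measurable_indic.
  - apply: le_lt_trans massH; apply: le_integral_any => x Ox; first exact: integral_ge0.
    apply: le_integral_any => y Oy //; rewrite lee_fin !normrM.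
    by rewrite (le_trans (ler_piMr _ _))// ?mulr_ge0// ler_piMr.
have iL : mu.-integrable Omega (EFin \o Lt B).
  apply/integrableP; split; first exact/measurable_EFinP.
  apply: le_lt_trans massH; apply: le_integral_any => x Ox; first exact: abse_ge0.
  apply: le_trans (abse_Rintegral_le _ _ _) _ => //.
    by apply: measurable_funM; [exact: measurable_heat_r|exact: measurable_indic].
  by apply: le_integral_any => y Oy //; rewrite lee_fin normrM ler_piMr.
have i1 (f : 'rV[R]_d -> R) A : measurable A -> mu.-integrable Omega (EFin \o f) ->
    mu.-integrable Omega (EFin \o (fun y => f y * \1_A y)).
  move=> mA iff; apply: (le_integrableR (g := fun y => `|f y|)) => //.
  - apply: measurable_funM; last exact: measurable_indic.
    exact: integrable_measurable iff.
  - by move=> y _; rewrite normrM ler_piMr.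
  - exact: integrable_norm iff.
have E A : measurable A -> \int[mu]_(x in Omega) ((Kt B x - Lt B x) * \1_A x) = 0.
  move=> mA; under eq_Rintegral do rewrite mulrBl.
  rewrite RintegralB//; [|exact: i1|exact: i1].
  by rewrite mass// [X in X - _]K_sym// subrr.
have h1 : {ae mu, forall x, Omega x -> 0 <= Kt B x - Lt B x}.
  apply: (ae_ge0_of_integrals mO); first exact: integrableBR.
  by move=> A mA; rewrite E.
have h2 : {ae mu, forall x, Omega x -> 0 <= - (Kt B x - Lt B x)}.
  apply: (ae_ge0_of_integrals mO).
    have := integrableZR (-1) mO (integrableBR mO iK iL).
    by apply: eq_integrable => // x _ /=; rewrite mulN1r.
  move=> A mA; under eq_Rintegral do rewrite mulNr.
  by rewrite Rintegral_opp E// oppr0.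
apply: filterS2 h1 h2 => x h1 h2 Ox.
by apply/eqP; rewrite -subr_eq0 eq_le h1// andbT -oppr_ge0 h2.
Qed.

(** The difference of the kernel and its transpose has, for almost every x, zero integral
    over every set of a countable generating algebra; apply the criterion of sign to it
    and to its opposite. *)
Lemma heat_sym : {ae mu, forall x, Omega x -> {ae mu, forall y, Omega y -> S t x y = S t y x}}.
Proof.
have h := ae_forall_countable (fun tau =>
  Lt_eq (measurable_bool_term_set (@measurable_rat_halfspace R d) tau)).
apply: filterS3 h int_l int_r => x h il ir Ox.
have {}il := il Ox; have {}ir := ir Ox.
have iB (f : 'rV[R]_d -> R) B : measurable B -> mu.-integrable Omega (EFin \o f) ->
    mu.-integrable Omega (EFin \o (fun y => f y * \1_B y)).
  move=> mB iff; apply: (le_integrableR (g := fun y => `|f y|)) => //.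
  - apply: measurable_funM; last exact: measurable_indic.
    exact: integrable_measurable iff.
  - by move=> y _; rewrite normrM ler_piMr// indicE; case: (_ \in _); rewrite ?normr1 ?normr0.
  - exact: integrable_norm iff.
have E tau : \int[mu]_(y in Omega)
    ((S t x y - S t y x) * \1_(bool_term_set (@rat_halfspace R d) tau) y) = 0.
  have mtau := measurable_bool_term_set (@measurable_rat_halfspace R d) tau.
  under eq_Rintegral do rewrite mulrBl.
  rewrite RintegralB//; [|exact: iB|exact: iB].
  by rewrite -[X in X - _]/(Kt _ x) h// subrr.
have h1 : {ae mu, forall y, Omega y -> 0 <= S t x y - S t y x}.
  apply: (ae_ge0_of_countable_integrals mO (integrableBR mO il ir)
    measurable_rat_halfspace rat_halfspace_generates) => tau.
  by rewrite E.
have h2 : {ae mu, forall y, Omega y -> 0 <= - (S t x y - S t y x)}.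
  have i2 : mu.-integrable Omega (EFin \o (fun y => - (S t x y - S t y x))).
    have := integrableZR (-1) mO (integrableBR mO il ir).
    by apply: eq_integrable => // y _ /=; rewrite mulN1r.
  apply: (ae_ge0_of_countable_integrals mO i2 measurable_rat_halfspace
    rat_halfspace_generates) => tau.
  under eq_Rintegral do rewrite mulNr.
  by rewrite Rintegral_opp E oppr0.
apply: filterS2 h1 h2 => y h1 h2 Oy.
by apply/eqP; rewrite -subr_eq0 eq_le h1// andbT -oppr_ge0 h2.
Qed.

End fixed_time.
End positivity.

(** * A regular version of the heat kernel *)

Section regularization.
Context {R : realType} {d : nat} (Omega : set 'rV[R]_d).
Notation X := 'rV[R]_d.
Notation mu := (lebesgue_rV R d).
Notation la := (@lebesgue_measure R).
Notation Ry := (`]0%R, +oo[%classic : set R).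
Notation inner := (inner Omega).
Hypothesis mO : measurable Omega.
Hypothesis muO : (mu Omega < +oo)%E.
Variables (G : X -> X -> R) (lambda : nat -> R) (phi : nat -> X -> R).
Variable S : R -> X -> X -> R.
Hypothesis mG : measurable_fun (Omega `*` Omega) (fun p => G p.1 p.2).
Hypothesis hphi : green_eigenbasis Omega G lambda phi.
Hypothesis hS : heat_kernel Omega lambda phi S.
Hypothesis symG : green_symmetric Omega G.
Hypothesis hsub : submarkovian Omega lambda phi.
Variable C : R.
Hypothesis iG : forall x, Omega x -> (\int[mu]_(y in Omega) `|(G x y)%:E| <= C%:E)%E.
Variables (D : X -> R) (C1 : R).
Hypothesis bD : bounded_on Omega D.
Hypothesis D0 : forall x, Omega x -> 0 <= D x.
Hypothesis C10 : 0 <= C1.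
Hypothesis GD : forall x, Omega x -> `|kernel_op Omega G D x| <= C1 * D x.

Let hb : orthonormal_basis Omega phi. Proof. by case: hphi. Qed.
Let mD : measurable_fun Omega D. Proof. by case: bD. Qed.
Let mRy : measurable Ry. Proof. exact: measurable_itv. Qed.
Let cyl := (Ry `*` Omega `*` Omega : set (measurableTypeR R * X * X)).
Let mcyl : measurable cyl. Proof. by apply: measurableX => //; exact: measurableX. Qed.

Let S1 (p : measurableTypeR R * X * X) : R := ((fun p => S p.1.1 p.1.2 p.2) \_ cyl) p.

Let mS1 : measurable_fun setT S1.
Proof. by apply/(measurable_restrictT _ _).1 => //; exact: hS.1. Qed.

Let S1E r x y : 0 < r -> Omega x -> Omega y -> S1 (r, x, y) = S r x y.
Proof.
move=> r0 Ox Oy; rewrite /S1 patchE mem_set//; split => //; split => //=.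
by rewrite in_itv/= andbT.
Qed.

Let sw (p : measurableTypeR R * X * X) : measurableTypeR R * X * X := (p.1.1, p.2, p.1.2).

Let msw : measurable_fun setT sw.
Proof.
apply: measurable_fun_pair.
  apply: measurable_fun_pair => //.
  exact: measurableT_comp measurable_fst measurable_fst.
exact: measurableT_comp measurable_snd measurable_fst.
Qed.

(** Nonnegative and symmetric everywhere, and equal to S almost everywhere. *)
Let S2 p : R := Num.max 0 (Num.min (S1 p) (S1 (sw p))).

Let mS2 : measurable_fun setT S2.
Proof.
apply: measurable_maxr => //; apply: measurable_minr => //.
exact: measurableT_comp mS1 msw.
Qed.

Let mS2r (r : R) : measurable_fun setT (fun p : X * X => S2 ((r : measurableTypeR R), p.1, p.2)).
Proof.
apply: (measurableT_comp (f := S2)) => //.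
by apply: measurable_fun_pair => //; apply: measurable_fun_pair => //; exact: measurable_cst.
Qed.

Let mDs A : measurable_fun (A `*` Omega : set (X * X)) (fun p => D p.2).
Proof.
apply: (measurable_comp (F := Omega) (f := D)) => //; first by move=> _ [[q y] [_ h] <-].
by apply: measurable_funTS; exact: measurable_snd.
Qed.

Let S2_ge0 p : 0 <= S2 p. Proof. by rewrite /S2 le_max lexx. Qed.

Let S2_sym r x y : S2 (r, x, y) = S2 (r, y, x).
Proof. by rewrite /S2 /sw/= minC. Qed.

Let S2_eq r : 0 < r -> {ae mu, forall x, Omega x ->
  {ae mu, forall y, Omega y -> S r x y = S2 (r, x, y)}}.
Proof.
move=> r0; apply: filterS2 (heat_ge0 mO muO hS hsub r0) (heat_sym mO muO hb hS hsub r0).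
move=> x h1 h2 Ox; apply: filterS2 (h1 Ox) (h2 Ox) => y {}h1 {}h2 Oy.
by rewrite /S2 /sw/= !S1E// -h2// minxx; apply/esym/max_idPr; exact: h1.
Qed.

Let g (x : X) (r : R) (y : X) : \bar R := (S2 (r, x, y) * D y)%:E.

Let g0 x r y : Omega y -> (0 <= g x r y)%E.
Proof. by move=> Oy; rewrite lee_fin mulr_ge0// D0. Qed.

Let mg : measurable_fun ((Omega `*` Ry) `*` Omega : set (X * measurableTypeR R * X))
  (fun q => g q.1.1 q.1.2 q.2).
Proof.
apply/measurable_EFinP; apply: measurable_funM.
  apply: measurable_funTS; apply: measurableT_comp mS2 _.
  apply: measurable_fun_pair => //; apply: measurable_fun_pair.
    exact: measurableT_comp measurable_snd measurable_fst.
  exact: measurableT_comp measurable_fst measurable_fst.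
apply: (measurable_comp (F := Omega) (f := D)) => //; first by move=> _ [[q y] [_ h] <-].
by apply: measurable_funTS; exact: measurable_snd.
Qed.

Let mJ : measurable_fun (Omega `*` Ry : set (X * measurableTypeR R))
  (fun q => \int[mu]_(y in Omega) g q.1 q.2 y)%E.
Proof.
apply: (measurable_ge0_integralD mu (measurableX mO mRy) mO
  (g := fun (q : X * measurableTypeR R) y => g q.1 q.2 y)) => //.
by move=> q y _ Oy; exact: g0.
Qed.

Let I x : \bar R := (\int[la]_(r in Ry) \int[mu]_(y in Omega) g x r y)%E.

Let J0 x r : (0 <= \int[mu]_(y in Omega) g x r y)%E.
Proof. by apply: integral_ge0 => y Oy; exact: g0. Qed.

Let I0 x : (0 <= I x)%E. Proof. by apply: integral_ge0. Qed.

Let mI : measurable_fun Omega I.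
Proof.
exact: (measurable_ge0_integralD la mO mRy (g := fun x r => \int[mu]_(y in Omega) g x r y)%E).
Qed.

(** For E included in Omega the left side is the integral over r of <S(r) D, 1_E>, that is
    <G D, 1_E>. As E is arbitrary, the pointwise inequality follows almost everywhere. *)
Let IE_le E : measurable E -> E `<=` Omega ->
  (\int[mu]_(x in E) I x <= \int[mu]_(x in E) (C1 * D x)%:E)%E.
Proof.
move=> mE EO.
have mJE : measurable_fun (E `*` Ry : set (X * measurableTypeR R))
    (fun q => \int[mu]_(y in Omega) g q.1 q.2 y)%E.
  apply: measurable_funS mJ; first exact: measurableX.
  by move=> -[x r] [/= /EO Ox h].
rewrite (tonelliD mu la mE mRy (g := fun x r => \int[mu]_(y in Omega) g x r y)%E)//.
have b1 : bounded_on Omega (\1_E).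
  split; first exact: measurable_indic.
  by exists 1 => x _; rewrite indicE; case: (_ \in _); rewrite ?normr1 ?normr0 ?ler01.
have L2E := bounded_on_L2 mO muO b1; have L2D := bounded_on_L2 mO muO bD.
have toE (h : X -> R) : (\int[mu]_(x in Omega) (h x * \1_E x)%:E = \int[mu]_(x in E) (h x)%:E)%E.
  rewrite integral_mkcond [RHS]integral_mkcond; apply: eq_integral => x _.
  rewrite !patchE indicE; have [xE|xE] := boolP (x \in E); last first.
    by rewrite mulr0; case: ifP.
  by rewrite mulr1 mem_set//; apply: EO; rewrite inE in xE.
have e r : Ry r -> (\int[mu]_(x in E) \int[mu]_(y in Omega) g x r y =
    (inner (kernel_op Omega (S r) D) (\1_E))%:E)%E.
  move=> /Ry_gt0 r0; have [hint [L2K _]] := hS.2 r _ r0 L2D.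
  rewrite /Defs.inner /Rintegral fineK; last first.
    by apply: integrable_fin_num => //; exact: L2_mul.
  rewrite toE; apply: ae_eq_integral => //.
  - have := measurable_ge0_integralD mu mE mO (g := fun x y => g x r y); apply => //.
      by apply/measurable_EFinP; apply: measurable_funM => //; exact: measurable_funTS.
    by move=> x y _ Oy; exact: g0.
  - by apply/measurable_EFinP; apply: measurable_funS L2K.1.
  apply: filterS2 hint (S2_eq r0) => x hx sx Ex; have Ox := EO _ Ex.
  rewrite /kernel_op /Rintegral fineK; last exact: integrable_fin_num (hx Ox).
  apply: ae_eq_integral => //.
  - apply/measurable_EFinP; apply: measurable_funM => //.
    apply: measurable_funTS.
    apply: (measurableT_comp (g := fun y : X => (x, y))) (mS2r r) _.
    exact: measurable_fun_pair.
  - exact: measurable_int (hx Ox).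
  by apply: filterS (sx Ox) => y sy Oy; rewrite /g -sy.
have -> : (\int[la]_(r in Ry) \int[mu]_(x in E) \int[mu]_(y in Omega) g x r y =
    \int[la]_(r in Ry) (inner (kernel_op Omega (S r) D) (\1_E))%:E)%E.
  by apply: eq_integral => r /[!inE] /e.
have [ih hh] := heat_green_integral mO muO mG hphi hS symG iG bD b1.
have -> : (\int[la]_(r in Ry) (inner (kernel_op Omega (S r) D) (\1_E))%:E =
    (inner (kernel_op Omega G D) (\1_E))%:E)%E.
  by rewrite -hh /Rintegral fineK//; exact: integrable_fin_num ih.
have L2G := bounded_on_L2 mO muO (green_op_bdd mO mG iG bD).
rewrite /Defs.inner /Rintegral fineK; last first.
  by apply: integrable_fin_num => //; exact: L2_mul.
rewrite toE.
apply: le_trans (lee_abs _) _; apply: le_trans (le_abse_integral _ mE _) _.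
  by apply/measurable_EFinP; apply: measurable_funS L2G.1.
by apply: le_integral_any => x Ex; [exact: abse_ge0|rewrite lee_fin GD//; exact: EO].
Qed.

(** Outside this set of full measure the regular kernel is set to 0, in both variables in
    order to keep it symmetric. *)
Let good : set X := [set x | Omega x /\ (I x <= (C1 * D x)%:E)%E].

Let mCD : measurable_fun Omega (fun x => (C1 * D x)%:E).
Proof. by apply/measurable_EFinP; exact: measurable_funM. Qed.

Let mgood : measurable good.
Proof. exact: (measurable_lee mO mI mCD). Qed.

Let ae_good : {ae mu, forall x, Omega x -> good x}.
Proof.
pose E : set X := [set x | Omega x /\ ((C1 * D x)%:E < I x)%E].
have mE : measurable E by exact: (measurable_lte mO mCD mI).
have EO : E `<=` Omega by move=> x [].
have iCD : mu.-integrable E (fun x => (C1 * D x)%:E).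
  have : mu.-integrable Omega (EFin \o (fun x => C1 * D x)).
    have b1 : bounded_on Omega (\1_setT).
      split; first exact: measurable_indic.
      by exists 1 => x _; rewrite indicE in_setT normr1.
    have := L2_mul mO (bounded_on_L2 mO muO bD) (bounded_on_L2 mO muO b1).
    move=> /(integrableZR C1 mO); apply: eq_integrable => // x _ /=.
    by rewrite indicE in_setT mulr1.
  exact: integrableS.
have h0 x : E x -> (0 <= I x - (C1 * D x)%:E)%E.
  by move=> [_ h]; rewrite sube_ge0 ?ltW//; exact: fin_numE.
have mh : measurable_fun E (fun x => I x - (C1 * D x)%:E)%E.
  by apply: emeasurable_funB; [exact: measurable_funS mI|exact: measurable_funS mCD].
have z : (\int[mu]_(x in E) (I x - (C1 * D x)%:E) = 0)%E.
  have := IE_le mE EO.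
  have -> : (\int[mu]_(x in E) I x = \int[mu]_(x in E) (C1 * D x)%:E +
     \int[mu]_(x in E) (I x - (C1 * D x)%:E))%E.
    rewrite -ge0_integralD//.
    - by apply: eq_integral => x _; rewrite addeC subeK.
    - by move=> x Ex; rewrite lee_fin mulr_ge0// D0//; exact: EO.
    - exact: measurable_funS mCD.
  have fin := integrable_fin_num mE iCD.
  rewrite -[leRHS]adde0 leeD2lE// => le0.
  by apply/eqP; rewrite eq_le le0 integral_ge0.
have := ge0_integral0_ae mE mh h0 z; apply: filterS => x hx Ox; split => //.
rewrite leNgt; apply/negP => lt; have := hx (conj Ox lt).
by apply/eqP; rewrite gt_eqF// sube_gt0.
Qed.

(** The equality with S holds for almost every r, with a null set that may depend on x
    and y: enough for the subordinated kernels, which are integrals over r. *)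
Lemma regular_heat_kernel : exists Sg : R -> X -> X -> R,
  [/\ measurable_fun setT (fun p : measurableTypeR R * X * X => Sg p.1.1 p.1.2 p.2),
    forall r x y, 0 <= Sg r x y, forall r x y, Sg r x y = Sg r y x &
    forall x, Omega x -> (\int[la]_(r in Ry) \int[mu]_(y in Omega) (Sg r x y * D y)%:E
      <= (C1 * D x)%:E)%E] /\
  {ae mu, forall x, Omega x -> {ae mu, forall y, Omega y ->
    {ae la, forall r, Ry r -> S r x y = Sg r x y}}}.
Proof.
have mi : measurable_fun setT (\1_good : X -> R) by exact: measurable_indic.
exists (fun r x y => S2 (r, x, y) * \1_good x * \1_good y); split; first split.
- apply: measurable_funM.
    apply: measurable_funM.
      by apply: eq_measurable_fun mS2 => -[[r x] y].
    exact: measurableT_comp mi (measurableT_comp measurable_snd measurable_fst).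
  exact: measurableT_comp mi measurable_snd.
- by move=> r x y; rewrite !mulr_ge0// indicE.
- by move=> r x y; rewrite S2_sym mulrAC.
- move=> x Ox; have [gx|ngx] := pselect (good x); last first.
    rewrite integral0_eq ?lee_fin ?mulr_ge0 ?D0// => r _.
    rewrite integral0_eq// => y _.
    by rewrite [\1_good x]indicE memNset// mulr0 !mul0r.
  apply: le_trans gx.2; apply: le_integral_any => r _.
    by apply: integral_ge0 => y Oy; rewrite lee_fin !mulr_ge0 ?D0// indicE.
  apply: le_integral_any => y Oy; first by rewrite lee_fin !mulr_ge0 ?D0// indicE.
  by rewrite lee_fin ler_wpM2r ?D0// -mulrA ler_piMr// !indicE.
pose n (x : X) (r : R) (y : X) : \bar R := (`|S1 (r, x, y) - S2 (r, x, y)|)%:E.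
have n0 x r y : (0 <= n x r y)%E by rewrite lee_fin.
have mn : measurable_fun setT (fun q : X * measurableTypeR R * X => n q.1.1 q.1.2 q.2).
  apply/measurable_EFinP; apply: measurableT_comp => //.
  apply: (measurableT_comp (f := fun p => S1 p - S2 p)
    (g := fun q : X * measurableTypeR R * X => (q.1.2, q.1.1, q.2))).
    exact: measurable_funB.
  apply: measurable_fun_pair => //; apply: measurable_fun_pair.
    exact: measurableT_comp measurable_snd measurable_fst.
  exact: measurableT_comp measurable_fst measurable_fst.
have mnx x : measurable_fun setT (fun q : measurableTypeR R * X => n x q.1 q.2).
  apply: (measurableT_comp (g := fun q : measurableTypeR R * X => (x, q.1, q.2))) mn _.
  by apply: measurable_fun_pair => //; apply: measurable_fun_pair => //; exact: measurable_cst.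
have mny x : measurable_fun setT (fun q : X * measurableTypeR R => n x q.2 q.1).
  apply: (measurableT_comp (g := fun q : X * measurableTypeR R => (q.2, q.1))) (mnx x) _.
  by apply: measurable_fun_pair; [exact: measurable_snd|exact: measurable_fst].
pose M x r : \bar R := (\int[mu]_(y in Omega) n x r y)%E.
have M0 x r : (0 <= M x r)%E by exact: integral_ge0.
have mM : measurable_fun (Omega `*` Ry : set (X * measurableTypeR R)) (fun q => M q.1 q.2).
  apply: (measurable_ge0_integralD mu (measurableX mO mRy) mO
    (g := fun (q : X * measurableTypeR R) y => n q.1 q.2 y)) => //.
  exact: measurable_funTS.
have Mx r : Ry r -> {ae mu, forall x, Omega x -> M x r = 0%E}.
  move=> /Ry_gt0 r0; apply: filterS (S2_eq r0) => x hx Ox.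
  apply: ae_integral0 => //.
    apply: measurable_funTS.
    apply: (measurableT_comp (g := fun y : X => ((r : measurableTypeR R), y))) (mnx x) _.
    by apply: measurable_fun_pair => //; exact: measurable_cst.
  by apply: filterS (hx Ox) => y hy Oy; rewrite /n S1E// hy// subrr normr0.
pose N x : \bar R := (\int[la]_(r in Ry) M x r)%E.
have N0 x : Omega x -> (0 <= N x)%E by move=> _; apply: integral_ge0 => r _; exact: M0.
have mN : measurable_fun Omega N.
  exact: (measurable_ge0_integralD la mO mRy (g := M)).
have iN : (\int[mu]_(x in Omega) N x = 0)%E.
  rewrite (tonelliD mu la mO mRy (g := M))//.
  apply: integral0_eq => r rR; apply: ae_integral0 => //; last exact: Mx.
  apply: (measurable_comp (F := Omega `*` Ry) (f := fun q => M q.1 q.2)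
    (g := fun x : X => (x, (r : measurableTypeR R)))) => //.
  - exact: measurableX.
  - by move=> _ [x Ox <-].
  - apply: measurable_funTS; apply: measurable_fun_pair => //; exact: measurable_cst.
have aeN := ge0_integral0_ae mO mN N0 iN.
apply: filterS2 aeN ae_good => x hx gx Ox; have {}hx := hx Ox; have {}gx := gx Ox.
have mP : measurable_fun Omega (fun y => \int[la]_(r in Ry) n x r y)%E.
  apply: (measurable_ge0_integralD la mO mRy (g := fun y r => n x r y)) => //.
  exact: measurable_funTS.
have iP : (\int[mu]_(y in Omega) \int[la]_(r in Ry) n x r y = 0)%E.
  rewrite (tonelliD mu la mO mRy (g := fun y r => n x r y))//.
  exact: measurable_funTS.
have P0 y : Omega y -> (0 <= \int[la]_(r in Ry) n x r y)%E.
  by move=> _; apply: integral_ge0 => r _; exact: n0.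
have aeP := ge0_integral0_ae mO mP P0 iP.
apply: filterS2 aeP ae_good => y hy gy Oy; have {}hy := hy Oy; have {}gy := gy Oy.
have mQ : measurable_fun Ry (fun r => n x r y).
  apply: measurable_funTS.
  apply: (measurableT_comp (g := fun r : measurableTypeR R => (r, y))) (mnx x) _.
  by apply: measurable_fun_pair => //; exact: measurable_cst.
have aeQ : {ae la, forall r, Ry r -> n x r y = 0%E} by apply: ge0_integral0_ae.
apply: ae_lebesgue_imp aeQ => r hr rR; have := hr rR.
rewrite /n S1E//; last exact: Ry_gt0.
move=> -[] /eqP; rewrite normr_eq0 subr_eq0 => /eqP ->.
by rewrite !indicE !mem_set// !mulr1.
Qed.

End regularization.

(** * Integrals over product domains *)

Section product_domains.
Context d1 d2 (T1 : measurableType d1) (T2 : measurableType d2) (R : realType).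
Variable m1 : {sigma_finite_measure set T1 -> \bar R}.
Variable m2 : {sigma_finite_measure set T2 -> \bar R}.
Variables (A : set T1) (B : set T2).
Hypotheses (mA : measurable A) (mB : measurable B).
Notation m12 := (m1 \x m2)%E.

Lemma tonelli_prod (F : T1 * T2 -> \bar R) : measurable_fun (A `*` B) F ->
  (forall p, (A `*` B) p -> (0 <= F p)%E) ->
  (\int[m12]_(p in A `*` B) F p = \int[m1]_(x in A) \int[m2]_(y in B) F (x, y))%E.
Proof.
move=> mF F0; rewrite integral_mkcond.
have mh : measurable_fun setT (F \_ (A `*` B)).
  by apply/(measurable_restrictT _ _).1 => //; exact: measurableX.
have h0 p : (0 <= (F \_ (A `*` B)) p)%E by apply: erestrict_ge0.
rewrite (fubini_tonelli1 _ mh h0) [RHS]integral_mkcond; apply: eq_integral => x _.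
rewrite /fubini_F patchE; case: ifPn => xA.
  rewrite [RHS]integral_mkcond; apply: eq_integral => y _.
  by rewrite !patchE in_setX xA.
by rewrite (eq_integral (cst 0%E)) ?integral0// => y _; rewrite patchE in_setX (negbTE xA).
Qed.

Lemma integrable_prod (F : T1 * T2 -> R) : measurable_fun (A `*` B) F ->
  (\int[m1]_(x in A) \int[m2]_(y in B) `|(F (x, y))%:E| < +oo)%E ->
  m12.-integrable (A `*` B) (EFin \o F).
Proof.
move=> mF foo; apply/integrableP; split; first exact/measurable_EFinP.
rewrite tonelli_prod//; apply: measurableT_comp => //; exact/measurable_EFinP.
Qed.

Let restr (F : T1 * T2 -> R) : m12.-integrable (A `*` B) (EFin \o F) ->
  m12.-integrable setT (EFin \o (F \_ (A `*` B))).
Proof.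
move=> iF; have /integrable_mkcond : measurable (A `*` B) by exact: measurableX.
by move=> /(_ _ _ (EFin \o F)) h; move: iF; rewrite h restrict_EFin.
Qed.

Lemma Rintegral_prod (F : T1 * T2 -> R) : m12.-integrable (A `*` B) (EFin \o F) ->
  \int[m12]_(p in A `*` B) F p = \int[m1]_(x in A) \int[m2]_(y in B) F (x, y).
Proof.
move=> iF; have iG := restr iF.
rewrite [LHS]Rintegral_mkcond -(Rfubini1 iG) [RHS]Rintegral_mkcond.
apply: eq_Rintegral => x _; rewrite patchE; case: ifPn => xA.
  by rewrite [RHS]Rintegral_mkcond; apply: eq_Rintegral => y _; rewrite !patchE in_setX xA.
by rewrite -[RHS](Rintegral0 m2 setT); apply: eq_Rintegral => y _; rewrite patchE in_setX (negbTE xA).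
Qed.

Lemma integrable_Rintegral_prod (F : T1 * T2 -> R) :
  m12.-integrable (A `*` B) (EFin \o F) ->
  m1.-integrable A (EFin \o (fun x => \int[m2]_(y in B) F (x, y))).
Proof.
move=> iF; have := integrable_Rfubini1 (restr iF).
move=> /(integrableS measurableT mA (@subsetT _ _)); apply: eq_integrable => // x xA /=.
congr (_%:E); rewrite [RHS]Rintegral_mkcond; apply: eq_Rintegral => y _.
by rewrite !patchE in_setX xA.
Qed.

End product_domains.

Section product_sigma_finite.
Context d1 d2 (T1 : measurableType d1) (T2 : measurableType d2) (R : realType).
Variable m1 : {sigma_finite_measure set T1 -> \bar R}.
Variable m2 : {sigma_finite_measure set T2 -> \bar R}.

(** The product measure with its sigma-finiteness, so that products can be iterated. *)
Definition sigma_finite_prod : {sigma_finite_measure set (T1 * T2)%type -> \bar R} :=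
  HB.pack (product_measure1 m1 m2)
    (@Measure_isSigmaFinite.Build _ _ _ (product_measure1 m1 m2) (sigma_finite_product m1 m2)).

End product_sigma_finite.

(** * Duality for integral operators *)

(** Fubini's theorem for the operator with kernel k applied to g and its transpose applied
    to Phi; E majorizes the transposed operator with absolute values. *)
Section duality.
Context d1 d2 (P : measurableType d1) (Q : measurableType d2) (R : realType).
Variable mP : {sigma_finite_measure set P -> \bar R}.
Variable mQ : {sigma_finite_measure set Q -> \bar R}.
Variables (A : set P) (B : set Q) (k : P -> Q -> R) (g : Q -> R) (Phi : P -> R) (E : Q -> R).
Hypotheses (mA : measurable A) (mB : measurable B).
Hypothesis mk : measurable_fun (A `*` B) (fun p => k p.1 p.2).
Hypothesis mg : measurable_fun B g.
Hypothesis mPhi : measurable_fun A Phi.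
Hypothesis bE : forall q, B q -> (\int[mP]_(p in A) `|(k p q * Phi p)%:E| <= (E q)%:E)%E.
Hypothesis iE : mQ.-integrable B (EFin \o (fun q => g q * E q)).

Let F p q := k p q * g q * Phi p.

Let mF : measurable_fun (A `*` B) (fun w => F w.1 w.2).
Proof.
apply: measurable_funM.
  apply: measurable_funM => //.
  apply: (measurable_comp (F := B) (f := g)) => //; first by move=> _ [[p q] [_ h] <-].
  by apply: measurable_funTS; exact: measurable_snd.
apply: (measurable_comp (F := A) (f := Phi)) => //; first by move=> _ [[p q] [h _] <-].
by apply: measurable_funTS; exact: measurable_fst.
Qed.

Let maF : measurable_fun (A `*` B) (fun w => `|(F w.1 w.2)%:E|%E).
Proof. by apply: measurableT_comp => //; exact/measurable_EFinP. Qed.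

Let mk1 q : B q -> measurable_fun A (k^~ q).
Proof.
move=> Bq; apply: (measurable_comp (f := fun w => k w.1 w.2) (g := fun p => (p, q)) _ _ mk).
- exact: measurableX.
- by move=> _ [p Ap <-].
- by apply: measurable_funTS; apply: measurable_fun_pair.
Qed.

Let mk2 p : A p -> measurable_fun B (k p).
Proof.
move=> Ap; apply: (measurable_comp (f := fun w => k w.1 w.2) (g := fun q => (p, q)) _ _ mk).
- exact: measurableX.
- by move=> _ [q Bq <-].
- by apply: measurable_funTS; apply: measurable_fun_pair.
Qed.

Let foo : (\int[mP]_(p in A) \int[mQ]_(q in B) `|(F p q)%:E| < +oo)%E.
Proof.
rewrite (tonelliD mP mQ mA mB (g := fun p q => `|(F p q)%:E|%E))//.
have iaE := integrable_norm iE.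
apply: (@le_lt_trans _ _ (\int[mQ]_(q in B) (`|g q * E q|)%:E)%E); last first.
  by have := integrable_fin_num mB iaE; case: (\int[mQ]_(q in B) _)%E => // r _; rewrite ltry.
apply: le_integral_any => q Bq; first exact: integral_ge0.
apply: (@le_trans _ _ (`|g q|%:E * \int[mP]_(p in A) `|(k p q * Phi p)%:E|)%E).
  rewrite -ge0_integralZl//; last first.
    apply: measurableT_comp => //; apply/measurable_EFinP.
    by apply: measurable_funM => //; exact: mk1.
  by apply: le_integral_any => // p _; rewrite -EFinM lee_fin /F !normrM mulrCA mulrA.
rewrite normrM EFinM lee_wpmul2l//; apply: le_trans (bE Bq) _.
by rewrite lee_fin ler_norm.
Qed.

Let iF : (mP \x mQ)%E.-integrable (A `*` B) (EFin \o (fun w => F w.1 w.2)).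
Proof. exact: integrable_prod. Qed.

Let pullP p : A p -> \int[mQ]_(q in B) F p q = (\int[mQ]_(q in B) (k p q * g q)) * Phi p.
Proof.
move=> Ap; rewrite mulrC -Rintegral_mull//.
  by apply: eq_Rintegral => q _; rewrite /F mulrC.
by apply: measurable_funM => //; exact: mk2.
Qed.

Let pullQ q : B q -> \int[mP]_(p in A) F p q = g q * \int[mP]_(p in A) (k p q * Phi p).
Proof.
move=> Bq; rewrite -Rintegral_mull//.
  by apply: eq_Rintegral => p _; rewrite /F; ring.
by apply: measurable_funM => //; exact: mk1.
Qed.

Lemma duality_integrable_l :
  mP.-integrable A (EFin \o (fun p => (\int[mQ]_(q in B) (k p q * g q)) * Phi p)).
Proof.
have := integrable_Rintegral_prod mA mB iF; apply: eq_integrable => // p /[!inE] Ap.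
by rewrite /= pullP.
Qed.

Lemma duality_integrable_r :
  mQ.-integrable B (EFin \o (fun q => g q * \int[mP]_(p in A) (k p q * Phi p))).
Proof.
have mFs : measurable_fun (B `*` A) (fun w => F w.2 w.1).
  apply: (measurable_comp (F := A `*` B) (f := fun w => F w.1 w.2) (g := fun w => (w.2, w.1))).
  - exact: measurableX.
  - by move=> _ [[q p] [? ?] <-].
  - exact: mF.
  - by apply: measurable_funTS; apply: measurable_fun_pair; [exact: measurable_snd|exact: measurable_fst].
have fs : (\int[mQ]_(q in B) \int[mP]_(p in A) `|(F p q)%:E| < +oo)%E.
  by rewrite -(tonelliD mP mQ mA mB (g := fun p q => `|(F p q)%:E|%E)).
have := integrable_Rintegral_prod mB mA (integrable_prod mB mA (F := fun w => F w.2 w.1) mFs fs).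
by apply: eq_integrable => // q /[!inE] Bq; rewrite /= pullQ.
Qed.

Lemma duality_eq :
  \int[mP]_(p in A) ((\int[mQ]_(q in B) (k p q * g q)) * Phi p) =
  \int[mQ]_(q in B) (g q * \int[mP]_(p in A) (k p q * Phi p)).
Proof.
transitivity (\int[mP]_(p in A) \int[mQ]_(q in B) F p q).
  by apply: eq_Rintegral => p /[!inE] Ap; rewrite pullP.
by rewrite RfubiniD//; apply: eq_Rintegral => q /[!inE] Bq; rewrite pullQ.
Qed.

(** At the points where Phi does not vanish, the operator applied to g is given by an
    absolutely convergent integral. *)
Lemma duality_section : {ae mP, forall p, A p -> Phi p != 0 ->
  mQ.-integrable B (EFin \o (fun q => k p q * g q))}.
Proof.
pose H p := (\int[mQ]_(q in B) `|(F p q)%:E|)%E.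
have H0 p : (0 <= H p)%E by exact: integral_ge0.
have mH : measurable_fun A H.
  exact: (measurable_ge0_integralD mQ mA mB (g := fun p q => `|(F p q)%:E|%E)).
have iH : mP.-integrable A H.
  apply/integrableP; split => //.
  by under eq_integral do rewrite gee0_abs//.
have := integrable_ae mA iH; apply: filterS => p hp Ap Pp.
have i1 : mQ.-integrable B (EFin \o (fun q => F p q)).
  apply/integrableP; split.
    apply/measurable_EFinP; apply: measurable_funM; last exact: measurable_cst.
    by apply: measurable_funM => //; exact: mk2.
  by have := hp Ap; have := H0 p; rewrite -[X in (X < _)%E]/(H p); case: (H p) => // r _ _; rewrite ltry.
have := integrableZR (Phi p)^-1 mB i1; apply: eq_integrable => // q _ /=.
by rewrite /F [_^-1 * _]mulrC mulfK.
Qed.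

End duality.

(** * Subordinated kernels and Duhamel potentials *)

Section cylinder_reflection.
Context d (X : measurableType d) (R : realType).
Variable mu : {sigma_finite_measure set X -> \bar R}.
Notation la := (@lebesgue_measure R).
Notation nu := (la \x mu)%E.
Variables (O : set X) (T : R).
Hypothesis mO : measurable O.
Notation JT := (`]0%R, T[%classic : set R).
Notation cyl := (JT `*` O : set (measurableTypeR R * X)).
Let mJT : measurable JT. Proof. exact: measurable_itv. Qed.
Variable F : measurableTypeR R * X -> R.
Hypothesis mF : measurable_fun cyl F.

Lemma measurable_cylinder_reflect : measurable_fun cyl (fun p => F (T - p.1, p.2)).
Proof.
apply: (measurable_comp (F := cyl) (f := F)
  (g := fun p : measurableTypeR R * X => (T - p.1, p.2))) => //.
- exact: measurableX.
- by move=> _ [[t x] [/= + Ox] <-]; rewrite !in_itv/= => /andP[t0 tT];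
    rewrite subr_gt0 tT gtrBl.
- apply: measurable_funTS; apply: measurable_fun_pair; last exact: measurable_snd.
  by apply: measurable_funB => //; exact: measurable_fst.
Qed.

Lemma cylinder_reflect_norm :
  (\int[nu]_(p in cyl) `|(F (T - p.1, p.2))%:E| = \int[nu]_(p in cyl) `|(F p)%:E|)%E.
Proof.
have mN : measurable_fun cyl (fun p => `|(F p)%:E|%E).
  by apply: measurableT_comp => //; exact/measurable_EFinP.
have mN1 : measurable_fun cyl (fun p => `|(F (T - p.1, p.2))%:E|%E).
  by apply: measurableT_comp => //; apply/measurable_EFinP; exact: measurable_cylinder_reflect.
rewrite (tonelli_prod la mu mJT mO mN1 (fun _ _ => abse_ge0 _)).
rewrite (tonelli_prod la mu mJT mO mN (fun _ _ => abse_ge0 _)).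
pose h (t : R) := (\int[mu]_(x in O) `|(F (t, x))%:E|)%E.
have mh : measurable_fun setT (h \_ JT).
  apply/(measurable_restrictT _ _).1 => //.
  have mN' : measurable_fun cyl (fun p => `|(F (p.1, p.2))%:E|%E).
    by move: mN; apply: eq_measurable_fun => -[].
  exact: (@measurable_ge0_integralD _ _ (measurableTypeR R) X R mu JT O
    (fun t x => `|(F (t, x))%:E|%E) mJT mO mN').
rewrite integral_mkcond [RHS]integral_mkcond -/h.
rewrite [RHS](@ge0_integral_affine _ (-1) T)//; last first.
  by move=> t; apply: erestrict_ge0 => s _; exact: integral_ge0.
rewrite normrN1 mul1e; apply: eq_integral => t _.
have E : -1 * t + T = T - t by ring.
rewrite E !patchE -/(h (T - t)).
suff -> : (t \in JT) = (T - t \in JT) by [].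
by apply/idP/idP; rewrite !inE/= !in_itv/= => /andP[a b]; apply/andP; split; lra.
Qed.

Hypothesis iF : nu.-integrable cyl (EFin \o F).

Lemma integrable_cylinder_reflect :
  nu.-integrable cyl (EFin \o (fun p => F (T - p.1, p.2))).
Proof.
apply/integrableP; split; first by apply/measurable_EFinP; exact: measurable_cylinder_reflect.
by move/integrableP : iF => [_]; rewrite -cylinder_reflect_norm.
Qed.

Lemma Rintegral_cylinder_reflect :
  \int[nu]_(p in cyl) F (T - p.1, p.2) = \int[nu]_(p in cyl) F p.
Proof.
rewrite (Rintegral_prod (m1 := la) (m2 := mu) mJT mO integrable_cylinder_reflect).
rewrite (Rintegral_prod (m1 := la) (m2 := mu) mJT mO iF)/=.
rewrite -[RHS]Rintegral_reflect//.
by have /measurable_EFinP := measurable_int _ (integrable_Rintegral_prod (m1 := la) (m2 := mu) mJT mO iF).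
Qed.

End cylinder_reflection.

Section volterra.
Context d (X : measurableType d) (R : realType).
Variable mu : {sigma_finite_measure set X -> \bar R}.
Notation la := (@lebesgue_measure R).
Notation nu := (la \x mu)%E.
Notation Ry := (`]0%R, +oo[%classic : set R).
Variables (O : set X) (Sg : R -> X -> X -> R) (D : X -> R) (C1 T : R).
Hypothesis mO : measurable O.
Hypothesis mSg : measurable_fun setT (fun p : measurableTypeR R * X * X => Sg p.1.1 p.1.2 p.2).
Hypothesis Sg0 : forall r x y, 0 <= Sg r x y.
Hypothesis Sgsym : forall r x y, Sg r x y = Sg r y x.
Hypothesis mD : measurable_fun O D.
Hypothesis D0 : forall x, O x -> 0 < D x.
Hypothesis hSg : forall x, O x ->
  (\int[la]_(r in Ry) \int[mu]_(y in O) (Sg r x y * D y)%:E <= (C1 * D x)%:E)%E.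
Hypothesis T0 : 0 < T.

Notation JT := (`]0%R, T[%classic : set R).
Notation cyl := (JT `*` O : set (measurableTypeR R * X)).

Let mJT : measurable JT. Proof. exact: measurable_itv. Qed.
Let mRy : measurable Ry. Proof. exact: measurable_itv. Qed.
Let mcyl : measurable cyl. Proof. exact: measurableX. Qed.

Section kernel.
Variables (kap : R -> R -> R) (Ck : R).
Hypothesis mkap : measurable_fun setT (fun p : measurableTypeR R * measurableTypeR R => kap p.1 p.2).
Hypothesis kap_r : forall r t, r <= 0 -> kap r t = 0.
Hypothesis kap_t : forall r t, t <= 0 -> kap r t = 0.
Hypothesis Ck0 : 0 <= Ck.
Hypothesis hkap : forall r, 0 < r -> (\int[la]_(t in JT) `|kap r t|%:E <= Ck%:E)%E.

(** The integral runs over the whole line because [kap] vanishes for r <= 0. *)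
Definition subordinated (t : R) (x y : X) : R := \int[la]_r (kap r t * Sg r x y).

Lemma measurable_subordinated_integrand d' (W : measurableType d') (r t : W -> R) (x y : W -> X) :
  measurable_fun setT (r : W -> measurableTypeR R) -> measurable_fun setT (t : W -> measurableTypeR R) ->
  measurable_fun setT x -> measurable_fun setT y ->
  measurable_fun setT (fun w => kap (r w) (t w) * Sg (r w) (x w) (y w)).
Proof.
move=> mr mt mx my; apply: measurable_funM.
  by apply: (measurableT_comp mkap (g := fun w => (r w, t w))); exact: measurable_fun_pair.
apply: (measurableT_comp mSg (g := fun w => (r w, x w, y w))).
by apply: measurable_fun_pair => //; exact: measurable_fun_pair.
Qed.

Lemma measurable_subordinated d' (W : measurableType d') (t : W -> R) (x y : W -> X) :
  measurable_fun setT (t : W -> measurableTypeR R) ->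
  measurable_fun setT x -> measurable_fun setT y ->
  measurable_fun setT (fun w => subordinated (t w) (x w) (y w)).
Proof.
move=> mt mx my.
apply: (measurable_Rintegral la (g := fun q : W * measurableTypeR R =>
  kap q.2 (t q.1) * Sg q.2 (x q.1) (y q.1))).
by apply: (measurable_subordinated_integrand (r := fun q : W * measurableTypeR R => q.2)
  (t := fun q => t q.1) (x := fun q => x q.1) (y := fun q => y q.1));
  [exact: measurable_snd|exact: measurableT_comp mt measurable_fst|
   exact: measurableT_comp mx measurable_fst|exact: measurableT_comp my measurable_fst].
Qed.

Lemma subordinated_sym t x y : subordinated t x y = subordinated t y x.
Proof. by apply: eq_Rintegral => r _; rewrite Sgsym. Qed.

Lemma subordinated_le0 t x y : t <= 0 -> subordinated t x y = 0.
Proof.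
by move=> t0; rewrite -[RHS](Rintegral0 la setT); apply: eq_Rintegral => r _; rewrite kap_t// mul0r.
Qed.

(** The times s t + b stay below T, and the nonpositive ones contribute nothing. The cases
    of interest are t, t - tau and tau - t, for the two variables of a convolution. *)
Lemma kap_shift r (s b : R) : `|s| = 1 -> (forall t, JT t -> s * t + b < T) -> 0 < r ->
  (\int[la]_(t in JT) `|kap r (s * t + b)|%:E <= Ck%:E)%E.
Proof.
move=> s1 sb r0; have s0 : s != 0 by rewrite -normr_gt0 s1.
pose h : R -> \bar R := (fun t => `|kap r t|%:E) \_ JT.
have mk1 : measurable_fun setT (fun t : R => `|kap r t|%:E).
  apply/measurable_EFinP; apply: measurableT_comp => //.
  apply: (measurableT_comp mkap (g := fun t : measurableTypeR R => ((r : measurableTypeR R), t))).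
  by apply: measurable_fun_pair => //; exact: measurable_cst.
have mh : measurable_fun setT h.
  by apply/(measurable_restrictT _ _).1 => //; exact: measurable_funTS.
have h0 t : (0 <= h t)%E by apply: erestrict_ge0.
have := hkap r0; apply: le_trans; rewrite [leRHS]integral_mkcond.
rewrite [leRHS](ge0_integral_affine b s0 mh h0) s1 mul1e integral_mkcond.
apply: le_integral_any => t _; first by apply: erestrict_ge0.
rewrite patchE; case: ifPn => [/[!inE] tJ|_]; last exact: h0.
have [st0|st0] := leP (s * t + b) 0; first by rewrite kap_t// normr0.
by rewrite /h patchE mem_set//= in_itv/= st0 sb.
Qed.

Section weighted.
Variables (s b : R) (y : X).
Hypotheses (s1 : `|s| = 1) (sb : forall t, JT t -> s * t + b < T) (Oy : O y).

Let I (p : measurableTypeR R * X) (r : R) := kap r (s * p.1 + b) * Sg r p.2 y.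

Let mI : measurable_fun setT (fun q : (measurableTypeR R * X) * measurableTypeR R => I q.1 q.2).
Proof.
apply: (measurable_subordinated_integrand
  (r := fun q : (measurableTypeR R * X) * measurableTypeR R => q.2)
  (t := fun q => s * q.1.1 + b) (x := fun q => q.1.2) (y := fun=> y)).
- exact: measurable_snd.
- apply: measurable_funD; last exact: measurable_cst.
  apply: measurable_funM; first exact: measurable_cst.
  exact: measurableT_comp measurable_fst measurable_fst.
- exact: measurableT_comp measurable_snd measurable_fst.
- exact: measurable_cst.
Qed.

Let mF : measurable_fun (cyl `*` setT : set ((measurableTypeR R * X) * measurableTypeR R))
  (fun q => (`|I q.1 q.2| * D q.1.2)%:E).
Proof.
apply/measurable_EFinP; apply: measurable_funM.
  by apply: measurableT_comp => //; exact: measurable_funTS mI.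
apply: (measurable_comp (F := O) (f := D)) => //; first by move=> _ [[[t x] r] [[_ h] _] <-].
by apply: measurable_funTS; exact: measurableT_comp measurable_snd measurable_fst.
Qed.

(** Integrate first in time, which leaves the constant Ck, then in r and x with the
    estimate on the heat kernel. *)
Lemma subordinated_integrand_bound :
  (\int[nu]_(p in cyl) \int[la]_r (`|kap r (s * p.1 + b) * Sg r p.2 y| * D p.2)%:E
   <= (Ck * C1 * D y)%:E)%E.
Proof.
have F0 p r : cyl p -> setT r -> (0 <= (`|I p r| * D p.2)%:E)%E.
  by move=> [_ /= Op] _; rewrite lee_fin mulr_ge0// ltW// D0.
rewrite (tonelliD (sigma_finite_prod la mu) la mcyl measurableT (g := fun p r => (`|I p r| * D p.2)%:E) mF F0).
pose J r : \bar R := (\int[mu]_(x in O) (Sg r y x * D x)%:E)%E.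
have J0 r : (0 <= J r)%E.
  by apply: integral_ge0 => x Ox; rewrite lee_fin mulr_ge0// ltW// D0.
have mSy r : measurable_fun O (fun x => Sg r y x).
  apply: measurable_funTS.
  apply: (measurableT_comp mSg (g := fun x : X => ((r : measurableTypeR R), y, x))).
  by apply: measurable_fun_pair => //; exact: measurable_cst.
have e r : (\int[nu]_(p in cyl) (`|I p r| * D p.2)%:E =
    (\int[la]_(t in JT) `|kap r (s * t + b)|%:E) * J r)%E.
  rewrite (tonelli_prod la mu mJT mO).
  - rewrite -ge0_integralZr//.
    + apply: eq_integral => t _ /=.
      rewrite -ge0_integralZl//.
      * apply: eq_integral => x _ /=.
        by rewrite -EFinM /I/= normrM (ger0_norm (Sg0 _ _ _)) Sgsym mulrA.
      * by apply/measurable_EFinP; apply: measurable_funM.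
      * by move=> x Ox; rewrite lee_fin mulr_ge0// ltW// D0.
    + apply/measurable_EFinP; apply: measurableT_comp => //; apply: measurable_funTS.
      apply: (measurableT_comp mkap (g := fun t : measurableTypeR R =>
        ((r : measurableTypeR R), (s * t + b : measurableTypeR R)))).
      apply: measurable_fun_pair; first exact: measurable_cst.
      by apply: measurable_funD => //; exact: measurable_funM.
  - apply/measurable_EFinP; apply: measurable_funM.
      apply: measurableT_comp => //; apply: measurable_funTS.
      apply: (measurableT_comp mI (g := fun p : measurableTypeR R * X => (p, (r : measurableTypeR R)))).
      by apply: measurable_fun_pair => //; exact: measurable_cst.
    apply: (measurable_comp (F := O) (f := D)) => //; first by move=> _ [[t x] [_ h] <-].
    by apply: measurable_funTS; exact: measurable_snd.
  - by move=> p pc; exact: F0.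
apply: (@le_trans _ _ (\int[la]_(r in Ry) (Ck%:E * J r))%E).
  rewrite [leRHS]integral_mkcond; apply: le_integral_any => r _.
    by apply: integral_ge0 => p pc; exact: F0.
  rewrite e patchE; case: ifPn => [/[!inE] /Ry_gt0 r0|].
    by rewrite lee_wpmul2r// kap_shift.
  rewrite notin_setE/= in_itv/= andbT => /negP; rewrite -leNgt => r0.
  by rewrite integral0_eq ?mul0e// => t _; rewrite kap_r// normr0.
rewrite ge0_integralZl//.
- by rewrite -mulrA EFinM lee_wpmul2l// hSg.
- apply: (measurable_ge0_integralD mu mRy mO (g := fun r x => (Sg r y x * D x)%:E)).
    apply/measurable_EFinP; apply: measurable_funM.
      apply: measurable_funTS.
      apply: (measurableT_comp mSg (g := fun q : measurableTypeR R * X => (q.1, y, q.2))).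
      by apply: measurable_fun_pair => //; apply: measurable_fun_pair.
    apply: (measurable_comp (F := O) (f := D)) => //; first by move=> _ [[t x] [_ h] <-].
    by apply: measurable_funTS; exact: measurable_snd.
  by move=> r x _ Ox; rewrite lee_fin mulr_ge0// ltW// D0.
Qed.

Lemma subordinated_bound (Phi : measurableTypeR R * X -> R) M : 0 <= M ->
  (forall p, cyl p -> `|Phi p| <= M * D p.2) ->
  (\int[nu]_(p in cyl) `|(subordinated (s * p.1 + b) p.2 y * Phi p)%:E|
   <= (M * (Ck * C1) * D y)%:E)%E.
Proof.
move=> M0 hPhi.
apply: (@le_trans _ _ (M%:E * \int[nu]_(p in cyl) \int[la]_r
   (`|kap r (s * p.1 + b) * Sg r p.2 y| * D p.2)%:E)%E); last first.
  by rewrite -mulrA EFinM lee_wpmul2l ?subordinated_integrand_bound.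
have F0 p r : cyl p -> setT r -> (0 <= (`|I p r| * D p.2)%:E)%E.
  by move=> [_ /= Op] _; rewrite lee_fin mulr_ge0// ltW// D0.
rewrite -ge0_integralZl//; last 2 first.
- exact: (measurable_ge0_integralD la mcyl measurableT (g := fun p r => (`|I p r| * D p.2)%:E)).
- by move=> p pc; apply: integral_ge0 => r _; exact: F0.
apply: le_integral_any => // p pc.
have mIp : measurable_fun setT (I p).
  apply: (measurableT_comp mI (g := fun r : measurableTypeR R => (p, r))).
  by apply: measurable_fun_pair => //; exact: measurable_cst.
have Dp : 0 <= D p.2 by rewrite ltW// D0//; case: pc.
have -> : (\int[la]_r (`|kap r (s * p.1 + b) * Sg r p.2 y| * D p.2)%:E =
    (\int[la]_r `|I p r|%:E) * (D p.2)%:E)%E.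
  rewrite -ge0_integralZr//.
  by apply/measurable_EFinP; exact: measurableT_comp.
rewrite [leLHS](_ : _ = (`|(subordinated (s * p.1 + b) p.2 y)%:E| * `|Phi p|%:E)%E); last first.
  by rewrite abse_EFin -EFinM normrM.
rewrite muleCA; apply: lee_pmul => //.
  exact: abse_Rintegral_le.
by rewrite -EFinM lee_fin hPhi.
Qed.

End weighted.

(** The Duhamel integral over (0,t), written over the whole cylinder since the kernel
    vanishes at nonpositive times. *)
Definition potential (t : R) (y : X) (F : measurableTypeR R * X -> R) : R :=
  \int[nu]_(p in cyl) (subordinated (t - p.1) y p.2 * F p).

Lemma potential_iterated t y F : t <= T ->
  nu.-integrable cyl (EFin \o (fun p => subordinated (t - p.1) y p.2 * F p)) ->
  \int[la]_(tau in `]0, t[) \int[mu]_(x in O) (subordinated (t - tau) y x * F (tau, x)) = potential t y F.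
Proof.
move=> tT iF; rewrite /potential (Rintegral_prod (m1 := la) (m2 := mu) mJT mO iF)/=.
rewrite Rintegral_mkcond [RHS]Rintegral_mkcond; apply: eq_Rintegral => r _.
rewrite !patchE; have [rt|rt] := ltP r t.
  suff -> : (r \in `]0, t[%classic) = (r \in JT) by [].
  by apply/idP/idP; rewrite !inE/= !in_itv/= rt (lt_le_trans rt tT).
rewrite memNset/= ?in_itv/=; last by apply/negP; rewrite negb_and -!leNgt rt orbT.
case: ifP => // _; rewrite -[LHS](Rintegral0 mu O); apply: eq_Rintegral => x _.
by rewrite subordinated_le0 ?mul0r// subr_le0.
Qed.

Variables (M : R) (F : measurableTypeR R * X -> R).
Hypotheses (M0 : 0 <= M) (mF : measurable_fun cyl F).
Hypothesis hF : forall p, cyl p -> `|F p| <= M * D p.2.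

Lemma potential_integrable t y : t <= T -> O y ->
  nu.-integrable cyl (EFin \o (fun p => subordinated (t - p.1) y p.2 * F p)).
Proof.
move=> tT Oy; apply/integrableP; split.
  apply/measurable_EFinP; apply: measurable_funM => //; apply: measurable_funTS.
  by apply: measurable_subordinated => //; apply: measurable_funB => //; exact: measurable_fst.
have n1 : `|-1 : R| = 1 by rewrite normrN1.
have sb r : JT r -> -1 * r + t < T by rewrite /= in_itv/= => /andP[r0 rT]; lra.
have := subordinated_bound n1 sb Oy M0 hF; set I := (X in (X <= _)%E -> _) => hI.
suff -> : (\int[nu]_(p in cyl) `|(subordinated (t - p.1) y p.2 * F p)%:E|)%E = I.
  by apply: le_lt_trans hI _; rewrite ltry.
apply: eq_integral => p _ /=; rewrite subordinated_sym.
by have -> : t - p.1 = -1 * p.1 + t by ring.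
Qed.

Notation spectral t y := (fun w : (measurableTypeR R * X) * measurableTypeR R =>
  kap w.2 (t - w.1.1) * (Sg w.2 y w.1.2 * F w.1)).

Lemma measurable_spectral t y : measurable_fun (cyl `*` setT) (spectral t y).
Proof.
have m1 : measurable_fun setT (fun w : (measurableTypeR R * X) * measurableTypeR R =>
    kap w.2 (t - w.1.1) * Sg w.2 y w.1.2).
  apply: (measurable_subordinated_integrand
    (r := fun w : (measurableTypeR R * X) * measurableTypeR R => w.2)
    (t := fun w => t - w.1.1) (x := fun=> y) (y := fun w => w.1.2)).
  - exact: measurable_snd.
  - apply: measurable_funB; first exact: measurable_cst.
    exact: measurableT_comp measurable_fst measurable_fst.
  - exact: measurable_cst.
  - exact: measurableT_comp measurable_snd measurable_fst.
have m2 : measurable_fun (cyl `*` setT : set ((measurableTypeR R * X) * measurableTypeR R))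
    (fun w => F w.1).
  apply: (measurable_comp (F := cyl) (f := F)) => //; first by move=> _ [[p r] [h _] <-].
  by apply: measurable_funTS; exact: measurable_fst.
have := measurable_funM (measurable_funTS m1) m2.
by apply: eq_measurable_fun => w _ /=; rewrite mulrA.
Qed.

Lemma spectral_bound t y : t <= T -> O y ->
  (\int[nu]_(p in cyl) \int[la]_r `|(spectral t y (p, r))%:E| <= (M * (Ck * C1 * D y))%:E)%E.
Proof.
move=> tT Oy.
have n1 : `|-1 : R| = 1 by rewrite normrN1.
have sb r : JT r -> -1 * r + t < T by rewrite /= in_itv/= => /andP[r0 rT]; lra.
have hI := subordinated_integrand_bound n1 sb Oy.
have F0 (p : measurableTypeR R * X) (r : measurableTypeR R) : cyl p -> setT r -> (0 <= (`|kap r (-1 * p.1 + t) * Sg r p.2 y| * D p.2)%:E)%E.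
  by move=> [_ /= Op] _; rewrite lee_fin mulr_ge0// ltW// D0.
apply: (@le_trans _ _ (M%:E * \int[nu]_(p in cyl) \int[la]_r
   (`|kap r (-1 * p.1 + t) * Sg r p.2 y| * D p.2)%:E)%E); last first.
  by rewrite EFinM lee_wpmul2l.
have mI : measurable_fun (cyl `*` setT : set ((measurableTypeR R * X) * measurableTypeR R))
    (fun w => (`|kap w.2 (-1 * w.1.1 + t) * Sg w.2 w.1.2 y| * D w.1.2)%:E).
  apply/measurable_EFinP; apply: measurable_funM.
    apply: measurableT_comp => //; apply: measurable_funTS.
    apply: (measurable_subordinated_integrand
      (r := fun w : (measurableTypeR R * X) * measurableTypeR R => w.2)
      (t := fun w => -1 * w.1.1 + t) (x := fun w => w.1.2) (y := fun=> y)).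
    - exact: measurable_snd.
    - apply: measurable_funD; last exact: measurable_cst.
      apply: measurable_funM; first exact: measurable_cst.
      exact: measurableT_comp measurable_fst measurable_fst.
    - exact: measurableT_comp measurable_snd measurable_fst.
    - exact: measurable_cst.
  apply: (measurable_comp (F := O) (f := D)) => //; first by move=> _ [[[s x] r] [[_ h] _] <-].
  by apply: measurable_funTS; exact: measurableT_comp measurable_snd measurable_fst.
rewrite -ge0_integralZl//; last 2 first.
- exact: (@measurable_ge0_integralD _ _ (measurableTypeR R * X)%type (measurableTypeR R) R la
    cyl setT (fun p r => (`|kap r (-1 * p.1 + t) * Sg r p.2 y| * D p.2)%:E) mcyl measurableT mI F0).
- by move=> p pc; apply: integral_ge0 => r _; exact: F0.
apply: le_integral_any => p pc; first exact: integral_ge0.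
rewrite -ge0_integralZl//; last 2 first.
- apply: (measurableT_comp (f := fun w : (measurableTypeR R * X) * measurableTypeR R =>
    (`|kap w.2 (-1 * p.1 + t) * Sg w.2 p.2 y| * D p.2)%:E)
    (g := fun r : measurableTypeR R => (p, r))); last first.
    by apply: measurable_fun_pair => //; exact: measurable_cst.
  apply/measurable_EFinP; apply: measurable_funM; last exact: measurable_cst.
  apply: measurableT_comp => //.
  apply: (measurable_subordinated_integrand
    (r := fun w : (measurableTypeR R * X) * measurableTypeR R => w.2)
    (t := fun=> -1 * p.1 + t) (x := fun=> p.2) (y := fun=> y)).
  + exact: measurable_snd.
  + exact: measurable_cst.
  + exact: measurable_cst.
  + exact: measurable_cst.
- by move=> r _; exact: F0.
apply: le_integral_any => // r _; rewrite -EFinM lee_fin /= Sgsym.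
have -> : -1 * p.1 + t = t - p.1 by ring.
rewrite mulrA normrM [leRHS]mulrCA; apply: ler_wpM2l => //; exact: hF.
Qed.

(** The integral over r is brought outside, so that the time variable enters through
    [kap] only. *)
Lemma potential_spectral t y : t <= T -> O y ->
  potential t y F = \int[(nu \x la)%E]_(w in cyl `*` setT) spectral t y w.
Proof.
move=> tT Oy.
have mJ := measurable_spectral t y.
have foo := le_lt_trans (spectral_bound tT Oy) (ltry _).
have iJ := integrable_prod (m1 := sigma_finite_prod la mu) (m2 := la) mcyl measurableT mJ foo.
rewrite (Rintegral_prod (m1 := sigma_finite_prod la mu) (m2 := la) mcyl measurableT iJ)/=.
apply: eq_Rintegral => p pc; rewrite mulrC /subordinated -Rintegral_mull//.
  by apply: eq_Rintegral => r _; ring.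
apply: (measurable_subordinated_integrand
  (r := id : measurableTypeR R -> R) (t := fun=> t - p.1) (x := fun=> y) (y := fun=> p.2)) => //.
Qed.

Notation Fr := (fun p : measurableTypeR R * X => F (T - p.1, p.2)).

Let mFr : measurable_fun cyl Fr.
Proof. exact: measurable_cylinder_reflect. Qed.

Let hFr p : cyl p -> `|Fr p| <= M * D p.2.
Proof.
move: p => [t x] [/= + Ox]; rewrite in_itv/= => /andP[t0 tT]; apply: hF; split => //=.
by rewrite in_itv/= subr_gt0 tT gtrBl.
Qed.

(** The symmetry of the kernel turns the transposed operator, applied to the test function
    reversed in time, into a Duhamel potential. *)
Lemma subordinated_reflect t x : t <= T -> O x ->
  \int[nu]_(p in cyl) (subordinated (p.1 - (T - t)) p.2 x * Fr p) = potential t x F.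
Proof.
move=> tT Ox; have := Rintegral_cylinder_reflect mO _ (potential_integrable tT Ox).
rewrite /potential => <-.
  apply: eq_Rintegral => p _ /=; rewrite subordinated_sym.
  by have -> : t - (T - p.1) = p.1 - (T - t) by ring.
by have /measurable_EFinP := measurable_int _ (potential_integrable tT Ox).
Qed.

Section initial.
Variable g : X -> R.
Hypotheses (mg : measurable_fun O g) (ig : mu.-integrable O (EFin \o (fun x => g x * D x))).

Let mk : measurable_fun (cyl `*` O) (fun p => subordinated p.1.1 p.1.2 p.2).
Proof.
apply: measurable_funTS; apply: (measurable_subordinated (t := fun p : measurableTypeR R * X * X => p.1.1)).
- exact: measurableT_comp measurable_fst measurable_fst.
- exact: measurableT_comp measurable_snd measurable_fst.
- exact: measurable_snd.
Qed.

Let bE (Phi : measurableTypeR R * X -> R) : (forall p, cyl p -> `|Phi p| <= M * D p.2) ->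
  forall y, O y -> (\int[nu]_(p in cyl) `|(subordinated p.1 p.2 y * Phi p)%:E| <= (M * (Ck * C1) * D y)%:E)%E.
Proof.
move=> hPhi y Oy.
have sb r : JT r -> 1 * r + 0 < T by rewrite /= in_itv/= => /andP[r0 rT]; lra.
have := subordinated_bound (@normr1 R) sb Oy M0 hPhi.
by under eq_integral do rewrite mul1r addr0.
Qed.

Let iE : mu.-integrable O (EFin \o (fun y => g y * (M * (Ck * C1) * D y))).
Proof.
have := integrableZR (M * (Ck * C1)) mO ig; apply: eq_integrable => // y _ /=.
by congr (_%:E); ring.
Qed.

Lemma initial_integrable :
  nu.-integrable cyl (EFin \o (fun p => (\int[mu]_(y in O) (subordinated p.1 p.2 y * g y)) * F p)).
Proof.
exact: (duality_integrable_l (mP := sigma_finite_prod la mu) (mQ := mu)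
  (k := fun p y => subordinated p.1 p.2 y) mcyl mO mk mg mF (bE hF) iE).
Qed.

Lemma initial_duality :
  \int[nu]_(p in cyl) ((\int[mu]_(y in O) (subordinated p.1 p.2 y * g y)) * Fr p) =
  \int[mu]_(y in O) (g y * potential T y F).
Proof.
rewrite (duality_eq (mP := sigma_finite_prod la mu) (mQ := mu)
  (k := fun p y => subordinated p.1 p.2 y) mcyl mO mk mg mFr (bE hFr) iE).
apply: eq_Rintegral => y /[!inE] Oy; rewrite -(subordinated_reflect (lexx T) Oy).
congr (_ * _); apply: eq_Rintegral => p _.
by have -> : p.1 - (T - T) = p.1 by ring.
Qed.

End initial.

Section source.
Variable g : measurableTypeR R * X -> R.
Hypotheses (mg : measurable_fun cyl g).
Hypothesis ig : nu.-integrable cyl (EFin \o (fun p => g p * D p.2)).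

Let mk : measurable_fun (cyl `*` cyl) (fun w => subordinated (w.1.1 - w.2.1) w.1.2 w.2.2).
Proof.
apply: measurable_funTS.
apply: (measurable_subordinated (t := fun w : (measurableTypeR R * X) * (measurableTypeR R * X) => w.1.1 - w.2.1)).
- apply: measurable_funB; first exact: measurableT_comp measurable_fst measurable_fst.
  exact: measurableT_comp measurable_fst measurable_snd.
- exact: measurableT_comp measurable_snd measurable_fst.
- exact: measurableT_comp measurable_snd measurable_snd.
Qed.

Let bE (Phi : measurableTypeR R * X -> R) N : 0 <= N -> (forall p, cyl p -> `|Phi p| <= N * D p.2) ->
  forall q, cyl q -> (\int[nu]_(p in cyl) `|(subordinated (p.1 - q.1) p.2 q.2 * Phi p)%:E|
    <= (N * (Ck * C1) * D q.2)%:E)%E.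
Proof.
move=> N0 hPhi [t y] [/= + Oy]; rewrite in_itv/= => /andP[t0 tT].
have sb r : JT r -> 1 * r + - t < T by rewrite /= in_itv/= => /andP[r0 rT]; lra.
have := subordinated_bound (@normr1 R) sb Oy N0 hPhi.
by under eq_integral do rewrite mul1r.
Qed.

Let iE N : nu.-integrable cyl (EFin \o (fun q => g q * (N * (Ck * C1) * D q.2))).
Proof.
have := integrableZR (N * (Ck * C1)) mcyl ig; apply: eq_integrable => // y _ /=.
by congr (_%:E); ring.
Qed.

Lemma source_integrable :
  nu.-integrable cyl (EFin \o (fun p => potential p.1 p.2 g * F p)).
Proof.
exact: (duality_integrable_l (mP := sigma_finite_prod la mu) (mQ := sigma_finite_prod la mu)
  (k := fun p q => subordinated (p.1 - q.1) p.2 q.2) mcyl mcyl mk mg mF (bE M0 hF) (iE _)).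
Qed.

Let e2 q : cyl q -> \int[nu]_(p in cyl) (subordinated (p.1 - q.1) p.2 q.2 * Fr p) = potential (T - q.1) q.2 F.
Proof.
move: q => [t y] [/= + Oy]; rewrite in_itv/= => /andP[t0 tT].
have tT' : T - t <= T by rewrite gerBl ltW.
rewrite -(subordinated_reflect tT' Oy); apply: eq_Rintegral => p _.
by have -> : T - (T - t) = t by ring.
Qed.

Lemma source_integrable_dual :
  nu.-integrable cyl (EFin \o (fun q => g q * potential (T - q.1) q.2 F)).
Proof.
have := (duality_integrable_r (mP := sigma_finite_prod la mu) (mQ := sigma_finite_prod la mu)
  (k := fun p q => subordinated (p.1 - q.1) p.2 q.2) mcyl mcyl mk mg mFr (bE M0 hFr) (iE _)).
by apply: eq_integrable => // q /[!inE] cq /=; rewrite e2.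
Qed.

Lemma source_duality :
  \int[nu]_(p in cyl) (potential p.1 p.2 g * Fr p) =
  \int[nu]_(q in cyl) (g q * potential (T - q.1) q.2 F).
Proof.
rewrite (duality_eq (mP := sigma_finite_prod la mu) (mQ := sigma_finite_prod la mu)
  (k := fun p q => subordinated (p.1 - q.1) p.2 q.2) mcyl mcyl mk mg mFr (bE M0 hFr) (iE _)).
by apply: eq_Rintegral => q /[!inE] cq; rewrite e2.
Qed.

(** Only almost everywhere, as the source is merely integrable. *)
Lemma source_iterated : {ae nu, forall p, cyl p ->
  \int[la]_(tau in `]0, p.1[) \int[mu]_(x in O) (subordinated (p.1 - tau) p.2 x * g (tau, x))
  = potential p.1 p.2 g}.
Proof.
have mD2 : measurable_fun cyl (fun p => D p.2).
  apply: (measurable_comp (F := O) (f := D)) => //; first by move=> _ [[t x] [_ h] <-].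
  by apply: measurable_funTS; exact: measurable_snd.
have hD p : cyl p -> `|D p.2| <= 1 * D p.2.
  by move=> [_ /= /D0 h]; rewrite mul1r ger0_norm// ltW.
have := (duality_section (mP := sigma_finite_prod la mu) (mQ := sigma_finite_prod la mu)
  (k := fun p q => subordinated (p.1 - q.1) p.2 q.2) mcyl mcyl mk mg mD2 (bE ler01 hD) (iE _)).
apply: filterS => -[t x] h ctx.
apply: potential_iterated; first by case: ctx => /=; rewrite in_itv/= => /andP[_ /ltW].
by apply: h => //; rewrite gt_eqF// D0//; case: ctx.
Qed.

End source.

End kernel.

Section riemann_liouville.
Variables (kp kq : R -> R -> R) (Cp Cq al c : R).
Hypothesis mkp : measurable_fun setT (fun p : measurableTypeR R * measurableTypeR R => kp p.1 p.2).
Hypothesis mkq : measurable_fun setT (fun p : measurableTypeR R * measurableTypeR R => kq p.1 p.2).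
Hypothesis kp_r : forall r t, r <= 0 -> kp r t = 0.
Hypothesis kq_r : forall r t, r <= 0 -> kq r t = 0.
Hypothesis kp_t : forall r t, t <= 0 -> kp r t = 0.
Hypothesis kq_t : forall r t, t <= 0 -> kq r t = 0.
Hypothesis Cp0 : 0 <= Cp.
Hypothesis Cq0 : 0 <= Cq.
Hypothesis hkp : forall r, 0 < r -> (\int[la]_(t in JT) `|kp r t|%:E <= Cp%:E)%E.
Hypothesis hkq : forall r, 0 < r -> (\int[la]_(t in JT) `|kq r t|%:E <= Cq%:E)%E.
Hypothesis al01 : 0 < al < 1.
Hypothesis conv : forall r t, 0 < r -> 0 < t ->
  \int[la]_(xi in `]0, t[) ((t - xi) `^ (- al) * kp r xi) = c * kq r t.
Variables (M : R) (F : measurableTypeR R * X -> R).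
Hypotheses (M0 : 0 <= M) (mF : measurable_fun cyl F).
Hypothesis hF : forall p, cyl p -> `|F p| <= M * D p.2.

Let mw : measurable_fun JT (fun xi : R => (T - xi) `^ (- al)).
Proof.
apply: measurable_funTS.
apply: (measurableT_comp (f := fun u : R => u `^ (- al)) (g := fun xi : R => T - xi)).
  exact: measurable_powR.
exact: measurable_funB.
Qed.

Let iw : la.-integrable JT (EFin \o (fun xi : R => (T - xi) `^ (- al))).
Proof.
have [a0 a1] := andP al01.
have b0 : 0 < 1 - al by rewrite subr_gt0.
apply/integrableP; split; first exact/measurable_EFinP.
have m0 : measurable_fun JT (fun xi : R => xi `^ (- al)).
  by apply: measurable_funTS; exact: measurable_powR.
have h : (\int[la]_(xi in JT) `|(xi `^ (- al))%:E| < +oo)%E.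
  have := integral_powR0 b0 T0; have -> : 1 - al - 1 = - al by ring.
  move=> e; apply: (@le_lt_trans _ _ (\int[la]_(u in `]0%R, T]) (u `^ (- al))%:E)%E).
    under eq_integral do rewrite gee0_abs ?lee_fin ?powR_ge0//.
    apply: ge0_subset_integral => //.
    - by apply/measurable_EFinP; apply: measurable_funTS; exact: measurable_powR.
    - by move=> u _; rewrite lee_fin powR_ge0.
    - by apply: subset_itvl; rewrite bnd_simp.
  by rewrite e ltry.
apply: le_lt_trans h.
rewrite [leRHS]integral_mkcond (@ge0_integral_affine _ (-1) T)//; last 2 first.
- by apply/(measurable_restrictT _ _).1 => //; apply: measurableT_comp => //; exact/measurable_EFinP.
- by move=> t; exact: erestrict_ge0.
rewrite normrN1 mul1e integral_mkcond; apply: le_integral_any => t _.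
  exact: erestrict_ge0.
have E : -1 * t + T = T - t by ring.
rewrite E !patchE; suff -> : (t \in JT) = (T - t \in JT) by [].
by apply/idP/idP; rewrite !inE/= !in_itv/= => /andP[a b]; apply/andP; split; lra.
Qed.

Lemma conv_shift r tau : JT tau ->
  \int[la]_(xi in JT) (kp r (xi - tau) * (T - xi) `^ (- al)) = c * kq r (T - tau).
Proof.
rewrite /= in_itv/= => /andP[tau0 tauT].
have [r0|r0] := leP r 0.
  rewrite kq_r// mulr0 -[RHS](Rintegral0 la JT); apply: eq_Rintegral => xi _.
  by rewrite kp_r// mul0r.
rewrite -conv ?subr_gt0// [LHS]Rintegral_mkcond [LHS](@Rintegral_affine _ 1 tau) ?oner_neq0//; last first.
  apply/(measurable_restrictT _ _).1 => //; apply: measurable_funM => //.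
  apply: measurable_funTS.
  apply: (measurableT_comp mkp (g := fun xi : measurableTypeR R =>
    ((r : measurableTypeR R), (xi - tau : measurableTypeR R)))).
  by apply: measurable_fun_pair; [exact: measurable_cst|exact: measurable_funB].
rewrite normr1 mul1r [RHS]Rintegral_mkcond; apply: eq_Rintegral => xi _.
have -> : 1 * xi + tau = xi + tau by ring.
rewrite !patchE addrK; have -> : T - (xi + tau) = T - tau - xi by ring.
have [x0|x0] := leP xi 0.
  by rewrite kp_t// mul0r mulr0 !if_same.
have -> : (xi + tau \in JT) = (xi \in `]0, (T - tau)[%classic).
  by apply/idP/idP; rewrite !inE/= !in_itv/= => /andP[a b]; apply/andP; split; lra.
by case: ifP => // _; rewrite mulrC.
Qed.

(** The fractional integral in time acts on the density [kp] alone, and transforms it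
    into [kq]. *)
Lemma potential_riemann_liouville y : O y ->
  \int[la]_(xi in JT) ((T - xi) `^ (- al) * potential kp xi y F) = c * potential kq T y F.
Proof.
move=> Oy.
pose B := (cyl `*` setT : set ((measurableTypeR R * X) * measurableTypeR R)).
have mB : measurable B by exact: measurableX.
pose k (w : (measurableTypeR R * X) * measurableTypeR R) (xi : R) : R := kp w.2 (xi - w.1.1).
pose Phi (w : (measurableTypeR R * X) * measurableTypeR R) : R := Sg w.2 y w.1.2 * F w.1.
have mk : measurable_fun (B `*` JT) (fun p => k p.1 p.2).
  apply: measurable_funTS.
  apply: (measurableT_comp mkp (g := fun p : ((measurableTypeR R * X) * measurableTypeR R) * measurableTypeR R =>
    (p.1.2, (p.2 - p.1.1.1 : measurableTypeR R)))).
  apply: measurable_fun_pair; first exact: measurableT_comp measurable_snd measurable_fst.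
  apply: measurable_funB; first exact: measurable_snd.
  apply: measurableT_comp measurable_fst _; exact: measurableT_comp measurable_fst measurable_fst.
have mPhi : measurable_fun B Phi.
  apply: measurable_funM.
    apply: measurable_funTS; apply: (measurableT_comp mSg
      (g := fun w : (measurableTypeR R * X) * measurableTypeR R => (w.2, y, w.1.2))).
    apply: measurable_fun_pair.
      by apply: measurable_fun_pair; [exact: measurable_snd|exact: measurable_cst].
    exact: measurableT_comp measurable_snd measurable_fst.
  apply: (measurable_comp (F := cyl) (f := F)) => //; first by move=> _ [[p r] [h _] <-].
  by apply: measurable_funTS; exact: measurable_fst.
pose E := M * (Cp * C1 * D y).
have bE xi : JT xi -> (\int[(nu \x la)%E]_(w in B) `|(k w xi * Phi w)%:E| <= E%:E)%E.
  rewrite /= in_itv/= => /andP[x0 /ltW xT].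
  have ms := measurable_spectral mkp mF xi y.
  rewrite (tonelli_prod (sigma_finite_prod la mu) la mcyl measurableT (F := fun w => `|(k w xi * Phi w)%:E|)%E).
  - exact: (spectral_bound mkp kp_r kp_t Cp0 hkp M0 hF xT Oy).
  - by apply: measurableT_comp => //; exact/measurable_EFinP.
  - by move=> w _; exact: abse_ge0.
have iE : la.-integrable JT (EFin \o (fun xi : R => (T - xi) `^ (- al) * E)).
  by have := integrableZR (m := la) E mJT iw; apply: eq_integrable => // xi _ /=; rewrite mulrC.
have := duality_eq (mP := sigma_finite_prod (sigma_finite_prod la mu) la) (mQ := la) mB mJT mk mw mPhi bE iE.
move=> e; transitivity (\int[la]_(xi in JT) ((T - xi) `^ (- al) *
    \int[(nu \x la)%E]_(w in B) (k w xi * Phi w))).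
  apply: eq_Rintegral => xi; rewrite inE/= in_itv/= => /andP[x0 /ltW xT].
  by congr (_ * _); apply: (potential_spectral mkp kp_r kp_t Cp0 hkp M0 mF hF).
rewrite -e (potential_spectral mkq kq_r kq_t Cq0 hkq M0 mF hF)// -Rintegral_mull//.
  apply: eq_Rintegral => w; rewrite inE => -[[jt _] _].
  by rewrite (conv_shift w.2 jt) mulrA.
exact: measurable_spectral.
Qed.

End riemann_liouville.

End volterra.

(** * The kernels of the fractional evolution *)

Section extended_kernels.
Context {R : realType}.
Notation la := (@lebesgue_measure R).
Notation Ry := (`]0%R, +oo[%classic : set R).

(** Extension by 0 to nonpositive times, which makes the convolutions above integrals over
    fixed domains. *)
Definition causal (k : R -> R -> R) (r t : R) : R :=
  if (0 < r) && (0 < t) then k r t else 0.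

Lemma causal_r k r t : r <= 0 -> causal k r t = 0.
Proof. by rewrite /causal; case: ltP. Qed.

Lemma causal_t k r t : t <= 0 -> causal k r t = 0.
Proof. by rewrite /causal andbC; case: ltP. Qed.

Lemma causalE k r t : 0 < r -> 0 < t -> causal k r t = k r t.
Proof. by rewrite /causal => -> ->. Qed.

Lemma measurable_causal k :
  measurable_fun (Ry `*` Ry : set (measurableTypeR R * measurableTypeR R)) (fun p => k p.1 p.2) ->
  measurable_fun setT (fun p : measurableTypeR R * measurableTypeR R => causal k p.1 p.2).
Proof.
move=> mk; have mA : measurable (Ry `*` Ry : set (measurableTypeR R * measurableTypeR R)).
  by apply: measurableX.
have := (measurable_restrictT _ mA).1 mk; apply: eq_measurable_fun => -[r t] _.
by rewrite patchE in_setX /= /causal !mem_setE !in_itv/= !andbT.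
Qed.

Variable al : R.
Hypothesis al01 : 0 < al < 1.

Let mRR : measurable (Ry `*` Ry : set (measurableTypeR R * measurableTypeR R)).
Proof. exact: measurableX. Qed.

Let posRR (p : measurableTypeR R * measurableTypeR R) : (Ry `*` Ry) p -> 0 < p.1 /\ 0 < p.2.
Proof. by move=> [/= /[!in_itv]/= /[!andbT] ? ?]. Qed.

Lemma measurable_causal_P_subord :
  measurable_fun setT (fun p : measurableTypeR R * measurableTypeR R => causal (P_subord al) p.1 p.2).
Proof.
apply: measurable_causal; apply: (measurable_P_subord al01) => //.
- by apply: measurable_funTS; exact: measurable_fst.
- by apply: measurable_funTS; exact: measurable_snd.
Qed.

Lemma measurable_causal_S_subord :
  measurable_fun setT (fun p : measurableTypeR R * measurableTypeR R => causal (S_subord al) p.1 p.2).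
Proof.
apply: measurable_causal; apply: (measurable_S_subord al01) => //.
- by apply: measurable_funTS; exact: measurable_fst.
- by apply: measurable_funTS; exact: measurable_snd.
Qed.

Lemma causal_P_subord_L1 : exists2 C : R, 0 <= C & forall T r : R, 0 < r ->
  (\int[la]_(t in `]0%R, T[) `|causal (P_subord al) r t|%:E <= C%:E)%E.
Proof.
have [C C0 hC] := P_subord_L1 al01; exists C => // T r r0; rewrite -(hC _ r0).
rewrite integral_mkcond [leRHS]integral_mkcond; apply: le_integral_any => t _.
  exact: erestrict_ge0.
rewrite !patchE; case: ifPn => [|_]; last by case: ifP => // _; rewrite lee_fin.
rewrite inE/= in_itv/= => /andP[t0 _].
by rewrite mem_set ?causalE//= in_itv/= t0.
Qed.

Lemma causal_S_subord_L1 T : 0 < T -> exists2 C : R, 0 <= C & forall r : R, 0 < r ->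
  (\int[la]_(t in `]0%R, T[) `|causal (S_subord al) r t|%:E <= C%:E)%E.
Proof.
move=> T0; have [a0 a1] := andP al01; have b0 : 0 < 1 - al by rewrite subr_gt0.
have [C C0 hC] := S_subord_bound al01.
exists (C * (T `^ (1 - al) / (1 - al))).
  by rewrite mulr_ge0 ?divr_ge0 ?powR_ge0// ltW.
move=> r r0; rewrite EFinM -(integral_powR0 b0 T0) -ge0_integralZl//.
- rewrite [leLHS]integral_mkcond [leRHS]integral_mkcond.
  apply: (@le_integral_any _ _ _ la) => t _.
    exact: erestrict_ge0.
  have e : 1 - al - 1 = - al by ring.
  rewrite !patchE; case: ifPn => [|_].
    rewrite inE/= in_itv/= => /andP[t0 tT].
    rewrite mem_set/= ?in_itv/= ?t0 ?(ltW tT)// causalE// e -EFinM lee_fin.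
    exact: hC.
  by case: ifP => // _; rewrite mule_ge0 ?lee_fin ?powR_ge0// ltW.
- by apply/measurable_EFinP; apply: measurable_funTS; exact: measurable_powR.
- by move=> t _; rewrite lee_fin powR_ge0.
- by rewrite lee_fin ltW.
Qed.

Lemma causal_P_subord_convolution (r t : R) : 0 < r -> 0 < t ->
  \int[la]_(xi in `]0, t[) ((t - xi) `^ (- al) * causal (P_subord al) r xi) =
  Gamma (1 - al) * causal (S_subord al) r t.
Proof.
move=> r0 t0; rewrite (causalE _ r0 t0) -(P_subord_convolution al01 r0 t0).
apply: eq_Rintegral => xi; rewrite inE/= in_itv/= => /andP[x0 _].
by rewrite causalE.
Qed.

End extended_kernels.

Section kernel_representation.
Context {R : realType} {d : nat}.
Notation X := 'rV[R]_d.
Notation la := (@lebesgue_measure R).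
Notation mu := (lebesgue_rV R d).
Notation Ry := (`]0%R, +oo[%classic : set R).
Variables (O : set X) (S Sg : R -> X -> X -> R).
Hypothesis mO : measurable O.
Hypothesis mS : measurable_fun (Ry `*` O `*` O : set (measurableTypeR R * X * X))
  (fun p => S p.1.1 p.1.2 p.2).
Variable al : R.
Hypothesis al01 : 0 < al < 1.

Lemma P_kernel_ae (x y : X) : O x -> O y ->
  {ae la, forall r, Ry r -> S r x y = Sg r x y} ->
  forall t, 0 < t -> P_kernel S al t x y = subordinated Sg (causal (P_subord al)) t x y.
Proof.
move=> Ox Oy h t t0; rewrite (P_kernelE mO mS al01 Ox Oy t0).
transitivity (\int[la]_(r in Ry) (P_subord al r t * Sg r x y)).
  apply: ae_eq_Rintegral_any; apply: ae_lebesgue_imp h => r h Rr; by rewrite h.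
rewrite Rintegral_mkcond; apply: eq_Rintegral => r _; rewrite patchE mem_setE in_itv/= andbT.
by rewrite /causal t0 andbT; case: ifP => //; rewrite mul0r.
Qed.

Lemma S_kernel_ae (x y : X) : O x -> O y ->
  {ae la, forall r, Ry r -> S r x y = Sg r x y} ->
  forall t, 0 < t -> S_kernel S al t x y = subordinated Sg (causal (S_subord al)) t x y.
Proof.
move=> Ox Oy h t t0; rewrite (S_kernelE mO mS al01 Ox Oy t0).
transitivity (\int[la]_(r in Ry) (S_subord al r t * Sg r x y)).
  apply: ae_eq_Rintegral_any; apply: ae_lebesgue_imp h => r h Rr; by rewrite h.
rewrite Rintegral_mkcond; apply: eq_Rintegral => r _; rewrite patchE mem_setE in_itv/= andbT.
by rewrite /causal t0 andbT; case: ifP => //; rewrite mul0r.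
Qed.

Let mscaled : measurable_fun
  ((Ry `*` O `*` O) `*` Ry : set ((measurableTypeR R * X * X) * measurableTypeR R))
  (fun w => S (w.2 * w.1.1.1 `^ al) w.1.1.2 w.1.2).
Proof.
apply: (measurable_comp (F := (Ry `*` O `*` O : set (measurableTypeR R * X * X)))
  (f := fun p => S p.1.1 p.1.2 p.2)
  (g := fun w : (measurableTypeR R * X * X) * measurableTypeR R =>
    (w.2 * w.1.1.1 `^ al : measurableTypeR R, w.1.1.2, w.1.2)) _ _ mS).
- by apply: measurableX => //; exact: measurableX.
- move=> _ [[[[t x] y] r] [[[/= t0 Ox] Oy] r0] <-]; split => //; split => //=.
  by rewrite in_itv/= andbT mulr_gt0 ?powR_gt0//;
    [move: r0|move: t0]; rewrite in_itv/= andbT.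
- apply: measurable_funTS; apply: measurable_fun_pair; last first.
    exact: measurableT_comp measurable_snd measurable_fst.
  apply: measurable_fun_pair; last first.
    apply: measurableT_comp measurable_snd _; exact: measurableT_comp measurable_fst measurable_fst.
  apply: measurable_funM; first exact: measurable_snd.
  apply: (measurableT_comp (f := fun t : R => t `^ al)
    (g := fun w : (measurableTypeR R * X * X) * measurableTypeR R => w.1.1.1)).
    exact: measurable_powR.
  apply: measurableT_comp measurable_fst _; exact: measurableT_comp measurable_fst measurable_fst.
Qed.

Let mRyOO : measurable (Ry `*` O `*` O : set (measurableTypeR R * X * X)).
Proof. by apply: measurableX => //; exact: measurableX. Qed.

Let mmain : measurable_fun
  ((Ry `*` O `*` O) `*` Ry : set ((measurableTypeR R * X * X) * measurableTypeR R))
  (fun w => mainardi al w.2).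
Proof.
apply: (measurable_comp (F := Ry) (f := mainardi al)) => //.
- by move=> _ [[p r] [_ h] <-].
- exact: measurable_mainardi.
- by apply: measurable_funTS; exact: measurable_snd.
Qed.

Lemma measurable_S_kernel : measurable_fun (Ry `*` O `*` O : set (measurableTypeR R * X * X))
  (fun p => S_kernel S al p.1.1 p.1.2 p.2).
Proof.
apply: (@measurable_RintegralD _ _ _ (measurableTypeR R) R la _ Ry
  (fun p r => mainardi al r * S (r * p.1.1 `^ al) p.1.2 p.2) mRyOO) => //.
by apply: measurable_funM; [exact: mmain|exact: mscaled].
Qed.

Lemma measurable_P_kernel : measurable_fun (Ry `*` O `*` O : set (measurableTypeR R * X * X))
  (fun p => P_kernel S al p.1.1 p.1.2 p.2).
Proof.
apply: measurable_funM.
  apply: measurable_funM => //; apply: measurable_funTS.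
  apply: (measurableT_comp (f := fun t : R => t `^ (al - 1))
    (g := fun w : (measurableTypeR R * X * X) => w.1.1)); first exact: measurable_powR.
  exact: measurableT_comp measurable_fst measurable_fst.
apply: (@measurable_RintegralD _ _ _ (measurableTypeR R) R la _ Ry
  (fun p r => r * mainardi al r * S (r * p.1.1 `^ al) p.1.2 p.2) mRyOO) => //.
apply: measurable_funM; last exact: mscaled.
apply: measurable_funM; last exact: mmain.
by apply: measurable_funTS; exact: measurable_snd.
Qed.

End kernel_representation.

(** * The weak formulation for abstract kernels *)

Section cylinder_null_sets.
Context d (X : measurableType d) (R : realType).
Variable mu : {sigma_finite_measure set X -> \bar R}.
Notation la := (@lebesgue_measure R).
Notation nu := (la \x mu)%E.
Variables (O : set X) (T : R).
Hypothesis mO : measurable O.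
Notation JT := (`]0%R, T[%classic : set R).
Notation cyl := (JT `*` O : set (measurableTypeR R * X)).
Let mJT : measurable JT. Proof. exact: measurable_itv. Qed.
Let mcyl : measurable cyl. Proof. exact: measurableX. Qed.

Lemma ae_cylinder_snd (P : X -> Prop) : {ae mu, forall x, O x -> P x} ->
  {ae nu, forall p, cyl p -> P p.2}.
Proof.
move=> [N [mN N0 hN]]; exists (setT `*` N); split.
- exact: measurableX.
- by rewrite product_measure1E// [X in (_ * X)%E]N0 mule0.
- move=> p /= hp; split => //; apply: hN => /= h; apply: hp => -[_ Op]; exact: h.
Qed.

(** A null set of the product has null sections over almost every time. *)
Lemma ae_cylinder_iterated (F : measurableTypeR R * X -> R) : measurable_fun cyl F ->
  (\int[nu]_(p in cyl) `|(F p)%:E| = 0)%E ->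
  {ae la, forall t, JT t -> {ae mu, forall x, O x -> F (t, x) = 0}}.
Proof.
move=> mF; have mN : measurable_fun cyl (fun p => `|(F p)%:E|%E).
  by apply: measurableT_comp => //; exact/measurable_EFinP.
rewrite (tonelli_prod la mu mJT mO mN (fun _ _ => abse_ge0 _)).
pose h (t : R) := (\int[mu]_(x in O) `|(F (t, x))%:E|)%E; rewrite -/h.
have mN' : measurable_fun cyl (fun p => `|(F (p.1, p.2))%:E|%E).
  by move: mN; apply: eq_measurable_fun => -[].
have mh : measurable_fun (JT : set (measurableTypeR R)) h.
  exact: (@measurable_ge0_integralD _ _ (measurableTypeR R) X R mu JT O
    (fun t x => `|(F (t, x))%:E|%E) mJT mO mN').
have h0 t : JT t -> (0 <= h t)%E by move=> _; exact: integral_ge0.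
move=> e0; have := ge0_integral0_ae (m := la) mJT mh h0 e0.
apply: ae_lebesgue_imp => t + Jt => /(_ Jt) ht.
have mFt : measurable_fun O (fun x => F (t, x)).
  apply: (measurable_comp (F := cyl) (f := F) (g := fun x : X => ((t : measurableTypeR R), x))) => //.
    by move=> _ [x Ox <-].
  by apply: measurable_funTS; apply: measurable_fun_pair => //; exact: measurable_cst.
have := ge0_integral0_ae mO _ (fun x _ => abse_ge0 (F (t, x))%:E) ht.
move=> /(_ _)[]; first by apply: measurableT_comp => //; exact/measurable_EFinP.
move=> N [mN0 N0 hN]; exists N; split => //; apply: subset_trans hN => x /= nx Nx; apply: nx => Ox.
by have := Nx Ox => -[] /eqP; rewrite normr_eq0 => /eqP.
Qed.

Lemma ae_cylinder_norm0 (F : measurableTypeR R * X -> R) : measurable_fun cyl F ->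
  {ae nu, forall p, cyl p -> F p = 0} -> (\int[nu]_(p in cyl) `|(F p)%:E| = 0)%E.
Proof.
move=> mF h; apply: ae_integral0 => //.
  by apply: measurableT_comp => //; exact/measurable_EFinP.
by apply: filterS h => p h cp; rewrite h// abse_EFin normr0.
Qed.

End cylinder_null_sets.

Section weak_dual.
Context d (X : measurableType d) (R : realType).
Variable mu : {sigma_finite_measure set X -> \bar R}.
Notation la := (@lebesgue_measure R).
Notation nu := (la \x mu)%E.
Notation Ry := (`]0%R, +oo[%classic : set R).
Variables (O : set X) (Sg : R -> X -> X -> R) (D : X -> R) (C1 T : R).
Hypothesis mO : measurable O.
Hypothesis mSg : measurable_fun setT (fun p : measurableTypeR R * X * X => Sg p.1.1 p.1.2 p.2).
Hypothesis Sg0 : forall r x y, 0 <= Sg r x y.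
Hypothesis Sgsym : forall r x y, Sg r x y = Sg r y x.
Hypothesis mD : measurable_fun O D.
Hypothesis D0 : forall x, O x -> 0 < D x.
Hypothesis hSg : forall x, O x ->
  (\int[la]_(r in Ry) \int[mu]_(y in O) (Sg r x y * D y)%:E <= (C1 * D x)%:E)%E.
Hypothesis T0 : 0 < T.

Notation JT := (`]0%R, T[%classic : set R).
Notation cyl := (JT `*` O : set (measurableTypeR R * X)).

Let mJT : measurable JT. Proof. exact: measurable_itv. Qed.
Let mcyl : measurable cyl. Proof. exact: measurableX. Qed.

Variables (k0 kp : R -> R -> R) (B0 Bp : R).
Hypothesis mk0 : measurable_fun setT (fun p : measurableTypeR R * measurableTypeR R => k0 p.1 p.2).
Hypothesis mkp : measurable_fun setT (fun p : measurableTypeR R * measurableTypeR R => kp p.1 p.2).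
Hypothesis k0_r : forall r t, r <= 0 -> k0 r t = 0.
Hypothesis kp_r : forall r t, r <= 0 -> kp r t = 0.
Hypothesis k0_t : forall r t, t <= 0 -> k0 r t = 0.
Hypothesis kp_t : forall r t, t <= 0 -> kp r t = 0.
Hypothesis B00 : 0 <= B0.
Hypothesis Bp0 : 0 <= Bp.
Hypothesis hk0 : forall r, 0 < r -> (\int[la]_(t in JT) `|k0 r t|%:E <= B0%:E)%E.
Hypothesis hkp : forall r, 0 < r -> (\int[la]_(t in JT) `|kp r t|%:E <= Bp%:E)%E.

Notation A0 := (potential mu O Sg T k0).
Notation Ap := (potential mu O Sg T kp).

Variables K P : R -> X -> X -> R.
Hypothesis mK : measurable_fun (Ry `*` O `*` O : set (measurableTypeR R * X * X))
  (fun p => K p.1.1 p.1.2 p.2).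
Hypothesis mP : measurable_fun (Ry `*` O `*` O : set (measurableTypeR R * X * X))
  (fun p => P p.1.1 p.1.2 p.2).

(** The exceptional set of y does not depend on t: all times occur in a Duhamel
    integral. *)
Definition represented (x : X) : Prop := {ae mu, forall y, O y ->
  forall t, 0 < t -> K t x y = subordinated Sg k0 t x y /\ P t x y = subordinated Sg kp t x y}.

Hypothesis hrep : {ae mu, forall x, O x -> represented x}.

Definition duhamel_op (phi : R -> X -> R) (t : R) (x : X) : R :=
  \int[la]_(tau in `]0, t[) \int[mu]_(y in O) (P (t - tau) x y * phi tau y).

Definition representation (u0 : X -> R) (f : R -> X -> R) (t : R) (x : X) : R :=
  \int[mu]_(y in O) (K t x y * u0 y) + duhamel_op f t x.

(** Extending the kernel by 0 to nonpositive times makes the domain of integration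
    independent of t. *)
Lemma measurable_duhamel_op (f : R -> X -> R) :
  measurable_fun cyl (fun p => f p.1 p.2) ->
  measurable_fun cyl (fun p => duhamel_op f p.1 p.2).
Proof.
move=> mf.
pose P' t x y := if 0 < t then P t x y else 0.
have mP' : measurable_fun (setT `*` O `*` O : set (measurableTypeR R * X * X))
    (fun p => P' p.1.1 p.1.2 p.2).
  apply: measurable_fun_if => //.
  - by apply: measurableX => //; exact: measurableX.
  - apply: measurable_fun_ltr => //; apply: measurable_funTS.
    exact: measurableT_comp measurable_fst measurable_fst.
  - rewrite [X in measurable_fun X](_ : _ = (Ry `*` O `*` O)) //.
    by apply/seteqP; split => [[[t x] y] [[[_ /= ?] ?] ?]|[[t x] y] [[/= + ?] ?]];
      rewrite ?in_itv/= ?andbT => // ?; split => //; split => //=; rewrite in_itv/= andbT.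
have mcc : measurable_fun (cyl `*` JT : set ((measurableTypeR R * X) * measurableTypeR R))
    (fun w => \int[mu]_(y in O) (P' (w.1.1 - w.2) w.1.2 y * f w.2 y)).
  apply: (@measurable_RintegralD _ _ _ X R mu (cyl `*` JT) O
    (fun w y => P' (w.1.1 - w.2) w.1.2 y * f w.2 y)) => //; first exact: measurableX.
  apply: measurable_funM.
    apply: (measurable_comp (F := (setT `*` O `*` O : set (measurableTypeR R * X * X)))
      (f := fun p => P' p.1.1 p.1.2 p.2)
      (g := fun w : ((measurableTypeR R * X) * measurableTypeR R) * X =>
        (w.1.1.1 - w.1.2 : measurableTypeR R, w.1.1.2, w.2)) _ _ mP').
    - by apply: measurableX => //; exact: measurableX.
    - by move=> _ [[[[t x] tau] y] [[[_ /= Ox] _] Oy] <-].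
    - apply: measurable_funTS; apply: measurable_fun_pair; last exact: measurable_snd.
      apply: measurable_fun_pair.
        apply: measurable_funB.
          by apply: measurableT_comp measurable_fst _; exact: measurableT_comp measurable_fst measurable_fst.
        exact: measurableT_comp measurable_snd measurable_fst.
      by apply: measurableT_comp measurable_snd _; exact: measurableT_comp measurable_fst measurable_fst.
  apply: (measurable_comp (F := cyl) (f := fun p => f p.1 p.2)
    (g := fun w : ((measurableTypeR R * X) * measurableTypeR R) * X => (w.1.2, w.2)) _ _ mf) => //.
  - by move=> _ [[[p tau] y] [[_ /= Jtau] Oy] <-].
  - apply: measurable_funTS; apply: measurable_fun_pair; last exact: measurable_snd.
    exact: measurableT_comp measurable_snd measurable_fst.
have := @measurable_RintegralD _ _ (measurableTypeR R * X)%type (measurableTypeR R) R la cyl JT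
  (fun p tau => \int[mu]_(y in O) (P' (p.1 - tau) p.2 y * f tau y)) mcyl mJT mcc.
apply: eq_measurable_fun => -[t x]; rewrite inE => -[/= + Ox]; rewrite in_itv/= => /andP[t0 tT].
rewrite /duhamel_op [LHS]Rintegral_mkcond [RHS]Rintegral_mkcond; apply: eq_Rintegral => tau _.
rewrite !patchE !mem_setE !in_itv/=; have [u0|u0]//= := ltP 0 tau.
have [tt|tt] := ltP tau t.
  rewrite (lt_trans tt tT); apply: eq_Rintegral => y _.
  by rewrite /P' subr_gt0 tt.
case: ifP => // _; transitivity (0 : R) => //.
rewrite -[RHS](Rintegral0 mu O); apply: eq_Rintegral => y _.
by rewrite /P' subr_gt0 ltNge tt mul0r.
Qed.

Lemma measurable_representation (u0 : X -> R) (f : R -> X -> R) :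
  measurable_fun O u0 -> measurable_fun cyl (fun p => f p.1 p.2) ->
  measurable_fun cyl (fun p => representation u0 f p.1 p.2).
Proof.
move=> mu0 mf; apply: measurable_funD; last exact: measurable_duhamel_op.
apply: (@measurable_RintegralD _ _ _ X R mu cyl O (fun p y => K p.1 p.2 y * u0 y)) => //.
apply: measurable_funM.
  apply: (measurable_comp (F := (Ry `*` O `*` O : set (measurableTypeR R * X * X)))
    (f := fun p => K p.1.1 p.1.2 p.2)
    (g := fun w : (measurableTypeR R * X) * X => (w.1.1, w.1.2, w.2)) _ _ mK).
  - by apply: measurableX => //; exact: measurableX.
  - move=> _ [[[t x] y] [[/= + Ox] Oy] <-]; rewrite in_itv/= => /andP[t0 _].
    by split => //; split => //=; rewrite in_itv/= t0.
  - apply: measurable_funTS; apply: measurable_fun_pair; last exact: measurable_snd.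
    by apply: measurable_fun_pair;
      [exact: measurableT_comp measurable_fst measurable_fst|exact: measurableT_comp measurable_snd measurable_fst].
apply: (measurable_comp (F := O) (f := u0)) => //; first by move=> _ [[p y] [_ h] <-].
by apply: measurable_funTS; exact: measurable_snd.
Qed.

Lemma duhamel_op_represented (f : R -> X -> R) t x : represented x ->
  duhamel_op f t x =
  \int[la]_(tau in `]0, t[) \int[mu]_(y in O) (subordinated Sg kp (t - tau) x y * f tau y).
Proof.
move=> rx; apply: eq_Rintegral => tau; rewrite inE/= in_itv/= => /andP[_ tt].
apply: ae_eq_Rintegral_any; apply: filterS rx => y h Oy.
have tt' : 0 < t - tau by rewrite subr_gt0.
by have [_ ->] := h Oy _ tt'.
Qed.

(** A test function is bounded by a multiple of D only almost everywhere; F is a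
    representative for which the bound holds everywhere. *)
Section test.
Variables (phi : R -> X -> R) (M : R) (F : measurableTypeR R * X -> R).
Hypothesis M0 : 0 <= M.
Hypothesis mphi : measurable_fun cyl (fun p => phi p.1 p.2).
Hypothesis mF : measurable_fun cyl F.
Hypothesis hF : forall p, cyl p -> `|F p| <= M * D p.2.
Hypothesis phiF : {ae nu, forall p, cyl p -> phi p.1 p.2 = F p}.

Let mdiff : measurable_fun cyl (fun p => phi p.1 p.2 - F p).
Proof. exact: measurable_funB. Qed.

Let diff0 : (\int[nu]_(p in cyl) `|(phi p.1 p.2 - F p)%:E| = 0)%E.
Proof.
apply: (ae_cylinder_norm0 mO (F := fun p => phi p.1 p.2 - F p) mdiff).
by apply: filterS phiF => p h cp; rewrite h// subrr.
Qed.

Lemma test_ae : {ae la, forall t, JT t -> {ae mu, forall x, O x -> phi t x = F (t, x)}}.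
Proof.
have := ae_cylinder_iterated mO (F := fun p => phi p.1 p.2 - F p) mdiff diff0.
apply: ae_lebesgue_imp => t h /h; apply: filterS => x {}h /h /eqP.
by rewrite subr_eq0 => /eqP.
Qed.

Lemma test_reflect_ae :
  {ae la, forall t, JT t -> {ae mu, forall x, O x -> phi (T - t) x = F (T - t, x)}}.
Proof.
have m := measurable_cylinder_reflect mO (F := fun p => phi p.1 p.2 - F p) mdiff.
have := cylinder_reflect_norm mu mO (F := fun p => phi p.1 p.2 - F p) mdiff.
rewrite diff0 => /(ae_cylinder_iterated mO (F := fun p => phi (T - p.1) p.2 - F (T - p.1, p.2)) m).
apply: ae_lebesgue_imp => t h /h; apply: filterS => x {}h /h /eqP.
by rewrite subr_eq0 => /eqP.
Qed.

Lemma duhamel_test x t : O x -> represented x -> t <= T -> duhamel_op phi t x = Ap t x F.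
Proof.
move=> Ox rx tT; rewrite duhamel_op_represented//.
have iA := potential_integrable mO mSg Sg0 Sgsym mD D0 hSg mkp kp_r kp_t Bp0 hkp M0 mF hF tT Ox.
rewrite -(potential_iterated mO kp_t tT iA).
apply: ae_eq_Rintegral_any; apply: ae_lebesgue_imp test_ae => tau h.
rewrite /= in_itv/= => /andP[u0 ut]; apply: ae_eq_Rintegral_any.
have : JT tau by rewrite /= in_itv/= u0 (lt_le_trans ut).
by move=> /h; apply: filterS => y {}h /h ->.
Qed.

Lemma pairing_test (u : R -> X -> R) :
  nu.-integrable cyl (EFin \o (fun p => u p.1 p.2 * F (T - p.1, p.2))) ->
  \int[la]_(t in JT) \int[mu]_(x in O) (u t x * phi (T - t) x) =
  \int[nu]_(p in cyl) (u p.1 p.2 * F (T - p.1, p.2)).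
Proof.
move=> iu; rewrite (Rintegral_prod (m1 := la) (m2 := mu) mJT mO iu)/=.
apply: ae_eq_Rintegral_any; apply: ae_lebesgue_imp test_reflect_ae => t h /h {}h.
by apply: ae_eq_Rintegral_any; apply: filterS h => x h /h ->.
Qed.

Lemma pairing_integrable (u : R -> X -> R) :
  nu.-integrable cyl (EFin \o (fun p => u p.1 p.2 * D p.2)) ->
  measurable_fun cyl (fun p => u p.1 p.2) ->
  nu.-integrable cyl (EFin \o (fun p => u p.1 p.2 * F (T - p.1, p.2))).
Proof.
move=> iu mu'.
have iM := integrable_norm (integrableZR (m := nu) M mcyl iu).
apply: (le_integrableR (m := nu) mcyl _ _ iM).
  by apply: measurable_funM => //; exact: measurable_cylinder_reflect.
move=> [t x] [/= + Ox]; rewrite in_itv/= => /andP[t0 tT].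
rewrite mulrCA !normrM; apply: ler_wpM2l => //.
rewrite -normrM [leRHS]ger0_norm; last by rewrite mulr_ge0// ltW// D0.
by apply: hF; split => //=; rewrite in_itv/= subr_gt0 tT gtrBl.
Qed.

End test.

Variables (u0 : X -> R) (f : R -> X -> R).
Hypothesis mu0 : measurable_fun O u0.
Hypothesis iu0 : mu.-integrable O (EFin \o (fun x => u0 x * D x)).
Hypothesis mf : measurable_fun cyl (fun p => f p.1 p.2).
Hypothesis if_ : nu.-integrable cyl (EFin \o (fun p => f p.1 p.2 * D p.2)).

Notation fu := (fun p : measurableTypeR R * X => f p.1 p.2).
Notation I0 := (fun p : measurableTypeR R * X => \int[mu]_(y in O) (subordinated Sg k0 p.1 p.2 y * u0 y)).

Lemma representation_ae : {ae nu, forall p, cyl p ->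
  representation u0 f p.1 p.2 = I0 p + Ap p.1 p.2 fu}.
Proof.
have h1 := ae_cylinder_snd T hrep.
have h2 := source_iterated mO mSg Sg0 Sgsym mD D0 hSg mkp kp_r kp_t Bp0 hkp (g := fu) mf if_.
apply: filterS2 h1 h2 => -[t x] /= h1 h2 ctx.
have [/= Jt Ox] := ctx.
rewrite /representation (duhamel_op_represented _ _ (h1 ctx)) h2//; congr (_ + _).
apply: ae_eq_Rintegral_any; apply: filterS (h1 ctx) => y h Oy.
move: Jt; rewrite in_itv/= => /andP[t0 _].
by have [->] := h Oy _ t0.
Qed.

Section dual.
Variables (M : R) (F : measurableTypeR R * X -> R).
Hypothesis M0 : 0 <= M.
Hypothesis mF : measurable_fun cyl F.
Hypothesis hF : forall p, cyl p -> `|F p| <= M * D p.2.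

Let Fr := fun p : measurableTypeR R * X => F (T - p.1, p.2).

Let mFr : measurable_fun cyl Fr.
Proof. exact: measurable_cylinder_reflect. Qed.

Let hFr p : cyl p -> `|Fr p| <= M * D p.2.
Proof.
move: p => [t x] [/= + Ox]; rewrite in_itv/= => /andP[t0 tT]; apply: hF; split => //=.
by rewrite in_itv/= subr_gt0 tT gtrBl.
Qed.

Lemma representation_dual :
  \int[nu]_(p in cyl) (representation u0 f p.1 p.2 * Fr p) =
  \int[mu]_(y in O) (u0 y * A0 T y F) +
  \int[nu]_(q in cyl) (f q.1 q.2 * Ap (T - q.1) q.2 F).
Proof.
rewrite -(initial_duality mO mSg Sg0 Sgsym mD D0 hSg mk0 k0_r k0_t B00 hk0 M0 mF hF mu0 iu0).
rewrite -(source_duality mO mSg Sg0 Sgsym mD D0 hSg mkp kp_r kp_t Bp0 hkp M0 mF hF (g := fu) mf if_).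
have i1 := initial_integrable mO mSg Sg0 Sgsym mD D0 hSg mk0 k0_r k0_t B00 hk0 M0 mFr hFr mu0 iu0.
have i2 := source_integrable mO mSg Sg0 Sgsym mD D0 hSg mkp kp_r kp_t Bp0 hkp M0 mFr hFr (g := fu) mf if_.
rewrite -(RintegralD mcyl i1 i2); apply: ae_eq_Rintegral_any.
by apply: filterS representation_ae => p h cp; rewrite h// mulrDl.
Qed.

End dual.

Lemma representation_integrable :
  nu.-integrable cyl (EFin \o (fun p => representation u0 f p.1 p.2 * D p.2)).
Proof.
have mD2 : measurable_fun cyl (fun p => D p.2).
  apply: (measurable_comp (F := O) (f := D)) => //; first by move=> _ [[t x] [_ h] <-].
  by apply: measurable_funTS; exact: measurable_snd.
have hD p : cyl p -> `|D p.2| <= 1 * D p.2.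
  by move=> [_ /= /D0 h]; rewrite mul1r ger0_norm// ltW.
have i1 := initial_integrable mO mSg Sg0 Sgsym mD D0 hSg mk0 k0_r k0_t B00 hk0 ler01 mD2 hD mu0 iu0.
have i2 := source_integrable mO mSg Sg0 Sgsym mD D0 hSg mkp kp_r kp_t Bp0 hkp ler01 mD2 hD (g := fu) mf if_.
have i12 := integrableDR (m := nu) mcyl i1 i2.
have mR : measurable_fun cyl (fun p => (representation u0 f p.1 p.2 * D p.2)%:E).
  apply/measurable_EFinP; apply: measurable_funM => //; exact: measurable_representation.
move/integrableP : i12 => [m12 f12]; apply/integrableP; split => //; apply: le_lt_trans f12.
rewrite le_eqVlt; apply/orP; left; apply/eqP; apply: ae_eq_integral => //.
- exact: measurableT_comp.
- exact: measurableT_comp.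
- by apply: filterS representation_ae => p h cp /=; rewrite h// mulrDl.
Qed.

(** J is the functional of the test function paired with the initial datum: the Duhamel
    integral at time T or its fractional integral, according to the derivative. *)
Section weak_formulation.
Variable J : (R -> X -> R) -> X -> R.
Hypothesis hJ : forall (phi : R -> X -> R) (M : R) (F : measurableTypeR R * X -> R) (x : X),
  0 <= M -> measurable_fun cyl (fun p => phi p.1 p.2) -> measurable_fun cyl F ->
  (forall p, cyl p -> `|F p| <= M * D p.2) ->
  {ae nu, forall p, cyl p -> phi p.1 p.2 = F p} ->
  O x -> represented x -> J phi x = A0 T x F.

Definition weak_formulation (u : R -> X -> R) : Prop :=
  forall phi : R -> X -> R, Linfty nu cyl (fun p => phi p.1 p.2 / D p.2) ->
    \int[la]_(t in JT) \int[mu]_(x in O) (u t x * phi (T - t) x) =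
    \int[mu]_(x in O) (u0 x * J phi x) +
    \int[la]_(t in JT) \int[mu]_(x in O) (f t x * duhamel_op phi (T - t) x).

Let mD2 : measurable_fun cyl (fun p => D p.2).
Proof.
apply: (measurable_comp (F := O) (f := D)) => //; first by move=> _ [[t x] [_ h] <-].
by apply: measurable_funTS; exact: measurable_snd.
Qed.

Lemma bounded_representative (phi : R -> X -> R) : Linfty nu cyl (fun p => phi p.1 p.2 / D p.2) ->
  exists M (F : measurableTypeR R * X -> R), [/\ 0 <= M,
    measurable_fun cyl (fun p => phi p.1 p.2), measurable_fun cyl F,
    forall p, cyl p -> `|F p| <= M * D p.2 &
    {ae nu, forall p, cyl p -> phi p.1 p.2 = F p}].
Proof.
move=> [mpD [M hM]]; pose N := Num.max M 0.
have N0 : 0 <= N by rewrite le_max lexx orbT.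
have mphi : measurable_fun cyl (fun p => phi p.1 p.2).
  have := measurable_funM mpD mD2; apply: eq_measurable_fun => -[t x] /[!inE] -[_ /= Ox] /=.
  by rewrite divfK// gt_eqF// D0.
have mN : measurable_fun cyl (fun p : measurableTypeR R * X => `|phi p.1 p.2|).
  exact: measurableT_comp.
have mND : measurable_fun cyl (fun p => N * D p.2) by exact: measurable_funM.
exists N, (fun p => if `|phi p.1 p.2| <= N * D p.2 then phi p.1 p.2 else 0); split => //.
- apply: measurable_fun_if => //; first exact: measurable_fun_ler.
  by apply: measurable_funS mphi => // p [].
- move=> [t x] [_ /= Ox]; case: ifP => // _.
  by rewrite normr0 mulr_ge0// ltW// D0.
- apply: filterS hM => -[t x] /= h ctx; have Dx : 0 < D x by apply: D0; case: ctx.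
  have := h ctx; rewrite normrM [`|(D x)^-1|]gtr0_norm ?invr_gt0// ler_pdivrMr// => hx.
  by rewrite (le_trans hx)// ler_wpM2r ?(ltW Dx)// le_max lexx.
Qed.

(** The right side of the weak formulation is the pairing of the representation formula
    with the test function, so only u and that formula are compared. *)
Lemma weak_formulation_test (u phi : R -> X -> R) (M : R) (F : measurableTypeR R * X -> R) :
  nu.-integrable cyl (EFin \o (fun p => u p.1 p.2 * D p.2)) ->
  measurable_fun cyl (fun p => u p.1 p.2) ->
  0 <= M -> measurable_fun cyl (fun p => phi p.1 p.2) -> measurable_fun cyl F ->
  (forall p, cyl p -> `|F p| <= M * D p.2) ->
  {ae nu, forall p, cyl p -> phi p.1 p.2 = F p} ->
  (\int[la]_(t in JT) \int[mu]_(x in O) (u t x * phi (T - t) x) =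
   \int[mu]_(x in O) (u0 x * J phi x) +
   \int[la]_(t in JT) \int[mu]_(x in O) (f t x * duhamel_op phi (T - t) x)) <->
  \int[nu]_(p in cyl) (u p.1 p.2 * F (T - p.1, p.2)) =
  \int[nu]_(p in cyl) (representation u0 f p.1 p.2 * F (T - p.1, p.2)).
Proof.
move=> iu mu' M0 mphi mF hF phiF.
rewrite (pairing_test mphi mF phiF (pairing_integrable M0 mF hF iu mu')).
rewrite (representation_dual M0 mF hF).
have -> : \int[mu]_(x in O) (u0 x * J phi x) = \int[mu]_(y in O) (u0 y * A0 T y F).
  apply: ae_eq_Rintegral_any; apply: filterS hrep => x h Ox.
  by rewrite (hJ M0 mphi mF hF phiF Ox (h Ox)).
have iA := source_integrable_dual mO mSg Sg0 Sgsym mD D0 hSg mkp kp_r kp_t Bp0 hkp M0 mF hF (g := fu) mf if_.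
rewrite (Rintegral_prod (m1 := la) (m2 := mu) mJT mO iA)/=.
suff -> : \int[la]_(t in JT) \int[mu]_(x in O) (f t x * duhamel_op phi (T - t) x) =
  \int[la]_(t in JT) \int[mu]_(x in O) (f t x * Ap (T - t) x F) by [].
apply: eq_Rintegral => t; rewrite inE/= in_itv/= => /andP[t0 tT].
apply: ae_eq_Rintegral_any; apply: filterS hrep => x h Ox.
by rewrite (duhamel_test M0 mphi mF hF phiF Ox (h Ox))// gerBl ltW.
Qed.

Let mR : measurable_fun cyl (fun p => representation u0 f p.1 p.2).
Proof. exact: measurable_representation. Qed.

Lemma representation_weak : weak_formulation (representation u0 f).
Proof.
move=> phi /bounded_representative[M [F [M0 mphi mF hF phiF]]].
exact/(weak_formulation_test representation_integrable mR M0 mphi mF hF phiF).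
Qed.

(** Test with D times the sign of the difference reversed in time, which the weak
    formulation reverses again. *)
Lemma weak_formulation_unique (u : R -> X -> R) :
  nu.-integrable cyl (EFin \o (fun p => u p.1 p.2 * D p.2)) ->
  measurable_fun cyl (fun p => u p.1 p.2) -> weak_formulation u ->
  {ae nu, forall p, cyl p -> u p.1 p.2 = representation u0 f p.1 p.2}.
Proof.
move=> iu mu' hu.
pose w (p : measurableTypeR R * X) := u p.1 p.2 - representation u0 f p.1 p.2.
have mw : measurable_fun cyl w by exact: measurable_funB.
pose sg (p : measurableTypeR R * X) : R := if 0 <= w p then 1 else -1.
have msg : measurable_fun cyl sg.
  by apply: measurable_fun_if => //; exact: measurable_fun_ler.
pose sr (p : measurableTypeR R * X) : R := sg (T - p.1, p.2).
have msr : measurable_fun cyl sr by exact: measurable_cylinder_reflect.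
pose F (p : measurableTypeR R * X) := D p.2 * sr p.
have sg1 p : `|sg p| = 1 by rewrite /sg; case: ifP; rewrite ?normrN1 ?normr1.
have hF p : cyl p -> `|F p| <= 1 * D p.2.
  move=> [_ /= Op]; rewrite /F normrM sg1 mulr1 mul1r ger0_norm// ltW//; exact: D0.
have mF : measurable_fun cyl F by exact: measurable_funM.
have lF : Linfty nu cyl (fun p => F (p.1, p.2) / D p.2).
  split.
    apply: eq_measurable_fun msr => -[t x] /[!inE] -[_ /= Ox].
    by rewrite /F/= mulrAC divff ?mul1r// gt_eqF// D0.
  exists 1; apply: nearW => -[t x] [_ /= Ox].
  by rewrite /F/= mulrAC divff ?mul1r ?sg1// gt_eqF// D0.
have mF' : measurable_fun cyl (fun p => F (p.1, p.2)).
  by apply: eq_measurable_fun mF => -[].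
have FF : {ae nu, forall p, cyl p -> F (p.1, p.2) = F p} by apply: nearW => -[].
have := hu (fun t x => F (t, x)) lF.
move=> /(weak_formulation_test (phi := fun t x => F (t, x)) iu mu' ler01 mF' mF hF FF).
have i1 := pairing_integrable ler01 mF hF iu mu'.
have i2 := pairing_integrable ler01 mF hF representation_integrable mR.
move=> e.
have absw p : w p * sg p = `|w p|.
  rewrite /sg; case: ifPn => [h|]; first by rewrite mulr1 ger0_norm.
  by rewrite -ltNge => h; rewrite mulrN1 ltr0_norm.
have eF p : F (T - p.1, p.2) = D p.2 * sg p.
  by rewrite /F /sr/= subKr; case: p.
have iw : nu.-integrable cyl (EFin \o (fun p => `|w p| * D p.2)).
  have := integrableBR (m := nu) mcyl i1 i2; apply: eq_integrable => // p _ /=.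
  by rewrite -mulrBl eF mulrCA -/(w p) absw mulrC.
have z : \int[nu]_(p in cyl) (`|w p| * D p.2) = 0.
  transitivity (\int[nu]_(p in cyl)
    (u p.1 p.2 * F (T - p.1, p.2) - representation u0 f p.1 p.2 * F (T - p.1, p.2))).
    by apply: eq_Rintegral => p _; rewrite -mulrBl eF mulrCA -/(w p) absw mulrC.
  by rewrite RintegralB// e subrr.
have w0 (p : measurableTypeR R * X) : cyl p -> (0 <= (`|w p| * D p.2)%:E)%E.
  by move=> [_ /= Op]; rewrite lee_fin mulr_ge0// ltW// D0.
have z' : (\int[nu]_(p in cyl) (`|w p| * D p.2)%:E = 0)%E.
  have := integrable_fin_num mcyl iw => /fineK /=.
  by rewrite -[X in X%:E]/(\int[nu]_(p in cyl) (`|w p| * D p.2)) z => <-.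
have mwD : measurable_fun cyl (fun p => (`|w p| * D p.2)%:E) := measurable_int _ iw.
have := ge0_integral0_ae (m := nu) mcyl mwD w0 z'.
apply: filterS => -[t x] h ctx; have := h ctx => -[] /eqP.
have Dx : 0 < D x by apply: D0; case: ctx.
by rewrite mulf_eq0 normr_eq0 (gt_eqF Dx) orbF subr_eq0 => /eqP.
Qed.

End weak_formulation.

End weak_dual.

(** * Existence, uniqueness and representation of weak-dual solutions *)

Theorem theorem2p5 (R : realType) (d : nat) (hd : (0 < d)%N)
    (Omega : set 'rV[R]_d) (hOmega : bounded_smooth_domain Omega)
    (alpha T s gamma : R) (halpha : 0 < alpha < 1) (hT : 0 < T)
    (hs : 0 < s <= 1) (hgamma : 0 < gamma <= 1)
    (domL : set ('rV[R]_d -> R)) (L : ('rV[R]_d -> R) -> 'rV[R]_d -> R)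
    (G : 'rV[R]_d -> 'rV[R]_d -> R) (hG : green_kernel Omega domL L G)
    (lambda : nat -> R) (phi : nat -> 'rV[R]_d -> R)
    (hphi : green_eigenbasis Omega G lambda phi)
    (S : R -> 'rV[R]_d -> 'rV[R]_d -> R)
    (hS : heat_kernel Omega lambda phi S)
    (h1sym : green_symmetric Omega G)
    (h1 : green_estimate Omega s gamma G)
    (h2 : boundary_estimate Omega s gamma G)
    (h3 : green_boundary_regular Omega gamma G)
    (h4 : submarkovian Omega lambda phi)
    (u0 : 'rV[R]_d -> R) (hu0 : wL1 Omega gamma u0)
    (f : R -> 'rV[R]_d -> R) (hf : wL1_cyl Omega gamma T f) :
  forall c : frac_derivative,
    weak_dual_solution Omega S c alpha gamma T u0 f
      (H_solution Omega S c alpha u0 f) /\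
    forall u : R -> 'rV[R]_d -> R,
      weak_dual_solution Omega S c alpha gamma T u0 f u ->
      {ae (lebesgue_measure \x lebesgue_rV R d)%E,
        forall p, cylinder Omega T p ->
          u p.1 p.2 = H_solution Omega S c alpha u0 f p.1 p.2}.
Proof.
have [gamma0 _] := andP hgamma.
have mO := measurable_domain hOmega.
have muO := domain_measure_lty hOmega.
have [mG _] := hG.
have [mS _] := hS.
pose D (x : 'rV[R]_d) := bdist Omega x `^ gamma.
have mD : measurable_fun Omega D by exact: measurable_weight.
have D0 x : Omega x -> 0 < D x by exact: weight_gt0.
have [C C0 iG] := green_integral_bound hd hOmega hs (ltW gamma0) h1.
have [C1 C10 GD] := green_weight_bound hd hOmega gamma0 h3.
have bD : bounded_on Omega D.
  split => //; have [K K0 hK] := weight_bounded hd hOmega (ltW gamma0).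
  by exists K => x Ox; rewrite ger0_norm ?hK// ltW// D0.
have [Sg [[mSg Sg0 Sgsym hSg] hSae]] := regular_heat_kernel mO muO mG hphi hS h1sym h4
  iG bD (fun x Ox => ltW (D0 x Ox)) (ltW C10) GD.
have [a0 a1] := andP halpha.
have [Bp Bp0 hBp] := causal_P_subord_L1 halpha.
have [Bq Bq0 hBq] := causal_S_subord_L1 halpha hT.
have mp := measurable_causal_P_subord halpha.
have mq := measurable_causal_S_subord halpha.
have mcyl : measurable (cylinder Omega T) by apply: measurableX.
have mD2 : measurable_fun (cylinder Omega T) (fun p => D p.2).
  apply: (measurable_comp (F := Omega) (f := D)) => //; first by move=> _ [[t x] [_ h] <-].
  by apply: measurable_funTS; exact: measurable_snd.
have unweight e (X : measurableType e) (A : set X) (w v : X -> R) :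
    measurable_fun A w -> (forall x, A x -> 0 < w x) ->
    measurable_fun A (fun x => (v x * w x)%:E) -> measurable_fun A v.
  move=> mw w0 /measurable_EFinP mvw.
  have mi : measurable_fun A (fun x => w x `^ (-1)).
    by apply: (measurableT_comp (f := fun t : R => t `^ (-1)) _ mw); exact: measurable_powR.
  have := measurable_funM mvw mi; apply: eq_measurable_fun => x /[!inE] Ax /=.
  by rewrite powR_inv1 ?mulfK// ?gt_eqF ?w0// ltW// w0.
have uncyl (v : R -> 'rV[R]_d -> R) : wL1_cyl Omega gamma T v ->
    measurable_fun (cylinder Omega T) (fun p => v p.1 p.2).
  move=> iv; have D2 (p : measurableTypeR R * 'rV[R]_d) : cylinder Omega T p -> 0 < D p.2.
    by move=> [_ /= Ox]; exact: D0.
  exact: (unweight _ _ _ _ (fun p => v p.1 p.2) mD2 D2 (measurable_int _ iv)).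
have mu0 : measurable_fun Omega u0.
  exact: (unweight _ _ _ _ _ mD D0 (measurable_int _ hu0)).
have mf := uncyl _ hf.
have mKP := measurable_P_kernel mO mS halpha.
have mKS := measurable_S_kernel mO mS halpha.
have hrep K k0 : (forall x y, Omega x -> Omega y ->
    {ae lebesgue_measure, forall r, `]0%R, +oo[%classic r -> S r x y = Sg r x y} ->
    forall t, 0 < t -> K t x y = subordinated Sg k0 t x y) ->
    {ae lebesgue_rV R d, forall x, Omega x ->
      represented (lebesgue_rV R d) Omega Sg k0 (causal (P_subord alpha)) K (P_kernel S alpha) x}.
  move=> hK; apply: filterS hSae => x h Ox; apply: filterS (h Ox) => y {}h Oy t t0.
  split; first exact: (hK x y Ox Oy (h Oy) t t0).
  exact: (P_kernel_ae mO mS halpha Ox Oy (h Oy) t0).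
have Gamma0 : Gamma (1 - alpha) != 0.
  (* Any angle between pi / 2 and pi will do. *)
  apply: (@Gamma_neq0 R (3 / 4 * pi)); first by have := pi_gt0 R; lra.
  by rewrite subr_gt0 a1 gtrBl a0.
have conv r t := @causal_P_subord_convolution R alpha halpha r t.
have pr := causal_r (P_subord alpha); have pt := causal_t (P_subord alpha).
have qr := causal_r (S_subord alpha); have qt := causal_t (S_subord alpha).
case.
- have rep := hrep _ _ (S_kernel_ae mO mS halpha).
  pose J (psi : R -> 'rV[R]_d -> R) (x : 'rV[R]_d) :=
    RL_integral alpha (fun t => duhamel Omega S alpha psi t x) T.
  have hJ (psi : R -> 'rV[R]_d -> R) M (F : measurableTypeR R * 'rV[R]_d -> R) x :
    0 <= M -> measurable_fun (cylinder Omega T) (fun p => psi p.1 p.2) ->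
    measurable_fun (cylinder Omega T) F ->
    (forall p, cylinder Omega T p -> `|F p| <= M * D p.2) ->
    {ae (lebesgue_measure \x lebesgue_rV R d)%E, forall p, cylinder Omega T p -> psi p.1 p.2 = F p} ->
    Omega x -> represented (lebesgue_rV R d) Omega Sg (causal (S_subord alpha)) (causal (P_subord alpha))
      (S_kernel S alpha) (P_kernel S alpha) x ->
    J psi x = potential (lebesgue_rV R d) Omega Sg T (causal (S_subord alpha)) T x F.
    move=> M0 mpsi mF hF psiF Ox rx.
    have := potential_riemann_liouville mO mSg Sg0 Sgsym mD D0 hSg hT mp mq pr qr pt qt Bp0 Bq0
      (hBp T) hBq halpha conv M0 mF hF Ox.
    move=> e; rewrite /J /RL_integral -[RHS](mulKf Gamma0); congr (_ * _); rewrite -e.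
    apply: eq_Rintegral => xi; rewrite inE/= in_itv/= => /andP[x0 xT]; congr (_ * _).
    exact: (duhamel_test mO mSg Sg0 Sgsym mD D0 hSg mp pr pt Bp0 (hBp T)
      (K := S_kernel S alpha) (k0 := causal (S_subord alpha)) M0 mpsi mF hF psiF Ox rx (ltW xT)).
  split; first split.
  + exact: (representation_integrable mO mSg Sg0 Sgsym mD D0 hSg mq mp qr pr qt pt Bq0 Bp0
      hBq (hBp T) mKS mKP rep mu0 hu0 mf hf).
  + exact: (representation_weak mO mSg Sg0 Sgsym mD D0 hSg mq mp qr pr qt pt Bq0 Bp0
      hBq (hBp T) mKS mKP rep mu0 hu0 mf hf hJ).
  + move=> u [iu wu].
    exact: (weak_formulation_unique mO mSg Sg0 Sgsym mD D0 hSg mq mp qr pr qt pt Bq0 Bp0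
      hBq (hBp T) mKS mKP rep mu0 hu0 mf hf hJ iu (uncyl _ iu) wu).
- have rep := hrep _ _ (P_kernel_ae mO mS halpha).
  pose J (psi : R -> 'rV[R]_d -> R) (x : 'rV[R]_d) := duhamel Omega S alpha psi T x.
  have hJ (psi : R -> 'rV[R]_d -> R) M (F : measurableTypeR R * 'rV[R]_d -> R) x :
    0 <= M -> measurable_fun (cylinder Omega T) (fun p => psi p.1 p.2) ->
    measurable_fun (cylinder Omega T) F ->
    (forall p, cylinder Omega T p -> `|F p| <= M * D p.2) ->
    {ae (lebesgue_measure \x lebesgue_rV R d)%E, forall p, cylinder Omega T p -> psi p.1 p.2 = F p} ->
    Omega x -> represented (lebesgue_rV R d) Omega Sg (causal (P_subord alpha)) (causal (P_subord alpha))
      (P_kernel S alpha) (P_kernel S alpha) x ->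
    J psi x = potential (lebesgue_rV R d) Omega Sg T (causal (P_subord alpha)) T x F.
    move=> M0 mpsi mF hF psiF Ox rx.
    exact: (duhamel_test mO mSg Sg0 Sgsym mD D0 hSg mp pr pt Bp0 (hBp T)
      (K := P_kernel S alpha) (k0 := causal (P_subord alpha)) M0 mpsi mF hF psiF Ox rx (lexx T)).
  split; first split.
  + exact: (representation_integrable mO mSg Sg0 Sgsym mD D0 hSg mp mp pr pr pt pt Bp0 Bp0
      (hBp T) (hBp T) mKP mKP rep mu0 hu0 mf hf).
  + exact: (representation_weak mO mSg Sg0 Sgsym mD D0 hSg mp mp pr pr pt pt Bp0 Bp0
      (hBp T) (hBp T) mKP mKP rep mu0 hu0 mf hf hJ).
  + move=> u [iu wu].
    exact: (weak_formulation_unique mO mSg Sg0 Sgsym mD D0 hSg mp mp pr pr pt pt Bp0 Bp0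
      (hBp T) (hBp T) mKP mKP rep mu0 hu0 mf hf hJ iu (uncyl _ iu) wu).
Qed.
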